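(* Let $(X,L)$ be a Dirac manifold for which $L\cap TX$ has constant rank, and denote by $\mathrm{pr}:(L\cap TX)^*\to X$ the bundle projection. Choose a complement to $L\cap TX$ in $TX$, let $j:(L\cap TX)^*\hookrightarrow T^*X$ be the induced inclusion and $\omega_{can}$ the canonical symplectic form on $T^*X$. (i) Any coisotropic embedding $i:(X,L)\hookrightarrow(M,\pi)$ into a Poisson manifold $(M,\pi)$ factors through the local model $\big(U,(\mathrm{pr}^!L)^{j^*\omega_{can}}\big)$. That is, there are a neighborhood $U\subset(L\cap TX)^*$ of the zero section $X$ on which the Dirac structure $(\mathrm{pr}^!L)^{j^*\omega_{can}}$ is Poisson, and a Poisson embedding $\psi:\big(U,(\mathrm{pr}^!L)^{j^*\omega_{can}}\big)\hookrightarrow(M,\pi)$ whose composition with the inclusion $X\hookrightarrow U$ as the zero section is $i$. (ii) In particular, if $(M_1,\pi_1)$ and $(M_2,\pi_2)$ are Poisson manifolds of minimal dimension $\dim X+\mathrm{rk}(L\cap TX)$ in which $(X,L)$ embeds coisotropically, then $(M_1,\pi_1)$ and $(M_2,\pi_2)$ are Poisson diffeomorphic around $X$.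
   Context: For a Poisson manifold $(M,\pi)$, $\langle\pi^\sharp(\alpha),\beta\rangle=\pi(\alpha,\beta)$ and $L_\pi=\{\pi^\sharp(\alpha)+\alpha:\alpha\in T^*M\}$. For a map $\varphi$ into a Dirac manifold with Dirac structure $L$, $\varphi^!L=\{v+(\mathrm{d}\varphi)^*\beta:\mathrm{d}\varphi(v)+\beta\in L\}$ (a Dirac structure when $\varphi$ is a submersion). For a closed two-form $\eta$, $L^\eta=\{v+\alpha+\iota_v\eta:v+\alpha\in L\}$. A Dirac structure is Poisson on $U$ if it equals $L_{\pi'}$ there for a Poisson structure $\pi'$ on $U$. $L\cap TX$ means $L\cap(TX\oplus0)$. A coisotropic embedding of a Dirac manifold $(X,L)$ into a Poisson manifold $(M,\pi)$ is an embedding $i:X\hookrightarrow M$ such that $i^!L_\pi=L$ and $i(X)$ is coisotropic in $(M,\pi)$, i.e. $\pi^\sharp(T(i(X))^\circ)\subset T(i(X))$, where $(\cdot)^\circ$ denotes the annihilator. It is known that when $L\cap TX$ has constant rank, $(\mathrm{pr}^!L)^{j^*\omega_{can}}$ is Poisson on some neighborhood of the zero section in $(L\cap TX)^*$. A Poisson embedding is an embedding that is a Poisson map. ''Poisson diffeomorphic around $X$'' means that there is a Poisson diffeomorphism between neighborhoods of (the images of) $X$ in $(M_1,\pi_1)$ and $(M_2,\pi_2)$. Sign convention: $\omega_{can}=\sum_i\mathrm{d}q^i\wedge\mathrm{d}p_i$. *)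

(* Defs.v *)
From HB Require Import structures.
From mathcomp Require Import all_boot all_order all_algebra.
From mathcomp Require Import all_classical all_reals all_analysis.

Set Implicit Arguments.
Unset Strict Implicit.
Unset Printing Implicit Defensive.
Import Order.TTheory GRing.Theory Num.Theory numFieldNormedType.Exports.
Local Open Scope classical_set_scope.
Local Open Scope ring_scope.

(** * Smooth manifolds

A smooth manifold is presented by its set of points and its algebra of smooth
real functions (functional structure in the sense of Bredon, differential space
in the sense of Sikorski): it is required to be locally isomorphic to R^n with
its C^oo functions.  The topology is the one induced by the smooth functions. *)

Fixpoint Ck (R : realType) (n k : nat) (V : set 'rV[R]_n) (f : 'rV[R]_n -> R)
    : Prop :=
  if k is k'.+1 then
    (forall x, V x -> differentiable f x) /\
    (forall v, Ck k' V (fun x => 'D_v f x))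
  else forall x, V x -> {for x, continuous f}.

(* Only meaningful on open V. *)
Definition Cinf (R : realType) (n : nat) (V : set 'rV[R]_n) (f : 'rV[R]_n -> R)
    : Prop :=
  forall k, Ck k V f.

Record diffspace (R : realType) : Type := DiffSpace {
  point_of :> Type;
  smooth : set (point_of -> R) }.

(* Open sets of the initial topology of a family G of real functions. *)
Definition open_for (R : realType) (T : Type) (G : set (T -> R)) (A : set T)
    : Prop :=
  forall x, A x -> exists (k : nat) (g : 'I_k -> T -> R) (e : R),
    [/\ forall i, G (g i), 0 < e &
        forall y, (forall i, `|g i y - g i x| < e) -> A y].

Definition sopen (R : realType) (S : diffspace R) (A : set S) : Prop :=
  open_for (@smooth R S) A.

Definition smooth_on (R : realType) (S : diffspace R) (A : set S) (h : S -> R)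
    : Prop :=
  forall x, A x -> exists (B : set S) (g : S -> R),
    [/\ sopen B, B x, smooth g & forall y, B y -> h y = g y].

(* c : A -> V and d : V -> A are inverse to each other and identify the smooth
   functions on opens of A with those on opens of V; hence c is also a
   homeomorphism. *)
Definition chart (R : realType) (n : nat) (S : diffspace R) (A : set S)
    (V : set 'rV[R]_n) (c : S -> 'rV[R]_n) (d : 'rV[R]_n -> S) : Prop :=
  [/\ sopen A, open V,
      (forall x, A x -> V (c x) /\ d (c x) = x),
      (forall v, V v -> A (d v) /\ c (d v) = v) &
      (forall (B : set S) (h : S -> R), sopen B -> B `<=` A ->
         smooth_on B h <-> Cinf [set v | V v /\ B (d v)] (h \o d))].

Record manifold (R : realType) (n : nat) (S : diffspace R) : Prop := Manifold {
  manifold_local : forall h : S -> R, smooth_on setT h -> smooth h;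
  manifold_hausdorff : forall x y : S, x <> y -> exists A B : set S,
    [/\ sopen A, sopen B, A x, B y & A `&` B = set0];
  manifold_second_countable : exists B : nat -> set S,
    (forall k, sopen (B k)) /\
    (forall (A : set S) x, sopen A -> A x -> exists k, B k x /\ B k `<=` A);
  manifold_chart : forall x : S, exists A V c d,
    @chart R n S A V c d /\ A x }.

Definition smooth_map (R : realType) (S T : diffspace R) (phi : S -> T)
    : Prop :=
  forall f : T -> R, smooth f -> smooth (f \o phi).

(* An open submanifold, when U is open. *)
Definition subspace_of (R : realType) (S : diffspace R) (U : set S)
    : diffspace R :=
  @DiffSpace R {p : S | U p} [set h | forall p : {p : S | U p},
    exists (A : set S) (g : S -> R), [/\ sopen A, A (sval p), smooth g &
      forall q : {p : S | U p}, A (sval q) -> h q = g (sval q)]].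

(** * Tangent vectors, covectors, fields and forms

Tangent vectors are derivations and covectors are linear forms on tangent
vectors.  Both are total functions, extended by 0 off their natural domain, so
that Leibniz equality is equality of (co)vectors. *)

Definition vec (R : realType) (S : diffspace R) : Type := (S -> R) -> R.
Definition covec (R : realType) (S : diffspace R) : Type := vec S -> R.

Definition dual_of (R : realType) (S : diffspace R) (V : set (vec S))
    (a : covec S)
    : Prop :=
  (forall (t : R) (u v : vec S), V u -> V v ->
     a (t \*o u \+ v) = t * a u + a v) /\
  (forall v, ~ V v -> a v = 0).

Definition tangent (R : realType) (S : diffspace R) (x : S) : set (vec S) :=
  [set v | [/\ forall f, ~ smooth f -> v f = 0,
    forall (t : R) (f g : S -> R), smooth f -> smooth g ->
      v (t \*o f \+ g) = t * v f + v g &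
    forall f g : S -> R, smooth f -> smooth g ->
      v (f \* g) = v f * g x + f x * v g]].

Definition cotangent (R : realType) (S : diffspace R) (x : S) : set (covec S) :=
  [set a | dual_of (tangent x) a].

Definition diff_at (R : realType) (S : diffspace R) (f : S -> R) (x : S)
    : covec S :=
  patch (fun=> 0) (tangent x) (fun v => v f).

Definition push (R : realType) (S T : diffspace R) (phi : S -> T) (v : vec S)
    : vec T :=
  patch (fun=> 0) (@smooth R T) (fun f => v (f \o phi)).

Definition pull (R : realType) (S T : diffspace R) (phi : S -> T) (x : S)
    (b : covec T) : covec S :=
  patch (fun=> 0) (tangent x) (fun v => b (push phi v)).

Definition field (R : realType) (S : diffspace R) (V : S -> vec S) : Prop :=
  (forall x, tangent x (V x)) /\
  (forall f, smooth f -> smooth (fun x => V x f)).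

Definition form1 (R : realType) (S : diffspace R) (a : S -> covec S) : Prop :=
  (forall x, cotangent x (a x)) /\
  (forall V, field V -> smooth (fun x => a x (V x))).

Definition lie_bracket (R : realType) (S : diffspace R) (V W : S -> vec S)
    : S -> vec S :=
  fun x f => V x (fun y => W y f) - W x (fun y => V y f).

(* (L_V b)_x (v) = V(b(Z)) - b([V,Z]) at x, for any field Z extending v. *)
Definition lie_derivative (R : realType) (S : diffspace R) (V : S -> vec S)
    (b : S -> covec S) : S -> covec S :=
  fun x v => xget 0 [set r | exists Z, [/\ field Z, Z x = v &
    r = V x (fun y => b y (Z y)) - b x (lie_bracket V Z x)]].

(* (da)_x (v,w) = V(a(W)) - W(a(V)) - a([V,W]) at x, for any fields V, W
   extending v, w. *)
Definition ext_deriv (R : realType) (S : diffspace R) (a : S -> covec S)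
    : S -> vec S -> covec S :=
  fun x v w => xget 0 [set r | exists V W,
    [/\ field V, field W, V x = v, W x = w &
    r = V x (fun y => a y (W y)) - W x (fun y => a y (V y))
        - a x (lie_bracket V W x)]].

Definition pull_form2 (R : realType) (S T : diffspace R) (phi : S -> T)
    (w : T -> vec T -> covec T) : S -> vec S -> covec S :=
  fun x v => pull phi x (w (phi x) (push phi v)).

Definition has_dim (R : realType) (S : diffspace R) (r : nat) (V : set (vec S))
    : Prop :=
  exists b : 'I_r -> vec S,
    injective (fun (c : 'rV[R]_r) f => \sum_i c 0 i * b i f) /\
    V = range (fun (c : 'rV[R]_r) f => \sum_i c 0 i * b i f).

Definition section_of (R : realType) (S : diffspace R) (D : S -> set (vec S))
    (V : S -> vec S) : Prop :=
  field V /\ forall x, D x (V x).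

Definition subbundle (R : realType) (S : diffspace R) (D : S -> set (vec S))
    : Prop :=
  [/\ exists k, forall x, has_dim k (D x),
      forall x, D x `<=` tangent x &
      forall x v, D x v -> exists V, section_of D V /\ V x = v].

Definition complement_of (R : realType) (S : diffspace R)
    (K C : S -> set (vec S))
    : Prop :=
  [/\ subbundle C,
      forall x v, K x v -> C x v -> v = (fun=> 0) &
      forall x v, tangent x v -> exists u w, [/\ K x u, C x w & v = u \+ w]].

(** * Dirac and Poisson structures *)

Definition pairing (R : realType) (S : diffspace R) (a b : vec S * covec S)
    : R :=
  a.2 b.1 + b.2 a.1.

Definition generalized_tangent (R : realType) (S : diffspace R) (x : S)
    : set (vec S * covec S) :=
  [set a | tangent x a.1 /\ cotangent x a.2].

Definition generalized_section (R : realType) (S : diffspace R)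
    (L : S -> set (vec S * covec S)) (V : S -> vec S) (a : S -> covec S)
    : Prop :=
  [/\ field V, form1 a & forall x, L x (V x, a x)].

Record dirac_structure (R : realType) (S : diffspace R)
    (L : S -> set (vec S * covec S)) : Prop := Dirac {
  dirac_lagrangian : forall x a, L x a <->
    (generalized_tangent x a /\ forall b, L x b -> pairing a b = 0);
  dirac_smooth : forall x a, L x a -> exists V b,
    generalized_section L V b /\ (V x, b x) = a;
  (* closedness under the Dorfman (= Courant) bracket ([V,W], L_V b - i_W da) *)
  dirac_involutive : forall V a W b,
    generalized_section L V a -> generalized_section L W b ->
    forall x, L x (lie_bracket V W x,
      fun z => lie_derivative V b x z - ext_deriv a x (W x) z) }.

Definition bracket (R : realType) (S : diffspace R)
    (pi : S -> covec S -> covec S -> R) (f g : S -> R) : S -> R :=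
  fun x => pi x (diff_at f x) (diff_at g x).

Record poisson (R : realType) (S : diffspace R)
    (pi : S -> covec S -> covec S -> R) : Prop := Poisson {
  poisson_linear : forall x (t : R) a b c,
    cotangent x a -> cotangent x b -> cotangent x c ->
    pi x (t \*o a \+ b) c = t * pi x a c + pi x b c;
  poisson_skew : forall x a b, cotangent x a -> cotangent x b ->
    pi x a b = - pi x b a;
  poisson_smooth : forall a b, form1 a -> form1 b ->
    smooth (fun x => pi x (a x) (b x));
  poisson_jacobi : forall (f g h : S -> R) x,
    smooth f -> smooth g -> smooth h ->
    bracket pi f (bracket pi g h) x + bracket pi g (bracket pi h f) x
      + bracket pi h (bracket pi f g) x = 0 }.

(* The vector with <sharp a, b> = pi(a, b), evaluated on f through b = df. *)
Definition sharp (R : realType) (S : diffspace R)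
    (pi : S -> covec S -> covec S -> R) (x : S) (a : covec S) : vec S :=
  fun f => pi x a (diff_at f x).

Definition graph_of (R : realType) (S : diffspace R)
    (pi : S -> covec S -> covec S -> R) (x : S) : set (vec S * covec S) :=
  [set (sharp pi x a, a) | a in cotangent x].

Definition pullback (R : realType) (S T : diffspace R) (phi : S -> T)
    (L : T -> set (vec T * covec T)) (x : S) : set (vec S * covec S) :=
  [set a | tangent x a.1 /\ exists b, [/\ cotangent (phi x) b,
    L (phi x) (push phi a.1, b) & a.2 = pull phi x b]].

Definition gauge_transform (R : realType) (S : diffspace R)
    (L : S -> set (vec S * covec S)) (eta : S -> vec S -> covec S) (x : S)
    : set (vec S * covec S) :=
  [set (a.1, a.2 \+ eta x a.1) | a in L x].

(* L \cap TX *)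
Definition tangent_part (R : realType) (S : diffspace R)
    (L : S -> set (vec S * covec S)) (x : S) : set (vec S) :=
  [set v | L x (v, fun=> 0)].

Definition poisson_map (R : realType) (S T : diffspace R)
    (piS : S -> covec S -> covec S -> R) (piT : T -> covec T -> covec T -> R)
    (phi : S -> T) : Prop :=
  smooth_map phi /\ forall f g : T -> R, smooth f -> smooth g -> forall x,
    bracket piS (f \o phi) (g \o phi) x = bracket piT f g (phi x).

Definition embedding (R : realType) (S T : diffspace R) (phi : S -> T) : Prop :=
  [/\ smooth_map phi, injective phi,
      forall x v w, tangent x v -> tangent x w -> push phi v = push phi w ->
        v = w &
      forall A : set S, sopen A -> exists B : set T,
        sopen B /\ A = phi @^-1` B].

(* The image is coisotropic: pi^sharp maps the annihilator of T(i(X)) into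
   T(i(X)) = di(TX). *)
Definition coisotropic_image (R : realType) (X M : diffspace R)
    (pi : M -> covec M -> covec M -> R) (i : X -> M) : Prop :=
  forall x a, cotangent (i x) a ->
    (forall v, tangent x v -> a (push i v) = 0) ->
    exists v, tangent x v /\ push i v = sharp pi (i x) a.

Definition coisotropic_embedding (R : realType) (X M : diffspace R)
    (L : X -> set (vec X * covec X)) (pi : M -> covec M -> covec M -> R)
    (i : X -> M) : Prop :=
  [/\ embedding i, forall x, pullback i (graph_of pi) x = L x &
      coisotropic_image pi i].

(* pi' is the restriction of pi to the open set U. *)
Definition poisson_restriction (R : realType) (M : diffspace R)
    (pi : M -> covec M -> covec M -> R) (U : set M)
    (pi' : subspace_of U -> covec (subspace_of U) -> covec (subspace_of U) -> R)
    : Prop :=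
  poisson pi' /\ poisson_map pi' pi (fun p : subspace_of U => sval p).

Definition poisson_diffeomorphic_around (R : realType) (X M1 M2 : diffspace R)
    (pi1 : M1 -> covec M1 -> covec M1 -> R)
    (pi2 : M2 -> covec M2 -> covec M2 -> R) (i1 : X -> M1) (i2 : X -> M2)
    : Prop :=
  exists (V1 : set M1) (V2 : set M2) pi1' pi2'
    (Phi : subspace_of V1 -> subspace_of V2)
    (Psi : subspace_of V2 -> subspace_of V1),
    [/\ sopen V1 /\ range i1 `<=` V1, sopen V2 /\ range i2 `<=` V2,
        poisson_restriction pi1 pi1' /\ poisson_restriction pi2 pi2',
        [/\ cancel Phi Psi, cancel Psi Phi & smooth_map Psi] &
        poisson_map pi1' pi2' Phi].

(** * Total space of the dual of a subbundle of the tangent bundle *)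

Definition dual_point (R : realType) (X : diffspace R) (K : X -> set (vec X))
    : Type :=
  {p : X * covec X | dual_of (K p.1) p.2}.

Definition base (R : realType) (X : diffspace R) (K : X -> set (vec X))
    (p : dual_point K) : X := (sval p).1.

Definition fib (R : realType) (X : diffspace R) (K : X -> set (vec X))
    (p : dual_point K) : covec X := (sval p).2.

(* Basic smooth functions: f \o pr, and the fibrewise linear functions
   (x, xi) |-> xi (V x) defined by the smooth sections V of K. *)
Definition dual_generators (R : realType) (X : diffspace R)
    (K : X -> set (vec X))
    : set (dual_point K -> R) :=
  [set h | (exists f : X -> R, smooth f /\ h = f \o @base R X K) \/
    (exists V, section_of K V /\ h = (fun p => fib p (V (base p))))].

(* K^*, with the smooth structure generated by dual_generators: locally,
   smooth functions of finitely many generators. *)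
Definition dual_bundle (R : realType) (X : diffspace R) (K : X -> set (vec X))
    : diffspace R :=
  @DiffSpace R (dual_point K) [set h | forall p, exists (A : set (dual_point K))
    (k : nat) (g : 'I_k -> dual_point K -> R) (F : 'rV[R]_k -> R),
    [/\ open_for (@dual_generators R X K) A /\ A p,
        forall i, dual_generators (g i), Cinf setT F &
        forall q, A q -> h q = F (\row_i g i q)]].

Definition pr (R : realType) (X : diffspace R) (K : X -> set (vec X))
    (p : dual_bundle K) : X := base p.

Lemma dual_of0 (R : realType) (X : diffspace R) (V : set (vec X)) :
  dual_of V (fun=> 0).
Proof. by split=> // t u v _ _; rewrite mulr0 addr0. Qed.

Definition zero_section (R : realType) (X : diffspace R) (K : X -> set (vec X))
    (x : X) : dual_bundle K :=
  exist (fun p : X * covec X => dual_of (K p.1) p.2) (x, fun=> 0)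
    (dual_of0 (K x)).

Definition cotangent_bundle (R : realType) (X : diffspace R) : diffspace R :=
  dual_bundle (@tangent R X).

(* theta_p = (d pr)^* p, locally \sum_i p_i dq^i *)
Definition tautological_form (R : realType) (X : diffspace R)
    (p : cotangent_bundle X) : covec (cotangent_bundle X) :=
  pull (@pr R X (@tangent R X)) p (fib p).

(* - d theta, locally \sum_i dq^i /\ dp_i *)
Definition omega_can (R : realType) (X : diffspace R) (p : cotangent_bundle X)
    (v : vec (cotangent_bundle X)) : covec (cotangent_bundle X) :=
  fun w => - ext_deriv (@tautological_form R X) p v w.

(* j extends a functional on K_x by 0 on C_x to one on T_x X. *)
Definition induced_inclusion (R : realType) (X : diffspace R)
    (K C : X -> set (vec X)) (j : dual_bundle K -> cotangent_bundle X) : Prop :=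
  forall p, [/\ pr (j p) = pr p,
    forall v, K (pr p) v -> fib (j p) v = fib p v &
    forall v, C (pr p) v -> fib (j p) v = 0].

(* (pr^! L)^{j^* omega_can} on (L \cap TX)^* *)
Definition local_model (R : realType) (X : diffspace R)
    (L : X -> set (vec X * covec X))
    (j : dual_bundle (tangent_part L) -> cotangent_bundle X) :=
  gauge_transform (pullback (@pr R X (tangent_part L)) L)
    (pull_form2 j (@omega_can R X)).

(* Main.v *)
(* Let K = L /\ TX. Choose functions f_l on M and vector fields W_l on X with
   sum_l v(f_l o i) W_l = v for all v in TX, and put C_l z = - z(pr_K W_l) and
   F_l = f_l o i o pr on K^*: the pull-back of omega_can is sum_l dC_l /\ dF_l.
   Let psi1 z be the time one value of the Hamiltonian flow of sum_l C_l(z) f_l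
   starting at i(pr z), and I_l z the integral of f_l along this curve. Then psi1
   carries pr^! L, twisted by sum_l dC_l /\ dI_l, into the graph of pi. Moser's
   method for the forms sum_l dC_l /\ d((1 - t) F_l + t I_l) gives Phi near the
   zero section, exchanging dI_l for dF_l, and psi = psi1 o Phi carries the local
   model into the graph of pi. In both stages the elements of the Dirac structure
   are transported by a linear differential equation. A count of ranks shows that
   the annihilator of the image of d psi lies in the kernel of pi^sharp, so psi is
   a Poisson immersion; it is injective and an embedding near X because i is an
   embedding. In the minimal dimension psi is open, and two such maps compose to
   the Poisson diffeomorphism of (ii). *)

Require Import Defs.
From HB Require Import structures.
From mathcomp Require Import all_boot all_order all_algebra.
From mathcomp Require Import all_classical all_reals all_analysis.
From mathcomp Require Import ring lra.

Set Implicit Arguments.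
Unset Strict Implicit.
Unset Printing Implicit Defensive.
Import Order.TTheory GRing.Theory Num.Theory numFieldNormedType.Exports.
Local Open Scope classical_set_scope.
Local Open Scope ring_scope.

(** * Calculus on R^n *)

(** Two obstacles shape the proof. The first stage maps a space of dimension n + r into M, so no
    diffeomorphism is available that could push a Dirac structure forward; instead the variation
    [D_w y] of each curve is completed to an element of the structure by a covector solving a linear
    equation, and Gronwall keeps the pair inside. Overcomplete families [f_l], [W_l] in place of a
    connection make the Hamiltonian a finite sum whose coefficients [C_l(z)] are constant along each
    curve, at the price of a wrong 2-form: [I_l] is an average of [f_l] along the curve and is known
    to agree with [F_l] only on X. The difference of the two forms is exact with primitive
    [sum_l C_l d(F_l - I_l)], which vanishes along X, so the second flow fixes X. The maps come from
    solutions that exist only near X; they are total functions with default values, and their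
    smoothness is asserted for germs. The Jacobi identity on U is not computed in the model: it is
    inherited from M through functions [f \o psi], which have enough differentials because [psi] is
    an immersion. *)

Notation ev i := (delta_mx 0 i : 'rV_ _).
Notation pd i f := ('D_(ev i) f).
Notation fn R n := ('rV[R]_n -> R)%type.

Section Calculus.
Variable R : realType.

Lemma sum_deltal n (F : 'I_n -> R) k : \sum_j (k == j)%:R * F j = F k.
Proof.
rewrite (bigD1 k)//= big1 ?addr0; first by rewrite eqxx mul1r.
by move=> j jk; rewrite eq_sym (negPf jk) mul0r.
Qed.

Lemma sum_deltar n (F : 'I_n -> R) k : \sum_j F j * (k == j)%:R = F k.
Proof. by under eq_bigr do rewrite mulrC; rewrite sum_deltal. Qed.

Lemma sum_ev n (s : 'rV[R]_n) i : \sum_j s 0 j * ev i 0 j = s 0 i.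
Proof. by rewrite -[RHS](sum_deltar (s 0)); apply: eq_bigr => j _; rewrite mxE eqxx eq_sym. Qed.

Lemma bound_fin (I : finType) T (D : set T) (f : I -> T -> R) :
  (forall i, exists2 C, 0 <= C & forall x, D x -> `|f i x| <= C) ->
  exists2 C, 0 <= C & forall i x, D x -> `|f i x| <= C.
Proof.
move=> h; have /choice[C hC] i : exists C, 0 <= C /\ forall x, D x -> `|f i x| <= C.
  by have [C C0 hC] := h i; exists C.
exists (\sum_i C i) => [|i x Dx]; first by apply: sumr_ge0 => i _; case: (hC i).
apply: le_trans ((hC i).2 x Dx) _; rewrite (bigD1 i)//= lerDl. by apply: sumr_ge0 => k _; case: (hC k).
Qed.

Lemma norm_ball n (x a : 'rV[R]_n) d : `|x - a| <= d -> `|x| <= `|a| + d.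
Proof. by rewrite -lerBlDl; apply: le_trans; exact: lerB_dist. Qed.

Lemma coord_le_norm n (x : 'rV[R]_n) i : `|x 0 i| <= `|x|.
Proof.
rewrite [leRHS]/Num.Def.normr/= mx_normrE.
exact: (le_bigmax _ (fun ij : 'I_1 * 'I_n => `|x ij.1 ij.2|) (0, i)).
Qed.

Lemma norm_le_coord n (x : 'rV[R]_n) e : 0 <= e -> (forall i, `|x 0 i| <= e) -> `|x| <= e.
Proof.
move=> e0 h; rewrite [leLHS]/Num.Def.normr/= mx_normrE. by apply: bigmax_le => // -[a i] _ /=; rewrite ord1.
Qed.

Lemma norm_lt_coord n (x : 'rV[R]_n) e : 0 < e -> (forall i, `|x 0 i| < e) -> `|x| < e.
Proof.
move=> e0 h; rewrite [ltLHS]/Num.Def.normr/= mx_normrE. by apply: bigmax_lt => // -[a i] _ /=; rewrite ord1.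
Qed.

Lemma rV_sum n (x : 'rV[R]_n) : x = \sum_i x 0 i *: ev i.
Proof. exact: row_sum_delta. Qed.

Lemma differentiable_rV (V : normedModType R) n (g : V -> 'rV[R]_n) x :
  (forall i, differentiable (fun z => g z 0 i) x) -> differentiable g x.
Proof.
move=> h; have -> : g = \sum_i (fun z => g z 0 i *: ev i). by apply/funext => z; rewrite fct_sumE -rV_sum.
by apply: differentiable_sum => i; exact: differentiableZl.
Qed.

Lemma derive_coord (V : normedModType R) n (g : V -> 'rV[R]_n) x v i :
  derivable g x v -> ('D_v g x) 0 i = 'D_v (fun z => g z 0 i) x.
Proof. by move=> h; rewrite derive_mx// mxE. Qed.

Lemma derive_pd n (f : fn R n) x v : differentiable f x -> 'D_v f x = \sum_i v 0 i * pd i f x.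
Proof.
move=> h; rewrite deriveE// [in LHS](rV_sum v) linear_sum/=.
by apply: eq_bigr => i _; rewrite linearZ/= deriveE.
Qed.

Lemma derive_compE (V : normedModType R) n (F : fn R n) (g : V -> 'rV[R]_n) x v :
  differentiable g x -> differentiable F (g x) ->
  'D_v (F \o g) x = \sum_i 'D_v (fun z => g z 0 i) x * pd i F (g x).
Proof.
move=> dg dF; rewrite deriveE; last exact: differentiable_comp.
rewrite diff_comp//= -deriveE// -deriveE// derive_pd//. apply: eq_bigr => i _; congr (_ * _).
by rewrite derive_coord//; exact: diff_derivable.
Qed.

Lemma derive_chain (V : normedModType R) n (F : fn R n) (g : V -> 'rV[R]_n) x v :
  differentiable g x -> differentiable F (g x) -> 'D_v (F \o g) x = 'D_('D_v g x) F (g x).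
Proof.
move=> dg dF; rewrite deriveE; last exact: differentiable_comp. by rewrite diff_comp//= -deriveE// -deriveE.
Qed.

Lemma nbhs_rVP n (x : 'rV[R]_n) (P : set 'rV[R]_n) :
  nbhs x P <-> exists2 d, 0 < d & forall y, `|y - x| < d -> P y.
Proof.
split=> [/nbhs_ballP[d d0 h]|[d d0 h]]. exists d => // y yx; apply: h; rewrite -ball_normE/=.
  by rewrite distrC. apply/nbhs_ballP; exists d => // y; rewrite -ball_normE/= => yx; apply: h.
by rewrite distrC.
Qed.

Lemma cont_sum (T : topologicalType) (I : Type) (f : I -> T -> R) (r : seq I)
    (P : pred I) x : (forall i, {for x, continuous (f i)}) ->
  {for x, continuous (fun y => \sum_(i <- r | P i) f i y)}.
Proof. by move=> h; apply: cvg_big => [|i _]; [exact: add_continuous|exact: h]. Qed.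

Lemma cont_rV (T : topologicalType) n (g : T -> 'rV[R]_n) x :
  (forall i, {for x, continuous (fun z => g z 0 i)}) -> {for x, continuous g}.
Proof.
move=> h; apply/(@cvgrPdist_lt _ 'rV[R]_n) => e e0; near=> y.
apply: norm_lt_coord => // i; rewrite !mxE; move: i; near: y.
apply: filter_forall => i; have /(@cvgrPdist_lt _ R^o)/(_ e e0) := h i. exact: filterS.
Unshelve. all: by end_near. Qed.

Definition lin_form n (a h : 'rV[R]_n) : R := \sum_i a 0 i * h 0 i.

Lemma lin_form_linear n (a : 'rV[R]_n) : linear (lin_form a).
Proof.
move=> t u v; rewrite /lin_form scaler_sumr -big_split/=; apply: eq_bigr => i _.
by rewrite !mxE mulrDr mulrCA.
Qed.

HB.instance Definition _ n (a : 'rV[R]_n) := GRing.isLinear.Build R _ _ _ (lin_form a) (@lin_form_linear n a).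

Lemma lin_form_continuous n (a : 'rV[R]_n) : continuous (lin_form a).
Proof.
move=> x. have := @cont_sum 'rV[R]_n _ (fun i h => a 0 i * h 0 i) (index_enum _) xpredT x. apply => i.
by apply: continuousM; [exact: cst_continuous|exact: coord_continuous].
Qed.

(** With [eps_diff], the little-o definition of the differential in epsilon form, which survives the
    passage to a limit of functions in [lim_derive]. *)
Lemma diff_eps n (f : fn R n) x (a : 'rV[R]_n) : (forall e, 0 < e -> \forall h \near (0 : 'rV[R]_n),
     `|f (h + x) - f x - lin_form a h| <= e * `|h|) ->
  differentiable f x /\ forall v, 'D_v f x = lin_form a v.
Proof.
move=> H. have E : f \o shift x = cst (f x) + lin_form a +o_ (0 : 'rV[R]_n) id.
  apply/eqaddoP => e e0; near=> h => /=.
  rewrite [X in `|X|](_ : _ = f (h + x) - f x - lin_form a h); last first. by rewrite -addrA -opprD.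
  by near: h; exact: H. have D := diff_unique (@lin_form_continuous n a) E. have df : differentiable f x.
  by apply/diff_locallyP; rewrite D; split => //; exact: lin_form_continuous.
by split=> // v; rewrite deriveE// D. Unshelve. all: by end_near. Qed.

Lemma eps_diff n (f : fn R n) x : differentiable f x -> forall e, 0 < e -> \forall h \near (0 : 'rV[R]_n),
     `|f (h + x) - f x - 'D_h f x| <= e * `|h|. Proof.
move=> df e e0; have /eqaddoP/(_ e e0) := diff_locally df. apply: filterS => h /= hh; rewrite deriveE//.
by move: hh; rewrite [X in `|X|](_ : _ = f (h + x) - f x - 'd f x h)// -addrA -opprD.
Qed.

Lemma differentiable_near n (f g : fn R n) x : {near x, f =1 g} -> differentiable f x -> differentiable g x.
Proof.
move=> fg df. apply: (proj1 (@diff_eps _ g x (\row_i pd i f x) _)) => e e0. have := eps_diff df e0.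
have : \forall h \near (0 : 'rV[R]_n), f (h + x) = g (h + x).
  have /nbhs_rVP[d d0 h] := fg; apply/nbhs_rVP; exists d => // y.
  by rewrite subr0 => yd; apply: h; rewrite addrK. apply: filterS2 => h <-; rewrite -(nbhs_singleton fg).
rewrite (derive_pd h df); under eq_bigr do rewrite mulrC.
by congr (`|_ - _| <= _); apply: eq_bigr => i _; rewrite mxE.
Qed.

Lemma Ck_congr n k (V : set 'rV[R]_n) (f g : fn R n) : open V ->
  (forall x, V x -> f x = g x) -> Ck k V f -> Ck k V g.
Proof.
move=> oV; have N x (f1 g1 : fn R n) :
    V x -> (forall x, V x -> f1 x = g1 x) -> \forall y \near x, f1 y = g1 y.
  by move=> Vx h; apply: (@filterS _ _ _ V) => //; exact: open_nbhs_nbhs. elim: k f g => [|k ih] f g fg /=.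
  move=> h x Vx; have := h x Vx; rewrite /prop_for /continuous_at -fg// => h'.
  exact: cvg_trans (near_eq_cvg (N x f g Vx fg)) h'. move=> [df dv]; split=> [x Vx|v].
  by apply: (@differentiable_near _ f); [exact: N|exact: df].
by apply: ih (dv v) => x Vx; apply: near_eq_derive; exact: N.
Qed.

Lemma Ck_sub n k (V W : set 'rV[R]_n) (f : fn R n) : W `<=` V -> Ck k V f -> Ck k W f.
Proof.
move=> WV; elim: k f => [|k ih] f /=; first by move=> h x /WV; exact: h.
by move=> [df dv]; split=> [x /WV /df//|v]; exact: ih.
Qed.

Lemma Ck_diff n k (V : set 'rV[R]_n) (f : fn R n) x : Ck k.+1 V f -> V x -> differentiable f x.
Proof. by case=> + _ => /[apply]. Qed.

Lemma Ck_cont n k (V : set 'rV[R]_n) (f : fn R n) x : Ck k V f -> V x -> {for x, continuous f}.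
Proof. case: k => [|k]; first by move=> /[apply]. by move=> [df _] /df; exact: differentiable_continuous. Qed.

Lemma Ck_pred n k (V : set 'rV[R]_n) (f : fn R n) : Ck k.+1 V f -> Ck k V f.
Proof.
elim: k f => [|k ih] f. by move=> h x Vx; exact: Ck_cont h Vx.
by move=> [df dv]; split=> // v; apply: ih; exact: dv.
Qed.

Lemma Ck_cst n k (V : set 'rV[R]_n) (c : R) : Ck k V (fun=> c).
Proof.
elim: k c => [|k ih] c; first by move=> x _; exact: cst_continuous.
split=> [x _|v]; first exact: differentiable_cst. rewrite (_ : 'D_v _ = fun=> 0); first exact: ih.
by apply/funext => x; exact: derive_cst.
Qed.

Lemma Ck_coord n k (V : set 'rV[R]_n) i : Ck k V (fun x => x 0 i).
Proof.
case: k => [|k]; first by move=> x _; exact: coord_continuous.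
split=> [x _|v]; first exact: differentiable_coord. rewrite (_ : 'D_v _ = fun=> v 0 i); first exact: Ck_cst.
apply/funext => x; rewrite -(@derive_coord _ _ (fun x => x)) ?derive_id//.
Qed.

Lemma Ck_add n k (V : set 'rV[R]_n) (f g : fn R n) : open V ->
  Ck k V f -> Ck k V g -> Ck k V (fun x => f x + g x).
Proof.
move=> oV; elim: k f g => [|k ih] f g. by move=> hf hg x Vx; apply: continuousD; [exact: hf|exact: hg].
move=> [df vf] [dg vg]; split=> [x Vx|v]. by apply: differentiableD; [exact: df|exact: dg].
apply: Ck_congr (ih _ _ (vf v) (vg v)) => // x Vx.
by rewrite deriveD//; apply: diff_derivable; [exact: df|exact: dg].
Qed.

Lemma Ck_mul n k (V : set 'rV[R]_n) (f g : fn R n) : open V ->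
  Ck k V f -> Ck k V g -> Ck k V (fun x => f x * g x).
Proof.
move=> oV; elim: k f g => [|k ih] f g. by move=> hf hg x Vx; apply: continuousM; [exact: hf|exact: hg].
move=> hf hg; case: (hf) (hg) => df vf [dg vg]; split=> [x Vx|v].
  by apply: differentiableM; [exact: df|exact: dg].
have := Ck_add oV (ih _ _ (Ck_pred hf) (vg v)) (ih _ _ (Ck_pred hg) (vf v)). apply: Ck_congr => // x Vx.
by rewrite deriveM//; apply: diff_derivable; [exact: df|exact: dg].
Qed.

Lemma Ck_sum n k (V : set 'rV[R]_n) (I : Type) (r : seq I) (P : pred I) (f : I -> fn R n) : open V ->
  (forall i, Ck k V (f i)) -> Ck k V (fun x => \sum_(i <- r | P i) f i x).
Proof. move=> oV h; rewrite -fct_sumE; elim/big_rec: _ => [|i g _]. exact: (Ck_cst _ _ 0). exact: Ck_add. Qed.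

Lemma Ck_prod n k (V : set 'rV[R]_n) (I : Type) (r : seq I) (P : pred I) (f : I -> fn R n) : open V ->
  (forall i, Ck k V (f i)) -> Ck k V (fun x => \prod_(i <- r | P i) f i x).
Proof.
move=> oV h; rewrite -fct_prodE; elim/big_rec: _ => [|i g _]. exact: (Ck_cst _ _ 1). exact: Ck_mul.
Qed.

Lemma Ck_inv n k (V : set 'rV[R]_n) (f : fn R n) : open V ->
  (forall x, V x -> f x != 0) -> Ck k V f -> Ck k V (fun x => (f x)^-1).
Proof.
move=> oV f0; elim: k => [|k ih]. by move=> hf x Vx; apply: continuousV; [exact: f0|exact: hf].
move=> hf; case: (hf) => df vf; split=> [x Vx|v]. by apply: differentiableV; [exact: df|exact: f0].
have vV := ih (Ck_pred hf). have := Ck_mul oV (Ck_mul oV vV vV) (Ck_mul oV (@Ck_cst _ k V (-1)) (vf v)).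
apply: Ck_congr => // x Vx. rewrite deriveV; [|exact: f0|by apply: diff_derivable; exact: df].
by rewrite mulN1r mulrN scaleNr expr2 invfM.
Qed.

Lemma Ck_comp n m k (V : set 'rV[R]_n) (W : set 'rV[R]_m) (F : fn R m) (g : 'rV[R]_n -> 'rV[R]_m) : open V ->
  (forall x, V x -> W (g x)) -> Ck k W F ->
  (forall i, Ck k V (fun x => g x 0 i)) -> Ck k V (fun x => F (g x)).
Proof.
move=> oV VW; elim: k F => [|k ih] F.
  move=> hF hg x Vx; apply: (@continuous_comp _ _ _ g F); last exact/hF/VW. by apply: cont_rV => i; exact: hg.
move=> [dF vF] hg; have dg x : V x -> differentiable g x.
  by move=> Vx; apply: differentiable_rV => i; exact: (Ck_diff (hg i)). split=> [x Vx|v].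
  by apply: (@differentiable_comp _ _ _ _ g F); [exact: dg|exact/dF/VW].
have : Ck k V (fun x => \sum_i 'D_v (fun z => g z 0 i) x * pd i F (g x)).
  apply: Ck_sum => // i; apply: Ck_mul => //; first exact: (proj2 (hg i) v).
  by apply: (ih (pd i F) (vF _)) => j; exact: Ck_pred.
apply: Ck_congr => // x Vx; rewrite -derive_compE//; first exact: dg. exact/dF/VW.
Qed.

End Calculus.

Notation sm := (Cinf setT).

(** * Smooth functions on R^n, flat functions and smooth steps *)

Section SmoothFunctions.
Variable R : realType.

Lemma open_setT n : open (setT : set 'rV[R]_n). Proof. exact: openT. Qed.
Local Hint Resolve open_setT : core.

Lemma sm_cst n (c : R) : sm (fun _ : 'rV[R]_n => c).
Proof. by move=> k; exact: Ck_cst. Qed.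

Lemma sm_coord n i : sm (fun x : 'rV[R]_n => x 0 i).
Proof. by move=> k; exact: Ck_coord. Qed.

Lemma sm_add n (f g : fn R n) : sm f -> sm g -> sm (fun x => f x + g x).
Proof. by move=> hf hg k; exact: Ck_add. Qed.

Lemma sm_mul n (f g : fn R n) : sm f -> sm g -> sm (fun x => f x * g x).
Proof. by move=> hf hg k; exact: Ck_mul. Qed.

Lemma sm_opp n (f : fn R n) : sm f -> sm (fun x => - f x).
Proof.
move=> hf; rewrite (_ : (fun x => _) = fun x => -1 * f x). by apply: sm_mul hf; exact: sm_cst.
by apply/funext => x; rewrite mulN1r.
Qed.

Lemma sm_sub n (f g : fn R n) : sm f -> sm g -> sm (fun x => f x - g x).
Proof. by move=> hf hg; exact: sm_add hf (sm_opp hg). Qed.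

Lemma sm_sum n (I : Type) (r : seq I) (P : pred I) (f : I -> fn R n) :
  (forall i, sm (f i)) -> sm (fun x => \sum_(i <- r | P i) f i x).
Proof. by move=> h k; apply: Ck_sum => // i; exact: h. Qed.

Lemma sm_exp n (f : fn R n) k : sm f -> sm (fun x => f x ^+ k).
Proof.
move=> hf; elim: k => [|k ih]; first by under eq_fun do rewrite expr0; exact: sm_cst.
by under eq_fun do rewrite exprS; exact: sm_mul.
Qed.

Lemma sm_comp n m (F : fn R m) (g : 'rV[R]_n -> 'rV[R]_m) :
  sm F -> (forall i, sm (fun x => g x 0 i)) -> sm (fun x => F (g x)).
Proof. by move=> hF hg k; apply: (@Ck_comp _ _ _ _ setT setT) => // i; exact: hg. Qed.

Lemma sm_derive n (f : fn R n) v : sm f -> sm ('D_v f).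
Proof. by move=> hf k; exact: (proj2 (hf k.+1) v). Qed.

Lemma sm_diff n (f : fn R n) x : sm f -> differentiable f x.
Proof. by move=> hf; exact: (proj1 (hf 1%N)). Qed.

Lemma sm_derivable n (f : fn R n) x v : sm f -> derivable f x v.
Proof. by move=> hf; exact/diff_derivable/sm_diff. Qed.

Lemma sm_cont n (f : fn R n) : sm f -> continuous f.
Proof. by move=> hf x; exact/differentiable_continuous/sm_diff. Qed.

Lemma sm_diff_rV n m (g : 'rV[R]_n -> 'rV[R]_m) x : (forall i, sm (fun z => g z 0 i)) -> differentiable g x.
Proof. by move=> h; apply: differentiable_rV => i; exact: sm_diff. Qed.

Lemma sm_cont_rV n m (g : 'rV[R]_n -> 'rV[R]_m) : (forall i, sm (fun z => g z 0 i)) -> continuous g.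
Proof. by move=> h x; apply: cont_rV => i; exact: sm_cont. Qed.

Lemma sm_ext n (f g : fn R n) : f =1 g -> sm f -> sm g.
Proof. by move=> /funext ->. Qed.

(** Each derivative of [G i \o h] is [G i.+1 \o h] times a derivative of h, so a single induction on
    the order, made for all i at once, suffices. *)
Lemma sm_scalar (G : nat -> R -> R) : (forall i (x : R), is_derive x 1 (G i) (G i.+1 x)) ->
  forall n (h : fn R n), sm h -> sm (fun x => G 0%N (h x)).
Proof.
move=> hG n h hh; suff H : forall k i, Ck k setT (fun x => G i (h x)). by move=> k; exact: H.
elim=> [|k ih] i. move=> x _; apply: (@continuous_comp _ _ _ h (G i)); first exact: sm_cont.
  apply: differentiable_continuous; apply/derivable1_diffP. by case: (hG i (h x)).
have dG x : differentiable (G i) (h x). by apply/derivable1_diffP; case: (hG i (h x)). split=> [x _|v].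
  by apply: (@differentiable_comp _ _ _ _ h (G i)); [exact: sm_diff|exact: dG].
rewrite (_ : 'D_v _ = fun x => G i.+1 (h x) * 'D_v h x). by apply: Ck_mul => //; exact: (sm_derive v hh).
apply/funext => x; rewrite deriveE; last first.
  by apply: (@differentiable_comp _ _ _ _ h (G i)); [exact: sm_diff|exact: dG].
rewrite (_ : (fun _ => _) = G i \o h)// diff_comp//=; last exact: sm_diff.
rewrite deriv1E; last by case: (hG i (h x)). rewrite derive1E (@derive_val _ _ _ _ _ _ _ (hG i (h x))).
by rewrite (deriveE v (sm_diff x hh)) mulrC.
Qed.

(* The functions x |-> p(1/x) e^(-1/x), extended by 0, are stable under
   derivation. *)
Definition flat (p : {poly R}) (x : R) : R := if 0 < x then p.[x^-1] * expR (- x^-1) else 0.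

(** The constant is the factorial in e^x >= x^(k+2) / (k+2)! at x = 1/h; the two spare powers leave
    the factor h^2, which makes the difference quotient at 0 vanish. *)
Lemma exp_decay k : exists2 C, 0 <= C & forall h : R, 0 < h -> `|h^-1 ^+ k * expR (- h^-1)| <= C * h ^+ 2.
Proof.
exists (k.+2)`!%:R => // h h0; have hV : 0 < h^-1 by rewrite invr_gt0.
rewrite ger0_norm; last by rewrite mulr_ge0// ?expR_ge0// exprn_ge0// ltW.
rewrite expRN ler_pdivrMr ?expR_gt0//. have e := expR_ge1Dxn k.+1 (ltW hV).
have f0 : 0 < (k.+2)`!%:R :> R by rewrite ltr0n fact_gt0. have {}e : h^-1 ^+ k.+2 <= (k.+2)`!%:R * expR h^-1.
  rewrite mulrC -ler_pdivrMr//; apply: le_trans e. by rewrite lerDr ler01.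
have : h ^+ 2 * h^-1 ^+ k.+2 <= h ^+ 2 * ((k.+2)`!%:R * expR h^-1). by rewrite ler_pM2l ?exprn_gt0.
have -> : h ^+ 2 * h^-1 ^+ k.+2 = h^-1 ^+ k.
  by rewrite -[k.+2]add2n exprD mulrA -exprMn divff ?gt_eqF// expr1n mul1r.
by rewrite mulrA [h ^+ 2 * _]mulrC.
Qed.

Lemma flat_decay p : exists2 C, 0 <= C & forall h : R, `|flat p h| <= C * h ^+ 2.
Proof.
have [D D0 HD] : exists2 D : nat -> R, (forall k, 0 <= D k) & forall k (h : R),
    0 < h -> `|h^-1 ^+ k * expR (- h^-1)| <= D k * h ^+ 2.
  by exists (fun k => s2val (cid2 (exp_decay k))) => k; case: cid2. exists (\sum_(i < size p) `|p`_i| * D i).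
  by apply: sumr_ge0 => i _; rewrite mulr_ge0. move=> h; rewrite /flat; case: ifPn => h0; last first.
  by rewrite normr0 mulr_ge0 ?sqr_ge0// sumr_ge0// => i _; rewrite mulr_ge0.
rewrite horner_coef mulr_suml mulr_suml; apply: le_trans (ler_norm_sum _ _ _) _.
apply: ler_sum => i _; rewrite -mulrA normrM -mulrA ler_wpM2l//. exact: HD.
Qed.

Lemma flat_derive p (x : R) : is_derive x 1 (flat p) (flat ('X^2 * (p - p^`())) x).
Proof.
have [x0|x0|->] := ltgtP x 0.
- rewrite {2}/flat ltNge ltW//=. have d0 : is_derive x 1 (cst (0 : R)) (0 : R) by exact: is_derive_cst.
  apply: near_eq_is_derive d0. near=> y; rewrite /flat ltNge ltW//=. by near: y; exact: lt_nbhsl.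
- have -> : flat ('X^2 * (p - p^`())) x = (p^`().[x^-1] * - x^-1 ^+ 2) * expR (- x^-1) +
      p.[x^-1] * (expR (- x^-1) * x^-1 ^+ 2). by rewrite /flat x0 hornerM hornerXn hornerD hornerN; ring.
  have dV : is_derive x 1 (fun y : R => y^-1) (- x^-1 ^+ 2). have -> : - x^-1 ^+ 2 = - x ^- 2 *: (1 : R).
      by rewrite /GRing.scale/= mulr1 exprVn. by apply: is_deriveV; rewrite ?gt_eqF.
  have d1 := @is_derive1_comp _ (horner p) _ x _ _ (is_derive_poly p _) dV.
  have d2 := @is_derive1_comp _ expR _ x _ _ (is_derive_expR _) (is_deriveN dV).
  have dF : is_derive x 1 (fun y : R => p.[y^-1] * expR (- y^-1))
      ((p^`().[x^-1] * - x^-1 ^+ 2) * expR (- x^-1) + p.[x^-1] * (expR (- x^-1) * x^-1 ^+ 2)).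
    have := is_deriveM d1 d2; rewrite /GRing.scale/= => h.
    apply: (is_derive_eq h); rewrite [expR _](_ : _ = expR (- x^-1))//; ring.
  apply: near_eq_is_derive dF; near=> y; rewrite /flat ifT//. by near: y; exact: lt_nbhsr.
(* At 0 the quadratic bound forces the difference quotient to 0, which is also the value there of
   the next flat function. *)
- have [C C0 hC] := flat_decay p. have C1 : 0 < C + 1 by rewrite ltr_wpDl.
  have -> : flat ('X^2 * (p - p^`())) 0 = 0 by rewrite /flat ltxx.
  have H : h^-1 *: (flat p (h *: (1 : R) + 0) - flat p 0) @[h --> 0^'] --> (0 : R).
    apply/cvgrPdist_le => e e0; near=> h.
    rewrite sub0r normrN addr0 [flat p 0]/flat ltxx subr0 /GRing.scale/= mulr1.
    have hn0 : h != 0 by near: h; exact: nbhs_dnbhs_neq. have h0 : 0 < `|h| by rewrite normr_gt0.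
    rewrite normrM normfV ler_pdivrMl//; apply: le_trans (hC h) _.
    rewrite -real_normK ?num_real// expr2 mulrA mulrC ler_pM2l//. have : `|h| <= e / (C + 1).
      by near: h; apply: dnbhs0_le; rewrite divr_gt0.
    rewrite ler_pdivlMr// mulrDr mulr1 mulrC; apply: le_trans. by rewrite lerDl.
  by apply: DeriveDef; [apply/cvg_ex; exists 0|apply: cvg_lim]. Unshelve. all: by end_near. Qed.

Lemma sm_flat n (h : fn R n) : sm h -> sm (fun x => flat 1 (h x)). Proof.
pose G i := flat (iter i (fun p => 'X^2 * (p - p^`())) 1).
by apply: (@sm_scalar G) => i x; rewrite /G iterS; exact: flat_derive.
Qed.

Lemma flat1_gt0 x : (0 < flat 1 x) = (0 < x).
Proof. by rewrite /flat; case: ifPn; rewrite ?ltxx// hornerC mul1r expR_gt0. Qed.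

Lemma flat1_ge0 x : 0 <= flat 1 x.
Proof. by rewrite /flat; case: ifPn => //; rewrite hornerC mul1r expR_ge0. Qed.

Definition step (x : R) : R := flat 1 x / (flat 1 x + flat 1 (1 - x)).

Lemma step_den x : 0 < flat 1 x + flat 1 (1 - x).
Proof.
have [x0|x0] := ltP 0 x. by rewrite ltr_pwDl ?flat1_gt0// flat1_ge0.
by rewrite ltr_wpDl ?flat1_ge0// flat1_gt0; lra.
Qed.

Lemma step0 x : x <= 0 -> step x = 0.
Proof. by move=> x0; rewrite /step {1}/flat ltNge x0 mul0r. Qed.

Lemma step1 x : 1 <= x -> step x = 1.
Proof.
move=> x1; have e : flat 1 (1 - x) = 0 by rewrite /flat ltNge subr_le0 x1.
by rewrite /step e addr0 divff// gt_eqF// flat1_gt0; lra.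
Qed.

Lemma step_ge0 x : 0 <= step x.
Proof. by rewrite divr_ge0 ?flat1_ge0// ltW ?step_den. Qed.

Lemma step_gt0 x : 0 < x -> 0 < step x.
Proof. by move=> x0; rewrite divr_gt0 ?step_den// flat1_gt0. Qed.

Lemma step_le1 x : step x <= 1.
Proof. by rewrite ler_pdivrMr ?step_den// mul1r lerDl flat1_ge0. Qed.

Lemma sm_step n (h : fn R n) : sm h -> sm (fun x => step (h x)).
Proof.
move=> hh; have s1 := sm_flat hh; have s2 := sm_flat (sm_sub (@sm_cst n 1) hh).
apply: sm_mul => // k; apply: Ck_inv => //; last exact: sm_add. by move=> x _; rewrite gt_eqF// step_den.
Qed.

End SmoothFunctions.
Global Hint Resolve open_setT : core.

(** * Mean value and Taylor estimates on balls *)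

Section Estimates.
Variable R : realType.

Lemma curve_derive n (F : fn R n) (g : R -> 'rV[R]_n) (dg : 'rV[R]_n) (t : R) :
  (forall i, is_derive t 1 (fun s => g s 0 i) (dg 0 i)) ->
  differentiable F (g t) -> is_derive t 1 (F \o g) ('D_dg F (g t)).
Proof.
move=> hg hF; have dgt : differentiable g t.
  by apply: differentiable_rV => i; apply/derivable1_diffP; case: (hg i).
apply: DeriveDef; first exact/diff_derivable/differentiable_comp.
rewrite derive_compE// derive_pd//; apply: eq_bigr => i _; congr (_ * _). by case: (hg i).
Qed.

Lemma line_derive n (f : fn R n) x v (t : R) : sm f ->
  is_derive t 1 (fun s : R => f (x + s *: v)) ('D_v f (x + t *: v)).
Proof.
move=> hf; apply: (@curve_derive _ f (fun s => x + s *: v)); last exact: sm_diff.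
move=> i; rewrite (_ : (fun s => _) = fun s => x 0 i + s * v 0 i); last first.
  by apply/funext => s; rewrite !mxE. have h := is_deriveD (is_derive_cst (x 0 i) t 1)
  (is_deriveM (is_derive_id t 1) (is_derive_cst (v 0 i) t 1)).
by apply: (is_derive_eq h); rewrite /cst scaler0 !add0r /GRing.scale/= mulr1.
Qed.

Lemma derivable_continuous_within (f df : R -> R) (a b : R) :
  (forall t : R, is_derive t 1 f (df t)) -> {within `[a, b], continuous f}.
Proof.
move=> h; apply: continuous_subspaceT => t. by apply/differentiable_continuous/derivable1_diffP; case: (h t).
Qed.

Lemma mvt01 (f df : R -> R) : (forall t : R, is_derive t 1 f (df t)) ->
  exists c, [/\ 0 <= c, c <= 1 & f 1 - f 0 = df c].
Proof.
move=> h; have [c] := MVT_segment ler01 (fun t _ => h t) (derivable_continuous_within (a := 0) (b := 1) h).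
by rewrite in_itv/= => /andP[c0 c1]; rewrite subr0 mulr1; exists c.
Qed.

Lemma mvt_line n (f : fn R n) x h : sm f ->
  exists c, [/\ 0 <= c, c <= 1 & f (x + h) - f x = 'D_h f (x + c *: h)].
Proof.
move=> hf; have [c [c0 c1]] := mvt01 (fun t => line_derive x h t hf).
by rewrite scale1r scale0r addr0; exists c.
Qed.

Lemma ball_convex n (x h : 'rV[R]_n) c r : `|x| <= r -> `|x + h| <= r ->
  0 <= c -> c <= 1 -> `|x + c *: h| <= r.
Proof.
move=> xr hr c0 c1; have -> : x + c *: h = (1 - c) *: x + c *: (x + h).
  by rewrite scalerDr addrA -scalerDl subrK scale1r.
rewrite (le_trans (ler_normD _ _))// !normrZ !ger0_norm ?subr_ge0//.
rewrite (_ : r = (1 - c) * r + c * r); last by ring. by rewrite lerD// ler_wpM2l ?subr_ge0.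
Qed.

Lemma norm_sum_le n (a : 'I_n -> R) C : (forall i, `|a i| <= C) -> `|\sum_i a i| <= n%:R * C.
Proof.
move=> h; apply: le_trans (ler_norm_sum _ _ _) _. apply: le_trans (ler_sum _ (fun i _ => h i)) _.
by rewrite sumr_const card_ord mulr_natl.
Qed.

Lemma derive_le n (f : fn R n) z v C : sm f -> (forall i, `|pd i f z| <= C) -> `|'D_v f z| <= n%:R * C * `|v|.
Proof.
move=> hf hC; rewrite (derive_pd v (sm_diff z hf)) -mulrA. apply: norm_sum_le => i; rewrite normrM mulrC.
by rewrite ler_pM// coord_le_norm.
Qed.

Lemma lip_of_pd n (f : fn R n) r C : sm f -> (forall i z, `|z| <= r -> `|pd i f z| <= C) ->
  forall x y, `|x| <= r -> `|y| <= r -> `|f y - f x| <= n%:R * C * `|y - x|.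
Proof.
move=> hf hC x y xr yr; have [c [c0 c1]] := mvt_line x (y - x) hf.
rewrite (addrC x) subrK => ->; apply: derive_le => // i; apply: hC.
by apply: ball_convex => //; rewrite addrC subrK.
Qed.

Lemma taylor2 n (f : fn R n) r C : sm f -> 0 <= C -> (forall i j z, `|z| <= r -> `|pd j (pd i f) z| <= C) ->
  forall x h, `|x| <= r -> `|x + h| <= r -> `|f (x + h) - f x - 'D_h f x| <= n%:R * (n%:R * C) * `|h| ^+ 2.
Proof.
move=> hf C0 hC x h xr hr; have [c [c0 c1 ->]] := mvt_line x h hf.
have dE z := derive_pd h (sm_diff z hf); rewrite !dE -sumrB -mulrA.
apply: norm_sum_le => i; rewrite -mulrBr normrM mulrC. rewrite expr2 mulrA ler_pM// ?coord_le_norm//.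
have := lip_of_pd (sm_derive (ev i) hf) (hC i) xr (ball_convex xr hr c0 c1).
move=> /le_trans; apply; rewrite ler_wpM2l ?mulr_ge0//. by rewrite addrC addKr normrZ ger0_norm// ler_piMl.
Qed.

Lemma closed_ball_compact n (r : R) : compact [set x : 'rV[R]_n | `|x| <= r].
Proof.
apply: bounded_closed_compact.
  by exists r; split; [exact: num_real|move=> M rM x /= /le_trans; apply; exact: ltW].
rewrite (_ : [set x | _] = (fun x : 'rV[R]_n => `|x|) @^-1` [set t : R | t <= r])//.
apply: closed_comp; last exact: closed_le. by move=> x _; exact: norm_continuous.
Qed.

Lemma cont_bounded n (f : fn R n) r : continuous f -> exists2 C, 0 <= C & forall x, `|x| <= r -> `|f x| <= C.
Proof.
move=> cf; have [M [Mr hM]] := compact_bounded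
  (continuous_compact (continuous_subspaceT cf) (@closed_ball_compact n r)).
exists (`|M| + 1); first by rewrite addr_ge0. move=> x xr; apply: (hM (`|M| + 1)); last by exists x.
by rewrite (le_lt_trans (ler_norm _))// ltrDl.
Qed.

Lemma cont_bounded_fin n (I : finType) (f : I -> fn R n) r : (forall i, continuous (f i)) ->
  exists2 C, 0 <= C & forall i x, `|x| <= r -> `|f i x| <= C.
Proof. move=> cf; apply: (bound_fin (D := fun x : 'rV[R]_n => `|x| <= r)) => i; exact: cont_bounded. Qed.

Lemma sm_lip n (f : fn R n) r : sm f -> exists2 C, 0 <= C &
  forall x y, `|x| <= r -> `|y| <= r -> `|f y - f x| <= C * `|y - x|.
Proof.
move=> hf; have [C C0 hC] := @cont_bounded_fin n _ (fun i => pd i f) r (fun i => sm_cont (sm_derive _ hf)).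
by exists (n%:R * C); [rewrite mulr_ge0|exact: lip_of_pd].
Qed.

(** The numbers q for different e need not be related; in [lim_derive] they are difference quotients
    of the limit function. *)
Lemma approx_cvg (u : nat -> R) :
  (forall e, 0 < e -> exists q, \forall m \near \oo, `|u m - q| <= e) -> cvgn u.
Proof.
move=> h; apply/cauchy_cvgP/cauchy_exP => e e0. have [q hq] := h (e / 2) (divr_gt0 e0 (ltr0n _ 2)); exists q.
near=> m; rewrite -ball_normE/= distrC; apply: le_lt_trans (_ : e / 2 < e). by near: m.
by rewrite ltr_pdivrMr// ltr_pMr// ltr1n. Unshelve. all: by end_near. Qed.

Lemma geometric_cvg (u : nat -> R) C : (forall m, `|u m.+1 - u m| <= C / 2 ^+ m) -> cvgn u. Proof.
move=> h; have C0 : 0 <= C. by have := h 0%N; rewrite expr0 divr1; exact: le_trans.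
have H k m : `|u (k + m)%N - u k| <= 2 * C / 2 ^+ k.
  (* The middle term is the exact sum of the m geometric increments, which makes the induction on m
     telescope. *)
  apply: (@le_trans _ _ (2 * C / 2 ^+ k - 2 * C / 2 ^+ (k + m))).
    elim: m => [|m ih]; first by rewrite addn0 !subrr normr0.
    rewrite addnS (_ : _ - _ = (u (k + m)%N - u k) + (u (k + m).+1 - u (k + m)%N)); last by ring.
    apply: le_trans (ler_normD _ _) _; apply: le_trans (lerD ih (h _)) _. by rewrite exprS invfM; lra.
  by rewrite lerBlDr lerDl divr_ge0// ?exprn_ge0// mulr_ge0. apply: approx_cvg => e e0.
have [k hk] : exists k, 2 * C / 2 ^+ k <= e. have [k hk] : exists k : nat, 2 * C / e <= k%:R.
    exists (Num.bound (2 * C / e)); apply/ltW/archi_boundP. by rewrite divr_ge0// ?mulr_ge0// ltW.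
  exists k; rewrite ler_pdivrMr ?exprn_gt0// [e * _]mulrC -ler_pdivrMr//.
  apply: le_trans hk _; rewrite -natrX ler_nat ltnW//; exact: ltn_expl.
exists (u k); exists k => // m /= km; rewrite -(subnKC km). exact: le_trans (H _ _) hk.
Qed.

Lemma cvg_norm_le (u : nat -> R) l C : u @ \oo --> l -> (forall m, `|u m| <= C) -> `|l| <= C.
Proof. move=> /cvg_norm ul h. have := ler_cvg_to ul (@cvg_cst _ C _ _ _); apply; first exact: nearW. Qed.

End Estimates.

(** * Smoothness of pointwise limits *)

Section SmoothLimits.
Variable R : realType.

Lemma norm_ev n (i : 'I_n) : `|ev i : 'rV[R]_n| <= 1.
Proof.
apply: norm_le_coord => // j; rewrite mxE/=; case: (_ == _); last by rewrite normr0. by rewrite normr1.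
Qed.

Definition loc_bounded n (f : nat -> fn R n) : Prop :=
  forall r, exists2 C, 0 <= C & forall m x, `|x| <= r -> `|f m x| <= C.

Fixpoint Ck_bounded n k (f : nat -> fn R n) : Prop :=
  loc_bounded f /\
  if k is k'.+1 then forall v, Ck_bounded k' (fun m => 'D_v (f m)) else True.

Lemma Ck_bounded0 n k (f : nat -> fn R n) : Ck_bounded k f -> loc_bounded f.
Proof. by case: k => [|k] []. Qed.

Lemma Ck_bounded_pd2 n (f : nat -> fn R n) r : Ck_bounded 2 f ->
  exists2 C, 0 <= C & forall m i j z, `|z| <= r -> `|pd j (pd i (f m)) z| <= C.
Proof.
move=> [_ hf]; have [|C C0 hC] := @bound_fin R ('I_n * 'I_n)%type _
    [set mx : nat * 'rV[R]_n | `|mx.2| <= r] (fun ij mx => pd ij.2 (pd ij.1 (f mx.1)) mx.2).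
  move=> ij; have [_ h1] := hf (ev ij.1); have [/(_ r)[C C0 hC] _] := h1 (ev ij.2).
  by exists C => // -[m x]; exact: hC. by exists C => // m i j z zr; exact: (hC (i, j) (m, z)).
Qed.

(** A locally uniform bound on second derivatives compares each first derivative with a difference
    quotient of fixed step s up to K s, uniformly in m. The quotients converge with [f m], so the
    derivatives are Cauchy, and the Taylor estimate itself passes to the limit. *)
Lemma lim_derive n (f : nat -> fn R n) (g : fn R n) : (forall m, sm (f m)) -> Ck_bounded 2 f ->
  (forall x, (f m x @[m --> \oo]) --> g x) -> forall x, differentiable g x /\
    forall v, ('D_v (f m) x @[m --> \oo]) --> 'D_v g x.
Proof.
move=> hf hb fg x. have [C C0 hC] := Ck_bounded_pd2 (`|x| + 1) hb.
pose K := n%:R * (n%:R * C); have K0 : 0 <= K by rewrite !mulr_ge0.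
have T m h : `|h| <= 1 -> `|f m (x + h) - f m x - 'D_h (f m) x| <= K * `|h| ^+ 2.
  move=> h1; apply: (taylor2 (hf m) C0 (hC m)); first by rewrite lerDl.
  by rewrite (le_trans (ler_normD _ _))// lerD2l. have cD i : cvgn (fun m => pd i (f m) x).
  apply: approx_cvg => e e0. pose s := Num.min 1 (e / 2 / (K + 1)). have K1 : 0 < K + 1 by rewrite ltr_wpDl.
  have s0 : 0 < s by rewrite lt_min ltr01 !divr_gt0. have s1 : s <= 1 by rewrite ge_min lexx.
  have Ks : K * s <= e / 2. have : s <= e / 2 / (K + 1) by rewrite ge_min lexx orbT.
    rewrite ler_pdivlMr// mulrDr mulr1 mulrC => h; apply: le_trans h. by rewrite lerDl ltW.
  have ns : `|s *: (ev i : 'rV[R]_n)| <= s.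
    by rewrite normrZ gtr0_norm// -[leRHS]mulr1 ler_wpM2l ?(ltW s0)// norm_ev.
  exists ((g (x + s *: ev i) - g x) / s). have q : (f m (x + s *: ev i) - f m x) / s @[m --> \oo] -->
           (g (x + s *: ev i) - g x) / s. by apply: cvgM; [apply: cvgB; exact: fg|exact: cvg_cst].
  have /(@cvgrPdist_le _ R^o)/(_ (e / 2)) := q; rewrite divr_gt0// => /(_ isT). apply: filterS => m hm.
  have := T m _ (le_trans ns s1). have -> : 'D_(s *: ev i) (f m) x = s * pd i (f m) x.
    by rewrite deriveE ?linearZ//= -?deriveE//; exact: sm_diff.
  set a := f m (x + _) - f m x; set d := pd i (f m) x => had. have {}had : `|a / s - d| <= e / 2.
    have -> : a / s - d = (a - s * d) / s by field; rewrite gt_eqF.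
    rewrite normrM normfV (gtr0_norm s0) ler_pdivrMr//; apply: le_trans had _.
    apply: (@le_trans _ _ (K * s ^+ 2)); last by rewrite expr2 mulrA ler_wpM2r// ltW.
    by rewrite ler_wpM2l// lerXn2r ?nnegrE// ltW.
  rewrite (_ : d - _ = - (a / s - d) - ((g (x + s *: ev i) - g x) / s - a / s)); last by ring.
  rewrite (le_trans (ler_normB _ _))// normrN [leRHS]splitr lerD//. pose G i := limn (fun m => pd i (f m) x).
have cG h : ('D_h (f m) x @[m --> \oo]) --> lin_form (\row_i G i) h.
  rewrite (_ : (fun m => _) = fun m => \sum_i h 0 i * pd i (f m) x); last first.
    by apply/funext => m; rewrite derive_pd//; exact: sm_diff.
  rewrite (_ : lin_form _ h = \sum_i h 0 i * G i); last first. by apply: eq_bigr => i _; rewrite mxE mulrC.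
  apply: cvg_big => [|i _]; first exact: add_continuous. by apply: cvgM; [exact: cvg_cst|exact: cD].
have [dg dE] : differentiable g x /\ forall v, 'D_v g x = lin_form (\row_i G i) v.
  apply: diff_eps => e e0; pose d := Num.min 1 (e / (K + 1)). have K1 : 0 < K + 1 by rewrite ltr_wpDl.
  have d0 : 0 < d by rewrite lt_min ltr01 divr_gt0. apply/nbhs_rVP; exists d => // h; rewrite subr0 => hd.
  have h1 : `|h| <= 1 by rewrite (le_trans (ltW hd))// ge_min lexx. have he : K * `|h| <= e.
    have : `|h| <= e / (K + 1) by rewrite (le_trans (ltW hd))// ge_min lexx orbT.
    rewrite ler_pdivlMr// mulrDr mulr1 mulrC => hh; apply: le_trans hh. by rewrite lerDl.
  apply: (@le_trans _ _ (K * `|h| ^+ 2)); last by rewrite expr2 mulrA ler_wpM2r.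
  apply: (@cvg_norm_le _ (fun m => f m (x + h) - f m x - 'D_h (f m) x)).
    by apply: cvgB; [apply: cvgB; rewrite 1?addrC; exact: fg|exact: cG]. by move=> m; exact: T.
by split=> // v; rewrite dE. Unshelve. all: by end_near. Qed.

Lemma lim_sm n (f : nat -> fn R n) (g : fn R n) : (forall m, sm (f m)) -> (forall k, Ck_bounded k f) ->
  (forall x, (f m x @[m --> \oo]) --> g x) -> sm g. Proof.
move=> + + + k; elim: k f g => [|k ih] f g hf hb fg.
  by move=> x _; have [/differentiable_continuous] := lim_derive hf (hb 2%N) fg x.
have L := lim_derive hf (hb 2%N) fg. split=> [x _|v]; first by case: (L x).
apply: (ih (fun m => 'D_v (f m))) => [m|l|x].
- exact: sm_derive.
- by have [_ h] := hb l.+1; exact: h.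
- by have [_] := L x.
Qed.

(** Applied with l x = (x, v): derivatives of Euler iterates are components of iterates of the
    lifted field at (x, v), and their bounds have to be brought back to functions of x. *)
Lemma Ck_bounded_affine n p k (f : nat -> fn R p) (l : 'rV[R]_n -> 'rV[R]_p) (dl : 'rV[R]_n -> 'rV[R]_p) :
  (forall m, sm (f m)) -> (forall i, sm (fun x => l x 0 i)) -> (forall x v, 'D_v l x = dl v) ->
  Ck_bounded k f -> Ck_bounded k (fun m x => f m (l x)).
Proof.
move=> + hl dlE; have lb r : exists2 C, 0 <= C & forall x, `|x| <= r -> `|l x| <= C.
  have [C C0 hC] := @cont_bounded_fin R n 'I_p (fun i x => l x 0 i) r (fun i => sm_cont (hl i)).
  by exists C => // x xr; apply: norm_le_coord => // i; exact: hC.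
have L j f' : Ck_bounded j f' -> loc_bounded (fun m x => f' m (l x)).
  move=> hb r; have [C C0 hC] := lb r; have [D D0 hD] := Ck_bounded0 hb C.
  by exists D => // m x xr; apply: hD; exact: hC.
elim: k f => [|k ih] f hf hb; first by split=> //; exact: L hb. split=> [|v]; first exact: L hb.
have [_ h] := hb; have := ih (fun m => 'D_(dl v) (f m)) _ (h _).
rewrite (_ : (fun m x => 'D_(dl v) (f m) (l x)) = fun m => 'D_v (fun x => f m (l x))).
  by apply => m; exact: sm_derive. apply/funext => m; apply/funext => x.
rewrite -(dlE x v) -(@derive_chain _ _ _ (f m) l)//; last exact: sm_diff. exact: sm_diff_rV.
Qed.

End SmoothLimits.

(** * Flows of vector fields *)

Section EulerScheme.
Variable R : realType.

Definition vfield N (F : 'I_N -> fn R N) (x : 'rV[R]_N) : 'rV[R]_N := \row_i F i x.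

Definition eul N (F : 'I_N -> fn R N) (h : R) (x : 'rV[R]_N) : 'rV[R]_N := x + h *: vfield F x.

Definition eulN N (F : 'I_N -> fn R N) (h : R) k (x : 'rV[R]_N) := iter k (eul F h) x.

Definition euler N (F : 'I_N -> fn R N) m (x : 'rV[R]_N) := eulN F (2 ^+ m)^-1 (2 ^ m) x.

(** An a priori bound uniform in the step size. It takes the place of completeness of the field:
    together with smoothness of F it yields convergence of the scheme and smoothness of the
    limit. *)
Definition good_field N (F : 'I_N -> fn R N) : Prop :=
  forall r, exists2 r', 0 <= r' & forall m k x, (k <= 2 ^ m)%N -> `|x| <= r ->
    `|eulN F (2 ^+ m)^-1 k x| <= r'.

Lemma eulNE N (F : 'I_N -> fn R N) h k x i : eulN F h k.+1 x 0 i = eulN F h k x 0 i + h * F i (eulN F h k x).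
Proof. by rewrite /eulN iterS /eul /vfield !mxE. Qed.

Lemma sm_eulN N (F : 'I_N -> fn R N) h k i : (forall i, sm (F i)) -> sm (fun x => eulN F h k x 0 i).
Proof.
move=> hF; elim: k i => [|k ih] i; first exact: sm_coord. under eq_fun do rewrite eulNE.
apply: sm_add (ih i) _; apply: sm_mul; first exact: sm_cst. exact: sm_comp.
Qed.

(* The vector field of the variational equation. *)
Definition lift_field N (F : 'I_N -> fn R N) (i : 'I_(N + N)) (z : 'rV[R]_(N + N)) : R :=
  match fintype.split i with
  | inl a => F a (lsubmx z)
  | inr a => \sum_b rsubmx z 0 b * pd b (F a) (lsubmx z) end.

Lemma sm_lift_field N (F : 'I_N -> fn R N) : (forall i, sm (F i)) -> forall i, sm (lift_field F i).
Proof.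
move=> hF i; rewrite /lift_field; case: (fintype.split i) => a.
  apply: sm_comp => // j; under eq_fun do rewrite mxE; exact: sm_coord. apply: sm_sum => b; apply: sm_mul.
  by under eq_fun do rewrite mxE; exact: sm_coord.
apply: (@sm_comp _ _ _ (pd b (F a)) lsubmx); first exact: sm_derive.
by move=> j; under eq_fun do rewrite mxE; exact: sm_coord.
Qed.

Lemma eulN_lift N (F : 'I_N -> fn R N) h k x v : (forall i, sm (F i)) ->
  eulN (lift_field F) h k (row_mx x v) = row_mx (eulN F h k x) (\row_i 'D_v (fun y => eulN F h k y 0 i) x).
Proof.
move=> hF; elim: k => [|k ih]. congr row_mx; apply/rowP => i; rewrite mxE -(@derive_coord _ _ _ (fun y => y)).
    by rewrite derive_id. exact: derivable_id.
apply/rowP => i; rewrite eulNE ih; case: (split_ordP i) => a ->.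
  rewrite !row_mxEl /lift_field; case: split_ordP => b; last first. by move/eqP; rewrite eq_lrshift.
  by move/lshift_inj => <-; rewrite row_mxKl eulNE. rewrite !row_mxEr /lift_field; case: split_ordP => b.
  by move/esym/eqP; rewrite eq_lrshift. move/rshift_inj => <-; rewrite row_mxKl row_mxKr !mxE.
have sE j : sm (fun y => eulN F h k y 0 j) by exact: sm_eulN.
rewrite (_ : (fun y => eulN F h k.+1 y 0 a) = (fun y => eulN F h k y 0 a) +
    h *: (F a \o eulN F h k)); last by apply/funext => y; rewrite eulNE.
have dE : differentiable (eulN F h k) x by exact: sm_diff_rV.
have dF : differentiable (F a) (eulN F h k x) by exact: sm_diff.
have dC : differentiable (F a \o eulN F h k) x by exact: differentiable_comp.
rewrite deriveD; [|exact: sm_derivable|exact/diff_derivable/differentiableZ].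
rewrite deriveZ; last exact: diff_derivable. rewrite derive_compE//; congr (_ + _ * _); apply: eq_bigr => j _.
by rewrite !mxE.
Qed.

Lemma vfield_bound N (F : 'I_N -> fn R N) r : (forall i, sm (F i)) ->
  exists2 K, 0 <= K & forall x, `|x| <= r -> `|vfield F x| <= K.
Proof.
move=> hF; have [K K0 hK] := @cont_bounded_fin R N _ F r (fun i => sm_cont (hF i)).
by exists K => // x xr; apply: norm_le_coord => // i; rewrite mxE; exact: hK.
Qed.

Lemma field_derive_bound N (F : 'I_N -> fn R N) r : (forall i, sm (F i)) ->
  exists2 L, 0 <= L & forall i x v, `|x| <= r -> `|'D_v (F i) x| <= L * `|v|.
Proof.
move=> hF; have [C C0 hC] := @cont_bounded_fin R N ('I_N * 'I_N)%type
  (fun ij => pd ij.2 (F ij.1)) r (fun ij => sm_cont (sm_derive _ (hF ij.1))).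
exists (N%:R * C); first by rewrite mulr_ge0.
by move=> i x v xr; apply: derive_le => // j; exact: (hC (i, j)).
Qed.

Lemma vfield_lip N (F : 'I_N -> fn R N) r : (forall i, sm (F i)) ->
  exists2 L, 0 <= L & forall x y, `|x| <= r -> `|y| <= r -> `|vfield F y - vfield F x| <= L * `|y - x|.
Proof.
move=> hF; have [L L0 hL] := field_derive_bound r hF.
exists L => // x y xr yr; apply: norm_le_coord => [|i]; first by rewrite mulr_ge0.
rewrite !mxE; have [c [c0 c1]] := mvt_line x (y - x) (hF i); rewrite (addrC x) subrK => ->.
by apply: hL; apply: ball_convex => //; rewrite addrC subrK.
Qed.

Lemma discrete_gronwall (d : nat -> R) a c M : 0 <= a -> 0 <= c ->
  (forall k, (k < M)%N -> d k.+1 <= (1 + a) * d k + c) ->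
  forall k, (k <= M)%N -> d k <= (1 + a) ^+ k * (d 0%N + k%:R * c).
Proof.
move=> a0 c0 h; elim=> [|k ih] kM. by rewrite expr0 mul1r mul0r addr0. apply: le_trans (h k kM) _.
have a1 : 1 <= 1 + a by rewrite lerDl.
apply: (@le_trans _ _ ((1 + a) * ((1 + a) ^+ k * (d 0%N + k%:R * c)) + c)).
  by rewrite lerD2r ler_wpM2l ?(le_trans ler01)// ih// ltnW.
rewrite mulrA -exprS -natr1 mulrDl mul1r addrA mulrDr [leRHS]mulrDr.
by rewrite -mulrDr lerD2l// ler_peMl// exprn_ege1.
Qed.

Lemma pow_le_exp m k (L : R) : 0 <= L -> (k <= 2 ^ m)%N -> (1 + (2 ^+ m)^-1 * L) ^+ k <= expR L.
Proof.
move=> L0 km; apply: (@le_trans _ _ (expR ((2 ^+ m)^-1 * L) ^+ k)).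
  by rewrite lerXn2r ?nnegrE ?expR_ge0 ?expR_ge1Dx// addr_ge0// mulr_ge0//.
rewrite -expRM_natl ler_expR mulrA ler_piMl// ler_pdivrMr ?exprn_gt0// mul1r. by rewrite -natrX ler_nat.
Qed.

(** The linear component grows by at most the factor 1 + h L per step, hence by e^L over the unit
    interval. *)
Lemma good_lift_field N (F : 'I_N -> fn R N) : (forall i, sm (F i)) ->
  good_field F -> good_field (lift_field F).
Proof.
move=> hF gF r; have [r' r'0 hr'] := gF r. have [L L0 hL] := field_derive_bound r' hF.
exists (r' + expR L * `|r|). by rewrite addr_ge0// mulr_ge0// expR_ge0.
move=> m k z km zr; rewrite -[z]hsubmxK eulN_lift//. set x := lsubmx z; set v := rsubmx z.
have xr : `|x| <= r. apply: norm_le_coord => [|i]; first exact: le_trans zr.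
  by rewrite mxE; exact: le_trans (coord_le_norm _ _) zr. have vr : `|v| <= `|r|.
  apply: norm_le_coord => // i. by rewrite mxE (le_trans (coord_le_norm _ _))// (le_trans zr)// ler_norm.
set h := (2 ^+ m)^-1; have h0 : 0 <= h by rewrite invr_ge0 exprn_ge0.
pose w k := \row_i 'D_v (fun y => eulN F h k y 0 i) x.
have wE j i : w j.+1 0 i = w j 0 i + h * 'D_(w j) (F i) (eulN F h j x).
  have := eulNE (lift_field F) h j (row_mx x v) (rshift N i).
  rewrite !eulN_lift// !row_mxEr -/(w _) => ->; congr (_ + _ * _). rewrite /lift_field; case: split_ordP => b.
    by move/esym/eqP; rewrite eq_lrshift. move/rshift_inj => <-; rewrite row_mxKl row_mxKr derive_pd//.
  exact: sm_diff. have W : `|w k| <= expR L * `|r|.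
  have H j : (j < 2 ^ m)%N -> `|w j.+1| <= (1 + h * L) * `|w j| + 0.
    move=> jm; rewrite addr0; apply: norm_le_coord => [|i]. by rewrite mulr_ge0// addr_ge0// mulr_ge0.
    rewrite wE (le_trans (ler_normD _ _))// mulrDl mul1r lerD ?coord_le_norm//.
    rewrite normrM ger0_norm// -mulrA ler_wpM2l// hL//; apply: hr' => //. exact: ltnW.
  have := discrete_gronwall (mulr_ge0 h0 L0) (lexx 0) H km.
  rewrite mulr0 addr0 => /le_trans; apply; rewrite ler_pM//.
  - by rewrite exprn_ge0// addr_ge0// mulr_ge0.
  - exact: pow_le_exp.
  - apply: le_trans vr; rewrite (_ : w 0%N = v)//; apply/rowP => i.
    rewrite mxE -(@derive_coord _ _ _ (fun y => y)) ?derive_id//.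
apply: norm_le_coord => [|i]; first by rewrite addr_ge0// mulr_ge0// expR_ge0. case: (split_ordP i) => a ->.
  rewrite row_mxEl (le_trans (coord_le_norm _ _))// (le_trans (hr' m k x km xr))//.
  by rewrite lerDl mulr_ge0// expR_ge0.
by rewrite row_mxEr (le_trans (coord_le_norm _ _))// (le_trans W)// lerDr.
Qed.

(** The induction on k runs over all fields and dimensions: a directional derivative of the scheme
    of F is a component of the scheme of [lift_field F], which is good again. *)
Lemma Ck_bounded_euler k N (F : 'I_N -> fn R N) i : (forall i, sm (F i)) ->
  good_field F -> Ck_bounded k (fun m x => euler F m x 0 i).
Proof.
have B N' (F' : 'I_N' -> 'rV[R]_N' -> R) i' : good_field F' -> loc_bounded (fun m x => euler F' m x 0 i').
  move=> gF r; have [r' r'0 h] := gF r; exists r' => // m x xr. by rewrite (le_trans (coord_le_norm _ _))// h.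
elim: k N F i => [|k ih] N F i hF gF; first by split=> //; exact: B. split=> [|v]; first exact: B.
  have := @Ck_bounded_affine R N (N + N) k
    (fun m z => euler (lift_field F) m z 0 (rshift N i)) (fun x => row_mx x v)
    (fun w => row_mx w 0) _ _ _ (ih _ _ _ (sm_lift_field hF) (good_lift_field hF gF)).
  rewrite (_ : (fun m x => euler (lift_field F) m (row_mx x v) 0 (rshift N i)) =
    (fun m => 'D_v (fun x => euler F m x 0 i))); last first.
    by apply/funext => m; apply/funext => x; rewrite /euler eulN_lift// row_mxEr mxE. apply.
  + by move=> m; apply: sm_eulN; exact: sm_lift_field.
  + move=> j; case: (split_ordP j) => a ->. by under eq_fun do rewrite row_mxEl; exact: sm_coord.
    by under eq_fun do rewrite row_mxEr; exact: sm_cst.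
  + move=> x w; apply/rowP => j; rewrite derive_coord; last first.
      apply: diff_derivable; apply: sm_diff_rV => l; case: (split_ordP l) => a ->.
        by under eq_fun do rewrite row_mxEl; exact: sm_coord.
      by under eq_fun do rewrite row_mxEr; exact: sm_cst. case: (split_ordP j) => a ->.
      under eq_fun do rewrite row_mxEl. by rewrite row_mxEl -(@derive_coord _ _ _ (fun y => y)) ?derive_id.
    under eq_fun do rewrite row_mxEr. by rewrite row_mxEr derive_cst mxE.
Qed.

(** One step of size h is compared with two of size h/2. The local discrepancy is O(h^2), and the
    discrete Gronwall inequality over 2^m steps leaves O(h), a geometric sequence in m. *)
Lemma cvg_euler N (F : 'I_N -> fn R N) x i : (forall i, sm (F i)) ->
  good_field F -> cvgn (fun m => euler F m x 0 i).
Proof.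
move=> hF gF; have [r r0 hr] := gF `|x|.
have [K K0 hK] := vfield_bound r hF; have [L L0 hL] := vfield_lip r hF.
apply: (@geometric_cvg _ _ (expR L * (L * K))) => m.
pose h : R := (2 ^+ m)^-1; have h0 : 0 <= h by rewrite invr_ge0 exprn_ge0. pose h' : R := (2 ^+ m.+1)^-1.
have hh : h = h' + h'. by rewrite /h /h' exprS invfM; lra. have h'0 : 0 <= h' by rewrite invr_ge0 exprn_ge0.
pose a k := eulN F h k x; pose b k := eulN F h' (2 * k) x. have ab k : (k < 2 ^ m)%N ->
    `|b k.+1 - a k.+1| <= (1 + h * L) * `|b k - a k| + h ^+ 2 * (L * K).
  move=> km; rewrite /b mulnS add2n /eulN !iterS -/(eulN _ _ _ _) -/(b k). rewrite -/(eulN F h k x) -/(a k).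
  set c := eul F h' (b k). have br : `|b k| <= r by apply: hr => //; rewrite expnS leq_mul2l/= ltnW.
  have cr : `|c| <= r. have := hr m.+1 (2 * k).+1 x; rewrite /eulN iterS; apply => //.
    by rewrite expnS mul2n mul2n ltn_double. have ar : `|a k| <= r by apply: hr => //; exact: ltnW.
  rewrite /eul. have -> : c + h' *: vfield F c - (a k + h *: vfield F (a k)) =
      (b k - a k) + h' *: (vfield F (b k) - vfield F (a k)) + h' *: (vfield F c - vfield F (a k)).
    by apply/rowP => j; rewrite hh {1}/c /eul !mxE; ring. have cb : `|c - a k| <= `|b k - a k| + h' * K.
    rewrite /c /eul addrAC (le_trans (ler_normD _ _))// lerD2l normrZ ger0_norm//. by rewrite ler_wpM2l// hK.
  apply: le_trans (ler_normD _ _) _. apply: le_trans (lerD (ler_normD _ _) (lexx _)) _.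
  rewrite !normrZ (ger0_norm h'0). have e1 := ler_wpM2l h'0 (hL _ _ ar br).
  have e2 := ler_wpM2l h'0 (le_trans (hL _ _ ar cr) (ler_wpM2l L0 cb)).
  apply: le_trans (lerD (lerD (lexx _) e1) e2) _. rewrite hh.
  have : 0 <= h' * h' * (L * K) by rewrite !mulr_ge0. set A := `|b k - a k|; nra.
have := discrete_gronwall (mulr_ge0 h0 L0) (mulr_ge0 (sqr_ge0 h) (mulr_ge0 L0 K0)) ab (leqnn _).
rewrite /a /b muln0 /eulN/= subrr normr0 add0r -expnS -!/(eulN _ _ _ _).
rewrite -/(euler F m x) -/(euler F m.+1 x) => H.
have := coord_le_norm (euler F m.+1 x - euler F m x) i; rewrite !mxE => /le_trans; apply. apply: le_trans H _.
have -> : (2 ^ m)%:R * (h ^+ 2 * (L * K)) = L * K / 2 ^+ m. rewrite natrX /h; field; by rewrite expf_neq0.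
rewrite mulrA ler_wpM2r// ?invr_ge0 ?exprn_ge0//. by rewrite ler_wpM2r ?mulr_ge0// pow_le_exp.
Qed.

Definition time1 N (F : 'I_N -> fn R N) i (x : 'rV[R]_N) : R := limn (fun m => euler F m x 0 i).

Lemma sm_time1 N (F : 'I_N -> fn R N) i : (forall i, sm (F i)) -> good_field F -> sm (time1 F i).
Proof.
move=> hF gF; apply: (@lim_sm _ _ (fun m x => euler F m x 0 i)).
- by move=> m; exact: sm_eulN.
- by move=> k; exact: Ck_bounded_euler.
- by move=> x; exact: cvg_euler.
Qed.

End EulerScheme.

Section Flow.
Variable R : realType.

Notation tv t z := (row_mx (t%:M : 'rV[R]_1) z).

(** The time s is absorbed into the step size, so that all fields s F with bounded s are controlled
    at once, as [tfield] requires. *)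
Definition scaled_good N (F : 'I_N -> fn R N) : Prop :=
  forall r, exists2 r', 0 <= r' & forall m k s x, (k <= 2 ^ m)%N ->
    `|s| <= r -> `|x| <= r -> `|eulN F ((2 ^+ m)^-1 * s) k x| <= r'.

(* Adding the time as a parameter: the flow of F at time s is the flow of s F
   at time 1. *)
Definition tfield N (F : 'I_N -> fn R N) (i : 'I_(1 + N)) (z : 'rV[R]_(1 + N)) : R :=
  match fintype.split i with
  | inl _ => 0
  | inr a => z 0 (lshift N 0) * F a (rsubmx z) end.

Lemma sm_rsubmx N M i : sm (fun z : 'rV[R]_(N + M) => rsubmx z 0 i).
Proof. by under eq_fun do rewrite mxE; exact: sm_coord. Qed.

Lemma sm_lsubmx N M i : sm (fun z : 'rV[R]_(N + M) => lsubmx z 0 i).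
Proof. by under eq_fun do rewrite mxE; exact: sm_coord. Qed.

Lemma sm_row_mx n N M (f : 'rV[R]_n -> 'rV[R]_N) (g : 'rV[R]_n -> 'rV[R]_M) :
  (forall i, sm (fun z => f z 0 i)) -> (forall i, sm (fun z => g z 0 i)) ->
  forall i, sm (fun z => row_mx (f z) (g z) 0 i).
Proof.
move=> hf hg i; case: (split_ordP i) => a ->. by under eq_fun do rewrite row_mxEl; exact: hf.
by under eq_fun do rewrite row_mxEr; exact: hg.
Qed.

Lemma sm_tfield N (F : 'I_N -> fn R N) : (forall i, sm (F i)) -> forall i, sm (tfield F i).
Proof.
move=> hF i; rewrite /tfield; case: (fintype.split i) => a; first exact: sm_cst.
by apply: sm_mul; [exact: sm_coord|apply: sm_comp => // j; exact: sm_rsubmx].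
Qed.

Lemma split_lshift m n (i : 'I_m) : fintype.split (lshift n i) = inl i.
Proof. exact: (unsplitK (inl i)). Qed.

Lemma split_rshift m n (i : 'I_n) : fintype.split (rshift m i) = inr i.
Proof. exact: (unsplitK (inr i)). Qed.

Lemma eulN_tfield N (F : 'I_N -> fn R N) h k s x : eulN (tfield F) h k (tv s x) = tv s (eulN F (h * s) k x).
Proof.
elim: k => // k ih; apply/rowP => i; rewrite eulNE ih. case: (split_ordP i) => a ->; rewrite /tfield.
  by rewrite split_lshift mulr0 addr0 !row_mxEl.
by rewrite split_rshift !row_mxEr row_mxEl row_mxKr eulNE mxE eqxx mulr1n mulrA.
Qed.

Lemma norm_row_mx_le N M (x : 'rV[R]_N) (y : 'rV[R]_M) r :
  0 <= r -> `|x| <= r -> `|y| <= r -> `|row_mx x y| <= r.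
Proof.
move=> r0 xr yr; apply: norm_le_coord => // i; case: (split_ordP i) => a ->.
  by rewrite row_mxEl (le_trans (coord_le_norm _ _)). by rewrite row_mxEr (le_trans (coord_le_norm _ _)).
Qed.

Lemma norm_lsubmx N M (x : 'rV[R]_(N + M)) : `|lsubmx x| <= `|x|.
Proof. by apply: norm_le_coord => // i; rewrite mxE coord_le_norm. Qed.

Lemma norm_rsubmx N M (x : 'rV[R]_(N + M)) : `|rsubmx x| <= `|x|.
Proof. by apply: norm_le_coord => // i; rewrite mxE coord_le_norm. Qed.

Lemma tvK N (z : 'rV[R]_(1 + N)) : z = tv (z 0 (lshift N 0)) (rsubmx z).
Proof. rewrite -[LHS]hsubmxK; congr row_mx; apply/rowP => i. by rewrite !mxE ord1 eqxx mulr1n. Qed.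

Lemma norm_scalar1 (s : R) : `|s%:M : 'rV[R]_1| <= `|s|.
Proof. by apply: norm_le_coord => // i; rewrite mxE ord1 eqxx mulr1n. Qed.

Lemma good_tfield N (F : 'I_N -> fn R N) : scaled_good F -> good_field (tfield F).
Proof.
move=> gF r; have [r' r'0 hr'] := gF r; exists (`|r| + r'); first by rewrite addr_ge0.
move=> m k z km zr; rewrite (tvK z) eulN_tfield. have zr' : `|z| <= `|r| by rewrite (le_trans zr)// ler_norm.
apply: norm_row_mx_le; first by rewrite addr_ge0.
  rewrite (le_trans (norm_scalar1 _))// (le_trans (coord_le_norm _ _))//. by rewrite (le_trans zr')// lerDl.
apply: (@le_trans _ _ r'); last by rewrite lerDr.
by apply: hr' => //; apply: le_trans zr; [exact: coord_le_norm|exact: norm_rsubmx].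
Qed.

Definition flow N (F : 'I_N -> fn R N) (i : 'I_N) (z : 'rV[R]_(1 + N)) : R := time1 (tfield F) (rshift 1 i) z.

Section FlowTheory.
Variables (N : nat) (F : 'I_N -> fn R N).
Hypothesis hF : forall i, sm (F i).
Hypothesis gF : scaled_good F.

Lemma sm_flow i : sm (flow F i).
Proof. by apply: sm_time1; [exact: sm_tfield|exact: good_tfield]. Qed.

Lemma cvg_flow i z : (euler (tfield F) m z 0 (rshift 1 i)) @[m --> \oo] --> flow F i z.
Proof. by apply: cvg_euler; [exact: sm_tfield|exact: good_tfield]. Qed.

Lemma flow0 i x : flow F i (tv 0 x) = x 0 i.
Proof.
rewrite /flow /time1 (_ : (fun m => _) = cst (x 0 i)); first exact: lim_cst.
apply/funext => m; rewrite /euler eulN_tfield row_mxEr mulr0 /cst /eulN.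
suff -> : forall k, iter k (eul F 0) x = x by []. by elim=> // k /= ->; rewrite /eul scale0r addr0.
Qed.

(** The time derivative u_k of the polygon after k steps is compared with k h F at its vertex. The
    difference obeys a discrete Gronwall inequality with source O(h^2), and k h = 1 at the last
    vertex, so the limit of the derivatives is F itself. *)
Lemma flow_ode i z : pd (lshift N 0) (flow F i) z = F i (\row_j flow F j z).
Proof.
have hG := sm_tfield hF; have gG := good_tfield gF.
pose f m (z : 'rV[R]_(1 + N)) := euler (tfield F) m z 0 (rshift 1 i).
have [_ /(_ (ev (lshift N 0)))] := @lim_derive _ _ f (flow F i)
  (fun m => sm_eulN _ _ _ hG) (Ck_bounded_euler 2 _ hG gG) (@cvg_flow i) z.
set s := z 0 (lshift N 0); set x := rsubmx z. have [r r0 hr] := gF (Num.max `|s| `|x|).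
have {}hr m k : (k <= 2 ^ m)%N -> `|eulN F ((2 ^+ m)^-1 * s) k x| <= r.
  by move=> km; apply: hr => //; rewrite le_max lexx ?orbT. have [K K0 hK] := vfield_bound r hF.
have [L L0 hL] := field_derive_bound r hF. have [C C0 hC] := @cont_bounded_fin R N ('I_N * ('I_N * 'I_N))%type
  (fun ij => pd ij.2.2 (pd ij.2.1 (F ij.1))) r (fun ij => sm_cont (sm_derive _ (sm_derive _ (hF ij.1)))).
have T a y d : `|y| <= r -> `|y + d| <= r ->
    `|F a (y + d) - F a y - 'D_d (F a) y| <= N%:R * (N%:R * C) * `|d| ^+ 2.
  by apply: taylor2 => // b c w wr; exact: (hC (a, (b, c))).
set C2 := N%:R * (N%:R * C) in T; have C20 : 0 <= C2 by rewrite !mulr_ge0.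
pose B := C2 * (`|s| * K) ^+ 2 + `|s| * L * K. have B0 : 0 <= B by rewrite addr_ge0// !mulr_ge0// sqr_ge0.
have W m a : `|pd (lshift N 0) (fun z => euler (tfield F) m z 0 (rshift 1 a)) z
    - F a (rsubmx (euler (tfield F) m z))| <= expR (`|s| * L) * B * (2 ^+ m)^-1.
  pose h : R := (2 ^+ m)^-1; have h0 : 0 <= h by rewrite invr_ge0 exprn_ge0. pose y k := eulN F (h * s) k x.
  pose u k : 'rV[R]_N := \row_a pd (lshift N 0) (fun z => eulN (tfield F) h k z 0 (rshift 1 a)) z.
  have uE0 k c : u k 0 c = pd (lshift N 0) (fun z => eulN (tfield F) h k z 0 (rshift 1 c)) z by rewrite mxE.
  have Ez k : eulN (tfield F) h k z = tv s (y k) by rewrite [z in LHS]tvK eulN_tfield.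
  have uE k b : u k.+1 0 b = u k 0 b + h * (F b (y k) + s * 'D_(u k) (F b) (y k)). rewrite [LHS]uE0.
    rewrite (_ : (fun z => eulN _ _ k.+1 z 0 _) = (fun z => eulN (tfield F) h k z 0 (rshift 1 b)) +
      h *: ((fun z : 'rV[R]_(1 + N) => z 0 (lshift N 0) : R) *
        (F b \o (fun z => rsubmx (eulN (tfield F) h k z))))).
      have dR : differentiable (fun z => rsubmx (eulN (tfield F) h k z)) z.
        apply: sm_diff_rV => c; under eq_fun do rewrite mxE; exact: sm_eulN.
      have dFR := differentiable_comp dR (sm_diff _ (hF b)).
      have dc : differentiable (fun z : 'rV[R]_(1 + N) => z 0 (lshift N 0)) z. exact: differentiable_coord.
      rewrite deriveD; last 2 first. by apply: sm_derivable; exact: sm_eulN.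
        by apply: diff_derivable; apply: differentiableZ; exact: differentiableM.
      rewrite deriveZ; last by apply: diff_derivable; exact: differentiableM.
      rewrite deriveM; [|exact: diff_derivable|exact: diff_derivable].
      rewrite (derive_chain _ dR (sm_diff _ (hF b))).
      rewrite /comp Ez row_mxKr -(@derive_coord _ _ _ (fun z => z))// derive_id !mxE eqxx/=.
      congr (_ + _ * _); rewrite /GRing.scale/= mulr1 addrC; congr (_ + s * _).
      congr ('D_ _ _ _); apply/rowP => c; rewrite derive_coord; last exact: diff_derivable. rewrite uE0.
      have -> : (fun z => rsubmx (eulN (tfield F) h k z) 0 c) =
        (fun z => eulN (tfield F) h k z 0 (rshift 1 c)) by apply/funext => w; rewrite mxE. by [].
    apply/funext => w; rewrite eulNE /tfield split_rshift; congr (_ + _ * (_ * _)).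
    rewrite (tvK w) eulN_tfield !row_mxEl//. have yE k : y k.+1 = y k + (h * s) *: vfield F (y k) by [].
  pose w k := u k - (k%:R * h) *: vfield F (y k).
  have E k' b : w k' 0 b = u k' 0 b - k'%:R * h * F b (y k') by rewrite !mxE.
  have wl k : (k < 2 ^ m)%N -> `|w k.+1| <= (1 + h * (`|s| * L)) * `|w k| + h ^+ 2 * B.
    move=> km; have yr := hr m k (ltnW km); have yr' := hr m k.+1 km.
    rewrite -/h -/(y _) in yr; rewrite -/h -/(y _) in yr'. apply: norm_le_coord => [|b].
      by rewrite addr_ge0 ?mulr_ge0 ?addr_ge0 ?mulr_ge0 ?sqr_ge0.
    have DL v1 v2 t : 'D_(v1 - t *: v2) (F b) (y k) = 'D_v1 (F b) (y k) - t * 'D_v2 (F b) (y k).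
      by rewrite !deriveE ?linearB ?linearZ//; exact: sm_diff.
    have DZ t v : 'D_(t *: v) (F b) (y k) = t * 'D_v (F b) (y k).
      by rewrite !deriveE ?linearZ//; exact: sm_diff.
    (* Apart from the part linear in w there remain a second order Taylor remainder of F between
       consecutive vertices and one term quadratic in h. *)
    have -> : w k.+1 0 b = w k 0 b + h * s * 'D_(w k) (F b) (y k)
       - (k.+1%:R * h) * (F b (y k.+1) - F b (y k) - 'D_((h * s) *: vfield F (y k)) (F b) (y k))
       - h * (h * s) * 'D_(vfield F (y k)) (F b) (y k). by rewrite !E uE DL DZ -natr1; ring.
    have Kb := hK _ yr. have e1 : `|h * s * 'D_(w k) (F b) (y k)| <= h * (`|s| * L) * `|w k|.
      by rewrite !normrM (ger0_norm h0) -!mulrA !ler_wpM2l// hL.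
    have dn : `|(h * s) *: vfield F (y k)| <= h * (`|s| * K).
      by rewrite normrZ normrM (ger0_norm h0) -mulrA !ler_wpM2l.
    have e2 : `|k.+1%:R * h * (F b (y k.+1) - F b (y k) - 'D_((h * s) *: vfield F (y k)) (F b) (y k))|
        <= h ^+ 2 * (C2 * (`|s| * K) ^+ 2).
      rewrite normrM (_ : h ^+ 2 * _ = 1 * (C2 * (h * (`|s| * K)) ^+ 2)); last by ring. rewrite ler_pM//.
        rewrite ger0_norm ?mulr_ge0// /h ler_pdivrMr ?exprn_gt0// mul1r -natrX ler_nat//.
      rewrite yE (le_trans (T _ _ _ yr _)) -?yE// ler_wpM2l// lerXn2r// nnegrE//. by rewrite !mulr_ge0.
    have e3 : `|h * (h * s) * 'D_(vfield F (y k)) (F b) (y k)| <= h ^+ 2 * (`|s| * L * K).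
      rewrite !normrM (ger0_norm h0) expr2 -!mulrA !ler_wpM2l//.
      by rewrite (le_trans (hL _ _ _ yr))// ler_wpM2l. have wb := coord_le_norm (w k) b.
    apply: le_trans (ler_normB _ _) _; apply: le_trans (lerD (ler_normB _ _) e3) _.
    apply: le_trans (lerD (lerD (ler_normD _ _) e2) (lexx _)) _.
    apply: le_trans (lerD (lerD (lerD wb e1) (lexx _)) (lexx _)) _. by rewrite /B; lra.
  have sL : 0 <= `|s| * L by rewrite mulr_ge0.
  have := discrete_gronwall (mulr_ge0 h0 sL) (mulr_ge0 (sqr_ge0 h) B0) wl (leqnn _). have w0 : w 0%N = 0.
    apply/rowP => b; rewrite !mxE mul0r mul0r subr0.
    rewrite (_ : (fun z => eulN _ _ 0 z 0 _) = fun z : 'rV[R]_(1 + N) => z 0 (rshift 1 b))//.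
    by rewrite -(@derive_coord _ _ _ (fun z => z))// derive_id mxE eqxx eq_rlshift.
  rewrite w0 normr0 add0r => Hw. have hm : (2 ^ m)%:R * h = 1 by rewrite natrX /h mulfV// expf_neq0.
  rewrite {2}/euler -/h Ez row_mxKr -[F a _]mul1r -[in X in _ - X]hm.
  have := uE0 (2 ^ m)%N a; rewrite -/(euler _ _) => <-.
  rewrite -E (le_trans (coord_le_norm _ _))// (le_trans Hw)// -mulrA.
  have -> : (2 ^ m)%:R * (h ^+ 2 * B) = B * h. by rewrite expr2 -[h * h * B]mulrA mulrA hm mul1r mulrC.
  by rewrite ler_wpM2r ?mulr_ge0// pow_le_exp.
have cF : F i (rsubmx (euler (tfield F) m z)) @[m --> \oo] --> F i (\row_j flow F j z).
  apply: (@continuous_cvg _ _ _ _ _ (fun m => rsubmx (euler (tfield F) m z)) (F i)). exact: sm_cont.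
  apply/(@cvgrPdist_lt _ 'rV[R]_N) => e e0; near=> m.
  apply: norm_lt_coord => // j; rewrite !mxE; move: j; near: m.
  apply: filter_forall => j; have /cvgrPdist_lt/(_ e e0) := @cvg_flow j z.
  by apply: filterS => n; rewrite ?mxE.
have c0 : (expR (`|s| * L) * B * (2 ^+ m)^-1) @[m --> \oo] --> (0 : R).
  rewrite -[X in _ --> X](mulr0 (expR (`|s| * L) * B)); apply: cvgM; first exact: cvg_cst.
  have := @cvg_geometric R 1 2^-1; rewrite /geometric/= => H. under eq_fun do rewrite -exprVn -[_ ^+ _]mul1r.
  by apply: H; rewrite ger0_norm// invf_lt1// ltr1n.
move=> c1; have c2 : (pd (lshift N 0) (f m) z - F i (rsubmx (euler (tfield F) m z))) @[m --> \oo] --> (0 : R).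
  apply/norm_cvg0P; apply: (squeeze_cvgr _ (@cvg_cst _ (0 : R) _ \oo _) c0).
  by apply: nearW => m; rewrite normr_ge0/= W.
have c3 : (pd (lshift N 0) (f m) z - F i (rsubmx (euler (tfield F) m z)))
    @[m --> \oo] --> pd (lshift N 0) (flow F i) z - F i (\row_j flow F j z). exact: cvgB c1 cF.
have /eqP : pd (lshift N 0) (flow F i) z - F i (\row_j flow F j z) = 0.
  by rewrite -(cvg_lim (@norm_hausdorff _ _) c3) (cvg_lim (@norm_hausdorff _ _) c2).
by rewrite subr_eq0 => /eqP. Unshelve. all: by end_near. Qed.

End FlowTheory.

End Flow.

Notation tv t z := (row_mx (t%:M : 'rV_1) z).

(** * Differential equations with parameters and linear growth *)

Section ParametricFlow. Variable R : realType.

(** The state is (t, z, y): time advances with speed 1, the parameters z stand still, and y follows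
    F. *)
Definition param_field d m (F : 'I_m -> fn R ((1 + d) + m))
    (i : 'I_((1 + d) + m)) (z : 'rV[R]_((1 + d) + m)) : R := match fintype.split i with
  | inl a => (a == lshift d 0)%:R | inr k => F k z end.

Lemma sm_param_field d m (F : 'I_m -> fn R ((1 + d) + m)) :
  (forall k, sm (F k)) -> forall i, sm (param_field F i).
Proof. by move=> hF i; rewrite /param_field; case: (fintype.split i) => a //; exact: sm_cst. Qed.

Lemma eulN_paramE d m (F : 'I_m -> fn R ((1 + d) + m)) h k z a : eulN (param_field F) h k z 0 (lshift m a) =
  z 0 (lshift m a) + k%:R * h * (a == lshift d 0)%:R.
Proof.
elim: k => [|k ih]; first by rewrite mul0r mul0r addr0.
rewrite eulNE ih /param_field split_lshift -natr1; ring.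
Qed.

Lemma eulN_param d m (F : 'I_m -> fn R ((1 + d) + m)) h k z : lsubmx (eulN (param_field F) h k z) =
  lsubmx z + (k%:R * h) *: ev (lshift d 0).
Proof.
apply/rowP => a; rewrite [LHS]mxE eulN_paramE [RHS]mxE; congr (_ + _). by rewrite mxE. by rewrite !mxE eqxx.
Qed.

(** Linear growth in y multiplies 1 + |y| by at most 1 + h |r| K per step, while time and parameters
    stay in a ball of radius 2 |r|. *)
Lemma scaled_good_param d m (F : 'I_m -> fn R ((1 + d) + m)) :
  (forall r, exists2 K, 0 <= K & forall q y k, `|q| <= r -> `|F k (row_mx q y)| <= K * (1 + `|y|)) ->
  scaled_good (param_field F).
Proof.
move=> gF r; have [K K0 hK] := gF (`|r| + `|r|). exists (`|r| + `|r| + expR (`|r| * K) * (1 + `|r|)).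
  by rewrite !addr_ge0// mulr_ge0 ?expR_ge0// addr_ge0. move=> m' k s z km sr zr; set h := (2 ^+ m')^-1 * s.
have hs : `|h| = (2 ^+ m')^-1 * `|s| by rewrite normrM ger0_norm// invr_ge0 exprn_ge0.
have rr : r <= `|r| by rewrite ler_norm. pose y j := rsubmx (eulN (param_field F) h j z).
pose q j := lsubmx (eulN (param_field F) h j z). have qr j : (j <= 2 ^ m')%N -> `|q j| <= `|r| + `|r|.
  move=> jm; rewrite /q eulN_param (le_trans (ler_normD _ _))// lerD//.
    by rewrite (le_trans (norm_lsubmx _))// (le_trans zr). rewrite normrZ normrM hs mulrA ger0_norm//.
  apply: le_trans (_ : `|s| * 1 <= _); last by rewrite mulr1 (le_trans sr).
  rewrite ler_pM ?mulr_ge0 ?norm_ev//. rewrite ler_piMl// ler_pdivrMr ?exprn_gt0// mul1r -natrX ler_nat//.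
have yE j : y j.+1 = y j + h *: \row_b F b (row_mx (q j) (y j)).
  apply/rowP => b; rewrite /y /q hsubmxK [LHS]mxE eulNE /param_field split_rshift.
  by rewrite [RHS]mxE; congr (_ + _); rewrite [RHS]mxE ?[in RHS]mxE. have H j : (j < 2 ^ m')%N ->
    1 + `|y j.+1| <= (1 + (2 ^+ m')^-1 * (`|r| * K)) * (1 + `|y j|) + 0. move=> jm; rewrite addr0 yE.
  apply: le_trans (lerD (lexx _) (ler_normD _ _)) _.
  rewrite addrA mulrDl mul1r lerD2l normrZ hs -!mulrA ler_wpM2l//.
  rewrite ler_pM// ?(le_trans sr)//; apply: norm_le_coord => [|b]. by rewrite mulr_ge0// addr_ge0.
  by rewrite mxE; apply: hK; exact/qr/ltnW. have a0 : 0 <= (2 ^+ m')^-1 * (`|r| * K) by rewrite !mulr_ge0.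
have := discrete_gronwall (d := fun j => 1 + `|y j|) a0 (lexx 0) H km. rewrite mulr0 addr0 => Y.
rewrite -[eulN _ _ _ _]hsubmxK -/(q k) -/(y k). have E0 : 0 <= expR (`|r| * K) * (1 + `|r|).
  by rewrite mulr_ge0 ?expR_ge0// addr_ge0. apply: norm_row_mx_le; first by rewrite !addr_ge0.
  by rewrite (le_trans (qr k km))// lerDl.
apply: (@le_trans _ _ (expR (`|r| * K) * (1 + `|r|))); last by rewrite lerDr addr_ge0.
apply: (@le_trans _ _ (1 + `|y k|)); first by rewrite lerDr.
apply: le_trans Y _; apply: ler_pM; rewrite ?exprn_ge0 ?addr_ge0//.
  by apply: pow_le_exp => //; rewrite mulr_ge0.
rewrite lerD2l; apply: le_trans (norm_rsubmx _) _; exact: le_trans zr rr.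
Qed.

Lemma derive_tv d (f : fn R (1 + d)) (t : R) z : differentiable f (tv t z) ->
  is_derive t 1 (fun s => f (tv s z)) (pd (lshift d 0) f (tv t z)).
Proof.
move=> hf; have := @curve_derive _ _ f (fun s => tv s z) (ev (lshift d 0)) t.
apply => // i; case: (split_ordP i) => a ->.
  rewrite ord1 mxE eqxx/=; under eq_fun do rewrite row_mxEl mxE eqxx mulr1n. exact: is_derive_id.
rewrite mxE eq_rlshift/=; under eq_fun do rewrite row_mxEr. exact: is_derive_cst.
Qed.

(** The source of all solutions of differential equations below. They are smooth in time and
    parameters jointly and exist for all times; nonlinear local problems are therefore cut off
    before this theorem is applied. *)
Theorem param_flow d m (F : 'I_m -> fn R ((1 + d) + m)) (y0 : 'I_m -> fn R d) :
  (forall k, sm (F k)) -> (forall k, sm (y0 k)) -> (forall r, exists2 K, 0 <= K & forall q y k, `|q| <= r ->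
    `|F k (row_mx q y)| <= K * (1 + `|y|)) -> exists Y : 'I_m -> fn R (1 + d), [/\ forall k, sm (Y k),
    forall k z, Y k (tv 0 z) = y0 k z & forall k q, pd (lshift d 0) (Y k) q = F k (row_mx q (\row_j Y j q))].
Proof.
move=> hF hy gF; have sF := sm_param_field hF; have gP := scaled_good_param gF. pose H := param_field F.
(* The first entry is the duration of the flow; the time coordinate inside the state starts at 0 and
   has reached the duration at the end. *)
pose g (q : 'rV[R]_(1 + d)) : 'rV[R]_(1 + ((1 + d) + m)) :=
  tv (q 0 (lshift d 0)) (row_mx (tv 0 (rsubmx q)) (\row_k y0 k (rsubmx q))).
have sg i : sm (fun q => g q 0 i). apply: sm_row_mx i => i.
    by rewrite (ord1 i); under eq_fun do rewrite mxE eqxx mulr1n; exact: sm_coord. apply: sm_row_mx i => i.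
    apply: sm_row_mx i => i; last exact: sm_rsubmx. by under eq_fun do rewrite mxE; exact: sm_cst.
  under eq_fun do rewrite mxE; apply: sm_comp => // j; exact: sm_rsubmx.
have fl q : \row_j flow H j (g q) = row_mx q (\row_k flow H (rshift _ k) (g q)).
  apply/rowP => i; rewrite mxE; case: (split_ordP i) => a ->; last by rewrite row_mxEr mxE.
  rewrite row_mxEl /flow /time1. rewrite (_ : (fun _ => _) = cst (q 0 a)); first exact: lim_cst.
  apply/funext => m'; rewrite /euler eulN_tfield row_mxEr.
  have := congr1 (fun w : 'rV_ _ => w 0 a) (eulN_param F ((2 ^+ m')^-1 * q 0 (lshift d 0))
    (2 ^ m') (row_mx (tv 0 (rsubmx q)) (\row_k y0 k (rsubmx q)))).
  rewrite mxE => ->; rewrite row_mxKl [in RHS](tvK q) !mxE mulrA natrX mulfV ?expf_neq0//.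
  rewrite mul1r; case: (split_ordP a) => b ->. by rewrite (ord1 b) /cst !mxE !eqxx/= !mulr1n mulr1 add0r.
  by rewrite eq_rlshift/= mulr0 addr0. exists (fun k q => flow H (rshift _ k) (g q)); split.
- by move=> k; apply: sm_comp => //; exact: sm_flow.
- move=> k z; rewrite /g row_mxEl mxE eqxx mulr1n row_mxKr flow0//. by rewrite row_mxEr mxE.
- move=> k q; rewrite {1 2}(tvK q); set t := q 0 _; set z := rsubmx q.
  have sY : sm (fun q => flow H (rshift _ k) (g q)). by apply: sm_comp => //; exact: sm_flow.
  have d1 := derive_tv (sm_diff (tv t z) sY).
  have d2 := derive_tv (sm_diff (tv t (row_mx (tv 0 z) (\row_k y0 k z))) (sm_flow sF gP (rshift (1 + d) k))).
  rewrite -(@derive_val _ _ _ _ _ _ _ d1). rewrite (_ : (fun s => _) = fun s => flow H (rshift (1 + d) k)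
    (tv s (row_mx (tv 0 z) (\row_k y0 k z)))); last first.
    by apply/funext => s; rewrite /g row_mxEl mxE eqxx mulr1n row_mxKr.
  rewrite (@derive_val _ _ _ _ _ _ _ d2) flow_ode// {1}/param_field split_rshift.
  by congr (F k _); rewrite -(tvK q) -fl.
Qed.

End ParametricFlow.

(** * Cutoffs and extension of locally defined functions *)

Section LocalExtension.
Variable R : realType.

Lemma Ck_local n k (f : fn R n) : (forall x, exists2 W : set 'rV[R]_n, W x & Ck k W f) -> Ck k setT f.
Proof.
elim: k f => [|k ih] f h; first by move=> x _; have [W Wx] := h x; apply.
split=> [x _|v]; first by have [W Wx [df _]] := h x; exact: df.
by apply: ih => x; have [W Wx [_ vf]] := h x; exists W => //; exact: vf.
Qed.

Definition sqdist n (x0 x : 'rV[R]_n) : R := \sum_i (x 0 i - x0 0 i) ^+ 2.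

Lemma sm_sqdist n (x0 : 'rV[R]_n) : sm (sqdist x0).
Proof.
apply: sm_sum => i; apply: (@sm_exp _ _ (fun x : 'rV[R]_n => x 0 i - x0 0 i)).
by apply: sm_sub; [exact: sm_coord|exact: sm_cst].
Qed.

Lemma sqdist_ge n (x0 x : 'rV[R]_n) : `|x - x0| ^+ 2 <= sqdist x0 x.
Proof.
have s0 : 0 <= sqdist x0 x by apply: sumr_ge0 => i _; exact: sqr_ge0.
rewrite -[leRHS]sqr_sqrtr// lerXn2r ?nnegrE ?sqrtr_ge0//.
apply: norm_le_coord => [|i]; first exact: sqrtr_ge0.
rewrite !mxE -sqrtr_sqr ler_wsqrtr// /sqdist (bigD1 i)//= lerDl. by apply: sumr_ge0 => j _; exact: sqr_ge0.
Qed.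

Lemma sqdistxx n (x0 : 'rV[R]_n) : sqdist x0 x0 = 0.
Proof. by rewrite /sqdist big1// => i _; rewrite subrr expr0n. Qed.

(** Equal to 1 where [sqdist] is at most d^2/4 and to 0 where it is at least d^2/2. The squared
    Euclidean distance is used because the norm on rows is a maximum and not smooth. *)
Definition cutoff n (x0 : 'rV[R]_n) (d : R) (x : 'rV[R]_n) : R := step (2 - 4 / d ^+ 2 * sqdist x0 x).

Lemma sm_cutoff n (x0 : 'rV[R]_n) d : sm (cutoff x0 d).
Proof.
apply: sm_step; apply: sm_sub; first exact: sm_cst. by apply: sm_mul; [exact: sm_cst|exact: sm_sqdist].
Qed.

Lemma cutoff0 n (x0 : 'rV[R]_n) d x : 0 < d -> d ^+ 2 / 2 <= sqdist x0 x -> cutoff x0 d x = 0.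
Proof. move=> d0 h; apply: step0; rewrite subr_le0 mulrAC ler_pdivlMr ?exprn_gt0//; lra. Qed.

Lemma cutoff1 n (x0 : 'rV[R]_n) d x : 0 < d -> sqdist x0 x <= d ^+ 2 / 4 -> cutoff x0 d x = 1.
Proof. move=> d0 h; apply: step1; rewrite lerBrDr -lerBrDl mulrAC ler_pdivrMr ?exprn_gt0//. lra. Qed.

Lemma sqdist_norm n (x0 x : 'rV[R]_n) d : 0 < d -> sqdist x0 x < d ^+ 2 -> `|x - x0| < d.
Proof. move=> d0 /(le_lt_trans (sqdist_ge x0 x)). by rewrite ltr_pXn2r ?nnegrE ?(ltW d0). Qed.

Lemma cutoff_support n (x0 : 'rV[R]_n) d x : 0 < d -> cutoff x0 d x != 0 -> `|x| <= `|x0| + d.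
Proof.
move=> d0 cx; apply/norm_ball/ltW/sqdist_norm => //; rewrite ltNge; apply: contra cx => h.
by rewrite cutoff0//; apply: le_trans h; rewrite ler_pdivrMr// ler_pMr ?exprn_gt0// ler1n.
Qed.

Lemma cutoff_ge0 n (x0 : 'rV[R]_n) d x : 0 <= cutoff x0 d x.
Proof. exact: step_ge0. Qed.

Lemma cutoff_le1 n (x0 : 'rV[R]_n) d x : cutoff x0 d x <= 1.
Proof. exact: step_le1. Qed.

Lemma open_sm_lt n (f : fn R n) c : sm f -> open [set x | f x < c].
Proof.
move=> hf; rewrite (_ : [set x | _] = f @^-1` [set t | t < c])//.
by apply: open_comp; [move=> x _; exact: sm_cont|exact: open_lt].
Qed.

Lemma open_sm_gt n (f : fn R n) c : sm f -> open [set x | c < f x].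
Proof.
move=> hf; rewrite (_ : [set x | _] = f @^-1` [set t | c < t])//.
by apply: open_comp; [move=> x _; exact: sm_cont|exact: open_gt].
Qed.

Lemma cutoff_near n (x0 : 'rV[R]_n) d : 0 < d -> \forall x \near x0, cutoff x0 d x = 1.
Proof.
move=> d0; have : nbhs x0 [set x | sqdist x0 x < d ^+ 2 / 4].
  apply: open_nbhs_nbhs; split; first exact/open_sm_lt/sm_sqdist. by rewrite /= sqdistxx divr_gt0// exprn_gt0.
by apply: filterS => x /= h; apply: cutoff1 => //; exact: ltW.
Qed.

(** Replaces a function on an open set by a bounded entire one with the same germ, so that later
    calculus can stay within functions smooth on the whole of R^n. *)
Lemma local_ext n (V : set 'rV[R]_n) (f : fn R n) x0 : open V -> V x0 -> Cinf V f ->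
  exists g, [/\ sm g, exists2 C, 0 <= C & forall x, `|g x| <= C & \forall x \near x0, g x = f x].
Proof.
move=> oV Vx0 hf; have /nbhs_rVP[d d0 hV] : nbhs x0 V by exact: open_nbhs_nbhs.
have VS x : sqdist x0 x < d ^+ 2 -> V x. by move=> h; apply: hV; exact: sqdist_norm.
have dd : d ^+ 2 / 2 < d ^+ 2 by rewrite ltr_pdivrMr// ltr_pMr ?exprn_gt0// ltr1n.
pose g x := if sqdist x0 x < d ^+ 2 then cutoff x0 d x * f x else 0. have sg : sm g.
  move=> k; apply: Ck_local => x; have [xd|xd] := ltP (sqdist x0 x) (d ^+ 2).
    exists [set x | sqdist x0 x < d ^+ 2] => //. have oW := @open_sm_lt _ _ (d ^+ 2) (sm_sqdist x0).
    apply: (@Ck_congr _ _ _ _ (fun x => cutoff x0 d x * f x)) => //. by move=> y /= yd; rewrite /g yd.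
    apply: Ck_mul => //; first exact: Ck_sub (sm_cutoff x0 d k). exact: Ck_sub (hf k).
  exists [set x | d ^+ 2 / 2 < sqdist x0 x]; first exact: lt_le_trans xd.
  apply: (@Ck_congr _ _ _ _ (fun=> 0)).
  - exact: open_sm_gt (sm_sqdist x0).
  - move=> y /= yd; rewrite /g; case: ifP => // _. by rewrite cutoff0 ?mul0r// ltW.
  - exact: Ck_cst. exists g; split => //. have [C C0 hC] := cont_bounded (`|x0| + d) (sm_cont sg).
  exists C => // x; have [xd|xd] := ltP (sqdist x0 x) (d ^+ 2); last first. by rewrite /g ltNge xd normr0.
  by apply/hC/norm_ball/ltW; exact: sqdist_norm. have n1 := cutoff_near x0 d0.
have n2 : nbhs x0 [set x | sqdist x0 x < d ^+ 2].
  apply: open_nbhs_nbhs; split; first exact/open_sm_lt/sm_sqdist. by rewrite /= sqdistxx exprn_gt0.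
by apply: filterS2 n1 n2 => x b1 /= x1; rewrite /g x1 b1 mul1r.
Qed.

Lemma local_ext_fin n (I : finType) (V : set 'rV[R]_n) (f : I -> fn R n) x0 :
  open V -> V x0 -> (forall i, Cinf V (f i)) -> exists g : I -> fn R n, [/\ forall i, sm (g i),
    exists2 C, 0 <= C & forall i x, `|g i x| <= C & \forall x \near x0, forall i, g i x = f i x].
Proof.
move=> oV Vx0 hf; have /choice[g hg] i := local_ext oV Vx0 (hf i). exists g; split=> [i||].
- by case: (hg i).
- have [|C C0 hC] := @bound_fin R I _ setT g; last by exists C => // i x; exact: hC.
  by move=> i; have [_ [C C0 h] _] := hg i; exists C.
- have H i : \forall x \near x0, g i x = f i x by case: (hg i). exact: (filter_forall _ H).
Qed.

Lemma Cinf_det n k (V : set 'rV[R]_n) (A : 'rV[R]_n -> 'M[R]_k) : open V ->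
  (forall i j, Cinf V (fun x => A x i j)) -> Cinf V (fun x => \det (A x)).
Proof.
move=> oV hA l; rewrite /determinant; apply: Ck_sum => // s. apply: Ck_mul => //; first exact: Ck_cst.
by apply: Ck_prod => // i; exact: hA.
Qed.

Lemma Cinf_invmx n k (V : set 'rV[R]_n) (A : 'rV[R]_n -> 'M[R]_k) i j : open V ->
  (forall x, V x -> \det (A x) != 0) ->
  (forall i j, Cinf V (fun x => A x i j)) -> Cinf V (fun x => invmx (A x) i j).
Proof.
move=> oV dA hA l. apply: (@Ck_congr _ _ _ _ (fun x => (\det (A x))^-1 * \adj (A x) i j)) => //.
  by move=> x Vx; rewrite /invmx unitmxE unitfE (dA _ Vx) [RHS]mxE.
apply: Ck_mul => //; first by apply: Ck_inv => //; exact: Cinf_det.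
apply: (@Ck_congr _ _ _ _ (fun x => cofactor (A x) j i)) => //. by move=> x Vx; rewrite mxE.
rewrite /cofactor; apply: Ck_mul => //; first exact: Ck_cst.
apply: (@Cinf_det _ _ V (fun x => row' j (col' i (A x)))) => // a b.
by under eq_fun do rewrite !mxE; exact: hA.
Qed.

End LocalExtension.

(** * Gronwall's inequality, linear equations, Hadamard's lemma and inverse functions *)

Section OdeTools.
Variable R : realType.

Lemma nbhs_rV2 n (x : 'rV[R]_n) (P Q : set 'rV[R]_n) : nbhs x P -> nbhs x Q ->
  exists2 d, 0 < d & forall y, `|y - x| < d -> P y /\ Q y.
Proof.
move=> /nbhs_rVP[d d0 hP] /nbhs_rVP[e e0 hQ]; exists (Num.min d e). by rewrite lt_min d0.
by move=> y; rewrite lt_min => /andP[yd ye]; split; [exact: hP|exact: hQ].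
Qed.

Lemma near_fin (T : topologicalType) (x : T) (I : finType) (P : I -> set T) :
  (forall i, nbhs x (P i)) -> nbhs x [set y | forall i, P i y].
Proof. by move=> h; exact: (filter_forall _ h). Qed.

Lemma drv_eq (f g : R -> R) (t d e : R) :
  is_derive t 1 f d -> (forall s, f s = g s) -> d = e -> is_derive t 1 g e.
Proof. by move=> h /funext <- <-. Qed.

Lemma drv_cst (c t : R) : is_derive t 1 (fun=> c) 0.
Proof. exact: is_derive_cst. Qed.

Lemma drv_id (t : R) : is_derive t 1 (fun s => s) 1.
Proof. exact: is_derive_id. Qed.

Lemma drv_add (f g : R -> R) (t df dg : R) : is_derive t 1 f df ->
  is_derive t 1 g dg -> is_derive t 1 (fun s => f s + g s) (df + dg).
Proof. by move=> hf hg; apply: (drv_eq (is_deriveD hf hg)). Qed.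

Lemma drv_sub (f g : R -> R) (t df dg : R) : is_derive t 1 f df ->
  is_derive t 1 g dg -> is_derive t 1 (fun s => f s - g s) (df - dg).
Proof. by move=> hf hg; apply: (drv_eq (is_deriveB hf hg)). Qed.

Lemma drv_mul (f g : R -> R) (t df dg : R) : is_derive t 1 f df ->
  is_derive t 1 g dg -> is_derive t 1 (fun s => f s * g s) (df * g t + f t * dg).
Proof.
move=> hf hg; apply: (drv_eq (is_deriveM hf hg)) => //. by rewrite /GRing.scale/= addrC (mulrC (g t)).
Qed.

Lemma drv_sum (I : Type) (r : seq I) (P : pred I) (f : I -> R -> R) (t : R) (df : I -> R) :
  (forall i, P i -> is_derive t 1 (f i) (df i)) ->
  is_derive t 1 (fun s => \sum_(i <- r | P i) f i s) (\sum_(i <- r | P i) df i).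
Proof.
move=> h; elim: r => [|i r ih]. by rewrite big_nil; apply: (drv_eq (drv_cst 0 t)) => // s; rewrite big_nil.
rewrite big_cons; case: (boolP (P i)) => Pi.
  by apply: (drv_eq (drv_add (h i Pi) ih)) => // s; rewrite big_cons Pi.
by apply: (drv_eq ih) => // s; rewrite big_cons (negPf Pi).
Qed.

Lemma drv_continuous (f : R -> R) (t d : R) : is_derive t 1 f d -> {for t, continuous f}.
Proof. by move=> h; apply/differentiable_continuous/derivable1_diffP; case: h. Qed.

Lemma mvt_itv (f df : R -> R) a b : a <= b -> (forall t, a <= t <= b -> is_derive (t : R) 1 f (df t)) ->
  exists2 c, a <= c <= b & f b - f a = df c * (b - a).
Proof.
move=> ab h. have h' (t : R) : t \in `]a, b[%R -> is_derive t 1 f (df t).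
  by rewrite in_itv/= => /andP[at_ tb]; apply: h; rewrite !ltW. have cf : {within `[a, b], continuous f}.
  apply: continuous_in_subspaceT => t; rewrite inE/= in_itv/= => tab. exact: drv_continuous (h t tab).
by have [c] := MVT_segment ab h' cf; rewrite in_itv/= => cab E; exists c.
Qed.

Lemma derive0_constant (f df : R -> R) a b : a <= b ->
  (forall t, a <= t <= b -> is_derive (t : R) 1 f (df t)) -> (forall t, a <= t <= b -> df t = 0) -> f b = f a.
Proof. move=> ab h h0; have [c cab /eqP] := mvt_itv ab h. by rewrite h0// mul0r subr_eq0 => /eqP. Qed.

(** After t0 the function N e^(-Kt) decreases, before t0 the function N e^(Kt) increases. Letting t0
    lie anywhere in the interval gives uniqueness in both directions of time. *)
Lemma gronwall (N dN : R -> R) K a b t0 : (forall t, a <= t <= b -> is_derive (t : R) 1 N (dN t)) ->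
  (forall t, 0 <= N t) -> (forall t, a <= t <= b -> `|dN t| <= K * N t) ->
  a <= t0 <= b -> N t0 = 0 -> forall t, a <= t <= b -> N t = 0.
Proof.
move=> hN N0 hK /andP[at0 t0b] Nt0 t /andP[at_ tb]. apply/eqP; rewrite eq_le N0 andbT.
have dE (k s : R) : a <= s <= b ->
    is_derive s 1 (fun u => N u * expR (k * u)) ((dN s + k * N s) * expR (k * s)).
  move=> sab; have dl := drv_mul (drv_cst k s) (drv_id s).
  have de := @is_derive1_comp _ expR _ s _ _ (is_derive_expR _) dl.
  by apply: (drv_eq (drv_mul (hN s sab) de)) => //=; ring. have [t0t|/ltW tt0] := leP t0 t.
- have sub s : t0 <= s <= t -> a <= s <= b. by case/andP => s1 s2; rewrite (le_trans at0 s1) (le_trans s2 tb).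
  have [c /sub cab E] := mvt_itv t0t (fun s hs => dE (- K) s (sub s hs)). have : N t * expR (- K * t) <= 0.
    move: E; rewrite Nt0 mul0r subr0 => ->.
    rewrite mulr_le0_ge0 ?subr_ge0// mulr_le0_ge0 ?expR_ge0// mulNr subr_le0.
    exact: le_trans (ler_norm _) (hK c cab). by rewrite pmulr_lle0// expR_gt0.
- have sub s : t <= s <= t0 -> a <= s <= b.
    by case/andP => s1 s2; rewrite (le_trans at_ s1) (le_trans s2 t0b).
  have [c /sub cab E] := mvt_itv tt0 (fun s hs => dE K s (sub s hs)). have : N t * expR (K * t) <= 0.
    rewrite -oppr_ge0; move: E; rewrite Nt0 mul0r sub0r => ->.
    rewrite mulr_ge0 ?subr_ge0// mulr_ge0 ?expR_ge0//.
    rewrite -lerBlDr sub0r (le_trans _ (_ : - `|dN c| <= _))//. by rewrite lerN2 hK.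
    by rewrite lerNl -normrN ler_norm. by rewrite pmulr_lle0// expR_gt0.
Qed.

Lemma gronwall_rV k (c dc : R -> 'rV[R]_k) C a b t0 : (forall t, a <= t <= b -> forall i,
     is_derive (t : R) 1 (fun s => c s 0 i) (dc t 0 i)) -> (forall t, a <= t <= b -> `|dc t| <= C * `|c t|) ->
  a <= t0 <= b -> c t0 = 0 -> forall t, a <= t <= b -> c t = 0.
Proof.
move=> hc hC ht0 c0 t ht. pose N s := sqdist 0 (c s); pose dN s := \sum_i 2 * c s 0 i * dc s 0 i.
have cN s : `|c s| ^+ 2 <= N s by have := sqdist_ge 0 (c s); rewrite subr0. suff Nt : N t = 0.
  apply/eqP; rewrite -normr_eq0 -sqrf_eq0; apply/eqP/le_anti. by rewrite sqr_ge0 andbT -Nt.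
apply: (@gronwall N dN (k%:R * (2 * `|C|)) a b t0) => //.
- move=> s sab; apply: (@drv_eq (fun s => \sum_i c s 0 i * c s 0 i) _ s
    (\sum_i (dc s 0 i * c s 0 i + c s 0 i * dc s 0 i))).
  + by apply: drv_sum => i _; apply: drv_mul; exact: hc.
  + by move=> u; apply: eq_bigr => i _; rewrite mxE subr0 expr2.
  + by apply: eq_bigr => i _; ring.
- by move=> s; apply: le_trans (cN s); exact: sqr_ge0.
- move=> s sab; apply: le_trans (_ : k%:R * (2 * `|C|) * `|c s| ^+ 2 <= _); last first.
    by rewrite ler_wpM2l// !mulr_ge0. rewrite -mulrA; apply: norm_sum_le => i; rewrite !normrM ger0_norm//.
  rewrite -!mulrA ler_wpM2l//; apply: le_trans (_ : `|c s| * (`|C| * `|c s|) <= _).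
    rewrite ler_pM ?coord_le_norm//; apply: le_trans (coord_le_norm _ _) _.
    by apply: le_trans (hC s sab) _; rewrite ler_wpM2r// ler_norm. by rewrite expr2 mulrCA.
- by rewrite /N c0 sqdistxx.
Qed.

Lemma linear_flow d k (M : 'I_k -> 'I_k -> fn R (1 + d)) (g : 'I_k -> fn R (1 + d)) (b0 : 'I_k -> fn R d) :
  (forall j l, sm (M j l)) -> (forall l, sm (g l)) -> (forall l, sm (b0 l)) ->
  exists b : 'I_k -> fn R (1 + d), [/\ forall l, sm (b l), forall l z, b l (tv 0 z) = b0 l z &
    forall l q, pd (lshift d 0) (b l) q = \sum_j b j q * M j l q + g l q].
Proof.
move=> hM hg hb; pose F l (x : 'rV[R]_((1 + d) + k)) :=
  \sum_j rsubmx x 0 j * M j l (lsubmx x) + g l (lsubmx x). have sF l : sm (F l).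
  apply: sm_add; last by apply: sm_comp => // i; exact: sm_lsubmx.
  apply: sm_sum => j; apply: sm_mul; first exact: sm_rsubmx. by apply: sm_comp => // i; exact: sm_lsubmx.
have gF r : exists2 K, 0 <= K & forall q y l, `|q| <= r -> `|F l (row_mx q y)| <= K * (1 + `|y|).
  have [C C0 hC] := @cont_bounded_fin R _ _ (fun jl => M jl.1 jl.2) r (fun jl => sm_cont (hM jl.1 jl.2)).
  have [D D0 hD] := cont_bounded_fin r (fun l => sm_cont (hg l)).
  exists (k%:R * C + D) => [|q y l qr]; first by rewrite addr_ge0// mulr_ge0.
  rewrite /F row_mxKl row_mxKr; apply: le_trans (ler_normD _ _) _.
  apply: (@le_trans _ _ (k%:R * (C * `|y|) + D)).
    rewrite lerD ?hD//; apply: norm_sum_le => j; rewrite normrM mulrC.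
    by rewrite ler_pM ?coord_le_norm//; exact: (hC (j, l)). have A0 : 0 <= k%:R * C by rewrite mulr_ge0.
  have := mulr_ge0 D0 (normr_ge0 y); rewrite mulrA. set A := k%:R * C in A0 *; set y1 := `|y|; lra.
have [Y [sY Y0 YE]] := param_flow sF hb gF.
exists Y; split=> // l q; rewrite YE /F row_mxKl row_mxKr; congr (_ + _).
by apply: eq_bigr => j _; rewrite mxE.
Qed.

(** The integrals of the partial derivatives along rays are obtained from [param_flow] with a
    right-hand side that does not contain the unknown, so their smoothness is part of that
    theorem. *)
Lemma hadamard n (f : fn R n) : sm f -> exists g : 'I_n -> fn R n, (forall i, sm (g i)) /\
    forall x, f x = f 0 + \sum_i x 0 i * g i x.
Proof.
move=> hf; pose F i (x : 'rV[R]_((1 + n) + n)) := pd i f (lsubmx x 0 (lshift n 0) *: rsubmx (lsubmx x)).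
have sF0 i : sm (fun q : 'rV[R]_(1 + n) => pd i f (q 0 (lshift n 0) *: rsubmx q)).
  apply: (@sm_comp _ _ _ (pd i f)); first exact: sm_derive.
  move=> j; under eq_fun do rewrite mxE; apply: sm_mul; first exact: sm_coord. exact: sm_rsubmx.
have sF i : sm (F i). by apply: (sm_comp (sF0 i)) => j; exact: sm_lsubmx.
have gF r : exists2 K, 0 <= K & forall q y l, `|q| <= r -> `|F l (row_mx q y)| <= K * (1 + `|y|).
  have [C C0 hC] := cont_bounded_fin r (fun i => sm_cont (sF0 i)).
  exists C => // q y l qr; rewrite /F row_mxKl; apply: le_trans (hC l q qr) _. by rewrite ler_peMr// lerDl.
have [Y [sY Y0 YE]] := param_flow sF (fun _ => @sm_cst R n 0) gF.
exists (fun i x => Y i (tv 1 x)); split=> [i|x].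
  apply: sm_comp => //; apply: sm_row_mx => j; last exact: sm_coord.
  by under eq_fun do rewrite mxE; exact: sm_cst. pose phi (t : R) := f (t *: x) - \sum_i x 0 i * Y i (tv t x).
have dphi (t : R) : 0 <= t <= 1 -> is_derive t 1 phi 0. move=> _; have d1 := line_derive 0 x t hf.
  have d2 i := drv_mul (drv_cst (x 0 i) t) (derive_tv (sm_diff (tv t x) (sY i))).
  have d3 := @drv_sum _ (index_enum _) xpredT _ t _ (fun i _ => d2 i).
  apply: (drv_eq (drv_sub d1 d3)) => [s|]; first by rewrite add0r.
  rewrite add0r (derive_pd _ (sm_diff _ hf)) -sumrB big1// => i _.
  by rewrite mul0r add0r YE /F row_mxKl row_mxEl row_mxKr mxE eqxx mulr1n subrr.
have := derive0_constant ler01 dphi (fun _ _ => erefl).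
rewrite /phi scale1r scale0r [in X in _ = X]big1 ?subr0; last first. by move=> i _; rewrite Y0 mulr0.
by move=> <-; rewrite subrK.
Qed.

Lemma derive_translate n (f : fn R n) u w x : 'D_u (fun y => f (y + w)) x = 'D_u f (x + w).
Proof.
rewrite /derive /= (_ : (fun h => h^-1 *: (f (h *: u + x + w) - f (x + w))) =
  (fun h => h^-1 *: (f (h *: u + (x + w)) - f (x + w))))//. by apply/funext => h; rewrite addrA.
Qed.

(** The second difference over the parallelogram spanned by s u and s v equals s^2 times either
    mixed derivative at some nearby point, by two mean value arguments in one order or the other. *)
Lemma schwarz n (f : fn R n) u v x : sm f -> 'D_u ('D_v f) x = 'D_v ('D_u f) x.
Proof.
move=> hf. have St w (g : fn R n) : sm g -> sm (fun y => g (y + w)).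
  move=> hg; apply: sm_comp => // i; under eq_fun do rewrite mxE.
  by apply: sm_add; [exact: sm_coord|exact: sm_cst].
have dZ (s : R) a (g : fn R n) y : sm g -> 'D_(s *: a) g y = s * 'D_a g y.
  by move=> hg; rewrite !deriveE ?linearZ//; exact: sm_diff.
have key a b (s : R) : 0 < s -> exists2 y, `|y - x| <= s * (`|a| + `|b|) &
    f (x + s *: a + s *: b) - f (x + s *: a) - f (x + s *: b) + f x = s ^+ 2 * 'D_b ('D_a f) y.
  move=> s0; pose g y := f (y + s *: b) - f y. have sg : sm g by apply: sm_sub => //; exact: St.
  have [c [c0 c1]] := mvt_line x (s *: a) sg.
  rewrite dZ// {3}/g deriveB; [|exact: sm_derivable (St _ _ hf)|exact: sm_derivable].
  rewrite derive_translate. have [c' [c'0 c'1]] := mvt_line (x + c *: (s *: a)) (s *: b) (sm_derive a hf).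
  rewrite dZ; last exact: sm_derive. move=> E2 E1; exists (x + c *: (s *: a) + c' *: (s *: b)).
    rewrite addrC -addrA addKr (le_trans (ler_normD _ _))// mulrDr.
    by rewrite lerD// !normrZ (gtr0_norm s0) ger0_norm// ler_piMl// mulr_ge0// ltW.
  move: E1; rewrite /g E2 => E1; rewrite expr2 -mulrA -E1; ring.
apply/eqP; rewrite -subr_eq0 -normr_eq0; apply/negPn/negP => ne.
pose e := `|'D_u ('D_v f) x - 'D_v ('D_u f) x| / 2.
have e0 : 0 < e by rewrite divr_gt0// lt_neqAle eq_sym ne normr_ge0.
have cA : \forall y \near x, `|'D_u ('D_v f) x - 'D_u ('D_v f) y| < e.
  have /cvgrPdist_lt/(_ e e0) := sm_cont (sm_derive u (sm_derive v hf)) (x := x). by [].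
have cB : \forall y \near x, `|'D_v ('D_u f) x - 'D_v ('D_u f) y| < e.
  have /cvgrPdist_lt/(_ e e0) := sm_cont (sm_derive v (sm_derive u hf)) (x := x). by [].
have [d d0 hd] := nbhs_rV2 cA cB. pose s := d / 2 / (`|u| + `|v| + 1).
have uv : 0 < `|u| + `|v| + 1 by rewrite ltr_wpDl// addr_ge0. have s0 : 0 < s by rewrite !divr_gt0.
have sd : s * (`|u| + `|v|) < d.
  apply: (@le_lt_trans _ _ (d / 2)); last by rewrite ltr_pdivrMr// ltr_pMr// ltr1n.
  by rewrite /s mulrAC ler_pdivrMr// ler_wpM2l ?lerDl// divr_ge0// ltW. have [y yx Ey] := key u v s s0.
have [z zx Ez] := key v u s s0. have EE : 'D_v ('D_u f) y = 'D_u ('D_v f) z.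
  apply: (@mulfI _ (s ^+ 2)); first by rewrite expf_neq0// gt_eqF.
  have E3 (a b c e' : R) : a - b - c + e' = a - c - b + e' by ring.
  apply: etrans (esym Ey) _; apply: etrans Ez; rewrite E3 (addrAC x). exact: erefl.
have [_ h1] := hd y (le_lt_trans yx sd).
have zd : `|z - x| < d by rewrite [`|v| + _]addrC in zx; exact: le_lt_trans zx sd. have [h2 _] := hd z zd.
have := ltrD h2 h1; rewrite EE /e -splitr => h3. have := le_lt_trans (ler_normB _ _) h3.
by rewrite opprB addrA subrK -/e ltxx.
Qed.

Lemma mulmx_bound n m (B : 'M[R]_(n, m)) : exists2 C, 0 <= C & forall v : 'rV[R]_n, `|v *m B| <= C * `|v|.
Proof.
exists (n%:R * \sum_i \sum_j `|B i j|). by rewrite mulr_ge0// sumr_ge0// => i _; rewrite sumr_ge0.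
move=> v; have S0 : 0 <= \sum_i \sum_j `|B i j|. by rewrite sumr_ge0// => i _; rewrite sumr_ge0.
apply: norm_le_coord => [|j]; first by rewrite !mulr_ge0.
rewrite mxE -mulrA; apply: norm_sum_le => i; rewrite normrM mulrC.
rewrite ler_pM ?coord_le_norm// (bigD1 i)//= (bigD1 j)//= -addrA lerDl.
by rewrite addr_ge0// sumr_ge0// => k _; rewrite sumr_ge0.
Qed.

Definition jac n m (f : 'rV[R]_n -> 'rV[R]_m) (x : 'rV[R]_n) : 'M[R]_(n, m) :=
  \matrix_(i, j) pd i (fun y => f y 0 j) x.

Lemma derive_jac n m (f : 'rV[R]_n -> 'rV[R]_m) x v j : (forall j, sm (fun y => f y 0 j)) ->
  'D_v (fun y => f y 0 j) x = (v *m jac f x) 0 j.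
Proof.
move=> hf; rewrite derive_pd; last exact: sm_diff. by rewrite mxE; apply: eq_bigr => i _; rewrite mxE.
Qed.

Lemma row_freeI n m (A : 'M[R]_(n, m)) : (forall v : 'rV[R]_n, v *m A = 0 -> v = 0) -> row_free A.
Proof.
move=> h; rewrite -kermx_eq0; apply/eqP/row_matrixP => i; rewrite row0.
by apply: h; apply/sub_kermxP; exact: row_sub.
Qed.

(** A right inverse B of the Jacobian J gives v = v J B. Where J varies by at most e, the increment
    of f differs from v J by at most n e |v|; the choice of e makes this error, after B, at most |v|
    / 2, and it is absorbed on the left. *)
Lemma immersion_estimate n m (f : 'rV[R]_n -> 'rV[R]_m) x0 :
  (forall j, sm (fun y => f y 0 j)) -> row_free (jac f x0) ->
  exists C d, [/\ 0 < C, 0 < d & forall x y, `|x - x0| < d -> `|y - x0| < d -> `|y - x| <= C * `|f y - f x|].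
Proof.
move=> hf /row_freeP[B JB]. have [C0 C00 hC0] := mulmx_bound B. pose e := (2 * (C0 + 1) * (n%:R + 1))^-1 : R.
have n1 : 0 < n%:R + 1 :> R by rewrite ltr_wpDl. have C1 : 0 < C0 + 1 by rewrite ltr_wpDl.
have e0 : 0 < e by rewrite invr_gt0 !mulr_gt0. have : \forall z \near x0, forall ij : 'I_n * 'I_m,
    `|pd ij.1 (fun y => f y 0 ij.2) x0 - pd ij.1 (fun y => f y 0 ij.2) z| <= e. apply: near_fin => -[i j] /=.
  have /cvgrPdist_le/(_ e e0) := sm_cont (sm_derive (ev i) (hf j)) (x := x0). by [].
move=> /nbhs_rVP[d d0 hd]; exists (2 * (C0 + 1)), d; split=> //. by rewrite mulr_gt0.
move=> x y xd yd; set v := y - x. have cvx c : 0 <= c -> c <= 1 -> `|x + c *: v - x0| < d.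
  move=> c0 c1; have -> : x + c *: v - x0 = (1 - c) *: (x - x0) + c *: (y - x0).
    by apply/rowP => i; rewrite !mxE; ring.
  rewrite (le_lt_trans (ler_normD _ _))// !normrZ !ger0_norm ?subr_ge0//.
  have [->|cn] := eqVneq c 0; first by rewrite subr0 mul1r mul0r addr0.
  have cp : 0 < c by rewrite lt_neqAle eq_sym cn. rewrite (_ : d = (1 - c) * d + c * d); last by ring.
  by rewrite ler_ltD ?ler_wpM2l ?subr_ge0 ?(ltW xd)// ltr_pM2l.
have E : `|v *m jac f x0 - (f y - f x)| <= n%:R * e * `|v|.
  apply: norm_le_coord => [|j]; first by rewrite !mulr_ge0// ltW.
  have EE (P Q S : 'rV[R]_m) : (P - (Q - S)) 0 j = P 0 j - (Q 0 j - S 0 j). by rewrite !mxE.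
  rewrite EE -derive_jac//. have [c [c0 c1 ]] := mvt_line x v (hf j). rewrite {1}/v (addrC x) subrK => ->.
  rewrite !derive_pd; [|exact: sm_diff|exact: sm_diff].
  rewrite -sumrB -mulrA; apply: norm_sum_le => i; rewrite -mulrBr normrM mulrC.
  by rewrite ler_pM ?coord_le_norm//; exact: (hd _ (cvx c c0 c1) (i, j)).
have Ev : `|v| <= C0 * (`|f y - f x| + n%:R * e * `|v|).
  rewrite -{1}[v]mulmx1 -JB mulmxA; apply: le_trans (hC0 _) _.
  rewrite ler_wpM2l// -[v *m _](subrK (f y - f x)) addrC. by rewrite (le_trans (ler_normD _ _))// lerD2l.
have ee : C0 * (n%:R * e * `|v|) <= `|v| / 2. have e2 : (C0 + 1) * (n%:R + 1) * e = 2^-1.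
    by rewrite /e; field; rewrite !gt_eqF. rewrite (_ : C0 * _ = C0 * n%:R * e * `|v|); last by ring.
  rewrite mulrC ler_wpM2l// -e2 ler_wpM2r ?(ltW e0)//. by rewrite ler_pM// lerDl.
rewrite mulrDr in Ev; have := mulr_ge0 C00 (normr_ge0 (f y - f x)). have := normr_ge0 (f y - f x); lra.
Qed.

(** Continuation rather than a fixed point: along the solution of Y' = w J(Y)^-1 from x0 the value
    of f is f(x0) + t w, so Y(1) is a preimage of f(x0) + w. Smoothness in w is smooth dependence of
    the flow on parameters. *)
Lemma inverse_function n (f : 'rV[R]_n -> 'rV[R]_n) x0 :
  (forall j, sm (fun y => f y 0 j)) -> \det (jac f x0) != 0 ->
  exists G : 'rV[R]_n -> 'rV[R]_n, [/\ forall j, sm (fun y => G y 0 j),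
    G (f x0) = x0 & \forall y \near f x0, f (G y) = y].
Proof.
move=> hf dJ; have sJ i j : sm (fun x => jac f x i j). by under eq_fun do rewrite mxE; exact: sm_derive.
have sdet : sm (fun x => \det (jac f x)) by apply: Cinf_det. have oV : open [set x | \det (jac f x) != 0].
  rewrite (_ : [set x | _] = (fun x => \det (jac f x)) @^-1` [set t | t != 0])//.
  by apply: open_comp; [move=> x _; exact: sm_cont|exact: open_neq].
have [A [sA [C C0 hC] nA]] := @local_ext_fin R n ('I_n * 'I_n)%type _
  (fun ij x => invmx (jac f x) ij.1 ij.2) x0 oV dJ (fun ij => Cinf_invmx ij.1 ij.2 oV (fun x h => h)
     (fun i j k => Ck_sub (@subsetT _ _) (sJ i j k))).
have nV : nbhs x0 [set x | \det (jac f x) != 0] by exact: open_nbhs_nbhs. have [d d0 hd] := nbhs_rV2 nA nV.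
pose F i (x : 'rV[R]_((1 + n) + n)) := \sum_j rsubmx (lsubmx x) 0 j * A (j, i) (rsubmx x).
have sF i : sm (F i). apply: sm_sum => j; apply: sm_mul.
    by apply: (sm_comp (@sm_rsubmx _ 1 n j)) => l; exact: sm_lsubmx.
  by apply: sm_comp => // l; exact: sm_rsubmx. have Fb q y l : `|F l (row_mx q y)| <= n%:R * C * `|rsubmx q|.
  rewrite /F row_mxKl row_mxKr -mulrA; apply: norm_sum_le => j. by rewrite normrM mulrC ler_pM ?coord_le_norm.
have gF r : exists2 K, 0 <= K & forall q y l, `|q| <= r -> `|F l (row_mx q y)| <= K * (1 + `|y|).
  exists (n%:R * C * `|r|); first by rewrite !mulr_ge0. move=> q y l qr; apply: le_trans (Fb q y l) _.
  apply: (@le_trans _ _ (n%:R * C * `|r|)).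
    rewrite ler_wpM2l ?mulr_ge0// (le_trans (norm_rsubmx _))// (le_trans qr)//. exact: ler_norm.
  by rewrite ler_peMr ?lerDl// !mulr_ge0.
have [Y [sY Y0 YE]] := param_flow sF (fun i => @sm_cst R n (x0 0 i)) gF. pose Yv q := \row_i Y i q.
have Yd w (t : R) i : is_derive t 1 (fun s => Y i (tv s w)) (F i (row_mx (tv t w) (Yv (tv t w)))).
  by rewrite -YE; apply: derive_tv; exact: sm_diff.
have Yn w (t : R) : 0 <= t <= 1 -> `|Yv (tv t w) - x0| <= n%:R * C * `|w|.
  case/andP => t0 t1; apply: norm_le_coord => [|i]; first by rewrite !mulr_ge0.
  rewrite !mxE; have [c _ ] := mvt_itv t0 (fun s _ => Yd w s i).
  rewrite Y0 => ->; rewrite subr0 normrM; apply: le_trans (_ : n%:R * C * `|w| * 1 <= _).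
    apply: ler_pM => //; last by rewrite ger0_norm. by apply: le_trans (Fb _ _ _) _; rewrite row_mxKr.
  by rewrite mulr1. pose G y := Yv (tv 1 (y - f x0)). exists G; split.
- move=> j; under eq_fun do rewrite mxE; apply: sm_comp => //.
  apply: sm_row_mx => i; first by under eq_fun do rewrite mxE; exact: sm_cst.
  under eq_fun do rewrite !mxE; apply: sm_add; first exact: sm_coord. exact: sm_cst.
- have := Yn 0 1; rewrite normr0 mulr0 ler01 lexx => /(_ isT). by rewrite normr_le0 subr_eq0 /G subrr => /eqP.
- apply/nbhs_rVP; exists (d / (n%:R * C + 1)). by rewrite divr_gt0// ltr_wpDl// mulr_ge0.
  move=> y; set w := y - f x0 => wd. have YV (t : R) : 0 <= t <= 1 -> `|Yv (tv t w) - x0| < d.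
    move=> t01; apply: le_lt_trans (Yn w t t01) _. have k1 : 0 < n%:R * C + 1 by rewrite ltr_wpDl// mulr_ge0.
    move: wd; rewrite ltr_pdivlMr// mulrDr mulr1 mulrC => wd. by apply: le_lt_trans wd; rewrite lerDl.
  apply/rowP => j; pose phi (t : R) := f (Yv (tv t w)) 0 j - t * w 0 j.
  have dphi (t : R) : 0 <= t <= 1 -> is_derive t 1 phi 0. move=> t01; have [hA hJ] := hd _ (YV t t01).
    pose dg := \row_i F i (row_mx (tv t w) (Yv (tv t w))).
    have hg i : is_derive t 1 (fun s => Yv (tv s w) 0 i) (dg 0 i).
      by apply: (drv_eq (Yd w t i)) => [s|]; rewrite mxE.
    have d1 := @curve_derive _ _ (fun x => f x 0 j) (fun s => Yv (tv s w)) dg t hg (sm_diff _ (hf j)).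
    have d2 := drv_mul (drv_id t) (drv_cst (w 0 j) t). apply: (drv_eq (drv_sub d1 d2)) => //.
    rewrite derive_jac// mulr0 addr0 mul1r. have -> : dg = w *m invmx (jac f (Yv (tv t w))).
      apply/rowP => i; rewrite !mxE /F row_mxKl !row_mxKr. by apply: eq_bigr => l _; rewrite (hA (l, i)).
    by rewrite mulmxKV ?subrr// unitmxE unitfE. have := derive0_constant ler01 dphi (fun _ _ => erefl).
  rewrite /phi mul1r mul0r subr0 => /eqP; rewrite subr_eq => /eqP; rewrite /G => ->.
  have -> : Yv (tv 0 w) = x0 by apply/rowP => i; rewrite mxE Y0.
  by rewrite -[RHS](subrK (f x0 0 j)) addrC /w !mxE.
Qed.

End OdeTools.

(** * Differential spaces and coordinates *)

Lemma open_norm_lt (R : realType) (n : nat) (c : 'rV[R]_n) (r : R) : open [set z | `|z - c| < r].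
Proof.
have := @ball_open _ _ c r. suff -> : ball c r = [set z | `|z - c| < r] by [].
by rewrite -ball_normE; apply/seteqP; split=> z /=; rewrite distrC.
Qed.

Section OpenSets.
Variables (R : realType) (S : diffspace R).
Implicit Types (A B O : set S) (p q : S) (f g h : S -> R).

Lemma sopenT : sopen [set: S].
Proof. by move=> p _; exists 0%N, (fun _ _ => 0), 1; split=> // -[]. Qed.

Lemma sopenI A B : sopen A -> sopen B -> sopen (A `&` B).
Proof.
move=> oA oB p [/oA[k [g [e [gs e0 h]]]] /oB[k' [g' [e' [gs' e'0 h']]]]].
exists (k + k')%N, (fun i => match fintype.split i with inl a => g a | inr b => g' b end),
  (Num.min e e'); split; first by move=> i; case: (fintype.split i).
- by rewrite lt_min e0.
- move=> q hq; split; [apply: h|apply: h'] => i.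
  + by have := hq (lshift k' i); rewrite split_lshift lt_min => /andP[].
  + by have := hq (rshift k i); rewrite split_rshift lt_min => /andP[].
Qed.

Lemma sopen_local O : (forall p, O p -> exists A, [/\ sopen A, A p & A `<=` O]) -> sopen O.
Proof.
move=> h p /h[A [oA Ap AO]]; have [k [g [e [gs e0 hA]]]] := oA p Ap. by exists k, g, e; split=> // q /hA/AO.
Qed.

Lemma sopen_fin (I : finType) (F : I -> set S) : (forall i, sopen (F i)) -> sopen [set p | forall i, F i p].
Proof.
move=> oF. suff H (s : seq I) : sopen [set p | forall i, i \in s -> F i p].
  apply: sopen_local => p hp; exists [set p | forall i, i \in enum I -> F i p].
  by split=> // q hq i; apply: hq; rewrite mem_enum. elim: s => [|i s ih].
  by apply: sopen_local => p _; exists setT; split=> //; exact: sopenT.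
apply: sopen_local => p hp; exists (F i `&` [set p | forall i, i \in s -> F i p]). split; first exact: sopenI.
  by split=> [|j js]; apply: hp; rewrite inE ?eqxx ?js ?orbT.
by move=> q [Fq hq] j; rewrite inE => /predU1P[->//|/hq].
Qed.

Definition snear p (P : set S) : Prop := exists A, [/\ sopen A, A p & A `<=` P].

Lemma snear_open A p : sopen A -> A p -> snear p A.
Proof. by move=> oA Ap; exists A; split. Qed.

Lemma snear2 p (P Q T : set S) : snear p P -> snear p Q -> (forall q, P q -> Q q -> T q) -> snear p T.
Proof.
move=> [A [oA Ap AP]] [B [oB Bp BQ]] h; exists (A `&` B); split=> //. exact: sopenI.
by move=> q [/AP + /BQ]; exact: h.
Qed.

Lemma snearI p (P Q : set S) : snear p P -> snear p Q -> snear p (P `&` Q).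
Proof. by move=> nP nQ; apply: snear2 nP nQ _ => q. Qed.

Lemma snearS p (P Q : set S) : (forall q, P q -> Q q) -> snear p P -> snear p Q.
Proof. by move=> h [A [oA Ap AP]]; exists A; split=> // q /AP/h. Qed.

Lemma snear_fin (I : finType) p (P : I -> set S) : (forall i, snear p (P i)) ->
  snear p [set q | forall i, P i q].
Proof.
move=> /choice[A hA]; exists [set q | forall i, A i q]; split.
- by apply: sopen_fin => i; case: (hA i).
- by move=> i; case: (hA i).
- by move=> q hq i; have [_ _] := hA i; apply.
Qed.

Lemma snear_self p P : snear p P -> P p.
Proof. by move=> [A [_ Ap]]; apply. Qed.

Lemma snear_snear p P : snear p P -> snear p [set q | snear q P].
Proof. by move=> [A [oA Ap AP]]; exists A; split=> // q Aq; exists A; split. Qed.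

Lemma smooth_onE A h : smooth_on A h <-> forall p, A p -> exists2 g, smooth g & snear p [set q | h q = g q].
Proof.
split=> H p /H; first by move=> [B [g [oB Bp gs hg]]]; exists g => //; exists B.
by move=> [g gs [B [oB Bp hg]]]; exists B, g; split.
Qed.

Lemma sopen_pre k (G : S -> 'rV[R]_k) (W : set 'rV[R]_k) :
  (forall i, smooth (fun q => G q 0 i)) -> open W -> sopen (G @^-1` W).
Proof.
move=> hG oW p Wp; have /nbhs_rVP[d d0 hd] : nbhs (G p) W by exact: open_nbhs_nbhs.
exists k, (fun i q => G q 0 i), d; split=> // q hq; apply: hd. by apply: norm_lt_coord => // i; rewrite !mxE.
Qed.

End OpenSets.

(** The map x is smooth on all of S and is a chart only between A and B. Functions pull back along y
    to germs of entire functions, so local computations never mention domains of smoothness. *)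
Record coords (R : realType) (S : diffspace R) (d : nat) (x : S -> 'rV[R]_d)
    (y : 'rV[R]_d -> S) (A : set S) (B : set 'rV[R]_d) : Prop := Coords {
  co_openA : sopen A;
  co_openB : open B;
  co_AB : forall q, A q -> B (x q) /\ y (x q) = q;
  co_BA : forall z, B z -> A (y z) /\ x (y z) = z;
  co_smooth : forall i, smooth (fun q => x q 0 i);
  co_pull : forall f z, smooth f -> B z ->
    exists2 F, sm F & \forall w \near z, f (y w) = F w }.

(* The properties of smooth manifolds that are used below; second countability
   is left out, because it is only needed for X and M. *)
Record good (R : realType) (d : nat) (S : diffspace R) : Prop := Good {
  good_comp : forall k (g : 'I_k -> S -> R) (F : fn R k),
    (forall i, smooth (g i)) -> sm F -> smooth (fun p => F (\row_i g i p));
  good_local : forall h : S -> R, smooth_on setT h -> smooth h;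
  good_coords : forall p : S, exists (x : S -> 'rV[R]_d) y A B,
    coords x y A B /\ A p;
  good_sep : forall p q : S, (forall f, smooth f -> f p = f q) -> p = q }.

Section GoodSpaces.
Variables (R : realType) (d : nat) (S : diffspace R).
Hypothesis gS : good d S.
Implicit Types (A B O : set S) (p q : S) (f g h : S -> R).

Lemma smooth_comp k (G : S -> 'rV[R]_k) (F : fn R k) :
  (forall i, smooth (fun q => G q 0 i)) -> sm F -> smooth (fun p => F (G p)).
Proof.
move=> hG hF; have := good_comp gS hG hF; congr smooth; apply/funext => p.
by congr F; apply/rowP => i; rewrite mxE.
Qed.

(** A constant is a smooth function of no arguments, hence an instance of closure under
    composition. *)
Lemma smooth_cst (c : R) : smooth (fun _ : S => c).
Proof. exact: (@smooth_comp 0 (fun=> 0) (fun=> c) (fun i => match i with Ordinal _ h => False_rect _ (notF h) end) (@sm_cst R 0 c)). Qed.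

Lemma smooth_op2 (F : fn R 2) f g : sm F -> smooth f -> smooth g ->
  smooth (fun p => F (\row_(i < 2) (if i == 0 then f p else g p))).
Proof. move=> hF hf hg; apply: smooth_comp => // i; under eq_fun do rewrite mxE. by case: (i == 0). Qed.

Lemma smooth_add f g : smooth f -> smooth g -> smooth (fun p => f p + g p).
Proof.
move=> hf hg; have := smooth_op2 (sm_add (@sm_coord R 2 0) (@sm_coord R 2 1)) hf hg.
by congr smooth; apply/funext => p; rewrite !mxE.
Qed.

Lemma smooth_mul f g : smooth f -> smooth g -> smooth (fun p => f p * g p).
Proof.
move=> hf hg; have := smooth_op2 (sm_mul (@sm_coord R 2 0) (@sm_coord R 2 1)) hf hg.
by congr smooth; apply/funext => p; rewrite !mxE.
Qed.

Lemma smooth_opp f : smooth f -> smooth (fun p => - f p).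
Proof.
move=> hf; have := smooth_mul (smooth_cst (-1)) hf. by congr smooth; apply/funext => p; rewrite mulN1r.
Qed.

Lemma smooth_sub f g : smooth f -> smooth g -> smooth (fun p => f p - g p).
Proof. by move=> hf hg; exact: smooth_add hf (smooth_opp hg). Qed.

Lemma smooth_sum (I : Type) (r : seq I) (P : pred I) (f : I -> S -> R) :
  (forall i, smooth (f i)) -> smooth (fun p => \sum_(i <- r | P i) f i p).
Proof.
move=> h; elim: r => [|i r ih]. by under eq_fun do rewrite big_nil; exact: smooth_cst.
case: (boolP (P i)) => Pi. by under eq_fun do rewrite big_cons Pi; exact: smooth_add.
by under eq_fun do rewrite big_cons (negPf Pi).
Qed.

Lemma smooth_loc h : (forall p, exists2 g, smooth g & snear p [set q | h q = g q]) -> smooth h.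
Proof. by move=> H; apply: (good_local gS); apply/smooth_onE => p _. Qed.

(** Basic open sets are balls for finitely many smooth functions, so a cutoff of the joint value of
    these functions is already a bump; no chart is involved. *)
Lemma smooth_bump A p : sopen A -> A p -> exists chi : S -> R,
  [/\ smooth chi, snear p [set q | chi q = 1], forall q, 0 <= chi q <= 1 &
   forall q, ~ A q -> snear q [set q | chi q = 0]].
Proof.
move=> oA Ap; have [k [g [e [gs e0 h]]]] := oA p Ap. pose G q := \row_i g i q.
have sG i : smooth (fun q => G q 0 i) by under eq_fun do rewrite mxE; exact: gs.
exists (fun q => cutoff (G p) e (G q)); split.
- exact: smooth_comp (sm_cutoff _ _).
- have [r r0 hr] := (nbhs_rVP _ _).1 (cutoff_near (G p) e0). exists (G @^-1` [set z | `|z - G p| < r]); split.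
  + by apply: sopen_pre => //; exact: open_norm_lt.
  + by rewrite /= subrr normr0.
  + by move=> q /= /hr.
- by move=> q; rewrite cutoff_ge0 cutoff_le1.
- move=> q nA; exists (G @^-1` [set z | e ^+ 2 / 2 < sqdist (G p) z]); split.
  + by apply: sopen_pre => //; exact: open_sm_gt (sm_sqdist _).
  + apply: (@lt_le_trans _ _ (e ^+ 2)). by rewrite ltr_pdivrMr// ltr_pMr ?exprn_gt0// ltr1n.
    rewrite leNgt; apply/negP => lt; apply: nA; apply: h => i. have := le_lt_trans (sqdist_ge (G p) (G q)) lt.
    rewrite ltr_pXn2r ?nnegrE ?(ltW e0)//; apply: le_lt_trans.
    by have := coord_le_norm (G q - G p) i; rewrite !mxE.
  + by move=> z /= hz; apply: cutoff0 => //; exact: ltW.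
Qed.

Lemma smooth_cut A chi h : smooth chi -> (forall q, ~ A q -> snear q [set q | chi q = 0]) -> smooth_on A h ->
  smooth (fun q => chi q * h q).
Proof.
move=> sc c0 /smooth_onE sh; apply: smooth_loc => q; have [Aq|nA] := pselect (A q).
  have [g sg hg] := sh q Aq; exists (fun q => chi q * g q); first exact: smooth_mul.
  by apply: snearS hg => z /= ->. exists (fun=> 0); first exact: smooth_cst.
by apply: snearS (c0 q nA) => z /= ->; rewrite mul0r.
Qed.

Section Coordinates.
Variables (x : S -> 'rV[R]_d) (y : 'rV[R]_d -> S) (A : set S) (B : set 'rV[R]_d).
Hypothesis cx : coords x y A B.

Lemma co_xy z : B z -> x (y z) = z. Proof. by move=> /(co_BA cx)[]. Qed.
Lemma co_yx q : A q -> y (x q) = q. Proof. by move=> /(co_AB cx)[]. Qed.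
Lemma co_B q : A q -> B (x q). Proof. by move=> /(co_AB cx)[]. Qed.
Lemma co_A z : B z -> A (y z). Proof. by move=> /(co_BA cx)[]. Qed.

Lemma snear_A p : A p -> snear p A.
Proof. by exists A; split=> //; exact: co_openA cx. Qed.

Lemma near_pull q (P : set S) : A q -> snear q P -> \forall z \near x q, B z /\ P (y z).
Proof.
move=> Aq [A' [oA' A'q A'P]]; have [k [g [e [gs e0 h]]]] := oA' q A'q.
have nB : nbhs (x q) B by apply: open_nbhs_nbhs; split; [exact: co_openB cx|exact: co_B].
have ng : nbhs (x q) [set z | forall i, `|g i (y z) - g i q| < e]. apply: near_fin => i.
  have [F sF nF] := co_pull cx (gs i) (co_B Aq).
  have gF : g i q = F (x q) by rewrite -(nbhs_singleton nF) co_yx.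
  have /cvgrPdist_lt/(_ e e0) := @sm_cont _ _ _ sF (x q). by apply: filterS2 nF => z -> ; rewrite gF distrC.
by apply: filterS (filterI nB ng) => z [Bz hz]; split=> //; apply: A'P; exact: h.
Qed.

Lemma snear_push q (P : set 'rV[R]_d) : A q -> nbhs (x q) P -> snear q [set r | A r /\ P (x r)].
Proof.
move=> Aq /nbhs_rVP[e e0 he]; exists (A `&` x @^-1` [set z | `|z - x q| < e]); split.
- apply: sopenI; first exact: co_openA cx. apply: sopen_pre; [exact: co_smooth cx|exact: open_norm_lt].
- by split=> //=; rewrite subrr normr0.
- by move=> r [Ar /= /he].
Qed.

Lemma co_ext f q : smooth f -> A q -> exists F, [/\ sm F,
  \forall z \near x q, F z = f (y z) & snear q [set r | f r = F (x r)]].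
Proof.
move=> hf Aq; have [F sF nF] := co_pull cx hf (co_B Aq).
have nF' : \forall z \near x q, F z = f (y z) by apply: filterS nF => z ->. exists F; split=> //.
by apply: snearS (snear_push Aq nF') => r [Ar /= ->]; rewrite /= co_yx.
Qed.

Lemma co_ext_fam (I : Type) (g : I -> S -> R) q : (forall l, smooth (g l)) -> A q ->
  exists G : I -> fn R d, forall l, sm (G l) /\ snear q [set r | g l r = G l (x r)].
Proof.
move=> sg Aq; have /choice : forall l, exists F, sm F /\ snear q [set r | g l r = F (x r)].
  by move=> l; have [F [sF _ nF]] := co_ext (sg l) Aq; exists F. by case=> G; exists G.
Qed.

Lemma snear_ball q e : A q -> 0 < e -> snear q [set r | A r /\ `|x r - x q| < e].
Proof.
move=> Aq e0; have nb : nbhs (x q) [set z | `|z - x q| < e] by apply/nbhs_rVP; exists e.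
by have := snear_push Aq nb.
Qed.

Lemma smooth_xcomp (F : fn R d) : sm F -> smooth (fun q => F (x q)).
Proof. by move=> sF; apply: smooth_comp => //; exact: co_smooth cx. Qed.

End Coordinates.

End GoodSpaces.

(** Writes F - F(z0) as a sum of products with factors vanishing at z0, the form on which the
    Leibniz rule acts in [tan_chain]. *)
Lemma hadamard_at (R : realType) (n : nat) (F : fn R n) z0 : sm F ->
  exists g : 'I_n -> fn R n, [/\ forall i, sm (g i), forall z, F z = F z0 + \sum_i (z 0 i - z0 0 i) * g i z &
    forall i, g i z0 = pd i F z0].
Proof.
move=> sF; have sF' : sm (fun z => F (z + z0)).
  by apply: sm_comp => // i; under eq_fun do rewrite mxE; apply: sm_add; [exact: sm_coord|exact: sm_cst].
have [g [sg gE]] := hadamard sF'. have FE z : F z = F z0 + \sum_i (z 0 i - z0 0 i) * g i (z - z0).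
  rewrite -{1}(subrK z0 z) gE add0r; congr +%R; apply: eq_bigr => i _. by rewrite !mxE.
have sg' i : sm (fun z => g i (z - z0)).
  by apply: sm_comp => // j; under eq_fun do rewrite !mxE; apply: sm_sub; [exact: sm_coord|exact: sm_cst].
exists (fun i z => g i (z - z0)); split=> // i. have d1 := @line_derive R n F z0 (ev i) 0 sF.
have d2 := drv_add (drv_cst (F z0) 0) (drv_mul (drv_id 0) (@line_derive R n _ z0 (ev i) 0 (sg' i))).
have e : 'D_(ev i) F (z0 + 0 *: ev i) = 0 + (1 * g i (z0 + 0 *: ev i - z0) +
      0 * 'D_(ev i) (fun z => g i (z - z0)) (z0 + 0 *: ev i)). have <- := @derive_val _ _ _ _ _ _ _ d1.
  have <- := @derive_val _ _ _ _ _ _ _ d2. suff -> : (fun s : R => F (z0 + s *: ev i)) =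
      (fun s : R => F z0 + s * g i (z0 + s *: ev i - z0)) by [].
  apply/funext => s; rewrite FE (bigD1 i)//= big1 ?addr0. by rewrite !mxE !eqxx mulr1 [z0 0 i + s]addrC addrK.
  by move=> j ji; rewrite !mxE eqxx (negPf ji) mulr0 addr0 subrr mul0r.
by move: e; rewrite scale0r addr0 mul1r mul0r addr0 add0r.
Qed.

Lemma pd_near (R : realType) (n : nat) (F G : fn R n) z i :
  (\forall w \near z, F w = G w) -> pd i F z = pd i G z.
Proof. by move=> h; apply: near_eq_derive. Qed.

Lemma pd_coord (R : realType) (n : nat) i j (z : 'rV[R]_n) : pd j (fun w : 'rV[R]_n => w 0 i) z = (i == j)%:R.
Proof.
have := @derive_coord R _ n id z (ev j) i. rewrite derive_id => <-; last exact: derivable_id.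
by rewrite mxE eqxx.
Qed.

Lemma D_cst (R : realType) (n : nat) (c : R) (v z : 'rV[R]_n) : 'D_v (fun=> c) z = 0.
Proof. exact: derive_cst. Qed.

Lemma D_add (R : realType) (n : nat) (f g : fn R n) v z : sm f -> sm g ->
  'D_v (fun w => f w + g w) z = 'D_v f z + 'D_v g z.
Proof. by move=> sf sg; apply: deriveD; exact: sm_derivable. Qed.

Lemma D_sub (R : realType) (n : nat) (f g : fn R n) v z : sm f -> sm g ->
  'D_v (fun w => f w - g w) z = 'D_v f z - 'D_v g z.
Proof. by move=> sf sg; apply: deriveB; exact: sm_derivable. Qed.

Lemma D_mul (R : realType) (n : nat) (f g : fn R n) v z : sm f -> sm g ->
  'D_v (fun w => f w * g w) z = 'D_v f z * g z + f z * 'D_v g z.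
Proof.
move=> sf sg; rewrite [LHS]deriveM; try exact: sm_derivable. by rewrite /GRing.scale/= addrC mulrC.
Qed.

Lemma D_sum (R : realType) (n : nat) (I : Type) (s : seq I) (P : pred I)
    (f : I -> fn R n) v z : (forall i, sm (f i)) ->
  'D_v (fun w => \sum_(i <- s | P i) f i w) z = \sum_(i <- s | P i) 'D_v (f i) z.
Proof.
move=> sf; elim: s => [|i s ih]. by under eq_fun do rewrite big_nil; rewrite big_nil D_cst.
rewrite big_cons -ih; case: (boolP (P i)) => Pi. under eq_fun do rewrite big_cons Pi.
  by rewrite (D_add _ _ (sf i))//; exact: sm_sum. by under eq_fun do rewrite big_cons (negPf Pi).
Qed.

(** * Tangent and cotangent spaces in coordinates *)

Section LinearSets.
Variables (R : realType) (S : diffspace R).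

Definition lin_set (V : set (vec S)) : Prop := V (fun=> 0) /\ forall t u v, V u -> V v -> V (t \*o u \+ v).

Lemma lin_comb V (I : Type) (s : seq I) (c : I -> R) (v : I -> vec S) :
  lin_set V -> (forall i, V (v i)) -> V (fun f => \sum_(i <- s) c i * v i f).
Proof.
move=> [V0 Vl] Vv; elim: s => [|i s ih]. by under eq_fun do rewrite big_nil.
by under eq_fun do rewrite big_cons; exact: Vl.
Qed.

Lemma dual_zero V a : lin_set V -> dual_of V a -> a (fun=> 0) = 0.
Proof.
move=> [V0 _] [al _]; have := al 1 _ _ V0 V0. have -> : 1 \*o (fun=> 0) \+ (fun=> 0) = (fun=> 0) :> vec S.
  by apply/funext => f /=; rewrite mulr0 addr0.
by rewrite mul1r => /esym/eqP; rewrite -subr_eq0 addrK => /eqP.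
Qed.

Lemma dual_comb V a (I : Type) (s : seq I) (c : I -> R) (v : I -> vec S) :
  lin_set V -> dual_of V a -> (forall i, V (v i)) ->
  a (fun f => \sum_(i <- s) c i * v i f) = \sum_(i <- s) c i * a (v i).
Proof.
move=> lV da Vv; elim: s => [|i s ih]. by under eq_fun do rewrite big_nil; rewrite big_nil (dual_zero lV da).
rewrite big_cons -ih; under eq_fun do rewrite big_cons. by case: da => al _; apply: al => //; exact: lin_comb.
Qed.

Lemma dual_ext V (a b : covec S) : dual_of V a -> dual_of V b -> (forall v, V v -> a v = b v) -> a = b.
Proof. move=> [_ a0] [_ b0] h; apply/funext => v. by have [/h//|nV] := pselect (V v); rewrite a0// b0. Qed.

Lemma lin_set_tangent p : lin_set (tangent p : set (vec S)).
Proof.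
split; first by split=> // *; rewrite ?(mulr0, mul0r, addr0). move=> t u v [u0 ul um] [v0 vl vm]; split=> /=.
- by move=> f nf; rewrite u0// v0// mulr0 addr0.
- by move=> s f g sf sg; rewrite ul// vl//; ring.
- by move=> f g sf sg; rewrite um// vm//; ring.
Qed.

Lemma dual_lin V t (a b : covec S) : dual_of V a -> dual_of V b -> dual_of V (t \*o a \+ b).
Proof.
move=> [al a0] [bl b0]; split=> /= [s u v Vu Vv|v nv]. by rewrite al// bl//; ring.
by rewrite a0// b0// mulr0 addr0.
Qed.

End LinearSets.

Section Tangent.
Variables (R : realType) (d : nat) (S : diffspace R).
Hypothesis gS : good d S.
#[local] Hint Resolve gS : core.
Implicit Types (p q : S) (f g h : S -> R) (v w : vec S).

Lemma tan_zero p v : tangent p v -> v (fun=> 0) = 0.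
Proof.
move=> [_ vl _]; have s0 := smooth_cst gS 0. have := vl 1 _ _ s0 s0.
have -> : 1 \*o (fun=> 0) \+ (fun=> 0) = (fun=> 0) :> (S -> R). by apply/funext => f /=; rewrite mulr0 addr0.
by rewrite mul1r => /esym/eqP; rewrite -subr_eq0 addrK => /eqP.
Qed.

Lemma tan_scale p v t f : tangent p v -> smooth f -> v (fun q => t * f q) = t * v f.
Proof.
move=> hv sf; have [_ vl _] := hv; have := vl t _ _ sf (smooth_cst gS 0).
rewrite (tan_zero hv) addr0 => <-; congr v. by apply/funext => q /=; rewrite addr0.
Qed.

Lemma tan_add p v f g : tangent p v -> smooth f -> smooth g -> v (fun q => f q + g q) = v f + v g.
Proof.
move=> [_ vl _] sf sg; have := vl 1 _ _ sf sg; rewrite mul1r => <-; congr v.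
by apply/funext => q /=; rewrite mul1r.
Qed.

Lemma tan_mul p v f g : tangent p v -> smooth f -> smooth g -> v (fun q => f q * g q) = v f * g p + f p * v g.
Proof. by move=> [_ _ vm]; exact: vm. Qed.

Lemma tan_cst p v c : tangent p v -> v (fun=> c) = 0.
Proof.
move=> hv; have s1 := smooth_cst gS 1. have v1 : v (fun=> 1) = 0.
  have := tan_mul hv s1 s1; rewrite (_ : (fun _ => 1 * 1) = (fun=> 1)); last by apply/funext => q; rewrite mulr1.
  by rewrite mulr1 mul1r => /esym/eqP; rewrite -subr_eq0 addrK => /eqP.
have := tan_scale c hv s1; rewrite v1 mulr0 => <-. by congr v; apply/funext => q; rewrite mulr1.
Qed.

Lemma tan_opp p v f : tangent p v -> smooth f -> v (fun q => - f q) = - v f.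
Proof. move=> hv sf; rewrite -mulN1r -(tan_scale _ hv sf). by congr v; apply/funext => q; rewrite mulN1r. Qed.

Lemma tan_sub p v f g : tangent p v -> smooth f -> smooth g -> v (fun q => f q - g q) = v f - v g.
Proof. by move=> hv sf sg; rewrite (tan_add hv sf (smooth_opp gS sg)) (tan_opp hv sg). Qed.

Lemma tan_sum p v (I : Type) (r : seq I) (P : pred I) (f : I -> S -> R) :
  tangent p v -> (forall i, smooth (f i)) ->
  v (fun q => \sum_(i <- r | P i) f i q) = \sum_(i <- r | P i) v (f i).
Proof.
move=> hv sf; elim: r => [|i r ih]. by under eq_fun do rewrite big_nil; rewrite big_nil (tan_zero hv).
rewrite big_cons -ih; case: (boolP (P i)) => Pi. under eq_fun do rewrite big_cons Pi.
  by apply: (tan_add hv) => //; exact: smooth_sum. by under eq_fun do rewrite big_cons (negPf Pi).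
Qed.

(** With a bump chi that vanishes off a set where f = g, the product chi (f - g) is 0, and the
    Leibniz rule at p reads this as v f = v g. *)
Lemma tan_local p v f g : tangent p v -> smooth f -> smooth g -> snear p [set q | f q = g q] -> v f = v g.
Proof.
move=> hv sf sg [A [oA Ap AE]]. have [chi [sc c1 _ c0]] := smooth_bump gS oA Ap.
have s := smooth_sub gS sf sg. have : v (fun q => chi q * (f q - g q)) = 0.
  rewrite -(tan_zero hv); congr v; apply/funext => q.
  have [/AE/= ->|/c0/snear_self/= ->] := pselect (A q); first by rewrite subrr mulr0. by rewrite mul0r.
rewrite (tan_mul hv sc s) (AE p Ap) subrr mulr0 add0r (snear_self c1) mul1r.
by rewrite (tan_sub hv sf sg) => /eqP; rewrite subr_eq0 => /eqP.
Qed.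

Lemma tan_chain p v k (G : S -> 'rV[R]_k) (F : fn R k) : tangent p v ->
  (forall i, smooth (fun q => G q 0 i)) -> sm F ->
  v (fun q => F (G q)) = \sum_i v (fun q => G q 0 i) * pd i F (G p).
Proof.
move=> hv sG sF; have [g [sg gE gp]] := hadamard_at (G p) sF. have s1 i : smooth (fun q => G q 0 i - G p 0 i).
  by apply: smooth_sub => //; exact: smooth_cst.
have s2 i : smooth (fun q => g i (G q)) by exact: smooth_comp.
have s3 i : smooth (fun q => (G q 0 i - G p 0 i) * g i (G q)) by exact: smooth_mul.
under eq_fun do rewrite gE. rewrite (tan_add hv (smooth_cst gS _)); last exact: smooth_sum.
rewrite (tan_cst _ hv) add0r (tan_sum _ _ hv)//; apply: eq_bigr => i _.
rewrite (tan_mul hv)// gp subrr mul0r addr0; congr *%R.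
by rewrite (tan_sub hv)// ?(tan_cst _ hv) ?subr0//; exact: smooth_cst.
Qed.

Lemma diff_at_cotangent f p : smooth f -> cotangent p (diff_at f p).
Proof.
move=> sf; have [t0 tl] := lin_set_tangent p.
split=> [t u v tu hv|v nv]; last by rewrite /diff_at patchN// notin_setE.
rewrite /diff_at !patchT// ?inE//; exact: tl.
Qed.

Lemma diff_atE f p v : tangent p v -> diff_at f p v = v f.
Proof. by move=> hv; rewrite /diff_at patchT// inE. Qed.

Lemma form1_diff f : smooth f -> form1 (diff_at f).
Proof.
move=> sf; split; first by move=> p; exact: diff_at_cotangent.
by move=> V [tV sV]; under eq_fun => x do rewrite diff_atE//; exact: sV.
Qed.

Lemma form1_comb (I : Type) (s : seq I) (c : I -> S -> R) (a : I -> S -> covec S) :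
  (forall i, smooth (c i)) -> (forall i, form1 (a i)) -> form1 (fun p v => \sum_(i <- s) c i p * a i p v).
Proof.
move=> sc fa; split. move=> p; split=> [t u v tu hv|v nv].
    rewrite mulr_sumr -big_split; apply: eq_bigr => i _ /=.
    by case: (fa i) => /(_ p)[al _] _; rewrite al//; ring.
  by rewrite big1// => i _; case: (fa i) => /(_ p)[_ ->//] _; rewrite mulr0.
move=> V fV; apply: (smooth_sum gS) => i; apply: smooth_mul => //. by case: (fa i) => _; apply.
Qed.

Lemma field_comb (I : Type) (s : seq I) (c : I -> S -> R) (V : I -> S -> vec S) :
  (forall i, smooth (c i)) -> (forall i, field (V i)) -> field (fun p f => \sum_(i <- s) c i p * V i p f).
Proof.
move=> sc fV; split. move=> p; apply: (lin_comb s (fun i => c i p) (v := fun i => V i p)).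
    exact: lin_set_tangent. by move=> i; case: (fV i).
move=> f sf; apply: (smooth_sum gS) => i; apply: smooth_mul => //. by case: (fV i) => _; apply.
Qed.

Section Coordinates.
Variables (x : S -> 'rV[R]_d) (y : 'rV[R]_d -> S) (A : set S) (B : set 'rV[R]_d).
Hypothesis cx : coords x y A B.

Definition tvec p (u : 'rV[R]_d) : vec S :=
  patch (fun=> 0) (@smooth R S) (fun f => \sum_i u 0 i * pd i (f \o y) (x p)).

Lemma tvecE p u f F : A p -> smooth f -> sm F -> snear p [set q | f q = F (x q)] ->
  tvec p u f = \sum_i u 0 i * pd i F (x p).
Proof.
move=> Ap sf sF nF; rewrite /tvec patchT ?inE//; apply: eq_bigr => i _.
congr *%R; apply: pd_near; apply: filterS (near_pull cx Ap nF) => z /= [Bz ->]. by rewrite (co_xy cx).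
Qed.

Lemma tvec_tangent p u : A p -> tangent p (tvec p u).
Proof.
move=> Ap; split=> [f nf|t f g sf sg|f g sf sg].
- by rewrite /tvec patchN// notin_setE.
- have [F [sF _ fF]] := co_ext cx sf Ap; have [G [sG _ gG]] := co_ext cx sg Ap.
  rewrite (tvecE u Ap sf sF fF) (tvecE u Ap sg sG gG). rewrite (@tvecE _ _ _ (fun z => t * F z + G z) Ap).
  + rewrite mulr_sumr -big_split; apply: eq_bigr => i _ /=.
    rewrite (D_add _ _ (sm_mul (sm_cst d t) sF) sG) (D_mul _ _ (sm_cst d t) sF) D_cst. by ring.
  + by have := smooth_add gS (smooth_mul gS (smooth_cst gS t) sf) sg.
  + exact: sm_add (sm_mul (sm_cst d t) sF) sG.
  + by apply: snear2 fF gG _ => q /= -> ->.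
- have [F [sF _ fF]] := co_ext cx sf Ap; have [G [sG _ gG]] := co_ext cx sg Ap.
  rewrite (tvecE u Ap sf sF fF) (tvecE u Ap sg sG gG). rewrite (@tvecE _ _ _ (fun z => F z * G z) Ap).
  + rewrite (snear_self fF) (snear_self gG) mulr_suml mulr_sumr -big_split. apply: eq_bigr => i _ /=.
    by rewrite (D_mul _ _ sF sG); ring.
  + exact: smooth_mul.
  + exact: sm_mul.
  + by apply: snear2 fF gG _ => q /= -> ->.
Qed.

Lemma tvec_coord p u i : A p -> tvec p u (fun q => x q 0 i) = u 0 i.
Proof.
move=> Ap; rewrite (@tvecE _ _ _ (fun z => z 0 i) Ap).
- by under eq_bigr do rewrite pd_coord; exact: sum_deltar.
- exact: co_smooth cx i.
- exact: sm_coord.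
- by exists setT; split=> //; exact: sopenT.
Qed.

Lemma tan_coords p v f F : A p -> tangent p v -> smooth f -> sm F -> snear p [set q | f q = F (x q)] ->
  v f = \sum_i v (fun q => x q 0 i) * pd i F (x p).
Proof.
move=> Ap hv sf sF nF; rewrite (tan_local hv sf _ nF); last exact: (smooth_xcomp gS cx).
by apply: (tan_chain hv) => // i; exact: co_smooth cx i.
Qed.

Lemma tan_eq p v w : A p -> tangent p v -> tangent p w ->
  (forall i, v (fun q => x q 0 i) = w (fun q => x q 0 i)) -> v = w.
Proof.
move=> Ap hv tw h; apply/funext => f; have [sf|nf] := pselect (smooth f).
  have [F [sF _ fF]] := co_ext cx sf Ap. rewrite (tan_coords Ap hv sf sF fF) (tan_coords Ap tw sf sF fF).
  by apply: eq_bigr => i _; rewrite h. by case: hv => -> // _ _; case: tw => ->.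
Qed.

Lemma tvec_sum p u : A p -> tvec p u = fun f => \sum_i u 0 i * tvec p (ev i) f.
Proof.
move=> Ap; apply: (tan_eq Ap); first exact: tvec_tangent.
  by apply: lin_comb; [exact: lin_set_tangent|move=> i; exact: tvec_tangent].
move=> i; rewrite tvec_coord//; under eq_bigr do rewrite tvec_coord// mxE eqxx /=. by rewrite sum_deltar.
Qed.

Lemma tan_tvec p v : A p -> tangent p v -> v = tvec p (\row_i v (fun q => x q 0 i)).
Proof.
move=> Ap hv; apply: (tan_eq Ap hv); first exact: tvec_tangent. by move=> i; rewrite tvec_coord// mxE.
Qed.

(** A field with given coordinates makes sense only on A; multiplied by a bump it extends by 0 to a
    global field with the same germ at p. *)
Lemma coord_field p (a : 'I_d -> S -> R) : A p -> (forall i, smooth (a i)) ->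
  exists Z, field Z /\ snear p [set q | A q /\ Z q = tvec q (\row_i a i q)].
Proof.
move=> Ap sa; have [chi [sc c1 _ c0]] := smooth_bump gS (co_openA cx) Ap.
pose h f q := tvec q (\row_i a i q) f.
exists (fun q f => chi q * (if `[< A q >] then h f q else 0)); split; [split|].
- move=> q; case: asboolP => Aq; last first. by under eq_fun do rewrite mulr0; case: (lin_set_tangent q).
  have := (lin_set_tangent q).2 (chi q) _ _ (tvec_tangent (\row_i a i q) Aq) (lin_set_tangent q).1.
  by congr tangent; apply/funext => f /=; rewrite addr0.
- move=> f sf; apply: (smooth_cut gS) sc c0 _; apply/smooth_onE => q Aq.
  have [F [sF _ fF]] := co_ext cx sf Aq. exists (fun q => \sum_i a i q * pd i F (x q)).
    apply: (smooth_sum gS) => i; apply: (smooth_mul gS) => //.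
    by apply: (smooth_xcomp gS cx (F := pd i F)); exact: sm_derive.
  apply: snear2 (snear_snear fF) (snear_A cx Aq) _ => r fr Ar /=. rewrite asboolT// /h (tvecE _ Ar sf sF fr).
  by apply: eq_bigr => i _; rewrite mxE.
- apply: snear2 c1 (snear_A cx Ap) _ => q /= c1 Aq; split=> //.
  by apply/funext => f; rewrite c1 mul1r asboolT.
Qed.

Lemma coord_frame p : A p -> exists Z : 'I_d -> S -> vec S,
  (forall i, field (Z i)) /\ snear p [set q | A q /\ forall i, Z i q = tvec q (ev i)].
Proof.
move=> Ap; have H i := coord_field Ap (fun j => smooth_cst gS ((i == j)%:R)).
have /choice[Z hZ] := H; exists Z; split; first by move=> i; case: (hZ i).
apply: snear2 (snear_A cx Ap) (snear_fin (fun i => (hZ i).2)) _ => q Aq hq.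
split=> // i; have [_ ->] := hq i; congr tvec; apply/rowP => j. by rewrite !mxE eqxx/= eq_sym.
Qed.

Lemma field_ext p v : A p -> tangent p v -> exists Z, field Z /\ Z p = v.
Proof.
move=> Ap hv; have [Z [fZ /snear_self/= [_ hZ]]] :=
  coord_field Ap (fun i => smooth_cst gS (v (fun q => x q 0 i))).
exists Z; split=> //; rewrite [RHS](tan_tvec Ap hv) hZ. by congr tvec; apply/rowP => i; rewrite !mxE.
Qed.

Lemma cot_tvec p a u : A p -> cotangent p a -> a (tvec p u) = \sum_i u 0 i * a (tvec p (ev i)).
Proof.
move=> Ap ca; rewrite (tvec_sum _ Ap) (dual_comb _ _ (lin_set_tangent p) ca)//.
by move=> i; exact: tvec_tangent.
Qed.

Lemma cot_expand p a v : A p -> cotangent p a -> tangent p v ->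
  a v = \sum_i a (tvec p (ev i)) * v (fun q => x q 0 i).
Proof.
move=> Ap ca hv; rewrite {1}(tan_tvec Ap hv) cot_tvec//. by apply: eq_bigr => i _; rewrite mxE mulrC.
Qed.

End Coordinates.

Lemma tan_field_ext p v : tangent p v -> exists Z, field Z /\ Z p = v.
Proof. by move=> hv; have [x [y [A [B [cx Ap]]]]] := good_coords gS p; exact: field_ext cx _ _ Ap hv. Qed.

Lemma lie_bracket_tangent (V W : S -> vec S) p : field V -> field W -> tangent p (lie_bracket V W p).
Proof.
move=> fV fW; have [tV sV] := fV; have [tW sW] := fW. rewrite /lie_bracket; split.
- move=> f nf. have -> : (fun y => W y f) = fun=> 0 by apply/funext => z; case: (tW z) => ->.
  have -> : (fun y => V y f) = fun=> 0 by apply/funext => z; case: (tV z) => ->.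
  by rewrite (tan_zero (tV p)) (tan_zero (tW p)) subrr.
- move=> t f h sf sh. have EE U : field U -> (fun y => U y (t \*o f \+ h)) = fun y => t * U y f + U y h.
    by move=> [tU _]; apply/funext => y; case: (tU y) => _ -> .
  rewrite !EE// !(tan_add (tV p), tan_add (tW p)) ?(tan_scale _ (tV p), tan_scale _ (tW p));
    try exact: sV; try exact: sW; try (apply: (smooth_mul gS) (smooth_cst gS t) _; by [exact: sV|exact: sW]).
  by ring.
- move=> f h sf sh. have EE U : field U -> (fun y => U y (f \* h)) = fun y => U y f * h y + f y * U y h.
    by move=> [tU _]; apply/funext => y; case: (tU y) => _ _ -> .
  have s1 U : field U -> smooth (fun y => U y f * h y).
    by move=> [_ sU]; apply: (smooth_mul gS) => //; exact: sU.
  have s2 U : field U -> smooth (fun y => f y * U y h).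
    by move=> [_ sU]; apply: (smooth_mul gS) => //; exact: sU.
  rewrite !EE// (tan_add (tV p)) ?(tan_add (tW p)); try (by apply: s1); try (by apply: s2).
  rewrite !(tan_mul (tV p), tan_mul (tW p))//; try exact: sV; try exact: sW. by ring.
Qed.

(** [ext_deriv] chooses extensions of v and w. For a local expression sum_i al_i dg_i all extensions
    give the same value, the derivatives of the extending fields being cancelled by the bracket
    term. *)
Lemma ext_derivE p (a : S -> covec S) k (al g : 'I_k -> S -> R) v w : tangent p v -> tangent p w ->
  cotangent p (a p) -> (forall i, smooth (al i)) -> (forall i, smooth (g i)) ->
  (forall V, field V -> smooth (fun q => a q (V q))) ->
  snear p [set q | forall u, tangent q u -> a q u = \sum_i al i q * u (g i)] ->
  ext_deriv a p v w = \sum_i (v (al i) * w (g i) - w (al i) * v (g i)).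
Proof.
move=> hv tw cp sal sg sa na; rewrite /ext_deriv. have key V W : field V -> field W -> V p = v -> W p = w ->
    V p (fun y => a y (W y)) - W p (fun y => a y (V y)) - a p (lie_bracket V W p) =
    \sum_i (v (al i) * w (g i) - w (al i) * v (g i)).
  move=> fV fW Vp Wp; have [tV sV] := fV; have [tW sW] := fW.
  have E U u : field U -> tangent p u -> u (fun y => a y (U y)) =
      \sum_i (u (al i) * U p (g i) + al i p * u (fun q => U q (g i))). move=> fU tu; have [tU sU] := fU.
    have s i : smooth (fun q => al i q * U q (g i)) by exact: smooth_mul (sU _ _).
    rewrite (@tan_local _ _ _ (fun q => \sum_i al i q * U q (g i)) tu).
    - rewrite (tan_sum _ _ tu)//; apply: eq_bigr => i _. by rewrite (tan_mul tu)//; exact: sU.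
    - exact: sa.
    - exact: smooth_sum.
    - by apply: snearS na => q /= ->. rewrite !E// ?Vp ?Wp//. have tb := lie_bracket_tangent p fV fW.
  rewrite (snear_self na) // -!sumrB; apply: eq_bigr => i _. by rewrite /lie_bracket Vp Wp; ring.
have [V [fV Vp]] := tan_field_ext hv; have [W [fW Wp]] := tan_field_ext tw.
case: xgetP => [r -> [V' [W' [fV' fW' Vp' Wp' ->]]]|]; first exact: key.
by move=> /(_ (V p (fun y => a y (W y)) - W p (fun y => a y (V y)) - a p (lie_bracket V W p)));
  case; exists V, W; split.
Qed.

Lemma lie_derivativeE p V (b : S -> covec S) k (be g : 'I_k -> S -> R) z :
  field V -> tangent p z -> cotangent p (b p) -> (forall i, smooth (be i)) -> (forall i, smooth (g i)) ->
  (forall Z, field Z -> smooth (fun q => b q (Z q))) ->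
  snear p [set q | forall u, tangent q u -> b q u = \sum_i be i q * u (g i)] -> lie_derivative V b p z =
    \sum_i (V p (be i) * z (g i) + be i p * z (fun q => V q (g i))).
Proof.
move=> fV hz cp sbe sg sb nb; rewrite /lie_derivative. have key Z : field Z -> Z p = z ->
    V p (fun y => b y (Z y)) - b p (lie_bracket V Z p) =
    \sum_i (V p (be i) * z (g i) + be i p * z (fun q => V q (g i))).
  move=> fZ Zp; have [tV sV] := fV; have [tZ sZ] := fZ.
  have s i : smooth (fun q => be i q * Z q (g i)) by exact: smooth_mul (sZ _ _).
  rewrite (@tan_local _ _ _ (fun q => \sum_i be i q * Z q (g i)) (tV p)).
  - rewrite (tan_sum _ _ (tV p))// (snear_self nb); last exact: lie_bracket_tangent.
    rewrite -sumrB; apply: eq_bigr => i _. rewrite (tan_mul (tV p))//; last exact: sZ.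
    by rewrite /lie_bracket Zp; ring.
  - exact: sb.
  - exact: smooth_sum.
  - by apply: snearS nb => q /= ->. have [Z [fZ Zp]] := tan_field_ext hz.
case: xgetP => [r -> [Z' [fZ' Zp' ->]]|]; first exact: key.
by move=> /(_ (V p (fun y => b y (Z y)) - b p (lie_bracket V Z p))); case; exists Z; split.
Qed.

End Tangent.

(** * Manifolds, open submanifolds and tangent maps *)

Section Manifold.
Variables (R : realType) (n : nat) (S : diffspace R).
Hypothesis mS : manifold n S.

Lemma smooth_smooth_on (A : set S) h : smooth h -> smooth_on A h.
Proof. by move=> sh p _; exists setT, h; split=> //; exact: sopenT. Qed.

Lemma chart_pull (A : set S) (V : set 'rV[R]_n) c d h : chart A V c d -> smooth_on A h -> Cinf V (h \o d).
Proof.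
move=> [oA oV cA cV cd] sh; have /(cd A h oA (fun _ a => a)) H := sh.
suff -> : V = [set v | V v /\ A (d v)] by [].
by apply/seteqP; split=> v /= => [Vv|[]//]; split=> //; case: (cV v Vv).
Qed.

Lemma chart_push (A : set S) (V : set 'rV[R]_n) c d h : chart A V c d -> Cinf V (h \o d) -> smooth_on A h.
Proof.
move=> [oA oV cA cV cd] sh; apply/(cd A h oA (fun _ a => a)). suff <- : V = [set v | V v /\ A (d v)] by [].
by apply/seteqP; split=> v /= => [Vv|[]//]; split=> //; case: (cV v Vv).
Qed.

Lemma chart_near (A : set S) (V : set 'rV[R]_n) c d v (P : set S) :
  chart A V c d -> V v -> snear (d v) P -> \forall w \near v, V w /\ P (d w).
Proof.
move=> ch Vv [A' [oA' A'v A'P]]; have [k [g [e [gs e0 h]]]] := oA' _ A'v. have [oA oV cA cV cd] := ch.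
have nV : nbhs v V by apply: open_nbhs_nbhs.
have ng : nbhs v [set w | forall i, `|g i (d w) - g i (d v)| < e]. apply: near_fin => i.
  have := Ck_cont (k := 0) (chart_pull ch (smooth_smooth_on (gs i)) 0%N) Vv.
  move=> /cvgrPdist_lt/(_ e e0); apply: filterS => w /=. by rewrite distrC.
by apply: filterS2 nV ng => w Vw hw; split=> //; apply: A'P; exact: h.
Qed.

(** The components of a chart are smooth on A alone. Near p they agree with global smooth functions,
    and the chart is shrunk to the set where they do. *)
Lemma chart_coords (A : set S) (V : set 'rV[R]_n) c d p : chart A V c d -> A p ->
  exists (x : S -> 'rV[R]_n) A1 B1, coords x d A1 B1 /\ A1 p.
Proof.
move=> ch Ap; have [oA oV cA cV cd] := ch. have sc i : smooth_on A (fun q => c q 0 i).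
  apply: (chart_push ch) => k; apply: (Ck_congr oV) (Ck_coord k V i) => w Vw /=. by case: (cV w Vw) => _ ->.
have /choice[g hg] : forall i, exists g : S -> R, smooth g /\ snear p [set q | c q 0 i = g q].
  by move=> i; have /smooth_onE/(_ p Ap)[g sg ng] := sc i; exists g.
have [A0 [oA0 A0p hA0]] := snear_fin (fun i => (hg i).2).
pose A1 := A `&` A0; pose B1 := [set v | V v /\ A1 (d v)]. have oA1 : sopen A1 by exact: sopenI.
have xc q : A1 q -> \row_i g i q = c q. by move=> [_ /hA0 h]; apply/rowP => i; rewrite mxE -h.
exists (fun q => \row_i g i q), A1, B1; split=> //; split=> //.
- rewrite openE => v [Vv Av]; apply: (chart_near ch Vv); exact: snear_open.
- by move=> q A1q; rewrite xc//; have [Vc dc] := cA q A1q.1; rewrite /B1/= dc.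
- by move=> z [Vz A1z]; rewrite xc//; have [_ ->] := cV z Vz.
- by move=> i; under eq_fun do rewrite mxE; case: (hg i).
- move=> f z sf [Vz _]. have [F [sF _ nF]] := local_ext oV Vz (chart_pull ch (smooth_smooth_on sf)).
  by exists F => //; apply: filterS nF => w ->.
Qed.

Lemma manifold_good : good n S.
Proof.
split.
- move=> k g F sg sF; apply: (manifold_local mS) => p _.
  have [A [V [c [d [ch Ap]]]]] := manifold_chart mS p; have [oA oV cA cV cd] := ch.
  suff sh : smooth_on A (fun q => F (\row_i g i q)) by exact: sh. apply: (chart_push ch) => l /=.
  apply: (Ck_comp oV (W := setT) (F := F) (g := fun v => \row_i g i (d v))) => //.
  by move=> i; under eq_fun do rewrite mxE; exact: (chart_pull ch (smooth_smooth_on (sg i)) l).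
- exact: manifold_local mS.
- move=> p; have [A [V [c [d [ch Ap]]]]] := manifold_chart mS p.
  by have [x [A1 [B1 [cx A1p]]]] := chart_coords ch Ap; exists x, d, A1, B1.
- move=> p q h; apply: contrapT => npq. have [A [B [oA oB Ap Bq AB]]] := manifold_hausdorff mS npq.
  have [k [g [e [gs e0 hA]]]] := oA p Ap. have Aq : A q by apply: hA => i; rewrite (h _ (gs i)) subrr normr0.
  by have : (A `&` B) q by []; rewrite AB.
Qed.

End Manifold.

Section OpenSubspace.
Variables (R : realType) (d : nat) (S : diffspace R) (U : set S).
Hypotheses (gS : good d S) (oU : sopen U).
Notation T := (subspace_of U).
#[local] Hint Resolve gS : core.

Lemma sub_inj (p q : T) : sval p = sval q -> p = q.
Proof. by case: p q => [p Up] [q Uq] /= E; subst q; congr exist; exact: Prop_irrelevance. Qed.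

Lemma sub_smooth f : smooth f -> smooth (fun q : T => f (sval q)).
Proof. by move=> sf p; exists setT, f; split=> //; exact: sopenT. Qed.

Lemma sub_smoothE (h : T -> R) : smooth h <-> forall p : T,
  exists2 g, smooth g & snear (sval p) [set z | forall q : T, sval q = z -> h q = g z].
Proof.
split=> H p; have := H p. move=> [A [g [oA Ap sg hg]]]; exists g => //; exists A; split=> // z Az q qz.
  by rewrite hg ?qz. move=> [g sg [A [oA Ap hA]]]; exists A, g; split=> // q Aq; exact: hA.
Qed.

Lemma sub_snear (p : T) (P : set S) : snear (sval p) P -> snear p [set q : T | P (sval q)].
Proof.
move=> [A [oA Ap AP]]; exists [set q : T | A (sval q)]; split=> //; last by move=> q /AP.
move=> q /oA[k [g [e [gs e0 h]]]].
exists k, (fun i q => g i (sval q)), e; split=> // [i|r hr]; first exact: sub_smooth. exact: h.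
Qed.

Lemma sub_snearV (p : T) (P : set T) : snear p P -> snear (sval p) [set z | forall q : T, sval q = z -> P q].
Proof.
move=> [A [oA Ap AP]]; have [k [g [e [gs e0 h]]]] := oA p Ap.
have /choice[G hG] : forall i, exists G, smooth G /\
    snear (sval p) [set z | forall q : T, sval q = z -> g i q = G z].
  by move=> i; have /sub_smoothE/(_ p)[G] := gs i; exists G.
have [A' [oA' A'p hA']] := snear_fin (fun i => (hG i).2). exists (A' `&` (fun z => \row_i G i z) @^-1`
  [set w | `|w - \row_i G i (sval p)| < e]); split.
- apply: sopenI => //; apply: sopen_pre; last exact: open_norm_lt.
  by move=> i; under eq_fun do rewrite mxE; case: (hG i).
- by split=> //=; rewrite subrr normr0.
- move=> z [A'z hz] q qz; apply: AP; apply: h => i. rewrite (hA' z A'z i q qz) (hA' _ A'p i p erefl).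
  have := coord_le_norm (\row_i G i z - \row_i G i (sval p)) i; rewrite !mxE => /le_lt_trans. exact.
Qed.

Lemma sub_good : good d T.
Proof.
split.
- move=> k g F sg sF; apply/sub_smoothE => p. have /choice[G hG] : forall i, exists G, smooth G /\
      snear (sval p) [set z | forall q : T, sval q = z -> g i q = G z].
    by move=> i; have /sub_smoothE/(_ p)[G] := sg i; exists G. exists (fun z => F (\row_i G i z)).
    by apply: (good_comp gS) => // i; case: (hG i).
  apply: snearS (snear_fin (fun i => (hG i).2)) => z hz q qz.
  by congr F; apply/rowP => i; rewrite !mxE (hz i q qz).
- move=> h /smooth_onE H; apply/sub_smoothE => p.
  have [g /sub_smoothE/(_ p)[G sG nG] nh] := H p I; exists G => //.
  by apply: snear2 nG (sub_snearV nh) _ => z h1 h2 q qz; rewrite -(h1 q qz); exact: h2.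
- move=> p; have [x [y [A [B [cx Ap]]]]] := good_coords gS (sval p).
  pose y' z : T := if pselect (U (y z)) is left Uz then exist _ (y z) Uz else p.
  have yE z : U (y z) -> sval (y' z) = y z by rewrite /y'; case: pselect.
  exists (fun q : T => x (sval q)), y', [set q : T | A (sval q)], [set z | B z /\ U (y z)]; split=> //; split.
  + apply: sopen_local => q Aq; apply: (sub_snear (p := q)). by apply: snear_open => //; exact: co_openA cx.
  + rewrite openE => z [Bz Uz]. have := near_pull cx (co_A cx Bz) (snear_open oU Uz); rewrite (co_xy cx)//.
  + move=> q Aq; rewrite /= (co_yx cx)//; split; first by split; [exact: co_B cx _ Aq|exact: svalP q].
    apply: sub_inj; rewrite yE ?(co_yx cx)//; exact: svalP q.
  + by move=> z [Bz Uz]; rewrite /= yE// (co_xy cx)//; split=> //; exact: co_A cx _ Bz.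
  + by move=> i; apply: (sub_smooth (f := fun q => x q 0 i)); exact: co_smooth cx i.
  + move=> f z /sub_smoothE sf [Bz Uz]. have [g sg] := sf (y' z); rewrite yE// => ng.
    have [F sF nF] := co_pull cx sg Bz; exists F => //.
    have := near_pull cx (co_A cx Bz) ng; have := near_pull cx (co_A cx Bz) (snear_open oU Uz).
    rewrite (co_xy cx)// => n1 n2; near=> w. have [_ Uw] : B w /\ U (y w) by near: w.
    have [_ hw] : B w /\ (forall q : T, sval q = y w -> f q = g (y w)) by near: w.
    by rewrite (hw (y' w)) ?yE//; near: w.
- by move=> p q h; apply: sub_inj; apply: (good_sep gS) => f sf; exact: h (sub_smooth sf).
Unshelve. all: by end_near. Qed.

End OpenSubspace.

Section Maps.
Variables (R : realType) (d e : nat) (S T : diffspace R) (phi : S -> T).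
Hypotheses (gS : good d S) (gT : good e T) (sphi : smooth_map phi).
#[local] Hint Resolve gS gT : core.

Lemma sopen_preim (A : set T) : sopen A -> sopen (phi @^-1` A).
Proof.
move=> oA p /oA[k [g [r [gs r0 h]]]]; exists k, (fun i q => g i (phi q)), r.
by split=> // [i|q hq]; [exact: sphi (gs i)|exact: h].
Qed.

Lemma snear_preim p (P : set T) : snear (phi p) P -> snear p [set q | P (phi q)].
Proof.
move=> [A [oA Ap AP]]; exists (phi @^-1` A); split=> //; first exact: sopen_preim. by move=> q /AP.
Qed.

Lemma pushE v f : smooth f -> push phi v f = v (f \o phi).
Proof. by move=> sf; rewrite /push patchT// inE. Qed.

Lemma push_tangent p v : tangent p v -> tangent (phi p) (push phi v).
Proof.
move=> [v0 vl vm]; split=> [f nf|t f g sf sg|f g sf sg].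
- by rewrite /push patchN// notin_setE.
- have s : smooth (t \*o f \+ g). by have := smooth_add gT (smooth_mul gT (smooth_cst gT t) sf) sg.
  by rewrite !pushE//; exact: vl (sphi sf) (sphi sg).
- have s : smooth (f \* g) by have := smooth_mul gT sf sg. by rewrite !pushE//; exact: vm (sphi sf) (sphi sg).
Qed.

Lemma push_lin t u v : push phi (t \*o u \+ v) = t \*o push phi u \+ push phi v.
Proof.
apply/funext => f /=; have [sf|nf] := pselect (smooth f); first by rewrite !pushE.
by rewrite /push !patchN ?notin_setE// mulr0 addr0.
Qed.

Lemma pull_cotangent p b : cotangent (phi p) b -> cotangent p (pull phi p b).
Proof.
move=> [bl b0]; split=> [t u v hu hv|v nv]; last by rewrite /pull patchN// notin_setE.
have huv := (lin_set_tangent p).2 t _ _ hu hv.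
by rewrite /pull !patchT ?inE// push_lin bl//; exact: push_tangent.
Qed.

Lemma pullE p b v : tangent p v -> pull phi p b v = b (push phi v).
Proof. by move=> hv; rewrite /pull patchT// inE. Qed.

End Maps.

Section OpenInclusion.
Variables (R : realType) (d : nat) (S : diffspace R) (U : set S).
Hypotheses (gS : good d S) (oU : sopen U).
Notation T := (subspace_of U).
Notation incl := (fun q : T => sval q).
Let gT : good d T := sub_good gS oU.
#[local] Hint Resolve gS gT : core.

Lemma incl_smooth : smooth_map incl.
Proof. by move=> f sf; exact: sub_smooth. Qed.

Lemma push_incl_inj (p : T) v w : tangent p v -> tangent p w -> push incl v = push incl w -> v = w.
Proof.
move=> hv hw E; apply/funext => h; have [sh|nh] := pselect (smooth h); last first.
  by case: hv => -> // _ _; case: hw => ->. have [g sg ng] := (sub_smoothE _).1 sh p.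
have L u : tangent p u -> u h = push incl u g.
  move=> hu; rewrite pushE//; apply: (tan_local gT hu) => //; first exact: sub_smooth.
  by apply: snearS (sub_snear ng) => q /= h'; exact: h'. by rewrite !L// E.
Qed.

(** A vector of S acts on a function of the open subspace through any global function with the same
    germ; by [tan_local] the choice is immaterial. *)
Lemma push_incl_surj (p : T) v : tangent (sval p) v -> exists w, tangent p w /\ push incl w = v.
Proof.
move=> hv. have /choice[g hg] : forall h : T -> R, exists g : S -> R, smooth h -> smooth g /\
    snear (sval p) [set z | forall q : T, sval q = z -> h q = g z].
  move=> h; have [/sub_smoothE/(_ p)[g sg ng]|nh] := pselect (smooth h); first by exists g.
  by exists (fun=> 0). pose w : vec T := patch (fun=> 0) (@smooth R T) (fun h => v (g h)).
have nU := snear_open oU (svalP p). have wE h f : smooth h -> smooth f ->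
    snear (sval p) [set z | forall q : T, sval q = z -> h q = f z] -> w h = v f.
  move=> sh sf nf; rewrite /w patchT ?inE//; have [sg ng] := hg h sh. apply: (tan_local gS hv) => //.
  apply: snear2 nU (snear2 ng nf (fun z a b => conj a b)) _ => z Uz [h1 h2] /=.
  by rewrite -(h1 (exist _ z Uz))// -(h2 (exist _ z Uz)). exists w; split; last first.
  apply/funext => f; have [sf|nf] := pselect (smooth f).
    rewrite pushE//; apply: wE => //; first exact: sub_smooth.
    by exists setT; split=> //; [exact: sopenT|move=> z _ q <-].
  by rewrite /push patchN ?notin_setE//; case: hv => ->. split=> [h nh|t h k sh sk|h k sh sk].
- by rewrite /w patchN ?notin_setE.
- have [sg ng] := hg h sh; have [sg' ng'] := hg k sk. rewrite (wE _ _ sh sg ng) (wE _ _ sk sg' ng').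
  have sgg : smooth (fun z => t * g h z + g k z).
    exact: (smooth_add gS (smooth_mul gS (smooth_cst gS t) sg) sg').
  rewrite (wE (t \*o h \+ k) (fun z => t * g h z + g k z))//.
  + by rewrite (tan_add hv) ?(tan_scale gS _ hv)//; exact: (smooth_mul gS (smooth_cst gS t) sg).
  + by have := smooth_add gT (smooth_mul gT (smooth_cst gT t) sh) sk.
  + by apply: snear2 ng ng' _ => z h1 h2 q qz /=; rewrite (h1 q qz) (h2 q qz).
- have [sg ng] := hg h sh; have [sg' ng'] := hg k sk. rewrite (wE _ _ sh sg ng) (wE _ _ sk sg' ng').
  rewrite (wE (h \* k) (fun z => g h z * g k z))//.
  + rewrite (tan_mul hv sg sg'). by rewrite -(snear_self ng p erefl) -(snear_self ng' p erefl).
  + by have := smooth_mul gT sh sk.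
  + exact: (smooth_mul gS).
  + by apply: snear2 ng ng' _ => z h1 h2 q qz /=; rewrite (h1 q qz) (h2 q qz).
Qed.

End OpenInclusion.

(** * The total space of a dual bundle as a manifold *)

Section DualBundle.
Variables (R : realType) (n r : nat) (S : diffspace R) (K : S -> set (vec S)).

Definition frame p (e : 'I_r -> S -> vec S) (w : 'I_r -> S -> covec S) : Prop :=
  [/\ forall a, section_of K (e a), forall a, form1 (w a) &
    snear p [set q | (forall v, K q v -> v = fun f => \sum_a w a q v * e a q f) /\
      forall a b, w a q (e b q) = (a == b)%:R]].

Hypothesis gS : good n S.
Hypothesis linK : forall p, lin_set (K p).
Hypothesis subK : forall p, K p `<=` tangent p.
Hypothesis frameK : forall p, exists e w, frame p e w.
#[local] Hint Resolve gS : core.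

Notation D := (dual_bundle K).
Notation G := (@DiffSpace R (dual_point K) (@dual_generators R S K)).
Implicit Types (p : dual_point K).

Lemma dual_point_eq p (q : dual_point K) : base p = base q ->
  (forall v, K (base p) v -> fib p v = fib q v) -> p = q.
Proof.
case: p q => [[x a] /= da] [[z b] /= db]; rewrite /base /fib /= => xz; subst z => h.
have ab : a = b by apply: dual_ext da db h. by subst b; congr exist; exact: Prop_irrelevance.
Qed.

Definition dual_covec x (w : 'I_r -> S -> covec S) (c : 'rV[R]_r) : covec S :=
  patch (fun=> 0) (K x) (fun v => \sum_a c 0 a * w a x v).

Lemma dual_covecP x w c : (forall a, form1 (w a)) -> dual_of (K x) (dual_covec x w c).
Proof.
move=> fw; split=> [t u v Ku Kv|v nv]; last by rewrite /dual_covec patchN// notin_setE.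
have Kuv := (linK x).2 t _ _ Ku Kv; rewrite /dual_covec !patchT ?inE//.
rewrite mulr_sumr -big_split; apply: eq_bigr => a _ /=.
by case: (fw a) => /(_ x)[al _] _; rewrite al//; [ring|exact: subK|exact: subK].
Qed.

Definition dual_mk w (fw : forall a, form1 (w a)) x c : dual_point K :=
  exist (fun p : S * covec S => dual_of (K p.1) p.2) (x, dual_covec x w c) (dual_covecP x c fw).

Lemma dual_smoothI (h : dual_point K -> R) : (forall p, exists k (g : 'I_k -> dual_point K -> R) F,
    [/\ forall i, dual_generators (g i), sm F &
     @snear R G p [set q | h q = F (\row_i g i q)]]) -> @smooth R D h.
Proof. move=> H p; have [k [g [F [gs sF [A [oA Ap hA]]]]]] := H p. by exists A, k, g, F; split. Qed.

Lemma generator_smooth g : dual_generators g -> @smooth R D g.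
Proof.
move=> gg; apply: dual_smoothI => p; exists 1%N, (fun=> g), (fun z => z 0 0); split=> //. exact: sm_coord.
exists setT; split=> //; first exact: (@sopenT R G). by move=> q _ /=; rewrite mxE.
Qed.

Lemma pr_smooth : smooth_map (@pr R S K).
Proof. by move=> f sf; apply: generator_smooth; left; exists f. Qed.

Lemma fib_smooth V : section_of K V -> @smooth R D (fun p => fib p (V (base p))).
Proof. by move=> sV; apply: generator_smooth; right; exists V. Qed.

Lemma gopen_sopen A : @sopen R G A -> @sopen R D A.
Proof.
move=> oA p /oA[k [g [e [gs e0 h]]]]; exists k, g, e; split=> // i. exact: generator_smooth (gs i).
Qed.

Lemma gopen_pr A : sopen A -> @sopen R G [set p | A (base p)].
Proof.
move=> oA p /oA[k [g [e [gs e0 h]]]]; exists k, (fun i q => g i (base q)), e.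
by split=> // [i|q hq]; [left; exists (g i)|exact: h].
Qed.

(** The topology of [dual_bundle] is induced by all its smooth functions, that of [G] by the
    generators. Smooth functions are locally functions of finitely many generators, so the two
    topologies agree. *)
Lemma sopen_gnear A p : @sopen R D A -> A p -> @snear R G p A.
Proof.
move=> oA /oA[k [g [e [gs e0 h]]]]. suff H i : @snear R G p [set q | `|g i q - g i p| < e].
  by apply: snearS (@snear_fin R G _ p _ H) => q hq; exact: h.
have [A0 [l [u [F [[oA0 A0p] gu sF gE]]]]] := gs i p.
have [b b0 hb] : exists2 b, 0 < b & forall z, `|z - \row_j u j p| < b -> `|F z - F (\row_j u j p)| < e.
  apply/nbhs_rVP; have /cvgrPdist_lt/(_ e e0) := @sm_cont _ _ _ sF (\row_j u j p).
  by apply: filterS => z; rewrite distrC.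
have oB : @sopen R G ((fun q => \row_j u j q) @^-1` [set z | `|z - \row_j u j p| < b]).
  apply: (@sopen_pre R G l (fun q => \row_j u j q)); last exact: open_norm_lt.
  by move=> j; under eq_fun do rewrite mxE; exact: gu.
exists (A0 `&` ((fun q => \row_j u j q) @^-1` [set z | `|z - \row_j u j p| < b])).
split; first exact: (@sopenI R G). by split=> //=; rewrite subrr normr0.
by move=> q [A0q hq] /=; rewrite !gE//; exact: hb.
Qed.

Section DualCoordinates.
Variables (p0 : dual_point K) (x : S -> 'rV[R]_n) (y : 'rV[R]_n -> S) (A : set S)
  (B : set 'rV[R]_n) (e : 'I_r -> S -> vec S) (w : 'I_r -> S -> covec S) (A0 : set S).
Hypothesis cx : coords x y A B.
Hypothesis se : forall a, section_of K (e a).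
Hypothesis fw : forall a, form1 (w a).
Hypothesis oA0 : sopen A0.
Hypothesis hA0 : forall q : S, A0 q -> (forall v, K q v -> v = fun f => \sum_a w a q v * e a q f) /\
      forall a b, w a q (e b q) = (a == b)%:R.

Definition dual_x (p : dual_point K) : 'rV[R]_(n + r) := row_mx (x (base p)) (\row_a fib p (e a (base p))).
Definition dual_y (z : 'rV[R]_(n + r)) : dual_point K := dual_mk fw (y (lsubmx z)) (rsubmx z).
Definition dual_A : set (dual_point K) := [set p | A (base p) /\ A0 (base p)].
Definition dual_B : set 'rV[R]_(n + r) := [set z | B (lsubmx z) /\ A0 (y (lsubmx z))].

Lemma fib_expand p v : A0 (base p) -> K (base p) v -> fib p v = \sum_a w a (base p) v * fib p (e a (base p)).
Proof.
move=> /hA0[h _] Kv; have dp : dual_of (K (base p)) (fib p) := svalP p.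
rewrite {1}(h v Kv) (dual_comb _ _ (linK _) dp)//. by move=> a; case: (se a).
Qed.

Lemma fib_dual_y z v : K (y (lsubmx z)) v ->
  fib (dual_y z) v = \sum_a z 0 (rshift n a) * w a (y (lsubmx z)) v.
Proof. move=> Kv; rewrite /fib/= /dual_covec patchT ?inE//. by apply: eq_bigr => a _; rewrite mxE. Qed.

Lemma generator_pull g z : dual_generators g -> dual_B z ->
  exists2 F, sm F & \forall z' \near z, g (dual_y z') = F z'.
Proof.
have lift (f : S -> R) : smooth f -> dual_B z -> exists2 F, sm F &
    \forall z' \near z, f (y (lsubmx z')) = F (lsubmx z').
  move=> sf [Bz _]; have [F sF nF] := co_pull cx sf Bz; exists F => //.
  have : {for z, continuous (fun z' : 'rV[R]_(n + r) => lsubmx z')}.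
    by apply: sm_cont_rV => i; exact: sm_lsubmx. by move=> c; exact: (c _ nF).
have sml F : sm F -> sm (fun z' : 'rV[R]_(n + r) => F (lsubmx z') : R).
  by move=> sF; apply: sm_comp => // i; exact: sm_lsubmx. case=> [[f [sf ->]] Bz|[V [sV ->]] Bz].
  have [F sF nF] := lift f sf Bz; exists (fun z' => F (lsubmx z')) => //; exact: sml.
have /choice[F hF] : forall a, exists F : fn R n, sm F /\
    \forall z' \near z, w a (y (lsubmx z')) (V (y (lsubmx z'))) = F (lsubmx z').
  move=> a; have [_ sw] := fw a. by have [F sF nF] := lift _ (sw V sV.1) Bz; exists F.
exists (fun z' : 'rV[R]_(n + r) => \sum_a z' 0 (rshift n a) * F a (lsubmx z')).
  by apply: sm_sum => a; apply: sm_mul; [exact: sm_coord|apply: sml; case: (hF a)].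
apply: filterS (near_fin (fun a => (hF a).2)) => z' hz. rewrite fib_dual_y; last exact: sV.2.
by apply: eq_bigr => a _; rewrite hz.
Qed.

Lemma dual_pull_near z (P : set (dual_point K)) : dual_B z -> @snear R G (dual_y z) P ->
  \forall z' \near z, P (dual_y z').
Proof.
move=> Bz [A1 [oA1 A1p hA1]]; have [k [g [b [gs b0 h]]]] := oA1 _ A1p.
suff : nbhs z [set z' | forall i, `|g i (dual_y z') - g i (dual_y z)| < b].
  by apply: filterS => z' hz; apply: hA1; exact: h.
apply: near_fin => i; have [F sF nF] := generator_pull (gs i) Bz.
have /cvgrPdist_lt/(_ b b0) := @sm_cont _ _ _ sF z. have gz := nbhs_singleton nF.
by apply: filterS2 nF => z' ->; rewrite gz distrC.
Qed.

Lemma dual_smooth_pull h z : @smooth R D h -> dual_B z ->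
  exists2 F, sm F & \forall z' \near z, h (dual_y z') = F z'.
Proof.
move=> sh Bz; have [A1 [k [g [F [[oA1 A1p] gg sF hE]]]]] := sh (dual_y z).
have /choice[H hH] : forall i, exists H : fn R (n + r), sm H /\ \forall z' \near z, g i (dual_y z') = H z'.
  by move=> i; have [H sH nH] := generator_pull (gg i) Bz; exists H. exists (fun z' => F (\row_i H i z')).
  by apply: sm_comp => // i; under eq_fun do rewrite mxE; case: (hH i).
have n1 : \forall z' \near z, A1 (dual_y z'). by apply: dual_pull_near => //; exists A1; split.
apply: filterS2 n1 (near_fin (fun i => (hH i).2)) => z' /hE-> h2.
by congr F; apply/rowP => i; rewrite !mxE h2.
Qed.

Lemma dual_xy z : dual_B z -> dual_x (dual_y z) = z.
Proof.
move=> [Bz Az]; have [_ wd] := hA0 Az; rewrite /dual_x.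
have -> : x (base (dual_y z)) = lsubmx z by rewrite /base/= (co_xy cx).
rewrite -[RHS]hsubmxK; congr row_mx; apply/rowP => a; rewrite !mxE. rewrite fib_dual_y; last exact: (se a).2.
rewrite (bigD1 a)//= big1 ?addr0; last first. by move=> b ba; rewrite wd (negPf ba) mulr0.
by rewrite wd eqxx mulr1.
Qed.

Lemma dual_yx p : dual_A p -> dual_y (dual_x p) = p.
Proof.
move=> [Ap A0p]; have E : base (dual_y (dual_x p)) = base p. by rewrite /base/= row_mxKl (co_yx cx).
apply: dual_point_eq => // v; rewrite E => Kv. rewrite fib_dual_y ?row_mxKl ?(co_yx cx)// fib_expand//.
by apply: eq_bigr => a _; rewrite row_mxEr mxE mulrC.
Qed.

Lemma dual_gen_x i : dual_generators (fun q => dual_x q 0 i).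
Proof.
rewrite /dual_x; case: (fintype.split_ordP i) => k ->.
- under eq_fun do rewrite row_mxEl; left. by exists (fun q => x q 0 k); split=> //; exact: co_smooth cx k.
- by under eq_fun do rewrite row_mxEr mxE; right; exists (e k).
Qed.

Lemma dual_coords : @coords R D (n + r) dual_x dual_y dual_A dual_B.
Proof.
split.
- apply: gopen_sopen; apply: (@sopenI R G); apply: gopen_pr => //. exact: co_openA cx.
- rewrite openE => z [Bz Az]. have := near_pull cx (co_A cx Bz) (snear_open oA0 Az); rewrite (co_xy cx)//.
  have : {for z, continuous (fun z' : 'rV[R]_(n + r) => lsubmx z')}.
    by apply: sm_cont_rV => i; exact: sm_lsubmx. by move=> c /c.
- move=> q Aq; rewrite dual_yx//; split=> //; rewrite /dual_B/= row_mxKl (co_yx cx).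
    by split; [exact: co_B cx _ Aq.1|exact: Aq.2]. exact: Aq.1.
- move=> z Bz; rewrite dual_xy//; split=> //; split; last exact: Bz.2. exact: co_A cx _ Bz.1.
- by move=> i; apply: generator_smooth; exact: dual_gen_x.
- by move=> f z; exact: dual_smooth_pull.
Qed.

Lemma dual_near_x h q : dual_A q -> @smooth R D h -> exists2 F, sm F &
  @snear R G q [set q' | h q' = F (dual_x q')].
Proof.
move=> Aq sh; have [Bz yq] := co_AB dual_coords Aq.
have [F sF /nbhs_rVP[b b0 hb]] := dual_smooth_pull sh Bz; exists F => //.
exists (dual_A `&` (dual_x @^-1` [set z | `|z - dual_x q| < b])); split.
- apply: (@sopenI R G). by apply: (@sopenI R G); apply: gopen_pr => //; exact: co_openA cx.
  apply: (@sopen_pre R G); last exact: open_norm_lt. exact: dual_gen_x.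
- by split=> //=; rewrite subrr normr0.
- by move=> q' [Aq' /= hq]; rewrite -hb// dual_yx.
Qed.

End DualCoordinates.

Lemma dual_good : good (n + r) D.
Proof.
have C p : exists (x : S -> 'rV[R]_n) y A B (e : 'I_r -> S -> vec S) w A0, [/\ coords x y A B, forall a, section_of K (e a),
    sopen A0, (forall a, form1 (w a)) & dual_A A A0 p /\ forall q : S, A0 q ->
  (forall v, K q v -> v = fun f => \sum_a w a q v * e a q f) /\ forall a b, w a q (e b q) = (a == b)%:R].
  have [x [y [A [B [cx Ap]]]]] := good_coords gS (base p).
  have [e [w [se fw [A0 [oA0 A0p hA0]]]]] := frameK (base p). by exists x, y, A, B, e, w, A0; split. split.
- move=> k g F sg sF; apply: dual_smoothI => p.
  have [x [y [A [B [e [w [A0 [cx se oA0 fw [Ap hA0]]]]]]]]] := C p.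
  have /choice[H hH] : forall i, exists H : fn R (n + r), sm H /\
      @snear R G p [set q' | g i q' = H (dual_x x e q')].
    by move=> i; have [H sH nH] := dual_near_x cx se fw oA0 hA0 Ap (sg i); exists H.
  exists (n + r)%N, (fun i q => dual_x x e q 0 i), (fun z => F (\row_i H i z)); split.
  + by move=> i; exact: dual_gen_x cx se i.
  + by apply: sm_comp => // i; under eq_fun do rewrite mxE; case: (hH i).
  + apply: snearS (@snear_fin R G _ p _ (fun i => (hH i).2)) => q hq /=.
    congr F; apply/rowP => i; rewrite !mxE hq; congr (H i). by apply/rowP => j; rewrite mxE.
- move=> h /smooth_onE hs p; have [g sg [A [oA Ap hA]]] := hs p I.
  have [A1 [oA1 A1p AA]] := sopen_gnear oA Ap. have [A2 [k [u [F [[oA2 A2p] gu sF uE]]]]] := sg p.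
  exists (A1 `&` A2), k, u, F; split=> //. by split=> //; exact: (@sopenI R G). by move=> q [/AA/hA/= -> /uE].
- move=> p; have [x [y [A [B [e [w [A0 [cx se oA0 fw [Ap hA0]]]]]]]]] := C p.
  exists (dual_x x e), (dual_y y fw), (dual_A A A0), (dual_B y B A0). by split=> //; exact: dual_coords.
- move=> p q h; have bpq : base p = base q. by apply: (good_sep gS) => f sf; exact: h (pr_smooth sf).
  apply: dual_point_eq => // v Kv. have [e [w [se fw /snear_self/= [ev _]]]] := frameK (base p).
  have dp : dual_of (K (base p)) (fib p) := svalP p.
  have dq : dual_of (K (base p)) (fib q) by rewrite bpq; exact: svalP q.
  have Ke a : K (base p) (e a (base p)) by case: (se a).
  rewrite (ev v Kv) (dual_comb _ _ (linK _) dp)// (dual_comb _ _ (linK _) dq)//.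
  apply: eq_bigr => a _; congr *%R; have := h _ (fib_smooth (se a)). by rewrite -bpq.
Qed.

Lemma to_dual_smooth d (T : diffspace R) (phi : T -> D) : good d T ->
  (forall g, dual_generators g -> smooth (fun z => g (phi z))) -> smooth_map phi.
Proof.
move=> gT hphi h sh; apply: (smooth_loc gT) => x. have [A [k [g [F [[oA Ap] gg sF hE]]]]] := sh (phi x).
exists (fun z => F (\row_i g i (phi z))). by apply: (good_comp gT) => // i; exact: hphi.
have [l [u [b [gu b0 hu]]]] := oA _ Ap.
exists ((fun z => \row_i u i (phi z)) @^-1` [set z | `|z - \row_i u i (phi x)| < b]); split.
- apply: sopen_pre; last exact: open_norm_lt. by move=> i; under eq_fun do rewrite mxE; exact: hphi.
- by rewrite /= subrr normr0.
- move=> z hz; apply: hE; apply: hu => i. have := coord_le_norm (\row_i u i (phi z) - \row_i u i (phi x)) i.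
  by rewrite !mxE => /le_lt_trans; apply.
Qed.

Lemma zero_section_smooth : smooth_map (@zero_section R S K).
Proof. apply: (to_dual_smooth gS) => g [[f [sf ->]]//|[V [sV ->]]]. exact: smooth_cst. Qed.

End DualBundle.

(** * Frames of Dirac structures *)

Section Matrices.
Variable R : realType.

Lemma sqr_sum0 n (v : 'rV[R]_n) : v *m v^T = 0 -> v = 0.
Proof.
move=> /matrixP/(_ 0 0); rewrite !mxE => /eqP.
under eq_bigr do rewrite mxE; rewrite psumr_eq0; last by move=> i _; exact: sqr_ge0.
move=> /allP h; apply/rowP => i; rewrite mxE; apply/eqP.
by have := h i (mem_index_enum _); rewrite mulf_eq0 orbb.
Qed.

(** Turns full rank into the nonvanishing of one smooth function of the entries, hence into an open
    condition, and makes the inverse Gram matrix available for smooth right inverses. *)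
Lemma gram_det k n (E : 'M[R]_(k, n)) : row_free E -> \det (E *m E^T) != 0.
Proof.
move=> fE; rewrite -unitfE -unitmxE -row_free_unit; apply: row_freeI => v.
rewrite mulmxA => h; have : (v *m E) *m (v *m E)^T = 0. by rewrite trmx_mul mulmxA h mul0mx.
by move=> /sqr_sum0 vE; apply: (row_free_injr fE); rewrite /= vE mul0mx.
Qed.

Lemma gram_free k n (E : 'M[R]_(k, n)) : \det (E *m E^T) != 0 -> row_free E.
Proof.
rewrite -unitfE -unitmxE => u; apply: row_freeI => v vE. by rewrite -(mulmxK u v) mulmxA vE !mul0mx.
Qed.

Lemma subspace_basis n (V : set 'rV[R]_n) : V 0 -> (forall t u v, V u -> V v -> V (t *: u + v)) ->
  exists k (E : 'M[R]_(k, n)), row_free E /\ forall z, V z <-> (z <= E)%MS.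
Proof.
move=> V0 Vl. pose P k := `[< exists E : 'M[R]_(k, n), row_free E /\ forall i, V (row i E) >].
have P0 : exists k, P k. by exists 0%N; apply/asboolP; exists 0; rewrite /row_free mxrank0; split=> // -[].
have Pn k : P k -> (k <= n)%N. by move=> /asboolP[E [/eqP fE _]]; rewrite -fE; exact: rank_leq_col.
case: (ex_maxnP P0 Pn) => k /asboolP[E [fE VE]] kmax; exists k, E; split=> // z.
have Vc m (c : 'rV[R]_m) (F : 'M[R]_(m, n)) : (forall i, V (row i F)) -> V (c *m F).
  move=> VF; rewrite mulmx_sum_row; elim/big_rec: _ => // i u _ Vu; exact: Vl.
split=> [Vz|/submxP[c ->]]; last exact: Vc. apply: contrapT => /negP nz.
suff : P k.+1 by move=> /kmax; rewrite ltnn. apply/asboolP; rewrite -addn1; exists (col_mx E z); split.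
  apply: row_freeI => v; rewrite -[v]hsubmxK mul_row_col => h. have r0 : rsubmx v = 0.
    apply: contrapT => /eqP nr; apply: (negP nz). have u : rsubmx v \in unitmx.
      rewrite unitmxE det_mx11 unitfE; apply: contra nr => /eqP r0.
      by apply/eqP/matrixP => i j; rewrite !ord1 r0 mxE. move: h => /eqP; rewrite addrC addr_eq0 => /eqP h.
    by rewrite -(mulKmx u z) h mulmxN -mulNmx mulmxA submxMl. move: h; rewrite r0 mul0mx addr0 => h.
  have -> : lsubmx v = 0 by apply: (row_free_injr fE); rewrite /= h mul0mx. by rewrite row_mx0.
move=> i; case: (fintype.split_ordP i) => j ->; first by rewrite rowKu. by rewrite rowKd row_id.
Qed.

Definition swap_mx n : 'M[R]_(n + n) := block_mx 0 1%:M 1%:M 0.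

Lemma swap_unit n : swap_mx n \in unitmx.
Proof.
suff h : swap_mx n *m swap_mx n = 1%:M by case/mulmx1_unit: h.
by rewrite /swap_mx mulmx_block !(mul0mx, mul1mx, add0r, addr0) -scalar_mx_block.
Qed.

(** V is its own orthogonal for a nondegenerate form on a space of dimension 2n, so dim V = 2n - dim
    V. *)
Lemma lagrangian_rank n (V : set 'rV[R]_(n + n)) :
  (forall z, V z <-> forall w, V w -> z *m swap_mx n *m w^T = 0) ->
  exists E : 'M[R]_(n, n + n), row_free E /\ forall z, V z <-> (z <= E)%MS.
Proof.
move=> VP; have V0 : V 0 by apply/VP => w _; rewrite !mul0mx. have Vl t u v : V u -> V v -> V (t *: u + v).
  move=> /VP Vu /VP Vv; apply/VP => w Vw. by rewrite !mulmxDl -!scalemxAl Vu// Vv// scaler0 addr0.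
have [k [E [fE EP]]] := subspace_basis V0 Vl. suff kn : k = n by subst k; exists E.
have VE i : V (row i E) by apply/EP; exact: row_sub. have rk : \rank (kermx (swap_mx n *m E^T)) = k.
  rewrite -[RHS](eqP fE); apply/eqP; rewrite eqn_leq; apply/andP; split; apply: mxrankS.
    apply/row_subP => i; apply/EP/VP => w /EP/submxP[c ->].
    have : row i (kermx (swap_mx n *m E^T)) *m (swap_mx n *m E^T) = 0. by rewrite -row_mul mulmx_ker row0.
    by rewrite trmx_mul !mulmxA => ->; rewrite mul0mx.
  apply/row_subP => i; rewrite sub_kermx; apply/eqP; rewrite mulmxA.
  apply/matrixP => a b; rewrite !ord1 [RHS]mxE.
  have /VP/(_ _ (VE b))/matrixP/(_ 0 0) := VE i; rewrite !mxE => h.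
  by rewrite -[RHS]h; apply: eq_bigr => l _; rewrite !mxE. have := mxrank_ker (swap_mx n *m E^T).
rewrite rk; have -> : \rank (swap_mx n *m E^T) = k.
  by rewrite eqmxMfull ?row_full_unit ?swap_unit// mxrank_tr (eqP fE).
have kle : (k <= n + n)%N by rewrite -(eqP fE) rank_leq_col.
by move=> h; apply: double_inj; rewrite -!addnn {1}h subnK.
Qed.

End Matrices.

Section HasDim.
Variables (R : realType) (S : diffspace R).

Lemma has_dim_lin r (V : set (vec S)) : has_dim r V -> lin_set V.
Proof.
move=> [b [_ ->]]; split=> [|t u v [c _ <-] [c' _ <-]].
  by exists 0 => //; apply/funext => f; rewrite big1// => i _; rewrite mxE mul0r.
exists (t *: c + c') => //; apply/funext => f /=; rewrite mulr_sumr -big_split.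
by apply: eq_bigr => i _; rewrite !mxE mulrDl mulrA.
Qed.

Lemma has_dim_span r (V : set (vec S)) (e : 'I_r -> vec S) : has_dim r V -> (forall a, V (e a)) ->
  (forall c : 'rV[R]_r, (fun f => \sum_a c 0 a * e a f) = (fun=> 0) -> c = 0) ->
  forall v, V v -> exists c : 'rV[R]_r, v = fun f => \sum_a c 0 a * e a f.
Proof.
move=> [b [_ VE]] Ve ie v; rewrite VE => -[c _ <-]. have /choice[P hP] : forall a, exists p : 'rV[R]_r,
    e a = fun f => \sum_i p 0 i * b i f. by move=> a; have := Ve a; rewrite VE => -[p _ <-]; exists p.
pose M := \matrix_(a, i) P a 0 i.
have EM (k : 'rV[R]_r) f : \sum_a k 0 a * e a f = \sum_i (k *m M) 0 i * b i f.
  under [RHS]eq_bigr do rewrite mxE mulr_suml; rewrite exchange_big/=.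
  apply: eq_bigr => a _; rewrite hP mulr_sumr; apply: eq_bigr => i _. by rewrite !mxE mulrA.
have uM : M \in unitmx. rewrite -row_free_unit; apply: row_freeI => k kM; apply: ie.
  by apply/funext => f; rewrite EM kM big1// => i _; rewrite mxE mul0r.
exists (c *m invmx M); apply/funext => f. by rewrite EM mulmxKV.
Qed.

Lemma has_dim_basis r (V : set (vec S)) : has_dim r V -> exists e : 'I_r -> vec S, (forall a, V (e a)) /\
  (forall c : 'rV[R]_r, (fun f => \sum_a c 0 a * e a f) = (fun=> 0) -> c = 0).
Proof.
move=> [b [ib ->]]; exists b; split=> [a|c h].
  exists (delta_mx 0 a) => //; apply/funext => f; rewrite (bigD1 a)//= big1 ?addr0.
    by rewrite !mxE !eqxx mul1r. by move=> i ia; rewrite mxE eqxx (negPf ia) mul0r.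
apply: ib; rewrite h; apply/funext => f. by rewrite big1// => i _; rewrite mxE mul0r.
Qed.

End HasDim.

Section Frames.
Variables (R : realType) (n : nat) (S : diffspace R).
Hypothesis gS : good n S.
#[local] Hint Resolve gS : core.

(** The right inverse is E^T (E E^T)^-1, smooth where the Gram determinant does not vanish and then
    replaced by entire functions with the same germ at z0. *)
Lemma right_inverse_near d k N (E : 'I_k -> 'I_N -> fn R d) z0 :
  (forall a i, sm (E a i)) -> row_free (\matrix_(a, i) E a i z0) ->
  exists H : 'I_N -> 'I_k -> fn R d, [/\ forall i a, sm (H i a),
    exists2 C, 0 <= C & forall i a z, `|H i a z| <= C &
    \forall z \near z0, row_free (\matrix_(a, i) E a i z) /\
      (\matrix_(a, i) E a i z) *m (\matrix_(i, a) H i a z) = 1%:M].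
Proof.
move=> sE f0; pose M z := \matrix_(a, i) E a i z; pose Gm z := M z *m (M z)^T.
have sG a b : sm (fun z => Gm z a b). rewrite /Gm; under eq_fun do rewrite mxE; apply: sm_sum => i.
  under eq_fun do rewrite !mxE; exact: sm_mul.
have sd : sm (fun z => \det (Gm z)) by exact: (Cinf_det (@open_setT _ _)).
pose V := [set z | \det (Gm z) != 0]. have oV : open V.
  have := @sm_cont _ _ _ sd; move=> /continuousP/(_ [set x | x != 0]); apply. exact: open_neq.
have V0 : V z0 by exact: gram_det.
have sI (ia : 'I_N * 'I_k) : Cinf V (fun z => ((M z)^T *m invmx (Gm z)) ia.1 ia.2).
  move=> l; under eq_fun do rewrite mxE; apply: Ck_sum => // a; apply: Ck_mul => //.
    under eq_fun do rewrite !mxE; apply: (Ck_sub (V := setT)) => //; exact: sE.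
  apply: (Cinf_invmx _ _ oV) => // b c l'. by apply: (Ck_sub (V := setT)) => //; exact: sG.
have [H [sH [C C0 hC] nH]] := local_ext_fin oV V0 sI.
exists (fun i a => H (i, a)); split=> //; first by exists C. have nV : nbhs z0 V by exact: open_nbhs_nbhs.
apply: filterS2 nV nH => z Vz hz; split; first exact: gram_free.
have -> : \matrix_(i, a) H (i, a) z = (M z)^T *m invmx (Gm z). by apply/matrixP => i a; rewrite mxE hz.
by rewrite mulmxA mulmxV// unitmxE unitfE.
Qed.

(** Extending the vectors at the single point p is enough: independence of the extensions is an open
    condition, and by constant dimension independent sections span nearby. *)
Lemma subbundle_frame r (D : S -> set (vec S)) p : (forall q, has_dim r (D q)) ->
  (forall q, D q `<=` tangent q) -> (forall v, D p v -> exists V, section_of D V /\ V p = v) ->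
  exists e w, @frame R r S D p e w.
Proof.
move=> dD tD xD; have [b [Db ib]] := has_dim_basis (dD p).
have /choice[e he] : forall a, exists V, section_of D V /\ V p = b a. by move=> a; exact: xD.
have [x [y [A [B [cx Ap]]]]] := good_coords gS p. have sx i := co_smooth cx i.
have [|E hE] := co_ext_fam cx (g := fun (ai : 'I_r * 'I_n) q => e ai.1 q (fun q => x q 0 ai.2)) _ Ap.
  by move=> [a i]; have [[[_ se] _] _] := he a; exact: se. have nE := snear_fin (fun ai => (hE ai).2).
have f0 : row_free (\matrix_(a, i) E (a, i) (x p)). apply: row_freeI => c h; apply: ib.
  apply: (tan_eq gS cx Ap); [|by case: (lin_set_tangent p)|].
    by apply: lin_comb; [exact: lin_set_tangent|move=> a; exact: tD].
  move=> i; have /rowP/(_ i) := h; rewrite !mxE => h'; rewrite -[RHS]h'. apply: eq_bigr => a _.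
  by rewrite mxE -(snear_self nE (a, i)) /=; case: (he a) => _ ->.
have [H [sH _ nH]] := right_inverse_near (fun a i => (hE (a, i)).1) f0.
(* The dual forms are combinations of coordinate differentials with the right inverse H of the frame
   matrix as coefficients. *)
exists e, (fun a q u => \sum_i H i a (x q) * diff_at (fun q => x q 0 i) q u); split.
- by move=> a; case: (he a).
- move=> a; apply: (form1_comb gS) => i; last exact: form1_diff. exact: (smooth_xcomp gS cx (F := H i a)).
- apply: snear2 nE (snear_push cx Ap nH) _ => q /= Eq [Aq [fq HI]].
  have et a : tangent q (e a q) by apply: tD; case: (he a) => -[].
  have key (c : 'rV[R]_r) : (fun f => \sum_a c 0 a * e a q f) = (fun=> 0) -> c = 0.
    move=> h; apply: (row_free_injr fq); rewrite /= mul0mx; apply/rowP => i.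
    rewrite !mxE; have := congr1 (fun u => u (fun q => x q 0 i)) h => /= h'.
    by rewrite -[RHS]h'; apply: eq_bigr => a _; rewrite mxE -(Eq (a, i)).
  have wE (c : 'rV[R]_r) a : \sum_i H i a (x q) *
      diff_at (fun q => x q 0 i) q (fun f => \sum_b c 0 b * e b q f) = c 0 a.
    have tc : tangent q (fun f => \sum_b c 0 b * e b q f). by apply: lin_comb => //; exact: lin_set_tangent.
    rewrite -[in RHS](mulmx1 c) -HI mulmxA; rewrite [in RHS]mxE.
    apply: eq_bigr => i _; rewrite diff_atE// !mxE mulrC; congr *%R.
    by apply: eq_bigr => b' _; rewrite mxE -(Eq (b', i)). split=> [v Dv|a b'].
    have [|c ->] := has_dim_span (dD q) _ key Dv; first by move=> a; case: (he a) => -[].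
    by apply/funext => f; apply: eq_bigr => a _; rewrite wE.
  have := wE (delta_mx 0 b') a; rewrite mxE eqxx /= => <-.
  apply: eq_bigr => i _; congr (_ * diff_at _ _ _); apply/funext => f.
  rewrite (bigD1 b')//= big1 ?addr0; first by rewrite !mxE !eqxx mul1r.
  by move=> c cb; rewrite mxE (negPf cb) andbF mul0r.
Qed.

Lemma has_dim_tangent p : has_dim n (tangent p : set (vec S)).
Proof.
have [x [y [A [B [cx Ap]]]]] := good_coords gS p. exists (fun i => tvec x y p (ev i)); split.
  move=> c c' /= h; apply/rowP => i. move: h; rewrite -(tvec_sum gS cx c Ap) -(tvec_sum gS cx c' Ap) => h.
  by have := congr1 (fun u => u (fun q => x q 0 i)) h => /=; rewrite !(tvec_coord cx _ _ Ap).
apply/seteqP; split=> v. move=> hv; exists (\row_i v (fun q => x q 0 i)) => //.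
  by rewrite -(tvec_sum gS cx _ Ap) -(tan_tvec gS cx Ap hv).
move=> [c _ <-]; apply: lin_comb; first exact: lin_set_tangent. by move=> i; exact: (tvec_tangent gS cx).
Qed.

Lemma tangent_frame p : exists e w, @frame R n S (@tangent R S) p e w.
Proof.
apply: subbundle_frame => [q|q v //|v hv]; first exact: has_dim_tangent.
have [Z [fZ Zp]] := tan_field_ext gS hv. by exists Z; split=> //; split=> // q; case: fZ.
Qed.

End Frames.

Section Codes.
Variables (R : realType) (n : nat) (S : diffspace R).
Hypothesis gS : good n S.
#[local] Hint Resolve gS : core.
Variables (x : S -> 'rV[R]_n) (y : 'rV[R]_n -> S) (A : set S) (B : set 'rV[R]_n).
Hypothesis cx : coords x y A B.

Definition cvec q (u : 'rV[R]_n) : covec S :=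
  patch (fun=> 0) (tangent q) (fun v => \sum_k u 0 k * v (fun q' => x q' 0 k)).

Lemma cvecE q u v : tangent q v -> cvec q u v = \sum_k u 0 k * v (fun q' => x q' 0 k).
Proof. by move=> hv; rewrite /cvec patchT// inE. Qed.

Lemma cvec_cotangent q u : cotangent q (cvec q u).
Proof.
split=> [t v w hv hw|v nv]; last by rewrite /cvec patchN// notin_setE.
have hvw := (lin_set_tangent q).2 t _ _ hv hw; rewrite !cvecE// mulr_sumr -big_split.
by apply: eq_bigr => k _ /=; ring.
Qed.

Lemma cvec_tvec q u w : A q -> cvec q u (tvec x y q w) = \sum_k u 0 k * w 0 k.
Proof.
move=> Aq; rewrite cvecE; last exact: (tvec_tangent gS cx). by apply: eq_bigr => k _; rewrite (tvec_coord cx).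
Qed.

Lemma cot_cvec q a : A q -> cotangent q a -> a = cvec q (\row_k a (tvec x y q (ev k))).
Proof.
move=> Aq ca; apply: (dual_ext ca); first exact: cvec_cotangent.
move=> v hv; rewrite (cot_expand gS cx Aq ca hv) cvecE//. by apply: eq_bigr => k _; rewrite mxE.
Qed.

Definition tcode (q : S) (v : vec S) : 'rV[R]_n := \row_k v (fun q' => x q' 0 k).
Definition ccode q (a : covec S) : 'rV[R]_n := \row_k a (tvec x y q (ev k)).
Definition code q (a : vec S * covec S) : 'rV[R]_(n + n) := row_mx (tcode q a.1) (ccode q a.2).

Lemma tcodeK q v : A q -> tangent q v -> tvec x y q (tcode q v) = v.
Proof. by move=> Aq hv; rewrite -(tan_tvec gS cx Aq hv). Qed.

Lemma tvecK q u : A q -> tcode q (tvec x y q u) = u.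
Proof. by move=> Aq; apply/rowP => k; rewrite mxE (tvec_coord cx). Qed.

Lemma ccodeK q a : A q -> cotangent q a -> cvec q (ccode q a) = a.
Proof. by move=> Aq ha; rewrite -(cot_cvec Aq ha). Qed.

Lemma cvecK q u : A q -> ccode q (cvec q u) = u.
Proof.
move=> Aq; apply/rowP => k; rewrite mxE cvec_tvec// (bigD1 k)//= big1 ?addr0. by rewrite mxE !eqxx mulr1.
by move=> l lk; rewrite mxE eqxx (negPf lk) mulr0.
Qed.

Lemma cot_code q a v : A q -> cotangent q a -> tangent q v -> a v = \sum_k ccode q a 0 k * tcode q v 0 k.
Proof.
move=> Aq ca hv; rewrite -{1}(ccodeK Aq ca) cvecE//. by apply: eq_bigr => k _; congr *%R; rewrite mxE.
Qed.

Lemma code_pairing q a b : A q -> generalized_tangent q a -> generalized_tangent q b ->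
  pairing a b = (code q a *m swap_mx R n *m (code q b)^T) 0 0.
Proof.
move=> Aq [ta ca] [tb cb]; rewrite /pairing /code /swap_mx mul_row_block.
rewrite !(mulmx0, mulmx1, add0r, addr0) tr_row_mx mul_row_col mxE.
rewrite (cot_code Aq ca tb) (cot_code Aq cb ta) !mxE; congr +%R. by apply: eq_bigr => k _; rewrite !mxE.
by apply: eq_bigr => k _; rewrite !mxE mulrC.
Qed.

End Codes.

Section DiracRank.
Variables (R : realType) (n : nat) (X : diffspace R).
Variable L : X -> set (vec X * covec X).
Hypotheses (gX : good n X) (dL : dirac_structure L).
#[local] Hint Resolve gX : core.
Variables (x : X -> 'rV[R]_n) (y : 'rV[R]_n -> X) (A : set X) (B : set 'rV[R]_n).
Hypothesis cx : coords x y A B.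

Lemma dirac_gt q a : L q a -> generalized_tangent q a.
Proof. by move=> /(dirac_lagrangian dL)[]. Qed.

Lemma dirac_iso q a b : L q a -> L q b -> pairing a b = 0.
Proof. by move=> /(dirac_lagrangian dL)[_ h] /h. Qed.

Lemma dirac_rank q : A q -> exists E : 'M[R]_(n, n + n), row_free E /\
  forall z, (exists a, L q a /\ code x y q a = z) <-> (z <= E)%MS.
Proof.
move=> Aq; apply: lagrangian_rank => z; split.
  move=> [a [La <-]] w [b [Lb <-]]; apply/matrixP => i j; rewrite !ord1.
  rewrite -(code_pairing gX cx Aq (dirac_gt La) (dirac_gt Lb)) (dirac_iso La Lb). by rewrite mxE.
move=> h; pose a := (tvec x y q (lsubmx z), cvec x q (rsubmx z)). have ga : generalized_tangent q a.
  by split; [exact: (tvec_tangent gX cx)|exact: cvec_cotangent]. have az : code x y q a = z.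
  by rewrite /code/= (tvecK cx)// (cvecK gX cx)// hsubmxK.
exists a; split=> //; apply/(dirac_lagrangian dL); split=> // b Lb.
rewrite (code_pairing gX cx Aq ga (dirac_gt Lb)) az h ?mxE//. by exists b.
Qed.

Lemma dirac_codeE q (E : 'M[R]_(n, n + n)) : A q -> (forall z, (exists a, L q a /\ code x y q a = z) <-> (z <= E)%MS) ->
  forall a, L q a <-> generalized_tangent q a /\ (code x y q a <= E)%MS.
Proof.
move=> Aq hE a; split=> [La|[[ta ca] /hE[b [Lb]]]]. by split; [exact: dirac_gt|apply/hE; exists a].
move=> /eq_row_mx[h1 h2]; have [tb cb] := dirac_gt Lb. suff -> : a = b by [].
rewrite [a]surjective_pairing [b]surjective_pairing; congr pair.
  by rewrite -(tcodeK gX cx Aq ta) -(tcodeK gX cx Aq tb) h1.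
by rewrite -(ccodeK gX cx Aq ca) -(ccodeK gX cx Aq cb) h2.
Qed.

(* The components of a frame (A_i, B_i) of L in coordinates, with the structure
   functions of the Dorfman bracket. *)
Record dirac_rep p (Ah Bh : 'I_n -> 'I_n -> fn R n)
    (c : 'I_n -> 'I_n -> 'I_n -> fn R n) (H : 'I_(n + n) -> 'I_n -> fn R n)
    : Prop := DiracRep {
  dr_smA : forall i k, sm (Ah i k);
  dr_smB : forall i k, sm (Bh i k);
  dr_smc : forall j i l, sm (c j i l);
  dr_smH : forall s l, sm (H s l);
  dr_mem : snear p [set q | A q /\ forall a, L q a <-> generalized_tangent q a /\
    exists k : 'rV[R]_n, forall l,
      tcode x q a.1 0 l = \sum_i k 0 i * Ah i l (x q) /\
      ccode x y q a.2 0 l = \sum_i k 0 i * Bh i l (x q)];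
  dr_inv : \forall z \near x p, forall (k : 'rV[R]_n) l,
    k 0 l = \sum_s (\sum_i k 0 i * Ah i s z) * H (lshift n s) l z +
            \sum_s (\sum_i k 0 i * Bh i s z) * H (rshift n s) l z;
  dr_iso : \forall z \near x p, forall i j,
    \sum_l (Ah i l z * Bh j l z + Ah j l z * Bh i l z) = 0;
  dr_brT : \forall z \near x p, forall j i k,
    \sum_l (Ah j l z * pd l (Ah i k) z - Ah i l z * pd l (Ah j k) z) =
    \sum_l c j i l z * Ah l k z;
  dr_brC : \forall z \near x p, forall j i m,
    \sum_l (Ah j l z * pd l (Bh i m) z + Bh i l z * pd m (Ah j l) z
      - (Ah i l z * pd l (Bh j m) z - Ah i l z * pd m (Bh j l) z)) =
    \sum_l c j i l z * Bh l m z }.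

(** Sections through a basis of L at p stay independent nearby and span L there for reasons of
    dimension. Their Dorfman brackets lie in L again, and a smooth right inverse H of the frame
    matrix reads off the coefficients. *)
Lemma dirac_rep_exists p : A p -> exists Ah Bh c H, dirac_rep p Ah Bh c H.
Proof.
move=> Ap; have [E0 [fE0 hE0]] := dirac_rank Ap.
have /choice[Vb hVb] : forall i, exists Vb : (X -> vec X) * (X -> covec X),
    generalized_section L Vb.1 Vb.2 /\ code x y p (Vb.1 p, Vb.2 p) = row i E0.
  move=> i; have [a [La ca]] : exists a, L p a /\ code x y p a = row i E0. by apply/hE0; exact: row_sub.
  by have [V [b [gVb Vba]]] := dirac_smooth dL La; exists (V, b); rewrite /= Vba.
pose V i := (Vb i).1; pose b i := (Vb i).2. have fV i : field (V i) by case: (hVb i) => -[].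
have fb i : form1 (b i) by case: (hVb i) => -[]. have LVb i q : L q (V i q, b i q) by case: (hVb i) => -[].
have sx k := co_smooth cx k. have [Z [fZ nZ]] := coord_frame gX cx Ap.
have [|Ah' hA] := co_ext_fam cx (g := fun (ik : 'I_n * 'I_n) q => V ik.1 q (fun q => x q 0 ik.2)) _ Ap.
  by move=> [i k]; have [_ sV] := fV i; exact: sV.
have [|Bh' hB] := co_ext_fam cx (g := fun (ik : 'I_n * 'I_n) q => b ik.1 q (Z ik.2 q)) _ Ap.
  by move=> [i k]; have [_ sb] := fb i; exact: sb. pose Ah i k := Ah' (i, k); pose Bh i k := Bh' (i, k).
have sA i k : sm (Ah i k) by case: (hA (i, k)). have sB i k : sm (Bh i k) by case: (hB (i, k)).
pose Eh i (s : 'I_(n + n)) z := match fintype.split s with inl k => Ah i k z | inr k => Bh i k z end.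
have sE i s : sm (Eh i s) by rewrite /Eh; case: (fintype.split s).
pose P q := [/\ A q, (forall i, Z i q = tvec x y q (ev i)),
  (forall i k, V i q (fun q => x q 0 k) = Ah i k (x q)) & (forall i k, b i q (Z k q) = Bh i k (x q))].
have nP : snear p P. apply: snear2 nZ (snearI (snear_fin (fun ik => (hA ik).2))
    (snear_fin (fun ik => (hB ik).2))) _ => q /= [Aq hZ] [h1 h2].
  by split=> // i k; [exact: (h1 (i, k))|exact: (h2 (i, k))].
have EhE q : P q -> \matrix_(i, s) Eh i s (x q) = \matrix_(i, s) code x y q (V i q, b i q) 0 s.
  move=> [Aq hZ h1 h2]; apply/matrixP => i s; rewrite !mxE /Eh /code.
  by case: (fintype.split s) => k; rewrite mxE/= -?h1 -?h2 ?hZ.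
have f0 : row_free (\matrix_(i, s) Eh i s (x p)). rewrite (EhE _ (snear_self nP)).
  suff -> : \matrix_(i, s) code x y p (V i p, b i p) 0 s = E0 by [].
  by apply/matrixP => i s; rewrite mxE; case: (hVb i) => _ ->; rewrite mxE.
have [H [sH _ nH]] := right_inverse_near sE f0.
(* [brT] and [brC] are the vector and covector components of the Dorfman bracket of the sections j
   and i in coordinates; applying H to them defines the structure functions. *)
pose brT j i k z := \sum_l (Ah j l z * pd l (Ah i k) z - Ah i l z * pd l (Ah j k) z).
pose brC j i m z := \sum_l (Ah j l z * pd l (Bh i m) z + Bh i l z * pd m (Ah j l) z
      - (Ah i l z * pd l (Bh j m) z - Ah i l z * pd m (Bh j l) z)).
pose c j i l z := \sum_s brT j i s z * H (lshift n s) l z + \sum_s brC j i s z * H (rshift n s) l z.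
have sD f v : sm f -> sm ('D_v f) by exact: sm_derive. have sT j i k : sm (brT j i k).
  by apply: sm_sum => l; apply: sm_sub; apply: sm_mul => //; exact: sD. have sC j i m : sm (brC j i m).
  apply: sm_sum => l; apply: sm_sub; [apply: sm_add|apply: sm_sub]; by apply: sm_mul => //; exact: sD.
have sc j i l : sm (c j i l). by apply: sm_add; apply: sm_sum => s; exact: sm_mul.
have nH' := snear_push cx Ap nH. have key : snear p [set q | P q /\ row_free (\matrix_(i, s) Eh i s (x q)) /\
    (\matrix_(i, s) Eh i s (x q)) *m (\matrix_(s, l) H s l (x q)) = 1%:M].
  by apply: snear2 nP nH' _ => q Pq [_ [h1 h2]].
(* The span of the n sections is contained in L and has the dimension of L. *)
have memE q : P q -> row_free (\matrix_(i, s) Eh i s (x q)) -> forall a, L q a <-> generalized_tangent q a /\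
     (code x y q a <= \matrix_(i, s) Eh i s (x q))%MS.
  move=> Pq fE; have [Aq _ _ _] := Pq; have [E [fE' hE]] := dirac_rank Aq.
  have sub : (\matrix_(i, s) Eh i s (x q) <= E)%MS.
    apply/row_subP => i; apply/hE; exists (V i q, b i q); split=> //.
    by rewrite (EhE _ Pq); apply/rowP => s; rewrite !mxE. have sup : (E <= \matrix_(i, s) Eh i s (x q))%MS.
    by rewrite -(geq_leqif (mxrank_leqif_sup sub)) (eqP fE) (eqP fE').
  move=> a; rewrite (dirac_codeE Aq hE); split=> -[ga h]; split=> //. exact: submx_trans h sup.
  exact: submx_trans h sub. have rowE q (k : 'rV[R]_n) : k *m (\matrix_(i, s) Eh i s (x q)) =
    row_mx (\row_s \sum_i k 0 i * Ah i s (x q)) (\row_s \sum_i k 0 i * Bh i s (x q)).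
  apply/rowP => s; rewrite mxE; case: (fintype.split_ordP s) => l ->;
    rewrite ?row_mxEl ?row_mxEr mxE; apply: eq_bigr => i _; by rewrite mxE /Eh ?split_lshift ?split_rshift.
have toz (Q : set 'rV[R]_n) : snear p [set q | Q (x q)] -> \forall z \near x p, Q z.
  move=> nQ; apply: filterS (near_pull cx Ap nQ) => z /= [Bz]. by rewrite (co_xy cx).
have invE q : (\matrix_(i, s) Eh i s (x q)) *m (\matrix_(s, l) H s l (x q)) = 1%:M ->
    forall (u w : 'rV[R]_n) (k : 'rV[R]_n), k *m (\matrix_(i, s) Eh i s (x q)) = row_mx u w -> forall l,
    k 0 l = \sum_s u 0 s * H (lshift n s) l (x q) + \sum_s w 0 s * H (rshift n s) l (x q).
  move=> HI u w k kE l; rewrite -[k]mulmx1 -HI mulmxA kE mxE big_split_ord/=.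
  by congr +%R; apply: eq_bigr => s _; rewrite ?row_mxEl ?row_mxEr mxE.
have br : snear p [set q | forall j i, exists k : 'rV[R]_n, k *m (\matrix_(i, s) Eh i s (x q)) =
      row_mx (\row_s brT j i s (x q)) (\row_s brC j i s (x q))].
  apply: snear2 key (snear_snear nP) _ => q [Pq [fE HI]] nPq j i. have [Aq hZ h1 h2] := Pq.
  have : L q (lie_bracket (V j) (V i) q,
      fun z => lie_derivative (V j) (b i) q z - ext_deriv (b j) q (V i q) z).
    exact: (dirac_involutive dL (hVb j).1 (hVb i).1 q).
  move=> /(memE q Pq fE)[_ /submxP[k hk]]; exists k; rewrite -hk /code/=.
  have vE i' (f : X -> R) F : smooth f -> sm F -> snear q [set r | f r = F (x r)] ->
      V i' q f = \sum_l Ah i' l (x q) * pd l F (x q). move=> sf sF nF; case: (fV i') => tV _.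
    rewrite (tan_coords gX cx Aq (tV q) sf sF nF). by apply: eq_bigr => l' _; rewrite h1.
  have nA i' k' : snear q [set r | V i' r (fun r' => x r' 0 k') = Ah i' k' (x r)].
    by apply: snearS nPq => r [_ _ h _]; exact: h.
  have nB i' k' : snear q [set r | b i' r (Z k' r) = Bh i' k' (x r)].
    by apply: snearS nPq => r [_ _ _ h]; exact: h.
  have sVx i' k' : smooth (fun r => V i' r (fun r' => x r' 0 k')). by case: (fV i') => _; apply.
  have sbZ i' k' : smooth (fun r => b i' r (Z k' r)) by case: (fb i') => _; apply.
  have bexp i' : snear q [set r | forall u, tangent r u ->
      b i' r u = \sum_k b i' r (Z k r) * u (fun r' => x r' 0 k)].
    apply: snearS nPq => r [Ar hZr _ _] u hu; case: (fb i') => /(_ r) cb _.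
    rewrite (cot_expand gX cx Ar cb hu); apply: eq_bigr => k' _. by rewrite hZr.
  congr row_mx; apply/rowP => s; rewrite !mxE.
    rewrite /lie_bracket (vE j _ (Ah i s))// (vE i _ (Ah j s))// -sumrB. by [].
  have tq := tvec_tangent gX cx (ev s) Aq.
  have tv' f F : smooth f -> sm F -> snear q [set r | f r = F (x r)] -> tvec x y q (ev s) f = pd s F (x q).
    move=> sf sF nF; rewrite (tvecE cx _ Aq sf sF nF) (bigD1 s)//= big1 ?addr0. by rewrite mxE !eqxx mul1r.
    by move=> l ls; rewrite mxE eqxx (negPf ls) mul0r.
  rewrite (@lie_derivativeE _ _ _ gX q (V j) (b i) n (fun k r => b i r (Z k r))
    (fun k r => x r 0 k))//; last first. by case: (fb i) => _. by case: (fb i).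
  rewrite (@ext_derivE _ _ _ gX q (b j) n (fun k r => b j r (Z k r)) (fun k r => x r 0 k))//; last first.
    by case: (fb j) => _. by case: (fb j). by case: (fV i).
  have d1 (F : 'I_n -> R) : \sum_k F k * tvec x y q (ev s) (fun r => x r 0 k) = F s.
    rewrite (bigD1 s)//= big1 ?addr0; first by rewrite (tvec_coord cx)// mxE !eqxx mulr1.
    by move=> k' ks; rewrite (tvec_coord cx)// mxE eqxx (negPf ks) mulr0.
  rewrite big_split/= d1 sumrB d1 (vE j _ (Bh i s))// (vE i _ (Bh j s))//.
  rewrite [RHS]sumrB sumrB big_split/=; congr (_ + _ - (_ - _)).
    by apply: eq_bigr => l _; rewrite (tv' _ (Ah j l))// -h2.
  by apply: eq_bigr => l _; rewrite (tv' _ (Bh j l))// h1 mulrC. exists Ah, Bh, c, H; split=> //.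
- apply: snearS key => q [Pq [fE HI]]; have [Aq _ _ _] := Pq; split=> // a.
  rewrite (memE q Pq fE); split=> -[ga h]; split=> //. have /submxP[k hk] := h; exists k => l.
    move: hk; rewrite rowE /code => /eq_row_mx[-> ->]. by rewrite !mxE.
  have [k hk] := h; apply/submxP; exists k; rewrite rowE /code.
  by congr row_mx; apply/rowP => l; have [h1 h2] := hk l; rewrite ?h1 ?h2 mxE.
- apply: toz; apply: snearS key => q [Pq [fE HI]] k l. rewrite (invE q HI _ _ k (rowE q k)).
  by congr +%R; apply: eq_bigr => s _; rewrite mxE.
- apply: toz; apply: snearS nP => q [Aq hZ h1 h2] i j.
  have := dirac_iso (LVb i q) (LVb j q); rewrite /pairing/=.
  have [tVi _] := fV i; have [tVj _] := fV j; have [cbi _] := fb i; have [cbj _] := fb j.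
  rewrite (cot_expand gX cx Aq (cbi q) (tVj q)) (cot_expand gX cx Aq (cbj q) (tVi q)).
  rewrite -big_split => h; rewrite -[RHS]h; apply: eq_bigr => l _ /=. by rewrite -!hZ !h1 !h2; ring.
- apply: toz; apply: snear2 key br _ => q [_ [_ HI]] hbr j i k.
  have [kk hk] := hbr j i; have := hk; rewrite rowE => /eq_row_mx[/rowP/(_ k) + _].
  rewrite !mxE => h; rewrite -[LHS]/(brT j i k (x q)) -h; apply: eq_bigr => l _; congr *%R.
  rewrite (invE q HI _ _ kk hk) /c; congr +%R; apply: eq_bigr => s _; by rewrite mxE.
- apply: toz; apply: snear2 key br _ => q [_ [_ HI]] hbr j i k.
  have [kk hk] := hbr j i; have := hk; rewrite rowE => /eq_row_mx[_ /rowP/(_ k)].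
  rewrite !mxE => h; rewrite -[LHS]/(brC j i k (x q)) -h; apply: eq_bigr => l _; congr *%R.
  rewrite (invE q HI _ _ kk hk) /c; congr +%R; apply: eq_bigr => s _; by rewrite mxE.
Qed.

End DiracRank.

(** * The bundle K, the projection onto it and the canonical form *)

Section ModelSpace.
Variables (R : realType) (n r : nat) (X : diffspace R).
Variables (L : X -> set (vec X * covec X)) (C : X -> set (vec X)).
Hypotheses (gX : good n X) (dL : dirac_structure L).
Hypothesis dimK : forall x, has_dim r (tangent_part L x).
Hypothesis compC : complement_of (tangent_part L) C.
#[local] Hint Resolve gX : core.
Notation K := (tangent_part L).

Lemma linK q : lin_set (K q).
Proof. exact: has_dim_lin. Qed.

Lemma subK q : K q `<=` tangent q.
Proof. by move=> v /(dirac_gt dL)[]. Qed.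

Lemma linC q : lin_set (C q).
Proof. by case: compC => -[[k dC] _ _] _ _; exact: has_dim_lin. Qed.

Lemma cot0 (q : X) : @cotangent R X q (fun=> 0).
Proof. exact: dual_of0. Qed.

(** Since L is Lagrangian, K is the annihilator of the covector parts of L; in this form it is cut
    out by the smooth functions [Bh] of a local frame. *)
Lemma tangent_partP q v : K q v <-> tangent q v /\ forall b, L q b -> b.2 v = 0.
Proof.
split=> [Kv|[hv h]]. split=> [|b Lb]; first exact: subK.
  by have := dirac_iso dL Kv Lb; rewrite /pairing add0r.
apply/(dirac_lagrangian dL); split; first by split=> //; exact: cot0.
by move=> b Lb; rewrite /pairing add0r; exact: h.
Qed.

Definition proj_K q (v : vec X) : vec X := xget (fun=> 0) [set u | K q u /\ C q (fun f => v f - u f)].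

Lemma lin_sub (V : set (vec X)) u v : lin_set V -> V u -> V v -> V (fun f => u f - v f).
Proof. move=> [_ lV] Vu Vv; have := lV (-1) _ _ Vv Vu; congr V; apply/funext => f /=. by ring. Qed.

Lemma proj_K_unique q v u : K q u -> C q (fun f => v f - u f) -> proj_K q v = u.
Proof.
move=> Ku Cu; rewrite /proj_K; case: xgetP => [u' _ [Ku' Cu']|/(_ u)]; last by case; split.
have KC : K q (fun f => u' f - u f) by exact: lin_sub (linK q) Ku' Ku. have CC : C q (fun f => u' f - u f).
  have := lin_sub (linC q) Cu Cu'; congr C; apply/funext => f; by ring.
case: compC => _ kc _; have /(congr1 (fun w => w _)) h := kc q _ KC CC.
by apply/funext => f; apply/eqP; rewrite -subr_eq0; apply/eqP; exact: h.
Qed.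

Lemma proj_KP q v : tangent q v -> K q (proj_K q v) /\ C q (fun f => v f - proj_K q v f).
Proof.
move=> hv; case: compC => _ _ /(_ q v hv)[u [w [Ku Cw ->]]]. have Cw' : C q (fun f => (u \+ w) f - u f).
  suff -> : (fun f => (u \+ w) f - u f) = w by []. by apply/funext => f /=; rewrite addrC addrA addNr add0r.
by rewrite (proj_K_unique Ku Cw').
Qed.

Lemma proj_K_id q v : K q v -> proj_K q v = v.
Proof. move=> Kv; apply: proj_K_unique => //. under eq_fun do rewrite subrr. by case: (linC q). Qed.

(** Smoothness is given for C and only the rank for K. The difference Z - pr_K Z is expanded in a
    frame g_j of C; since the covector parts b_i of a frame of L vanish on K, the coefficients solve
    b_i(Z) = sum_j d_j b_i(g_j), a smooth system of full rank. *)
Lemma proj_K_section Z : field Z -> section_of K (fun q => proj_K q (Z q)).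
Proof.
move=> [tZ sZ]; split; last by move=> q; case: (proj_KP (tZ q)).
split; first by move=> q; apply: subK; case: (proj_KP (tZ q)). move=> f sf; apply: (smooth_loc gX) => p.
have [[[k dC] tC xC] _ _] := compC. have [g [w [sg fw ng]]] := subbundle_frame gX dC tC (xC p).
have [x [y [A [B [cx Ap]]]]] := good_coords gX p.
have [Ah [Bh [c [H [sA sB _ _ nM _ _ _ _]]]]] := dirac_rep_exists gX dL cx Ap. have sx l := co_smooth cx l.
pose b i q (v : vec X) := \sum_l Bh i l (x q) * v (fun q' => x q' 0 l).
have sb i V : field V -> smooth (fun q => b i q (V q)).
  move=> [_ sV]; apply: (smooth_sum gX) => l; apply: (smooth_mul gX); last exact: sV.
  exact: (smooth_xcomp gX cx (F := Bh i l)).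
have bK q : (A q /\ forall a, L q a <-> generalized_tangent q a /\ exists k : 'rV[R]_n, forall l,
      tcode x q a.1 0 l = \sum_i k 0 i * Ah i l (x q) /\ ccode x y q a.2 0 l = \sum_i k 0 i * Bh i l (x q)) ->
    forall v, tangent q v -> K q v <-> forall i, b i q v = 0. move=> [Aq LE] v hv; split=> [Kv i|h].
    have [_ h] := (tangent_partP _ _).1 Kv.
    pose e := (tvec x y q (\row_l Ah i l (x q)), cvec x q (\row_l Bh i l (x q))). have Le : L q e.
      apply/LE; split. by split; [exact: (tvec_tangent gX cx)|exact: cvec_cotangent].
      exists (ev i) => l; rewrite (tvecK cx)// (cvecK gX cx)//.
      by split; rewrite (bigD1 i)//= big1 ?addr0 ?mxE ?eqxx ?mul1r// => j ji;
        rewrite mxE eqxx (negPf ji) mul0r.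
    by have := h _ Le; rewrite /= cvecE// => h'; rewrite -[RHS]h'; apply: eq_bigr => l _; rewrite mxE.
  apply/tangent_partP; split=> // a /LE[[_ ca] [kk hk]]. rewrite (cot_code gX cx Aq ca hv).
  transitivity (\sum_i kk 0 i * b i q v); last by apply: big1 => i _; rewrite h mulr0.
  under [RHS]eq_bigr do rewrite mulr_sumr; rewrite exchange_big/=.
  apply: eq_bigr => l _; have [_ ->] := hk l; rewrite mulr_suml. by apply: eq_bigr => i _; rewrite mxE mulrA.
have [|G hG] := co_ext_fam cx (g := fun (ji : 'I_k * 'I_n) q => b ji.2 q (g ji.1 q)) _ Ap.
  by move=> [j i]; exact: sb i _ (sg j).1. have nG := snear_fin (fun ji => (hG ji).2).
have tg j q : tangent q (g j q) by case: (sg j) => -[]. have blin i q (d : 'I_k -> R) :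
    b i q (fun f => \sum_j d j * g j q f) = \sum_j d j * b i q (g j q).
  rewrite /b; under [RHS]eq_bigr do rewrite mulr_sumr; rewrite exchange_big/=.
  by apply: eq_bigr => l _; rewrite mulr_sumr; apply: eq_bigr => j _; ring.
(* A linear dependence would give a vector of C annihilated by all b_i, that is, a vector of K, and
   K meets C only in 0. *)
have f0 : row_free (\matrix_(j, i) G (j, i) (x p)). apply: row_freeI => d h.
  pose w0 : vec X := fun f => \sum_j d 0 j * g j p f.
  have tw0 : tangent p w0 by apply: lin_comb => //; exact: lin_set_tangent.
  have Cw0 : C p w0 by apply: lin_comb; [exact: linC|move=> j; case: (sg j)]. have Kw0 : K p w0.
    apply/(bK p (snear_self nM)) => // i; rewrite blin.
    have /rowP/(_ i) := h; rewrite !mxE => h'; rewrite -[RHS]h'.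
    by apply: eq_bigr => j _; rewrite mxE -(snear_self nG (j, i)).
  have [_ kc _] := compC; have w00 := kc p _ Kw0 Cw0.
  have [_ wd] := snear_self ng; apply/rowP => a; rewrite mxE. have ca : cotangent p (w a p) by case: (fw a).
  have := dual_comb (index_enum 'I_k) (fun j => d 0 j) (lin_set_tangent p) ca (tg ^~ p).
  rewrite -/w0 w00 (dual_zero (lin_set_tangent p) ca). by under eq_bigr do rewrite wd; rewrite sum_deltar.
have [Hh [sH _ nH]] := right_inverse_near (fun j i => (hG (j, i)).1) f0.
pose t j q := \sum_i b i q (Z q) * Hh i j (x q). exists (fun q => Z q f - \sum_j t j q * g j q f).
  apply: (smooth_sub gX); first exact: sZ.
  apply: (smooth_sum gX) => j; apply: (smooth_mul gX); last by case: (sg j) => -[_ s _]; exact: s.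
  apply: (smooth_sum gX) => i; apply: (smooth_mul gX); first exact: sb.
  exact: (smooth_xcomp gX cx (F := Hh i j)).
apply: snear2 (snearI nM ng) (snearI nG (snear_push cx Ap nH)) _ => q /= [Mq [wE _]] [Gq [Aq [_ HI]]].
have [Kz Cz] := proj_KP (tZ q). have [d hd] : exists d : 'rV[R]_k, forall h,
    Z q h - proj_K q (Z q) h = \sum_j d 0 j * g j q h.
  exists (\row_j w j q (fun f => Z q f - proj_K q (Z q) f)) => h.
  by have /(congr1 (fun u => u h)) /= -> := wE _ Cz; apply: eq_bigr => j _; rewrite mxE.
suff dt j : d 0 j = t j q.
  have hf := hd f; rewrite -(eq_bigr _ (fun j _ => congr1 ( *%R^~ (g j q f)) (dt j))) -hf. by ring.
have bE i : b i q (Z q) = (d *m \matrix_(j, i) G (j, i) (x q)) 0 i. have K0 := (bK q Mq _ (subK Kz)).1 Kz i.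
  rewrite -[LHS]subr0 -K0 mxE. transitivity (b i q (fun h => Z q h - proj_K q (Z q) h)).
    by rewrite /b -sumrB; apply: eq_bigr => l _; ring.
  have -> : (fun h => Z q h - proj_K q (Z q) h) = fun h => \sum_j d 0 j * g j q h.
    by apply/funext => h; exact: hd. by rewrite blin; apply: eq_bigr => j' _; rewrite mxE -(Gq (j', i)).
rewrite /t; under eq_bigr do rewrite bE.
rewrite -{1}[d]mulmx1 -HI mulmxA mxE; apply: eq_bigr => i _; congr *%R. by rewrite mxE.
Qed.

(** Any field extending a vector of K becomes a section of K after projection, so constant rank
    already makes K a subbundle. *)
Lemma frameK p : exists e w, @frame R r X K p e w.
Proof.
apply: (subbundle_frame gX) => // [q v|v Kv]; first exact: subK.
have [Z [fZ Zp]] := tan_field_ext gX (subK Kv).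
exists (fun q => proj_K q (Z q)); split; first exact: proj_K_section. by rewrite Zp proj_K_id.
Qed.

Lemma model_good : good (n + r) (dual_bundle K).
Proof. by apply: dual_good => //; [exact: linK|exact: subK|exact: frameK]. Qed.

Lemma cot_good : good (n + n) (cotangent_bundle X).
Proof. apply: dual_good => //; [exact: lin_set_tangent|by move=> q v|exact: tangent_frame]. Qed.

Section CanonicalForm.
Variable j : dual_bundle K -> cotangent_bundle X.
Hypothesis jP : induced_inclusion C j.
Notation S := (dual_bundle K).
Notation TX := (cotangent_bundle X).
Let gS := model_good.
Let gTX := cot_good.
#[local] Hint Resolve gS gTX : core.

Lemma fib_j p v : tangent (base p) v -> fib (j p) v = fib p (proj_K (base p) v).
Proof.
move=> hv; have [bj jK jC] := jP p; have [Kv Cv] := proj_KP hv.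
have dj : dual_of (@tangent R X (base p)) (fib (j p)).
  by have := svalP (j p); rewrite /= -[(sval (j p)).1]/(pr (j p)) bj.
have tk : tangent (base p) (proj_K (base p) v) := subK Kv.
have tc : tangent (base p) (fun f => v f - proj_K (base p) v f). exact: lin_sub (lin_set_tangent _) hv tk.
have [jl _] := dj; have := jl 1 _ _ tk tc. rewrite mul1r (jK _ Kv) (jC _ Cv) addr0 => <-; congr (fib (j p)).
by apply/funext => f /=; rewrite mul1r addrC subrK.
Qed.

Lemma j_smooth : smooth_map j.
Proof.
apply: (to_dual_smooth gS) => g [[f [sf ->]]|[V [sV ->]]].
  suff -> : (fun z => (f \o base (K:=tangent (S:=X))) (j z)) = f \o @pr R X K. exact: pr_smooth.
  by apply/funext => p /=; case: (jP p) => <-. have -> : (fun z => fib (j z) (V (base (j z)))) =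
    fun z : S => fib z (proj_K (base z) (V (base z))).
  apply/funext => p; rewrite -fib_j; last by case: (sV).1 => h _; exact: h.
  by case: (jP p) => h _ _; rewrite -[base (j p)]/(pr (j p)) h.
apply: (fib_smooth (V := fun q => proj_K q (V q))); apply: proj_K_section. by case: sV.
Qed.

Lemma tautological_expand N (W : 'I_N -> X -> vec X) (h : 'I_N -> X -> R) (p : TX) :
  (forall l, field (W l)) -> (forall l, smooth (h l)) ->
  snear (base p) [set q | forall u, tangent q u -> u = fun f => \sum_l u (h l) * W l q f] ->
  snear p [set q : TX | forall u, tangent q u ->
    tautological_form q u = \sum_l fib q (W l (base q)) * u (fun z : TX => h l (base z))].
Proof.
move=> fW sh nW; have sp : smooth_map (@pr R X (@tangent R X)) by exact: pr_smooth.
apply: snearS (snear_preim sp nW) => q hq u hu. rewrite /tautological_form pullE//.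
have tp : tangent (pr q) (push (@pr R X (@tangent R X)) u) by have := push_tangent gX sp hu.
have tW l : tangent (base q) (W l (base q)) by case: (fW l).
have dq : dual_of (@tangent R X (base q)) (fib q) := svalP q.
rewrite {1}(hq _ tp) (dual_comb _ _ (lin_set_tangent _) dq)//. by apply: eq_bigr => l _; rewrite mulrC pushE.
Qed.

Lemma tautological_smooth V : field V -> smooth (fun q : TX => tautological_form q (V q)).
Proof.
move=> [tV sV]; apply: (smooth_loc gTX) => p. have [x [y [A [B [cx Ap]]]]] := good_coords gX (base p).
have [Z [fZ nZ]] := coord_frame gX cx Ap; have sx l := co_smooth cx l.
have nW : snear (base p) [set q | forall u, tangent q u ->
    u = fun f => \sum_l u (fun q => x q 0 l) * Z l q f].
  apply: snearS nZ => q [Aq hZ] u hu; apply/funext => f.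
  rewrite {1}(tan_tvec gX cx Aq hu) (tvec_sum gX cx _ Aq). by apply: eq_bigr => l _; rewrite mxE hZ.
exists (fun q => \sum_l fib q (Z l (base q)) * V q (fun z : TX => x (base z) 0 l)).
  apply: (smooth_sum gTX) => l; apply: (smooth_mul gTX). by apply: fib_smooth; split=> // q; case: (fZ l).
  apply: sV; have sp : smooth_map (@pr R X (@tangent R X)) by exact: pr_smooth. exact: (sp _ (sx l)).
by apply: snearS (tautological_expand fZ sx nW) => q /= ->.
Qed.

(** A family with u = sum_l u(h_l) W_l expresses the tautological form as sum_l p(W_l) dh_l, as
    coordinates would. On the image of j the functional p sees only the projection of W_l to K. *)
Lemma canonical_form N (W : 'I_N -> X -> vec X) (h : 'I_N -> X -> R) (p : S) v w :
  (forall l, field (W l)) -> (forall l, smooth (h l)) ->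
  snear (base p) [set q | forall u, tangent q u -> u = fun f => \sum_l u (h l) * W l q f] ->
  tangent p v -> tangent p w -> pull_form2 j (@omega_can R X) p v w =
  \sum_l (v (fun z : S => - fib z (proj_K (base z) (W l (base z)))) * w (fun z : S => h l (base z)) -
          w (fun z : S => - fib z (proj_K (base z) (W l (base z)))) * v (fun z : S => h l (base z))).
Proof.
move=> fW sh nW hv hw; have sj := j_smooth. rewrite /pull_form2 pullE// /omega_can.
have tv1 := push_tangent gTX sj hv; have tw1 := push_tangent gTX sj hw.
have bj q : base (j q) = base q by case: (jP q).
have nW' : snear (base (j p)) [set q | forall u, tangent q u ->
  u = fun f => \sum_l u (h l) * W l q f] by rewrite bj.
have sp : smooth_map (@pr R X (@tangent R X)) by exact: pr_smooth.
have s1 l : smooth (fun q : TX => fib q (W l (base q))). by apply: fib_smooth; split=> // q; case: (fW l).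
have s2 l : smooth (fun q : TX => h l (base q)) by exact: sp (sh l).
have cj : cotangent (j p) (tautological_form (j p)). by apply: (pull_cotangent gX sp); exact: svalP (j p).
rewrite (ext_derivE gTX tv1 tw1 cj s1 s2 tautological_smooth (tautological_expand fW sh nW')).
rewrite -sumrN; apply: eq_bigr => l _. have sC : smooth (fun z : S => fib z (proj_K (base z) (W l (base z)))).
  by apply: (fib_smooth (V := fun q => proj_K q (W l q))); exact: proj_K_section.
have E1 u : tangent p u -> push j u (fun q : TX => fib q (W l (base q))) =
    - u (fun z : S => - fib z (proj_K (base z) (W l (base z)))).
  move=> hu; rewrite pushE// (tan_opp gS hu sC) opprK; congr u; apply/funext => z /=.
  by rewrite bj fib_j//; case: (fW l).
have E2 u : push j u (fun q : TX => h l (base q)) = u (fun z : S => h l (base z)).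
  by rewrite pushE//; congr u; apply/funext => z /=; rewrite bj. rewrite !E1// !E2; by ring.
Qed.

End CanonicalForm.
End ModelSpace.

(** * Partitions of unity, metrics and globally defined families *)

Section Globalization.
Variables (R : realType) (n : nat) (S : diffspace R).
Hypothesis mS : manifold n S.
Let gS := manifold_good mS.
#[local] Hint Resolve gS : core.

(** One function is selected for each basic open set on which some [rho p] is 1. With h_k = u_k
    prod_(i<k) (1 - u_i) the partial sums are 1 minus a product, and both the product and the later
    h_k vanish where one u_i is 1. *)
Lemma partition_of_unity (rho : S -> S -> R) : (forall p, [/\ smooth (rho p), forall q, 0 <= rho p q <= 1 &
     snear p [set q | rho p q = 1]]) -> exists (c : nat -> option S) (h : nat -> S -> R),
  [/\ forall k, smooth (h k), forall k q, h k q != 0 -> exists2 p, c k = Some p & rho p q != 0 &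
      forall p, exists N, snear p [set q | (forall k, (N <= k)%N -> h k q = 0) /\ \sum_(k < N) h k q = 1]].
Proof.
move=> Hr; have [B [oB bB]] := manifold_second_countable mS.
have /choice[c hc] : forall k, exists o : option S,
    (forall p, o = Some p -> B k `<=` [set q | rho p q = 1]) /\
    ((exists p, B k `<=` [set q | rho p q = 1]) -> isSome o).
  move=> k; have [[p hp]|np] := pselect (exists p, B k `<=` [set q | rho p q = 1]).
    by exists (Some p); split=> // _ [<-]. by exists None; split.
pose u k q := if c k is Some p then rho p q else 0. pose h k q := u k q * \prod_(i < k) (1 - u i q).
have su k : smooth (u k). by rewrite /u; case: (c k) => [p|]; [case: (Hr p)|exact: smooth_cst].
have sprod k : smooth (fun q => \prod_(i < k) (1 - u i q)).
  elim: k => [|k ih]; first by under eq_fun do rewrite big_ord0; exact: smooth_cst.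
  under eq_fun do rewrite big_ord_recr/=; apply: (smooth_mul gS) => //.
  by apply: (smooth_sub gS) => //; exact: smooth_cst.
have sumE N q : \sum_(k < N) h k q = 1 - \prod_(i < N) (1 - u i q).
  elim: N => [|N ih]; first by rewrite !big_ord0 subrr.
  by rewrite big_ord_recr/= ih [in RHS]big_ord_recr/= /h; ring. exists c, h; split.
- by move=> k; exact: smooth_mul.
- move=> k q; rewrite /h /u; case: (c k) => [p|]; last by rewrite mul0r eqxx.
  by rewrite mulf_eq0 negb_or => /andP[hp _]; exists p.
- move=> p; have [_ _ [A [oA Ap hA]]] := Hr p. have [k [Bp BA]] := bB A p oA Ap.
  have u1 q : B k q -> u k q = 1. move=> Bq; rewrite /u; have [h1 h2] := hc k.
    have : isSome (c k) by apply: h2; exists p => z /BA/hA. by case E : (c k) => [z|//] _; exact: h1 E _ Bq.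
  have prod0 q N : B k q -> (k < N)%N -> \prod_(i < N) (1 - u i q) = 0.
    by move=> Bq kN; rewrite (bigD1 (Ordinal kN))//= u1// subrr mul0r.
  exists k.+1, (B k); split=> // q Bq; split=> [l kl|]. by rewrite /h prod0// mulr0.
  by rewrite sumE prod0// subr0.
Qed.

(** Metrization by countably many functions: a pair (k, l) of basic sets contributes one that is 1
    on B_k and 0 off B_l, if there is any. Truncation at 1/(t+1) makes all but finitely many terms
    small, and a supremum instead of a series keeps the triangle inequality termwise. *)
Lemma manifold_metric : exists d : S -> S -> R,
  [/\ forall p q z, d p z <= d p q + d q z, forall p q, d p q = d q p, forall p, d p p = 0,
     forall p e, 0 < e -> snear p [set q | d p q < e] &
     forall p (A : set S), snear p A -> exists2 e, 0 < e & forall q, d p q < e -> A q].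
Proof.
have [B [oB bB]] := manifold_second_countable mS. pose ok (kl : nat * nat) (chi : S -> R) := [/\ smooth chi,
  forall q, B kl.1 q -> chi q = 1 & forall q, ~ B kl.2 q -> chi q = 0].
have /choice[G hG] : forall kl, exists chi : S -> R, smooth chi /\ ((exists f, ok kl f) -> ok kl chi).
  move=> kl; have [[f okf]|nf] := pselect (exists f, ok kl f). by exists f; split=> //; case: okf.
  by exists (fun=> 0); split=> //; exact: smooth_cst.
pose g t q := if unpickle t is Some kl then G kl q else 0. have sg t : smooth (g t).
  by rewrite /g; case: (unpickle t) => [kl|]; [case: (hG kl)|exact: smooth_cst].
pose c (t : nat) : R := t.+1%:R^-1. have c0 t : 0 < c t by rewrite invr_gt0.
pose m p q t := Num.min (c t) `|g t p - g t q|. pose d p q := sup [set m p q t | t in [set: nat]].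
have bd p q : has_sup [set m p q t | t in [set: nat]]. split; first by exists (m p q 0%N), 0%N.
  exists 1 => _ [t _ <-]; rewrite /m ge_min; apply/orP; left. by rewrite invf_le1// ler1n.
have mle p q t : m p q t <= d p q. by apply: ub_le_sup; [case: (bd p q)|exists t].
have dle p q e : (forall t, m p q t <= e) -> d p q <= e. move=> h; apply: ge_sup; first by case: (bd p q).
  by move=> _ [t _ <-]; exact: h. have m0 p q t : 0 <= m p q t by rewrite /m le_min normr_ge0 (ltW (c0 t)).
exists d; split.
- move=> p q z; apply: dle => t; apply: le_trans (lerD (mle p q t) (mle q z t)).
  have tri : `|g t p - g t z| <= `|g t p - g t q| + `|g t q - g t z|. by rewrite -(subrKA (g t q)) ler_normD.
  have [a0 b0] := (m0 p q t, m0 q z t); move: a0 b0; rewrite /m !minEle.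
  have := c0 t; case: ifP; case: ifP; case: ifP; move=> *; lra.
- move=> p q; congr (sup _); congr image; apply/funext => t. by rewrite /m distrC.
- move=> p; apply/eqP; rewrite eq_le; apply/andP; split.
    by apply: dle => t; rewrite /m subrr normr0 ge_min lexx orbT. exact: le_trans (m0 p p 0%N) (mle _ _ _).
- move=> p e e0; pose N := Num.trunc (2 / e). have cN t : (N <= t)%N -> c t <= e / 2.
    move=> Nt; rewrite /c -[e / 2]invrK lef_pV2 ?posrE ?invr_gt0 ?divr_gt0//.
    rewrite invf_div; apply: le_trans (_ : N.+1%:R <= _); last by rewrite ler_nat.
    by apply: ltW; have := truncnS_gt (2 / e).
  exists ((fun q => \row_(t < N) g t q) @^-1` [set z | `|z - \row_(t < N) g t p| < e / 2]). split.
  + apply: sopen_pre; last exact: open_norm_lt. by move=> i; under eq_fun do rewrite mxE.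
  + by rewrite /= subrr normr0 divr_gt0.
  + move=> q /= hq; apply: le_lt_trans (_ : d p q <= e / 2) _; last by lra.
    apply: dle => t; rewrite /m ge_min; have [tN|Nt] := ltnP t N; last by rewrite cN.
    apply/orP; right; apply: ltW; apply: le_lt_trans hq.
    have := coord_le_norm (\row_(t < N) g t q - \row_(t < N) g t p) (Ordinal tN). by rewrite !mxE/= distrC.
- move=> p A [A' [oA' A'p AA]]; have [l [Bp BA]] := bB A' p oA' A'p.
  have [chi [sc c1 _ cz]] := smooth_bump gS (oB l) Bp.
  have [A2 [oA2 A2p hA2]] := c1; have [k [Bkp BkA]] := bB A2 p oA2 A2p. have [_ /(_ _)[]] := hG (k, l).
    exists chi; split=> //= q; first by move=> /BkA/hA2. by move=> /cz/snear_self.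
  move=> _ /= G1 G0; pose t := pickle (k, l). have gt q : g t q = G (k, l) q by rewrite /g /t pickleK.
  exists (c t) => // q dq; apply: AA; apply: BA; apply: contrapT => nBq.
  have := le_lt_trans (mle p q t) dq; rewrite /m !gt G1// G0// subr0 normr1 gt_min ltxx/=.
  by rewrite /c ltNge invf_le1// ler1n.
Qed.

End Globalization.

Lemma sum_divmod (R : realType) m N (G : nat -> nat -> R) :
  \sum_(l < N * m) G (l %/ m)%N (l %% m)%N = \sum_(k < N) \sum_(b < m) G k b.
Proof.
elim: N => [|N ih]; first by rewrite mul0n !big_ord0.
rewrite big_ord_recr/= -ih mulSnr big_split_ord/=; congr +%R.
apply: eq_bigr => b _; have m0 : (0 < m)%N by apply: leq_ltn_trans (ltn_ord b).
by rewrite divnMDl// divn_small// addn0 modnMDl modn_small.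
Qed.

Section ImmersionFrame.
Variables (R : realType) (n m : nat) (X M : diffspace R) (i : X -> M).
Hypotheses (gX : good n X) (gM : good m M) (si : smooth_map i).
Hypothesis imm : forall x v w, tangent x v -> tangent x w -> push i v = push i w -> v = w.
#[local] Hint Resolve gX gM : core.

(** Injectivity of the differential makes the matrix of derivatives of coordinates of M along a
    frame of X of full rank; the W_b come from its right inverse. *)
Lemma immersion_local p : exists (f : 'I_m -> M -> R) (W : 'I_m -> X -> vec X),
  [/\ forall b, smooth (f b), forall b, field (W b) &
    snear p [set q | forall u, tangent q u -> u = fun h => \sum_b u (f b \o i) * W b q h]].
Proof.
have [x [y [A [B [cx Ap]]]]] := good_coords gX p. have [z [y' [A' [B' [cz Aip]]]]] := good_coords gM (i p).
have sx a := co_smooth cx a; have sz b := co_smooth cz b. have [Z [fZ nZ]] := coord_frame gX cx Ap.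
pose f b := fun q : M => z q 0 b.
have [|E hE] := co_ext_fam cx (g := fun (ab : 'I_n * 'I_m) q => Z ab.1 q (f ab.2 \o i)) _ Ap.
  by move=> [a b]; have [_ sZ] := fZ a; exact: sZ _ (si (sz b)). have nE := snear_fin (fun ab => (hE ab).2).
have f0 : row_free (\matrix_(a, b) E (a, b) (x p)). apply: row_freeI => v h; have [_ hZ] := snear_self nZ.
  pose u : vec X := fun f => \sum_a v 0 a * Z a p f. have hu : tangent p u.
    by apply: lin_comb; [exact: lin_set_tangent|move=> a; case: (fZ a)].
  have t0 : tangent p (fun=> 0) by case: (lin_set_tangent p). suff u0 : u = fun=> 0.
    apply/rowP => a; rewrite mxE; have := congr1 (fun w => w (fun q => x q 0 a)) u0.
    by rewrite /u /=; under eq_bigr do rewrite hZ (tvec_coord cx)// mxE eqxx /=; rewrite sum_deltar.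
  apply: (imm hu t0); apply: (tan_eq gM cz Aip).
  - by have := push_tangent gM si hu.
  - by have := push_tangent gM si t0.
  - move=> b; rewrite !pushE//; have /rowP/(_ b) := h; rewrite !mxE => h'.
    rewrite -[RHS]h'; apply: eq_bigr => a _. by rewrite mxE -(snear_self nE (a, b)).
have [H [sH _ nH]] := right_inverse_near (fun a b => (hE (a, b)).1) f0.
exists f, (fun b q h => \sum_a H b a (x q) * Z a q h); split=> //.
- by move=> b; apply: (field_comb gX) => // a; exact: (smooth_xcomp gX cx (F := H b a)).
- apply: snear2 (snearI nZ nE) (snear_push cx Ap nH) _.
  move=> q /= [[Aq hZ] Eq] [_ [_ HI]] u hu; apply/funext => h. pose v : 'rV_n := \row_a u (fun q => x q 0 a).
  have uE g : u g = \sum_a v 0 a * Z a q g. rewrite {1}(tan_tvec gX cx Aq hu) (tvec_sum gX cx _ Aq).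
    by apply: eq_bigr => a _; rewrite hZ. rewrite uE; under [RHS]eq_bigr do rewrite mulr_sumr.
  rewrite exchange_big/=; apply: eq_bigr => a _.
  under eq_bigr do rewrite mulrA; rewrite -mulr_suml; congr *%R.
  rewrite -{1}[v]mulmx1 -HI mulmxA mxE; apply: eq_bigr => b _; rewrite [in RHS]uE.
  rewrite !mxE; congr *%R; apply: eq_bigr => c _. by congr *%R; rewrite mxE -(Eq (c, b)).
Qed.

End ImmersionFrame.

Section Families.
Variables (R : realType) (n m : nat) (X M : diffspace R) (i : X -> M).
Hypotheses (mX : manifold n X) (gM : good m M) (si : smooth_map i).
Hypothesis imm : forall x v w, tangent x v -> tangent x w -> push i v = push i w -> v = w.
Let gX := manifold_good mX.
#[local] Hint Resolve gX gM : core.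

(** The local resolutions of the identity of TX are weighted by a partition of unity. The index l
    encodes the piece l / m and the number l mod m within the piece, both [f] and [W] being 0 for
    pieces without a centre. *)
Lemma families : exists (f : nat -> M -> R) (W : nat -> X -> vec X),
  [/\ forall l, smooth (f l), forall l, field (W l) & forall p, exists N, snear p [set q |
      (forall l, (N <= l)%N -> W l q = fun=> 0) /\
      forall u, tangent q u -> u = fun h => \sum_(l < N) u (f l \o i) * W l q h]].
Proof.
have /choice[T hT] : forall p, exists T : ('I_m -> M -> R) * ('I_m -> X -> vec X) * (X -> R),
  [/\ forall b, smooth (T.1.1 b), forall b, field (T.1.2 b),
    [/\ smooth T.2, forall q, 0 <= T.2 q <= 1 & snear p [set q | T.2 q = 1]] &
    forall q, T.2 q != 0 -> forall u, tangent q u -> u = fun h => \sum_b u (T.1.1 b \o i) * T.1.2 b q h].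
  move=> p; have [f [W [sf fW [A [oA Ap hA]]]]] := immersion_local gX gM si imm p.
  have [chi [sc c1 cb c0]] := smooth_bump gX oA Ap.
  exists (f, W, chi); split=> //= q cq; apply: hA; apply: contrapT => /c0/snear_self/= c0q.
  by rewrite c0q eqxx in cq. have [c [h [sh hc hs]]] := partition_of_unity mX (rho := fun p => (T p).2)
  (fun p => match hT p with And4 _ _ t _ => t end). pose f l := if c (l %/ m)%N is Some p then
  if insub (l %% m)%N is Some b then (T p).1.1 b else fun=> 0 else fun=> 0.
pose W l q g := h (l %/ m)%N q * (if c (l %/ m)%N is Some p then
  if insub (l %% m)%N is Some b then (T p).1.2 b q g else 0 else 0).
have s0 : @smooth R M (fun=> 0) by exact: smooth_cst.
have t0 q : tangent q (fun=> 0 : R) by case: (lin_set_tangent q). exists f, W; split.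
- rewrite /f => l; case: (c _) => [p|//]; case: insub => [b|//]. by case: (hT p).
- move=> l; have F1 : field (fun q g => if c (l %/ m)%N is Some p then
      if insub (l %% m)%N is Some b then (T p).1.2 b q g else 0 else 0).
    case: (c _) => [p|]; last by split=> // ? _; exact: smooth_cst.
    case: insub => [b|]; last by split=> // ? _; exact: smooth_cst. by case: (hT p).
  have := field_comb gX (index_enum 'I_1) (fun _ => sh (l %/ m)%N) (fun _ => F1).
  by congr field; apply/funext => q; apply/funext => g; rewrite big_ord1.
- move=> p; have [N nN] := hs p; exists (N * m)%N. apply: snearS nN => q [hN h1]; split.
    move=> l Nl; apply/funext => g; rewrite /W.
    case E : (insub (l %% m)%N) => [b|]; last by case: (c _) => [?|]; rewrite mulr0.
    have m0 : (0 < m)%N by apply: leq_ltn_trans (ltn_ord b). by rewrite hN ?mul0r// leq_divRL.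
  move=> u hu; apply/funext => g. pose G k b := u ((if c k is Some p then
    if insub b is Some b then (T p).1.1 b else fun=> 0 else fun=> 0) \o i) * (h k q * (if c k is Some p then
      if insub b is Some b then (T p).1.2 b q g else 0 else 0)).
  rewrite -[RHS]/(\sum_(l < N * m) G (l %/ m)%N (l %% m)%N) sum_divmod.
  rewrite -[LHS]mul1r -h1 mulr_suml; apply: eq_bigr => k _; rewrite /G. have [->|hk] := eqVneq (h k q) 0.
    by rewrite mul0r big1// => b _; rewrite mul0r mulr0.
  have [p' -> Tp'] := hc k q hk; have [_ _ _ /(_ q Tp' u hu) uE] := hT p'.
  rewrite {1}uE mulr_sumr; apply: eq_bigr => b _. have -> : insub (b : nat) = Some b by rewrite valK.
  by rewrite mulrCA.
Qed.

End Families.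

(** * Transport along flows *)

Section Transport.
Variables (R : realType) (k N d : nat).
Variables (A B : 'I_N -> 'I_k -> fn R k) (c : 'I_N -> 'I_N -> 'I_N -> fn R k).
Variables (sg : 'I_N -> fn R (1 + d)) (y : 'I_k -> fn R (1 + d)).
Hypothesis sA : forall i l, sm (A i l).
Hypothesis sB : forall i l, sm (B i l).
Hypothesis sc : forall j i l, sm (c j i l).
Hypothesis ssg : forall j, sm (sg j).
Hypothesis sy : forall l, sm (y l).
Definition pos q : 'rV[R]_k := \row_l y l q.
Notation Y := pos.
Notation et := (ev (lshift d 0) : 'rV[R]_(1 + d)).
Hypothesis ode : forall l q, 'D_et (y l) q = \sum_j sg j q * A j l (Y q).

(* The integrability conditions of the frame (A_i, B_i) at the point x. *)
Definition dirac_frame_at (x : 'rV[R]_k) : Prop :=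
  [/\ forall i j, \sum_l (A i l x * B j l x + A j l x * B i l x) = 0,
      forall j i m, \sum_l (A j l x * pd l (A i m) x - A i l x * pd l (A j m) x) =
        \sum_l c j i l x * A l m x & forall j i m, \sum_l (A j l x * pd l (B i m) x + B i l x * pd m (A j l) x
        - (A i l x * pd l (B j m) x - A i l x * pd m (B j l) x)) = \sum_l c j i l x * B l m x].

Lemma smY (f : fn R k) : sm f -> sm (fun q => f (Y q)).
Proof. by move=> sf; apply: sm_comp => // i; under eq_fun do rewrite mxE; exact: sy. Qed.

Lemma D_Y (f : fn R k) v q : sm f -> 'D_v (fun q => f (Y q)) q = \sum_m 'D_v (y m) q * pd m f (Y q).
Proof.
move=> sf; have dY : differentiable Y q.
  by apply: sm_diff_rV => i; rewrite /pos; under eq_fun do rewrite mxE; exact: sy.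
rewrite [LHS](derive_compE v dY (sm_diff _ sf)); apply: eq_bigr => m _; congr *%R.
by congr ('D_v _ q); apply/funext => z; rewrite mxE.
Qed.

(** The coefficients along dy_l of the 1-form sum_j sg_j B_j pulled back by the position map. *)
Definition alpha l q := \sum_j sg j q * B j l (Y q).

Lemma sm_alpha l : sm (alpha l).
Proof. by apply: sm_sum => j; apply: sm_mul => //; exact: smY. Qed.

Lemma D_sgY (F : 'I_N -> fn R k) v q : (forall j, sm (F j)) -> 'D_v (fun q => \sum_j sg j q * F j (Y q)) q =
  \sum_j ('D_v (sg j) q * F j (Y q) + sg j q * \sum_m 'D_v (y m) q * pd m (F j) (Y q)).
Proof.
move=> sF; rewrite D_sum; last by move=> j; apply: sm_mul => //; exact: smY.
apply: eq_bigr => j _; rewrite D_mul//; last exact: smY. by rewrite D_Y.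
Qed.

Lemma D_et_D v l q : 'D_et ('D_v (y l)) q =
  \sum_j ('D_v (sg j) q * A j l (Y q) + sg j q * \sum_m 'D_v (y m) q * pd m (A j l) (Y q)).
Proof.
rewrite schwarz//; have -> : 'D_et (y l) = fun q => \sum_j sg j q * A j l (Y q).
  by apply/funext => z; exact: ode. exact: (D_sgY (F := fun j => A j l)).
Qed.

Lemma D_et_Y (f : fn R k) q : sm f ->
  'D_et (fun q => f (Y q)) q = \sum_j sg j q * \sum_m A j m (Y q) * pd m f (Y q).
Proof.
move=> sf; rewrite D_Y//; under eq_bigr do rewrite ode mulr_suml.
rewrite exchange_big/=; apply: eq_bigr => j _; rewrite mulr_sumr. by apply: eq_bigr => m _; rewrite mulrA.
Qed.

Section Covector.
Variables (w : 'rV[R]_(1 + d)) (b : 'I_k -> fn R (1 + d)).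
Hypothesis sb : forall l, sm (b l).
Hypothesis bode : forall l q, 'D_et (b l) q = 'D_w (alpha l) q - \sum_j sg j q *
    (\sum_m b m q * pd l (A j m) (Y q) + \sum_m 'D_w (y m) q * pd l (B j m) (Y q)).

(** The pairing of the candidate (D_w y, b) with the i-th frame element. For a frame of a Lagrangian
    family, vanishing of all deviations is membership of the candidate. *)
Definition deviation i q := \sum_l (b l q * A i l (Y q) + B i l (Y q) * 'D_w (y l) q).

Lemma sm_deviation i : sm (deviation i).
Proof. apply: sm_sum => l; apply: sm_add; apply: sm_mul => //; try exact: smY. exact: sm_derive. Qed.

(** A relabelling of double sums that collects the derivatives of frame coefficients into the two
    components of the Dorfman bracket of the elements j and i. *)
Lemma contraction (bb u Ai Aj Bi Bj : 'I_k -> R) (dAi dAj dBi dBj : 'I_k -> 'I_k -> R) :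
  \sum_l ((\sum_m u m * dBj m l - (\sum_m bb m * dAj l m + \sum_m u m * dBj l m)) * Ai l
    + bb l * (\sum_m Aj m * dAi m l) + (\sum_m Aj m * dBi m l) * u l + Bi l * (\sum_m u m * dAj m l)) =
  \sum_m bb m * (\sum_l (Aj l * dAi l m - Ai l * dAj l m)) +
  \sum_m u m * (\sum_l (Aj l * dBi l m + Bi l * dAj m l - (Ai l * dBj l m - Ai l * dBj m l))).
Proof.
transitivity (\sum_l \sum_m (u m * dBj m l * Ai l - (bb m * dAj l m * Ai l + u m * dBj l m * Ai l)
    + Bi l * (u m * dAj m l)) + \sum_m \sum_l (bb m * (Aj l * dAi l m) + Aj l * dBi l m * u m)).
  rewrite -big_split/=; apply: eq_bigr => l _.
  rewrite -!big_split -!sumrB !mulr_suml !mulr_sumr -!big_split/=. by apply: eq_bigr => m _; ring.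
rewrite exchange_big/= -!big_split/=; apply: eq_bigr => m _.
rewrite !mulr_sumr -!big_split/=; apply: eq_bigr => l _; ring.
Qed.

(** Isotropy removes the derivatives of the coefficients sg, and closedness under the Dorfman
    bracket rewrites the rest through the structure functions. The result is linear and homogeneous,
    so vanishing deviations persist. *)
Lemma deviation_ode i q : dirac_frame_at (Y q) ->
  'D_et (deviation i) q = \sum_l (\sum_j sg j q * c j i l (Y q)) * deviation l q.
Proof.
move=> [iso brT brC]; rewrite /deviation D_sum; last first.
  move=> l; apply: sm_add; apply: sm_mul => //; try exact: smY. exact: sm_derive.
have sD l : sm ('D_w (y l)) by exact: sm_derive. under eq_bigr => l _.
  rewrite D_add; [|by apply: sm_mul => //; exact: smY|by apply: sm_mul => //; exact: smY].
  rewrite D_mul//; last exact: smY.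
  rewrite (D_mul _ _ (smY (sB i l)) (sD l)) !D_et_Y// D_et_D bode (D_sgY (F := fun j => B j l))//. over.
rewrite /=.
transitivity (\sum_j ('D_w (sg j) q * \sum_l (A i l (Y q) * B j l (Y q) + A j l (Y q) * B i l (Y q)) +
  sg j q * (\sum_m b m q * (\sum_l c j i l (Y q) * A l m (Y q)) +
            \sum_m 'D_w (y m) q * (\sum_l c j i l (Y q) * B l m (Y q))))). under [RHS]eq_bigr => j _.
    under [X in _ * (X + _)]eq_bigr do rewrite -brT. under [X in _ * (_ + X)]eq_bigr do rewrite -brC.
    rewrite -(contraction (fun m => b m q) (fun m => 'D_w (y m) q)
      (fun l => A i l (Y q)) (fun l => A j l (Y q)) (fun l => B i l (Y q))
      (fun l => B j l (Y q)) (fun l m => pd l (A i m) (Y q)) (fun l m => pd l (A j m) (Y q))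
      (fun l m => pd l (B i m) (Y q)) (fun l m => pd l (B j m) (Y q))).
    rewrite mulr_sumr mulr_sumr -big_split/=. over. rewrite exchange_big/=; apply: eq_bigr => l _.
  rewrite -sumrB !mulr_suml !mulr_sumr -!big_split/=. by apply: eq_bigr => j _; ring.
rewrite big_split/= [X in X + _]big1 ?add0r; last by move=> j _; rewrite iso mulr0.
under [RHS]eq_bigr do rewrite mulr_suml; rewrite [RHS]exchange_big/=.
apply: eq_bigr => j _; under [RHS]eq_bigr do rewrite -mulrA; rewrite -mulr_sumr; congr *%R.
under [RHS]eq_bigr do rewrite mulr_sumr; rewrite [RHS]exchange_big/= -big_split/=.
apply: eq_bigr => m _; rewrite !mulr_sumr -big_split/=; apply: eq_bigr => l _; ring.
Qed.

Lemma sum_lin (a v' c' w' : R) (x1 x2 x3 : 'I_N -> R) :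
  (a - \sum_j x1 j) * v' + c' * (\sum_j x2 j) + ((\sum_j x3 j) * w' - a * v') =
  \sum_j (- x1 j * v' + c' * x2 j + x3 j * w').
Proof. by rewrite !big_split/= -!mulr_suml -mulr_sumr sumrN; ring. Qed.

(** The derivatives of sg along v multiply deviations, which are 0, and the second derivatives of
    the frame map cancel in pairs; what remains is the exterior derivative of the 1-form [alpha] on
    (w, v). *)
Lemma pairing_ode v q : (forall j, deviation j q = 0) -> 'D_et (fun q => \sum_l b l q * 'D_v (y l) q) q =
  \sum_l ('D_w (alpha l) q * 'D_v (y l) q - 'D_v (alpha l) q * 'D_w (y l) q).
Proof.
move=> P0; have sD u l : sm ('D_u (y l)) by exact: sm_derive. rewrite D_sum; last by move=> l; exact: sm_mul.
under eq_bigr => l _ do rewrite D_mul// bode D_et_D.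
under [RHS]eq_bigr => l _ do rewrite (D_sgY (F := fun j => B j l) v)//. rewrite [RHS]sumrB.
apply/eqP; rewrite -subr_eq0 opprB addrA; apply/eqP. transitivity (\sum_j 'D_v (sg j) q * deviation j q +
   \sum_j sg j q * (\sum_l (\sum_m b l q * 'D_v (y m) q * pd m (A j l) (Y q)) -
     \sum_l \sum_m b m q * 'D_v (y l) q * pd l (A j m) (Y q) +
     (\sum_l \sum_m 'D_w (y l) q * 'D_v (y m) q * pd m (B j l) (Y q) -
      \sum_l \sum_m 'D_w (y m) q * 'D_v (y l) q * pd l (B j m) (Y q)))). rewrite -[in RHS]big_split/=.
  under [RHS]eq_bigr => j _. rewrite /deviation -!sumrB -big_split/= !mulr_sumr -big_split/=. over.
  rewrite /= [RHS]exchange_big/= -addrA -sumrB -big_split/=; apply: eq_bigr => l _.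
  transitivity (\sum_j (- (sg j q * (\sum_m b m q * pd l (A j m) (Y q) +
      \sum_m 'D_w (y m) q * pd l (B j m) (Y q))) * 'D_v (y l) q +
    b l q * ('D_v (sg j) q * A j l (Y q) + sg j q * \sum_m 'D_v (y m) q * pd m (A j l) (Y q)) +
    ('D_v (sg j) q * B j l (Y q) + sg j q * \sum_m 'D_v (y m) q * pd m (B j l) (Y q)) * 'D_w (y l) q)).
    exact: sum_lin. apply: eq_bigr => j _. have E1 : \sum_m b l q * 'D_v (y m) q * pd m (A j l) (Y q) =
    b l q * \sum_m 'D_v (y m) q * pd m (A j l) (Y q). by rewrite mulr_sumr; apply: eq_bigr => m _; ring.
  have E2 : \sum_m b m q * 'D_v (y l) q * pd l (A j m) (Y q) =
    'D_v (y l) q * \sum_m b m q * pd l (A j m) (Y q). by rewrite mulr_sumr; apply: eq_bigr => m _; ring.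
  have E3 : \sum_m 'D_w (y l) q * 'D_v (y m) q * pd m (B j l) (Y q) =
    'D_w (y l) q * \sum_m 'D_v (y m) q * pd m (B j l) (Y q).
    by rewrite mulr_sumr; apply: eq_bigr => m _; ring.
  have E4 : \sum_m 'D_w (y m) q * 'D_v (y l) q * pd l (B j m) (Y q) =
    'D_v (y l) q * \sum_m 'D_w (y m) q * pd l (B j m) (Y q).
    by rewrite mulr_sumr; apply: eq_bigr => m _; ring. rewrite E1 E2 E3 E4; ring.
rewrite big1 ?add0r; last by move=> j _; rewrite P0 mulr0.
apply: big1 => j _; rewrite exchange_big/= subrr add0r exchange_big/= subrr mulr0. by [].
Qed.

Lemma tv_norm t (z : 'rV[R]_d) : 0 <= t <= 1 -> `|tv t z| <= Num.max 1 `|z|.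
Proof.
move=> /andP[t0 t1]; apply: norm_row_mx_le; first by rewrite le_max ler01.
  apply: le_trans (norm_scalar1 t) _; rewrite le_max ger0_norm//. by rewrite t1. by rewrite le_max lexx orbT.
Qed.

Lemma deviation_zero z : (forall t : R, 0 <= t <= 1 -> dirac_frame_at (Y (tv t z))) ->
  (forall i, deviation i (tv 0 z) = 0) -> forall t, 0 <= t <= 1 -> forall i, deviation i (tv t z) = 0.
Proof.
move=> fr P0. have sK (il : 'I_N * 'I_N) : continuous (fun q => \sum_j sg j q * c j il.1 il.2 (Y q)).
  by apply: sm_cont; apply: sm_sum => j; apply: sm_mul => //; exact: smY.
have [C C0 hC] := cont_bounded_fin (Num.max 1 `|z|) sK.
pose cc (t : R) := \row_i deviation i (tv t z) : 'rV[R]_N.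
pose dc (t : R) := \row_i 'D_et (deviation i) (tv t z) : 'rV[R]_N.
have H := @gronwall_rV R N cc dc (N%:R * C) 0 1 0. move=> t ht i; suff /rowP/(_ i) : cc t = 0 by rewrite !mxE.
apply: H => //.
- move=> s hs l; rewrite mxE; under eq_fun do rewrite mxE. exact: derive_tv (sm_diff _ (sm_deviation l)).
- move=> s hs; apply: norm_le_coord; first by rewrite !mulr_ge0.
  move=> l; rewrite mxE deviation_ode; last exact: fr.
  apply: le_trans (norm_sum_le (C := C * `|cc s|) _) _; last by rewrite mulrA.
  move=> m; rewrite normrM; apply: ler_pM => //; first exact: hC (l, m) _ (tv_norm z hs).
  by have := coord_le_norm (cc s) m; rewrite mxE.
- by rewrite lexx ler01.
- by apply/rowP => l; rewrite !mxE P0.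
Qed.

End Covector.

Lemma covector_flow w (b0 : 'rV[R]_k) : exists b : 'I_k -> fn R (1 + d),
  [/\ forall l, sm (b l), forall l z, b l (tv 0 z) = b0 0 l & forall l q, 'D_et (b l) q =
  'D_w (alpha l) q - \sum_j sg j q *
    (\sum_m b m q * pd l (A j m) (Y q) + \sum_m 'D_w (y m) q * pd l (B j m) (Y q))].
Proof.
have sD f v : sm f -> sm ('D_v f) by exact: sm_derive. have [|||b [sb bi be]] := @linear_flow R d k
  (fun m l q => - \sum_j sg j q * pd l (A j m) (Y q))
  (fun l q => 'D_w (alpha l) q - \sum_j sg j q * \sum_m 'D_w (y m) q * pd l (B j m) (Y q))
  (fun l _ => b0 0 l).
- move=> m l; apply: sm_opp; apply: sm_sum => j; apply: sm_mul => //.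
  apply: (smY (f := pd l (A j m))); exact: sm_derive.
- move=> l; apply: sm_sub; first by apply: sm_derive; exact: sm_alpha.
  apply: sm_sum => j; apply: sm_mul => //; apply: sm_sum => m; apply: sm_mul. exact: sm_derive.
  apply: (smY (f := pd l (B j m))); exact: sm_derive.
- by move=> l; exact: sm_cst. exists b; split=> // l q; rewrite be.
have -> : \sum_j b j q * - \sum_j0 sg j0 q * pd l (A j0 j) (Y q) =
    - \sum_j sg j q * \sum_m b m q * pd l (A j m) (Y q). under [in RHS]eq_bigr do rewrite mulr_sumr.
  rewrite exchange_big/= -sumrN; apply: eq_bigr => m _; rewrite mulrN mulr_sumr.
  by congr (- _); apply: eq_bigr => j _; ring. have -> : \sum_j sg j q * (\sum_m b m q * pd l (A j m) (Y q) +
      \sum_m 'D_w (y m) q * pd l (B j m) (Y q)) = \sum_j sg j q * (\sum_m b m q * pd l (A j m) (Y q)) +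
    \sum_j sg j q * (\sum_m 'D_w (y m) q * pd l (B j m) (Y q)).
  by rewrite -big_split; apply: eq_bigr => j _; rewrite mulrDr. by ring.
Qed.

(* Transport of (u, b) in L along the curve: it stays in L, and b changes by the
   exterior derivative of the form sum_j sg_j B_j. *)
Lemma transport z w (b0 : 'rV[R]_k) : (forall t : R, 0 <= t <= 1 -> dirac_frame_at (Y (tv t z))) ->
  (forall i, \sum_l (b0 0 l * A i l (Y (tv 0 z)) + B i l (Y (tv 0 z)) * 'D_w (y l) (tv 0 z)) = 0) ->
  exists b : 'I_k -> fn R (1 + d), [/\ forall l, b l (tv 0 z) = b0 0 l, forall t i, 0 <= t <= 1 ->
      \sum_l (b l (tv t z) * A i l (Y (tv t z)) + B i l (Y (tv t z)) * 'D_w (y l) (tv t z)) = 0 &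
    forall (t : R) v, 0 <= t <= 1 -> is_derive t 1 (fun s => \sum_l b l (tv s z) * 'D_v (y l) (tv s z))
      (\sum_l ('D_w (alpha l) (tv t z) * 'D_v (y l) (tv t z) -
               'D_v (alpha l) (tv t z) * 'D_w (y l) (tv t z)))].
Proof.
move=> fr P0; have [b [sb bi be]] := covector_flow w b0. have P0' i : deviation w b i (tv 0 z) = 0.
  by rewrite /deviation; under eq_bigr do rewrite bi; exact: P0. have Pt := deviation_zero sb be fr P0'.
exists b; split=> [l|t i ht|t v ht]; [exact: bi|exact: Pt|]. rewrite -(pairing_ode sb be v (Pt t ht)).
apply: (derive_tv (f := fun q => \sum_l b l q * 'D_v (y l) q)); apply: sm_diff.
by apply: sm_sum => l; apply: sm_mul => //; exact: sm_derive.
Qed.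

Lemma derive0v n (f : fn R n) x : sm f -> 'D_0 f x = 0.
Proof. by move=> sf; rewrite derive_pd ?big1//; [move=> i _; rewrite mxE mul0r|exact: sm_diff]. Qed.

(** This is transport with w = 0, for covectors b with (0, b) in the structure. The equation is then
    homogeneous, so transport is a matrix P; Gronwall backwards from time 1 makes P invertible, and
    the pairing with variations has derivative 0. *)
Lemma annihilator_transport z : (forall t : R, 0 <= t <= 1 -> dirac_frame_at (Y (tv t z))) ->
  exists P : 'M[R]_k, P \in unitmx /\ forall b0 : 'rV[R]_k,
    (forall i, \sum_l b0 0 l * A i l (Y (tv 0 z)) = 0) ->
    (forall i, \sum_l (b0 *m P) 0 l * A i l (Y (tv 1 z)) = 0) /\
    forall v, \sum_l (b0 *m P) 0 l * 'D_v (y l) (tv 1 z) = \sum_l b0 0 l * 'D_v (y l) (tv 0 z).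
Proof.
move=> fr; have /choice[b hb] := fun a : 'I_k => covector_flow 0 (ev a).
have sb a l : sm (b a l) by case: (hb a). pose bb (b0 : 'rV[R]_k) l q := \sum_a b0 0 a * b a l q.
have sbb b0 l : sm (bb b0 l) by apply: sm_sum => a; apply: sm_mul => //; exact: sm_cst.
have bbi b0 l : bb b0 l (tv 0 z) = b0 0 l. rewrite -[RHS](sum_deltar (b0 0)); apply: eq_bigr => a _.
  by case: (hb a) => _ -> _; rewrite mxE eqxx.
have bbe b0 l q : 'D_et (bb b0 l) q = 'D_0 (alpha l) q - \sum_j sg j q *
    (\sum_m bb b0 m q * pd l (A j m) (Y q) + \sum_m 'D_0 (y m) q * pd l (B j m) (Y q)).
  have Z j : \sum_m 'D_0 (y m) q * pd l (B j m) (Y q) = 0. by rewrite big1// => m _; rewrite derive0v// mul0r.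
  rewrite D_sum; last by move=> a; apply: sm_mul => //; exact: sm_cst. under eq_bigr => a _.
    rewrite (D_mul _ _ (sm_cst _ _))// D_cst mul0r add0r; case: (hb a) => _ _ ->.
    rewrite derive0v ?sub0r; last exact: sm_alpha. under [X in - X]eq_bigr do rewrite Z addr0. over.
  rewrite derive0v ?sub0r; last exact: sm_alpha. under [X in _ = - X]eq_bigr do rewrite Z addr0.
  under eq_bigr do rewrite mulrN; rewrite sumrN; congr (- _).
  under [LHS]eq_bigr do rewrite mulr_sumr; rewrite [LHS]exchange_big/=; apply: eq_bigr => j _.
  under [LHS]eq_bigr do rewrite mulrA mulr_sumr.
  rewrite [LHS]exchange_big/= [RHS]mulr_sumr; apply: eq_bigr => m _.
  by rewrite /bb mulr_suml mulr_sumr; apply: eq_bigr => a _; ring.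
pose P : 'M[R]_k := \matrix_(a, l) b a l (tv 1 z). have bbP b0 l : bb b0 l (tv 1 z) = (b0 *m P) 0 l.
  by rewrite mxE; apply: eq_bigr => a _; rewrite mxE. exists P; split.
  rewrite -row_free_unit; apply: row_freeI => b0 h. have sK (ml : 'I_k * 'I_k) :
      continuous (fun q => \sum_j sg j q * pd ml.2 (A j ml.1) (Y q)).
    apply: sm_cont; apply: sm_sum => j; apply: sm_mul => //.
    by apply: (smY (f := pd ml.2 (A j ml.1))); exact: sm_derive.
  have [C C0 hC] := cont_bounded_fin (Num.max 1 `|z|) sK.
  pose cc (t : R) := \row_l bb b0 l (tv t z) : 'rV[R]_k.
  pose dc (t : R) := \row_l 'D_et (bb b0 l) (tv t z) : 'rV[R]_k.
  have H := @gronwall_rV R k cc dc (k%:R * C) 0 1 1.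
  suff /rowP c0 : cc 0 = 0 by apply/rowP => l; have := c0 l; rewrite !mxE bbi. apply: H => //.
  - move=> s hs l; rewrite mxE; under eq_fun do rewrite mxE. exact: derive_tv (sm_diff _ (sbb b0 l)).
  - move=> s hs; apply: norm_le_coord; first by rewrite !mulr_ge0.
    move=> l; rewrite mxE bbe derive0v ?sub0r; last exact: sm_alpha. rewrite normrN.
    have -> : \sum_j sg j (tv s z) * (\sum_m bb b0 m (tv s z) * pd l (A j m) (Y (tv s z)) +
        \sum_m 'D_0 (y m) (tv s z) * pd l (B j m) (Y (tv s z))) =
      \sum_m (\sum_j sg j (tv s z) * pd l (A j m) (Y (tv s z))) * bb b0 m (tv s z).
      under [RHS]eq_bigr do rewrite mulr_suml; rewrite [RHS]exchange_big/=.
      apply: eq_bigr => j _; rewrite [X in _ + X]big1 ?addr0.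
        by rewrite mulr_sumr; apply: eq_bigr => m _; ring. by move=> m _; rewrite derive0v// mul0r.
    apply: le_trans (norm_sum_le (C := C * `|cc s|) _) _; last by rewrite mulrA.
    move=> m; rewrite normrM; apply: ler_pM => //; first exact: hC (m, l) _ (tv_norm z hs).
    by have := coord_le_norm (cc s) m; rewrite mxE.
  - by rewrite ler01 lexx.
  - by apply/rowP => l; rewrite !mxE bbP h mxE.
  - by rewrite lexx ler01. move=> b0 P0.
have dev i q : deviation 0 (bb b0) i q = \sum_l bb b0 l q * A i l (Y q).
  by apply: eq_bigr => l _; rewrite derive0v// mulr0 addr0. have P0' i : deviation 0 (bb b0) i (tv 0 z) = 0.
  by rewrite dev; under eq_bigr do rewrite bbi; exact: P0. have Pt := deviation_zero (sbb b0) (bbe b0) fr P0'.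
split=> [i|v]. have := Pt 1 _ i; rewrite lexx ler01 => /(_ isT); rewrite dev => h; rewrite -[RHS]h.
  by apply: eq_bigr => l _; rewrite bbP. have -> : \sum_l (b0 *m P) 0 l * 'D_v (y l) (tv 1 z) =
    \sum_l bb b0 l (tv 1 z) * 'D_v (y l) (tv 1 z). by apply: eq_bigr => l _; rewrite bbP.
have -> : \sum_l b0 0 l * 'D_v (y l) (tv 0 z) = \sum_l bb b0 l (tv 0 z) * 'D_v (y l) (tv 0 z).
  by apply: eq_bigr => l _; rewrite bbi. pose f (s : R) := \sum_l bb b0 l (tv s z) * 'D_v (y l) (tv s z).
pose df (s : R) := 'D_et (fun q => \sum_l bb b0 l q * 'D_v (y l) q) (tv s z).
have h1 t : 0 <= t <= 1 -> is_derive (t : R) 1 f (df t).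
  move=> _; apply: (derive_tv (f := fun q => \sum_l bb b0 l q * 'D_v (y l) q)).
  by apply: sm_diff; apply: sm_sum => l; apply: sm_mul => //; exact: sm_derive.
have h2 t : 0 <= t <= 1 -> df t = 0.
  move=> ht; rewrite /df (pairing_ode (sbb b0) (bbe b0) v (Pt t ht)) big1// => l _.
  by rewrite derive0v ?(derive0v _ (sy l)) ?mul0r ?mulr0 ?subrr//; exact: sm_alpha.
by have := derive0_constant ler01 h1 h2.
Qed.

End Transport.

Section TubeLemmas.
Variable R : realType.

(** A Lipschitz constant of g on one ball containing all the points involved gives a radius that
    does not depend on t. *)
Lemma tube n (g : fn R (1 + n)) z0 e : sm g -> 0 < e ->
  exists2 b, 0 < b & forall t z, 0 <= t <= 1 -> `|z - z0| < b -> `|g (tv t z) - g (tv t z0)| < e.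
Proof.
move=> sg e0; pose r := Num.max 1 (`|z0| + 1); have [K K0 hK] := sm_lip r sg.
have K1 : 0 < K + 1 by rewrite ltr_wpDl.
exists (Num.min 1 (e / (K + 1))); first by rewrite lt_min ltr01 divr_gt0.
move=> t z ht; rewrite lt_min => /andP[z1 ze]. have nz : `|z| <= `|z0| + 1 by apply/norm_ball/ltW.
have nz0 : `|z0| <= `|z0| + 1 by rewrite lerDl. have b1 (w : 'rV[R]_n) : `|w| <= `|z0| + 1 -> `|tv t w| <= r.
  move=> hw; apply: le_trans (tv_norm w ht) _; rewrite ge_max /r le_max lexx/=. by rewrite le_max hw orbT.
apply: le_lt_trans (hK _ _ (b1 _ nz0) (b1 _ nz)) _. have -> : tv t z - tv t z0 = row_mx 0 (z - z0).
  by rewrite opp_row_mx add_row_mx subrr. have n0 : `|row_mx (0 : 'rV[R]_1) (z - z0)| <= `|z - z0|.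
  by apply: norm_row_mx_le; rewrite ?normr0. apply: le_lt_trans (ler_wpM2l K0 n0) _.
apply: le_lt_trans (_ : (K + 1) * `|z - z0| < e); last by rewrite mulrC -ltr_pdivlMr.
by rewrite ler_wpM2r// lerDl.
Qed.

Lemma tube_rV n m (g : 'I_m -> fn R (1 + n)) z0 (c : 'rV[R]_m) e :
  (forall k, sm (g k)) -> (forall t k, 0 <= t <= 1 -> g k (tv t z0) = c 0 k) -> 0 < e ->
  exists2 b, 0 < b & forall t z, 0 <= t <= 1 -> `|z - z0| < b -> `|\row_k g k (tv t z) - c| < e.
Proof.
move=> sg gc e0; have /choice[b hb] : forall k, exists b, 0 < b /\
    forall t z, 0 <= t <= 1 -> `|z - z0| < b -> `|g k (tv t z) - g k (tv t z0)| < e.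
  by move=> k; have [b b0 hb] := tube z0 (sg k) e0; exists b. exists (\big[Num.min/1]_k b k).
  by elim/big_ind: _ => // [u v u0 v0|k _]; [rewrite lt_min u0|case: (hb k)].
move=> t z ht hz; apply: norm_lt_coord => // k; rewrite !mxE -(gc t k ht).
have [_ h] := hb k; apply: h => //; apply: lt_le_trans hz _. by apply: bigmin_le_cond.
Qed.

Lemma cutoff_bounded n (I : finType) (x0 : 'rV[R]_n) d (f : I -> fn R n) : 0 < d ->
  (forall i, sm (f i)) -> exists2 K, 0 <= K & forall i x, `|cutoff x0 d x * f i x| <= K.
Proof.
move=> d0 sf; have [K K0 hK] := cont_bounded_fin (`|x0| + d) (fun i => sm_cont (sf i)).
exists K => // i x; have [->|c0] := eqVneq (cutoff x0 d x) 0; first by rewrite mul0r normr0.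
rewrite normrM ger0_norm ?cutoff_ge0// -[K]mul1r.
by rewrite ler_pM ?cutoff_ge0 ?cutoff_le1// hK//; exact: cutoff_support.
Qed.

Lemma in01_0 : 0 <= (0 : R) <= 1. Proof. by rewrite lexx ler01. Qed.
Lemma in01_1 : 0 <= (1 : R) <= 1. Proof. by rewrite lexx ler01. Qed.

Lemma pos_cont n m (y : 'I_m -> fn R (1 + n)) : (forall k, sm (y k)) -> continuous (pos y).
Proof. by move=> sy; apply: sm_cont_rV => k; apply: sm_ext (sy k) => q; rewrite mxE. Qed.

Lemma pos_tv_cont n m (y : 'I_m -> fn R (1 + n)) z (t : R) : (forall k, sm (y k)) ->
  {for t, continuous (fun s : R => pos y (tv s z))}.
Proof.
move=> sy; apply: cont_rV => k.
have -> : (fun s : R => pos y (tv s z) 0 k) = fun s => y k (tv s z) by apply/funext => s; rewrite mxE.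
exact: drv_continuous (derive_tv (sm_diff (tv t z) (sy k))).
Qed.

End TubeLemmas.
Arguments in01_0 {R}.
Arguments in01_1 {R}.

(** * Uniqueness of integral curves of relations *)

Section CurveUniqueness.
Variables (R : realType) (d : nat) (S : diffspace R).
Hypothesis gS : good d S.
#[local] Hint Resolve gS : core.

Definition curve_of (E : R -> S -> vec S -> Prop) (c : R -> S) : Prop :=
  forall t, 0 <= t <= 1 -> exists v, E t (c t) v /\
    forall f, smooth f -> is_derive (t : R) 1 (fun s => f (c s)) (v f).

(* Near (t, q), the relation E is the graph of a smooth time dependent field. *)
Definition regular_at (E : R -> S -> vec S -> Prop) (t : R) (q : S) : Prop :=
  exists (x : S -> 'rV[R]_d) y A B (F : 'I_d -> fn R (1 + d)),
  [/\ coords x y A B, A q, forall i, sm (F i) & snear q [set q' | forall s v, 0 <= s <= 1 -> E s q' v ->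
      forall i, v (fun z => x z 0 i) = F i (tv s (x q'))]].

Lemma curve_near (c : R -> S) (t : R) (P : set S) :
  (forall f, smooth f -> {for t, continuous (fun s => f (c s))}) -> snear (c t) P ->
  exists2 b, 0 < b & forall s, `|s - t| < b -> P (c s).
Proof.
move=> cc [A [oA Ap AP]]; have [k [g [e [gs e0 h]]]] := oA _ Ap.
have : \forall s \near t, forall i, `|g i (c s) - g i (c t)| < e.
  apply: near_fin => i; have /cvgrPdist_lt/(_ e e0) := cc _ (gs i). by apply: filterS => s; rewrite distrC.
move=> /nbhs_ballP[b b0 hb]; exists b => // s hs; apply: AP; apply: h. by apply: hb; rewrite /ball/= distrC.
Qed.

Lemma curve_continuous E c t f : curve_of E c -> 0 <= t <= 1 -> smooth f ->
  {for t, continuous (fun s => f (c s))}.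
Proof. by move=> cE /cE[v [_ h]] /h; exact: drv_continuous. Qed.

(** Let tau be the supremum of the times up to which the curves agree. They agree at tau because
    smooth functions separate points, and a little beyond it by Gronwall in the chart of
    [regular_at]; there both curves start from the same point, so regularity along c serves for c'
    too. *)
Lemma curve_unique E c c' : curve_of E c -> curve_of E c' -> c 0 = c' 0 ->
  (forall t, 0 <= t <= 1 -> regular_at E t (c t)) -> forall t, 0 <= t <= 1 -> c t = c' t.
Proof.
move=> cE cE' c0 reg. pose T := [set t | 0 <= t <= 1 /\ forall s, 0 <= s <= t -> c s = c' s]. have T0 : T 0.
  split=> [|s]; first by rewrite lexx ler01.
  by move=> /andP[s0 s1]; have -> : s = 0 by apply/eqP; rewrite eq_le s0 s1. have bT : has_sup T.
  by split; [exists 0|exists 1 => t [/andP[]]]. pose tau := sup T.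
have tau0 : 0 <= tau by apply: ub_le_sup => //; case: bT.
have tau1 : tau <= 1 by apply: ge_sup; [exists 0|move=> t [/andP[]]].
have htau : 0 <= tau <= 1 by rewrite tau0. have lt_tau s : 0 <= s < tau -> c s = c' s.
  move=> /andP[s0 st]; have [t Tt tt] := sup_gt bT.1 st. by case: Tt => _ h; apply: h; rewrite s0 ltW.
have cct f (sf : smooth f) := curve_continuous cE htau sf.
have cct' f (sf : smooth f) := curve_continuous cE' htau sf. have ctau : c tau = c' tau.
  have [tau00|tau00] := eqVneq tau 0; first by rewrite tau00.
  have tp : 0 < tau by rewrite lt_neqAle eq_sym tau00.
  apply: (good_sep gS) => f sf; apply/eqP; rewrite -subr_eq0; apply/negPn/negP => ne.
  have /cvgrPdist_lt/(_ `|f (c tau) - f (c' tau)|) : {for tau, continuous (fun s => f (c s) - f (c' s))}.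
    have [v [_ dv]] := cE tau htau; have [v' [_ dv']] := cE' tau htau.
    exact: drv_continuous (drv_sub (dv f sf) (dv' f sf)). rewrite normr_gt0 => /(_ ne)/nbhs_ballP[b b0 hb].
  pose s := Num.max 0 (tau - b / 2). have st : s < tau by rewrite gt_max tp/= ltrBlDr ltrDl divr_gt0.
  have s0 : 0 <= s by rewrite le_max lexx. have /hb : ball tau b s.
    rewrite /ball/= ger0_norm ?subr_ge0 ?ltW//. have : tau - b / 2 <= s by rewrite le_max lexx orbT.
    by move=> h; lra. by rewrite /= (lt_tau s) ?s0// subrr subr0 ltxx.
have [x [y [A [B [F [cx Aq sF nF]]]]]] := reg tau htau. have sx l := co_smooth cx l.
have nP := snearI (snear_A cx Aq) nF. have nP' := nP; rewrite ctau in nP'.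
have [b1 b10 hb1] := curve_near cct nP; have [b2 b20 hb2] := curve_near cct' nP'.
have bx (e : R -> S) : (forall f, smooth f -> {for tau, continuous (fun s => f (e s))}) ->
    exists2 b, 0 < b & forall s, `|s - tau| < b -> `|x (e s)| <= `|x (e tau)| + 1.
  move=> ec; have n1 : snear (e tau) [set q | `|x q - x (e tau)| < 1].
    exists (x @^-1` [set z | `|z - x (e tau)| < 1]); split=> //.
      by apply: sopen_pre => //; exact: open_norm_lt. by rewrite /= subrr normr0.
  have [b b0 hb] := curve_near ec n1; exists b => // s /hb/= h. by apply/norm_ball/ltW.
have [b3 b30 hb3] := bx c cct; have [b4 b40 hb4] := bx c' cct'; rewrite -ctau in hb4.
pose b := Num.min (Num.min b1 b2) (Num.min b3 b4). have b0 : 0 < b by rewrite !lt_min b10 b20 b30.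
pose tau' := Num.min 1 (tau + b / 2). have tt' : tau <= tau' by rewrite le_min tau1/= lerDl divr_ge0 ?ltW.
have near s : tau <= s <= tau' -> [/\ 0 <= s <= 1, `|s - tau| < b1, `|s - tau| < b2,
    `|s - tau| < b3 & `|s - tau| < b4]. move=> /andP[s1]; rewrite le_min => /andP[s2 s3].
  have : `|s - tau| < b by rewrite ger0_norm ?subr_ge0//; lra.
  by rewrite !lt_min => /andP[/andP[-> ->] /andP[-> ->]]; rewrite s2 (le_trans tau0 s1).
pose r := Num.max 1 (`|x (c tau)| + 1).
have /choice[K hK] : forall i, exists K, 0 <= K /\ forall z w, `|z| <= r -> `|w| <= r ->
    `|F i w - F i z| <= K * `|w - z|. by move=> i; have [K K0 hK] := sm_lip r (sF i); exists K.
pose D (s : R) := x (c s) - x (c' s).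
pose dD (s : R) := \row_i (F i (tv s (x (c s))) - F i (tv s (x (c' s)))) : 'rV[R]_d.
have gr := @gronwall_rV R d D dD (\sum_i K i) tau tau' tau. have eqD s : tau <= s <= tau' -> c s = c' s.
  move=> hs; have D0 : D s = 0. apply: gr => //.
    - move=> t ht i; have [h01 h1 h2 _ _] := near t ht.
      have [v [Ev dv]] := cE t h01; have [v' [Ev' dv']] := cE' t h01.
      have [_ Fv] := hb1 t h1; have [_ Fv'] := hb2 t h2. have e1 := drv_sub (dv _ (sx i)) (dv' _ (sx i)).
      apply: (drv_eq e1) => [u|]; first by rewrite /D !mxE. by rewrite mxE (Fv t v h01 Ev) (Fv' t v' h01 Ev').
    - move=> t ht; have [h01 _ _ h3 h4] := near t ht.
      have K0 : 0 <= \sum_i K i by apply: sumr_ge0 => i _; case: (hK i).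
      apply: norm_le_coord; first by rewrite mulr_ge0. move=> i; rewrite mxE.
      have nr (w : 'rV[R]_d) : `|w| <= `|x (c tau)| + 1 -> `|tv t w| <= r.
        move=> hw; apply: le_trans (tv_norm w h01) _; rewrite ge_max /r le_max lexx/=.
        by rewrite le_max hw orbT. have [Ki hKi] := hK i.
      apply: le_trans (hKi _ _ (nr _ (hb4 t h4)) (nr _ (hb3 t h3))) _.
      have -> : tv t (x (c t)) - tv t (x (c' t)) = row_mx 0 (D t). by rewrite opp_row_mx add_row_mx subrr.
      have n0 : `|row_mx (0 : 'rV[R]_1) (D t)| <= `|D t|. by apply: norm_row_mx_le; rewrite ?normr0.
      apply: le_trans (ler_wpM2l Ki n0) _; apply: ler_wpM2r => //.
      rewrite (bigD1 i)//= lerDl; apply: sumr_ge0 => k _; by case: (hK k).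
    - by rewrite lexx.
    - by rewrite /D ctau subrr. have [_ h1 h2 _ _] := near s hs.
  have [A1 _] := hb1 s h1; have [A2 _] := hb2 s h2.
  by rewrite -(co_yx cx A1) -(co_yx cx A2); congr y; apply/eqP; rewrite -subr_eq0 -/(D s) D0.
have Tt' : T tau'. split; first by rewrite (le_trans tau0 tt')/= ge_min lexx.
  move=> s /andP[s0 s1]; have [st|ts] := ltP s tau; first by apply: lt_tau; rewrite s0.
  by apply: eqD; rewrite ts. have : tau' <= tau by apply: ub_le_sup => //; case: bT.
rewrite ge_min => /orP[t1|]; last by rewrite gerDl leNgt divr_gt0.
move=> t /andP[t0 t1']; case: Tt' => _ h; apply: h; rewrite t0/=. by rewrite le_min t1'/=; lra.
Qed.

End CurveUniqueness.

(** * Poisson structures in coordinates *)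

Section PoissonCoordinates.
Variables (R : realType) (m : nat) (M : diffspace R) (pi : M -> covec M -> covec M -> R).
Hypotheses (gM : good m M) (pP : poisson pi).
#[local] Hint Resolve gM : core.

Lemma poisson0l x b : cotangent x b -> pi x (fun=> 0) b = 0.
Proof.
move=> cb; have c0 : cotangent x (fun=> 0 : R) by exact: dual_of0. have := poisson_linear pP 1 c0 c0 cb.
have -> : 1 \*o (fun=> 0) \+ (fun=> 0) = (fun=> 0) :> covec M. by apply/funext => v /=; rewrite mulr0 addr0.
by rewrite mul1r => /esym/eqP; rewrite -subr_eq0 addrK => /eqP.
Qed.

Lemma cot_comb x (I : Type) (s : seq I) (t : I -> R) (a : I -> covec M) :
  (forall i, cotangent x (a i)) -> cotangent x (fun v => \sum_(i <- s) t i * a i v).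
Proof.
move=> ca; elim: s => [|i s ih]. by under eq_fun do rewrite big_nil; exact: dual_of0.
under eq_fun do rewrite big_cons; exact: dual_lin (ca i) ih.
Qed.

Lemma poisson_comb x (I : Type) (s : seq I) (t : I -> R) (a : I -> covec M) b :
  (forall i, cotangent x (a i)) -> cotangent x b ->
  pi x (fun v => \sum_(i <- s) t i * a i v) b = \sum_(i <- s) t i * pi x (a i) b.
Proof.
move=> ca cb; elim: s => [|i s ih]. by under eq_fun do rewrite big_nil; rewrite big_nil poisson0l.
rewrite big_cons -ih; under eq_fun do rewrite big_cons. by apply: (poisson_linear pP) => //; exact: cot_comb.
Qed.

Lemma poisson_comb2 x (I J : Type) (s : seq I) (s' : seq J) (t : I -> R) (t' : J -> R)
    (a : I -> covec M) (b : J -> covec M) : (forall i, cotangent x (a i)) -> (forall j, cotangent x (b j)) ->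
  pi x (fun v => \sum_(i <- s) t i * a i v) (fun v => \sum_(j <- s') t' j * b j v) =
  \sum_(i <- s) \sum_(j <- s') t i * t' j * pi x (a i) (b j).
Proof.
move=> ca cb; rewrite poisson_comb//; last exact: cot_comb.
apply: eq_bigr => i _; rewrite (poisson_skew pP)//; last exact: cot_comb.
rewrite poisson_comb// -sumrN mulr_sumr; apply: eq_bigr => j _. by rewrite [in RHS](poisson_skew pP)//; ring.
Qed.

Lemma bracket_smooth f g : smooth f -> smooth g -> smooth (bracket pi f g).
Proof. by move=> sf sg; apply: (poisson_smooth pP); exact: form1_diff. Qed.

Lemma sharp_tangent x a : cotangent x a -> tangent x (sharp pi x a).
Proof.
move=> ca; have D f g : (forall v, tangent x v -> v f = v g) -> diff_at f x = diff_at g x.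
  move=> h; apply/funext => v; have [hv|nv] := pselect (tangent x v). by rewrite !diff_atE// h.
  by rewrite /diff_at !patchN// notin_setE. have D0 : forall f, ~ smooth f -> diff_at f x = fun=> 0 : R.
  move=> f nf; apply/funext => v; have [hv|nv] := pselect (tangent x v).
    by rewrite diff_atE//; case: hv => ->. by rewrite /diff_at !patchN// notin_setE. split.
- move=> f nf; rewrite /sharp D0// (poisson_skew pP)//; last exact: dual_of0. by rewrite poisson0l// oppr0.
- move=> t f g sf sg; rewrite /sharp. have -> : diff_at (t \*o f \+ g) x = t \*o diff_at f x \+ diff_at g x.
    apply/funext => v /=; have [hv|nv] := pselect (tangent x v). by rewrite !diff_atE//; case: hv => _ ->.
    by rewrite /diff_at !patchN ?notin_setE// mulr0 addr0.
  have cf := diff_at_cotangent x sf; have cg := diff_at_cotangent x sg.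
  rewrite (poisson_skew pP ca); last exact: dual_lin. rewrite (poisson_linear pP)//.
  by rewrite (poisson_skew pP ca cf) (poisson_skew pP ca cg); ring.
- move=> f g sf sg; rewrite /sharp. have -> : diff_at (f \* g) x = (g x) \*o diff_at f x \+
      ((f x) \*o diff_at g x \+ (fun=> 0)). apply/funext => v /=; have [hv|nv] := pselect (tangent x v).
      by rewrite !diff_atE//; case: hv => _ _ ->//; rewrite addr0 mulrC.
    by rewrite /diff_at !patchN ?notin_setE// !mulr0 !addr0.
  have cf := diff_at_cotangent x sf; have cg := diff_at_cotangent x sg.
  have c0 : cotangent x (fun=> 0 : R) by exact: dual_of0. have cfg := dual_lin (f x) cg c0.
  rewrite (poisson_skew pP ca); last exact: dual_lin. rewrite !(poisson_linear pP)// poisson0l//.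
  by rewrite (poisson_skew pP ca cf) (poisson_skew pP ca cg); ring.
Qed.

Section InChart.
Variables (y : M -> 'rV[R]_m) (y' : 'rV[R]_m -> M) (A : set M) (B : set 'rV[R]_m).
Hypothesis cy : coords y y' A B.
Let sy k : smooth (fun q => y q 0 k) := co_smooth cy k.
Notation dy k := (diff_at (fun q : M => y q 0 k)).

Lemma cot_dy q k : cotangent q (dy k q). Proof. exact: diff_at_cotangent. Qed.

Lemma cot_sum_dy q a : A q -> cotangent q a -> a = fun v => \sum_k ccode y y' q a 0 k * dy k q v.
Proof.
move=> Aq ca; apply: (dual_ext ca); first by apply: cot_comb => k; exact: cot_dy.
move=> v hv; rewrite (cot_code gM cy Aq ca hv); apply: eq_bigr => k _; congr *%R. by rewrite diff_atE// mxE.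
Qed.

Lemma ccode_diff q f F : A q -> smooth f -> sm F -> snear q [set r | f r = F (y r)] ->
  ccode y y' q (diff_at f q) = \row_k pd k F (y q).
Proof.
move=> Aq sf sF nF; apply/rowP => k; rewrite !mxE diff_atE; last exact: (tvec_tangent gM cy).
rewrite (tvecE cy _ Aq sf sF nF) (bigD1 k)//= big1 ?addr0; first by rewrite mxE !eqxx mul1r.
by move=> l lk; rewrite mxE eqxx (negPf lk) mul0r.
Qed.

Lemma poisson_code q a b : A q -> cotangent q a -> cotangent q b ->
  pi q a b = \sum_j \sum_k ccode y y' q a 0 j * ccode y y' q b 0 k *
    bracket pi (fun q => y q 0 j) (fun q => y q 0 k) q.
Proof.
move=> Aq ca cb; rewrite {1}(cot_sum_dy Aq ca) {1}(cot_sum_dy Aq cb).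
by rewrite poisson_comb2// => k; exact: cot_dy.
Qed.

Lemma sharp_code q a k : A q -> cotangent q a -> sharp pi q a (fun q => y q 0 k) = \sum_j ccode y y' q a 0 j *
    bracket pi (fun q => y q 0 j) (fun q => y q 0 k) q.
Proof.
move=> Aq ca; rewrite /sharp {1}(cot_sum_dy Aq ca) poisson_comb//; first last. exact: cot_dy.
by move=> j; exact: cot_dy.
Qed.

(** The graph of the bivector is framed by the pairs of pi^sharp(dy_j) and dy_j. The covector part
    of the bracket of two of them is d{y_j, y_i}, whence the partial derivatives of [Pi j i] as
    structure functions. *)
Definition poisson_frame (Pi : 'I_m -> 'I_m -> fn R m) z :=
  dirac_frame_at Pi (fun j k _ => (j == k)%:R) (fun j i l => pd l (Pi j i)) z.

Lemma poisson_frame_skew Pi z j k : poisson_frame Pi z -> Pi j k z = - Pi k j z.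
Proof. move=> [/(_ j k) + _ _]; rewrite big_split/= !sum_deltar. by move/eqP; rewrite addr_eq0 => /eqP. Qed.

Lemma poisson_rep q : A q -> exists Pi : 'I_m -> 'I_m -> fn R m,
  [/\ forall j k, sm (Pi j k), snear q [set z | forall j k,
      bracket pi (fun q => y q 0 j) (fun q => y q 0 k) z = Pi j k (y z)] &
    \forall z \near y q, poisson_frame Pi z].
Proof.
move=> Aq; pose br j k := bracket pi (fun q => y q 0 j) (fun q => y q 0 k).
have sbr j k : smooth (br j k) by exact: bracket_smooth.
have [P hP] := co_ext_fam cy (fun jk => sbr jk.1 jk.2) Aq. pose Pi j k := P (j, k).
have sP j k : sm (Pi j k) by case: (hP (j, k)).
have nP : snear q [set z | forall j k, br j k z = Pi j k (y z)].
  by apply: snearS (snear_fin (fun jk => (hP jk).2)) => z h j k; exact: (h (j, k)). exists Pi; split=> //.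
suff nQ : snear q [set z | poisson_frame Pi (y z)]. apply: filterS (near_pull cy Aq nQ) => z /= [Bz].
  by rewrite (co_xy cy). apply: snear2 (snear_A cy Aq) (snear_snear nP) _ => z Az nPz.
have Pz := snear_self nPz. have skew j k : Pi j k (y z) = - Pi k j (y z).
  rewrite -!Pz /br /bracket; apply: (poisson_skew pP); exact: cot_dy.
have brE k f F : smooth f -> sm F -> snear z [set r | f r = F (y r)] ->
    bracket pi (fun q => y q 0 k) f z = \sum_l pd l F (y z) * Pi k l (y z).
  move=> sf sF nF; have cd := diff_at_cotangent z sf. rewrite /bracket (poisson_skew pP (cot_dy z k) cd).
  rewrite {1}(cot_sum_dy Az cd) poisson_comb; last 2 first.
  - by move=> l; exact: cot_dy.
  - exact: cot_dy. rewrite -sumrN; apply: eq_bigr => l _; rewrite (ccode_diff Az sf sF nF) mxE.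
  by rewrite -Pz /br /bracket (poisson_skew pP (cot_dy z k))//; [ring|exact: cot_dy].
have nPjk j k : snear z [set r | br j k r = Pi j k (y r)]. by apply: snearS nPz => r; apply.
have dpd (b : bool) (l : 'I_m) : pd l (fun _ : 'rV[R]_m => b%:R : R) (y z) = 0. by rewrite D_cst. split.
- by move=> i j; rewrite big_split/= !sum_deltar skew addNr.
(* The Jacobi identity for three coordinate functions is closedness of the frame under the Lie
   bracket of its vector parts. *)
- move=> j i k. have := poisson_jacobi pP z (sy j) (sy i) (sy k). rewrite -/(br i k) -/(br k j) -/(br j i).
  rewrite (brE j _ _ (sbr i k) (sP i k) (nPjk i k)) (brE i _ _ (sbr k j) (sP k j) (nPjk k j)).
  rewrite (brE k _ _ (sbr j i) (sP j i) (nPjk j i)) => jac0.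
  have pds l : pd l (Pi k j) (y z) = - pd l (Pi j k) (y z).
    have -> : - pd l (Pi j k) (y z) = pd l (fun w => 0 - Pi j k w) (y z).
      by rewrite D_sub ?D_cst ?sub0r//; exact: sm_cst.
    apply: pd_near; apply: filterS (near_pull cy Az nPz) => w /= [Bw h].
    rewrite sub0r -(co_xy cy Bw) -!h /br /bracket; apply: (poisson_skew pP); exact: cot_dy.
  apply/eqP; rewrite -subr_eq0; apply/eqP; rewrite -[RHS]jac0.
  rewrite -sumrB -!big_split; apply: eq_bigr => l _ /=. by rewrite pds (skew l k); ring.
- move=> j i k; rewrite (eq_bigr (fun l => (i == l)%:R * pd k (Pi j l) (y z))); last first.
    by move=> l _; rewrite !dpd; ring.
  by rewrite sum_deltal -[LHS](sum_deltar (fun l => pd l (Pi j i) (y z))); apply: eq_bigr => l _; rewrite eq_sym.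
Qed.

End InChart.
End PoissonCoordinates.

Section TwoForms.
Variable R : realType.

Lemma sum_trunc (a : nat -> R) N N' : (forall l, (N <= l)%N -> a l = 0) ->
  (forall l, (N' <= l)%N -> a l = 0) -> \sum_(l < N) a l = \sum_(l < N') a l.
Proof.
have key k k' : (k <= k')%N -> (forall l, (k <= l)%N -> a l = 0) -> \sum_(l < k) a l = \sum_(l < k') a l.
  move=> kk' h; rewrite -!(big_mkord xpredT) (@big_cat_nat _ _ _ k _ k')//=.
  rewrite [X in _ = _ + X]big1_seq ?addr0// => l; rewrite mem_index_iota => /andP[_ /andP[kl _]]. exact: h.
move=> h h'; have [NN|NN] := leqP N N'; first exact: key. by rewrite -(key _ _ (ltnW NN) h').
Qed.

Lemma D_near n (f g : fn R n) v x : sm f -> sm g -> (\forall z \near x, f z = g z) -> 'D_v f x = 'D_v g x.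
Proof.
move=> sf sg h; rewrite !derive_pd; try exact: sm_diff. by apply: eq_bigr => i _; congr *%R; exact: pd_near.
Qed.

(** Two local expressions of one 1-form have the same exterior derivative; the terms with second
    derivatives cancel by symmetry. *)
Lemma two_form n (I J : finType) (a y : I -> fn R n) (g h : J -> fn R n) q :
  (forall i, sm (a i)) -> (forall i, sm (y i)) -> (forall i, sm (g i)) -> (forall i, sm (h i)) ->
  (forall v, \forall z \near q, \sum_i a i z * 'D_v (y i) z = \sum_j g j z * 'D_v (h j) z) -> forall v w,
  \sum_i ('D_w (a i) q * 'D_v (y i) q - 'D_v (a i) q * 'D_w (y i) q) =
  \sum_j ('D_w (g j) q * 'D_v (h j) q - 'D_v (g j) q * 'D_w (h j) q).
Proof.
move=> sa sy sg sh E v w.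
have s1 (K : finType) (b z : K -> fn R n) u : (forall i, sm (b i)) -> (forall i, sm (z i)) ->
    sm (fun x => \sum_i b i x * 'D_u (z i) x).
  by move=> sb sz; apply: sm_sum => i; apply: sm_mul => //; exact: sm_derive.
have D (K : finType) (b z : K -> fn R n) : (forall i, sm (b i)) -> (forall i, sm (z i)) ->
    'D_w (fun x => \sum_i b i x * 'D_v (z i) x) q - 'D_v (fun x => \sum_i b i x * 'D_w (z i) x) q =
    \sum_i ('D_w (b i) q * 'D_v (z i) q - 'D_v (b i) q * 'D_w (z i) q).
  move=> sb sz; have s2 i u : sm (fun x => b i x * 'D_u (z i) x). by apply: sm_mul => //; exact: sm_derive.
  rewrite !D_sum// -sumrB; apply: eq_bigr => i _. rewrite !D_mul//; try exact: sm_derive.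
  by rewrite (schwarz w v)//; ring.
rewrite -(D I)// -(D J)//; congr (_ - _); apply: D_near; try exact: s1; exact: E.
Qed.

Lemma D_slice n (g : fn R (1 + n)) (t : R) z w : 'D_(row_mx 0 w) g (tv t z) = 'D_w (fun z => g (tv t z)) z.
Proof.
rewrite /derive; set F := (fun h : R => _); set G := (fun h : R => _). suff -> : F = G by [].
apply/funext => h; rewrite /F /G /=; congr (_ *: (g _ - _)). by rewrite scale_row_mx add_row_mx scaler0 add0r.
Qed.

End TwoForms.

(* The data of the construction: f_l on M and W_l on X satisfy
   sum_l v(f_l \o i) W_l = v for v in TX, locally finitely. *)
Record setting (R : realType) (n r m : nat) (X M : diffspace R)
    (L : X -> set (vec X * covec X)) (C : X -> set (vec X))
    (pi : M -> covec M -> covec M -> R) (i : X -> M)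
    (f : nat -> M -> R) (W : nat -> X -> vec X) : Prop := Setting {
  st_mX : manifold n X;
  st_dL : dirac_structure L;
  st_dim : forall x, has_dim r (tangent_part L x);
  st_comp : complement_of (tangent_part L) C;
  st_mM : manifold m M;
  st_pi : poisson pi;
  st_emb : coisotropic_embedding L pi i;
  st_f : forall l, smooth (f l);
  st_W : forall l, field (W l);
  st_fam : forall p, exists N, snear p [set q |
      (forall l, (N <= l)%N -> W l q = fun=> 0) /\
      forall u, tangent q u -> u = fun h => \sum_(l < N) u (f l \o i) * W l q h] }.

Section Germs.
Variables (R : realType) (d : nat) (S : diffspace R).
Hypothesis gS : good d S.

(** [prim] is smooth only near the zero section, and by convention a tangent vector is 0 on
    functions that are not globally smooth. A smooth function with the same germ is therefore chosen
    before differentiating. *)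
Definition germ (q : S) (h : S -> R) : S -> R :=
  xget (fun=> 0) [set g | smooth g /\ snear q [set z | h z = g z]].

Lemma germP q h g : smooth g -> snear q [set z | h z = g z] ->
  smooth (germ q h) /\ forall v, tangent q v -> v (germ q h) = v g.
Proof.
move=> sg ng; rewrite /germ; case: xgetP => [k -> /= [sk nk]|/(_ g)]; last by case.
split=> // v hv; apply: (tan_local gS hv) => //. by apply: snear2 ng nk _ => z /= -> ->.
Qed.

End Germs.

(* The frame of pr^! L in the coordinates dual_x. *)
Definition mxA (R : realType) n r (Ah : 'I_n -> 'I_n -> fn R n) (u : 'rV[R]_n) : 'M[R]_(n + r) :=
  block_mx (\matrix_(a, b) Ah a b u) 0 0 1%:M.
Definition mxB (R : realType) n r (Bh : 'I_n -> 'I_n -> fn R n) (u : 'rV[R]_n) : 'M[R]_(n + r) :=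
  block_mx (\matrix_(a, b) Bh a b u) 0 0 0.

Lemma tube_lower (R : realType) n (g : fn R (1 + n)) z0 : sm g ->
  (forall t : R, 0 <= t <= 1 -> 0 < g (tv t z0)) -> exists2 e, 0 < e &
  \forall z \near z0, forall t, 0 <= t <= 1 -> e < g (tv t z).
Proof.
move=> sg g0.
have [t0 ht0 hmin] : exists2 t0, t0 \in `[0, 1] & forall t, t \in `[0, 1] -> g (tv t0 z0) <= g (tv t z0).
  apply: (EVT_min (f := fun t : R => g (tv t z0))) => //. apply: continuous_subspaceT => t.
  exact: drv_continuous (derive_tv (sm_diff (tv t z0) sg)).
have m0 : 0 < g (tv t0 z0) by apply: g0; rewrite in_itv in ht0.
have m20 : 0 < g (tv t0 z0) / 2 by rewrite divr_gt0.
exists (g (tv t0 z0) / 2) => //; have [b b0 hb] := tube z0 sg m20.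
apply/nbhs_rVP; exists b => // z hz t ht; have := hb t z ht hz; rewrite ltr_norml => /andP[+ _].
have := hmin t; rewrite in_itv => /(_ ht); lra.
Qed.

(* d(c d(f - g) - c' dk + k' dc) + (dc /\ dk)' = 0 on vectors tangent to the
   slices of T, for k = f + T (g - f), where ' is the derivative along e. *)
Lemma moser_cancel (R : realType) k (c f g T : fn R k) e w v q : sm c -> sm f -> sm g -> sm T ->
  'D_w T q = 0 -> 'D_v T q = 0 -> 'D_e T q = 1 -> let kk u x := 'D_u f x + T x * ('D_u g x - 'D_u f x) in
  'D_w c q * 'D_v (fun x => f x - g x) q - 'D_v c q * 'D_w (fun x => f x - g x) q +
  'D_w (fun x => - ('D_e c x * (1 - T x))) q * 'D_v f q -
  'D_v (fun x => - ('D_e c x * (1 - T x))) q * 'D_w f q + 'D_w (fun x => - ('D_e c x * T x)) q * 'D_v g q -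
  'D_v (fun x => - ('D_e c x * T x)) q * 'D_w g q +
  'D_w (fun x => kk e x) q * 'D_v c q - 'D_v (fun x => kk e x) q * 'D_w c q +
  'D_e (fun x => 'D_w c x * kk v x - 'D_v c x * kk w x) q = 0.
Proof.
move=> sc' sf sg sT wT vT eT kk. have sD u (h : fn R k) : sm h -> sm ('D_u h) by exact: sm_derive.
have s1 : sm (fun x => 1 - T x) by apply: sm_sub => //; exact: sm_cst.
have sfg u : sm (fun x => 'D_u g x - 'D_u f x) by apply: sm_sub; exact: sD.
have sTfg u : sm (fun x => T x * ('D_u g x - 'D_u f x)) by exact: sm_mul.
have sk u : sm (kk u) by apply: sm_add => //; exact: sD.
have sO (h : fn R k) u : sm h -> 'D_u (fun x => - h x) q = - 'D_u h q.
  move=> sh; have := D_sub u q (sm_cst k 0) sh; rewrite D_cst sub0r => <-.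
  by have -> : (fun x => 0 - h x) = fun x => - h x by apply/funext => x; rewrite sub0r.
have E0 u : 'D_u (fun x => f x - g x) q = 'D_u f q - 'D_u g q by exact: D_sub.
have E1 u : 'D_u T q = 0 -> 'D_u (fun x => - ('D_e c x * (1 - T x))) q = - ('D_e ('D_u c) q * (1 - T q)).
  move=> uT; rewrite sO; last by apply: sm_mul => //; exact: sD. rewrite D_mul//; last exact: sD.
  by rewrite D_sub ?D_cst ?uT//; [rewrite subr0 mulr0 addr0 (schwarz u e)|exact: sm_cst].
have E2 u : 'D_u T q = 0 -> 'D_u (fun x => - ('D_e c x * T x)) q = - ('D_e ('D_u c) q * T q).
  move=> uT; rewrite sO; last by apply: sm_mul => //; exact: sD.
  by rewrite D_mul//; [rewrite uT mulr0 addr0 (schwarz u e)|exact: sD].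
have E3 u u' : 'D_u (fun x => kk u' x) q = 'D_u ('D_u' f) q + ('D_u T q * ('D_u' g q - 'D_u' f q) +
    T q * ('D_u ('D_u' g) q - 'D_u ('D_u' f) q)). by rewrite /kk D_add ?D_mul ?D_sub//; exact: sD.
have S u h : sm h -> 'D_u ('D_e h) q = 'D_e ('D_u h) q by move=> sh; exact: schwarz.
have E3w u : 'D_u T q = 0 -> 'D_u (fun x => kk e x) q =
    'D_e ('D_u f) q + T q * ('D_e ('D_u g) q - 'D_e ('D_u f) q).
  by move=> uT; rewrite E3 uT mul0r add0r (S u f sf) (S u g sg). have E3e u : 'D_e (fun x => kk u x) q =
    'D_e ('D_u f) q + ('D_u g q - 'D_u f q + T q * ('D_e ('D_u g) q - 'D_e ('D_u f) q)).
  by rewrite E3 eT mul1r. have E4 : 'D_e (fun x => 'D_w c x * kk v x - 'D_v c x * kk w x) q =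
    'D_e ('D_w c) q * kk v q + 'D_w c q * 'D_e (fun x => kk v x) q -
    ('D_e ('D_v c) q * kk w q + 'D_v c q * 'D_e (fun x => kk w x) q).
  have s2 u u' : sm (fun x => 'D_u c x * kk u' x) by apply: sm_mul => //; exact: sD.
  by rewrite (D_sub e q (s2 w v) (s2 v w)) (D_mul e q (sD w c sc') (sk v)) (D_mul e q (sD v c sc') (sk w)).
have alg (cw cv fw fv gw gv cew cev few fev gew gev t a1 a2 a3 a4 a5 a6 a7 a8 a9 b1 b2 : R) :
    a1 = fv - gv -> a2 = fw - gw -> a3 = - (cew * (1 - t)) -> a4 = - (cev * (1 - t)) ->
    a5 = - (cew * t) -> a6 = - (cev * t) -> a7 = few + t * (gew - few) -> a8 = fev + t * (gev - fev) ->
    b1 = fev + (gv - fv + t * (gev - fev)) -> b2 = few + (gw - fw + t * (gew - few)) ->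
    a9 = cew * (fv + t * (gv - fv)) + cw * b1 - (cev * (fw + t * (gw - fw)) + cv * b2) ->
    cw * a1 - cv * a2 + a3 * fv - a4 * fw + a5 * gv - a6 * gw + a7 * cv - a8 * cw + a9 = 0.
  by move=> -> -> -> -> -> -> -> -> -> -> ->; ring.
exact: alg (E0 v) (E0 w) (E1 w wT) (E1 v vT) (E2 w wT) (E2 v vT) (E3w w wT) (E3w v vT) (E3e v) (E3e w) E4.
Qed.

(** * Moser's method in coordinates *)

Section Moser.
Variables (R : realType) (n r N : nat).
Notation D := (n + r)%N.
Variables (Ah Bh : 'I_n -> 'I_n -> fn R n) (c : 'I_n -> 'I_n -> 'I_n -> fn R n).
Variables (Ch Fh Ih : 'I_N -> fn R D) (z0 : 'rV[R]_D).
Hypotheses (sA : forall i l, sm (Ah i l)) (sB : forall i l, sm (Bh i l)).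
Hypothesis sc : forall j i l, sm (c j i l).
Hypotheses (sC : forall l, sm (Ch l)) (sF : forall l, sm (Fh l)) (sI : forall l, sm (Ih l)).

Definition tm (q : 'rV[R]_(1 + D)) : R := q 0 (lshift D 0).

(** The partial derivative of (1 - t) F_l + t I_l in the direction a, with t held fixed. *)
Definition kd t l a z := pd a (Fh l) z + t * (pd a (Ih l) z - pd a (Fh l) z).

Definition etaM (q : 'rV[R]_(1 + D)) : 'M[R]_D := \matrix_(a, b) \sum_l
  (pd a (Ch l) (rsubmx q) * kd (tm q) l b (rsubmx q) - pd b (Ch l) (rsubmx q) * kd (tm q) l a (rsubmx q)).

(** The covector parts of the frame of pr^! L after the gauge transformation by [etaM]. Its
    invertibility says that the twisted structure is the graph of a bivector. *)
Definition frameM (q : 'rV[R]_(1 + D)) : 'M[R]_D :=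
  mxB r Bh (lsubmx (rsubmx q)) + mxA r Ah (lsubmx (rsubmx q)) *m etaM q.

(** A primitive of minus the t-derivative of the moving 2-form. It carries the factors C_l and so
    vanishes on the zero section. *)
Definition primM (z : 'rV[R]_D) : 'rV[R]_D := \row_a \sum_l Ch l z * (pd a (Fh l) z - pd a (Ih l) z).

Definition frame_det q : R := \det (frameM q).

(* The coordinates s of the Moser field in the frame, s frameM = primM; the
   denominator is det^2 when det^2 >= e, and does not vanish. *)
Definition fieldS e q : 'rV[R]_D :=
  (frame_det q / (frame_det q ^+ 2 + step (e - frame_det q ^+ 2))) *: (primM (rsubmx q) *m \adj (frameM q)).

Definition fieldV e q : 'rV[R]_D := fieldS e q *m mxA r Ah (lsubmx (rsubmx q)).

Lemma tm_tv t z : tm (tv t z) = t. Proof. by rewrite /tm row_mxEl mxE eqxx. Qed.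

Lemma sm_r (h : fn R D) : sm h -> sm (fun q : 'rV[R]_(1 + D) => h (rsubmx q)).
Proof. by move=> sh; apply: (sm_comp (F := h)) => // k; exact: sm_rsubmx. Qed.

Lemma sm_lr (h : fn R n) : sm h -> sm (fun q : 'rV[R]_(1 + D) => h (lsubmx (rsubmx q))).
Proof.
move=> sh; apply: (sm_r (h := fun z => h (lsubmx z))). by apply: (sm_comp (F := h)) => // k; exact: sm_lsubmx.
Qed.

Lemma sm_block (a : 'rV[R]_(1 + D) -> 'M[R]_n) (b : 'M[R]_r) :
  (forall i j, sm (fun q => a q i j)) -> forall i j, sm (fun q => block_mx (a q) 0 0 b i j).
Proof.
move=> sa i j; case: (fintype.split_ordP i) => i' ->; case: (fintype.split_ordP j) => j' ->.
- by apply: sm_ext (sa i' j') => q; rewrite block_mxEul.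
- by apply: sm_ext (sm_cst D.+1 0) => q; rewrite block_mxEur mxE.
- by apply: sm_ext (sm_cst D.+1 0) => q; rewrite block_mxEdl mxE.
- by apply: sm_ext (sm_cst D.+1 (b i' j')) => q; rewrite block_mxEdr.
Qed.

Lemma sm_mxA i j : sm (fun q : 'rV[R]_(1 + D) => mxA r Ah (lsubmx (rsubmx q)) i j).
Proof. apply: sm_block => a b. by apply: sm_ext (sm_lr (sA a b)) => q; rewrite mxE. Qed.

Lemma sm_mxB i j : sm (fun q : 'rV[R]_(1 + D) => mxB r Bh (lsubmx (rsubmx q)) i j).
Proof. apply: sm_block => a b. by apply: sm_ext (sm_lr (sB a b)) => q; rewrite mxE. Qed.

Lemma sm_kd l a : sm (fun q => kd (tm q) l a (rsubmx q)).
Proof.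
apply: sm_add; first by apply: (sm_r (h := pd a (Fh l))); exact: sm_derive.
apply: sm_mul; first exact: sm_coord.
by apply: sm_sub; [apply: (sm_r (h := pd a (Ih l)))|apply: (sm_r (h := pd a (Fh l)))]; exact: sm_derive.
Qed.

Lemma sm_mulmx k k' (a : 'rV[R]_(1 + D) -> 'M[R]_(k, D)) (b : 'rV[R]_(1 + D) -> 'M[R]_(D, k')) :
  (forall i j, sm (fun q => a q i j)) -> (forall i j, sm (fun q => b q i j)) ->
  forall i j, sm (fun q => (a q *m b q) i j).
Proof.
move=> sa sb i j; apply: (sm_ext (f := fun q => \sum_l a q i l * b q l j)); first by move=> q; rewrite mxE.
by apply: sm_sum => l; exact: sm_mul.
Qed.

Lemma sm_frameM i j : sm (fun q => frameM q i j).
Proof.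
apply: (sm_ext (f := fun q => mxB r Bh (lsubmx (rsubmx q)) i j +
    (mxA r Ah (lsubmx (rsubmx q)) *m etaM q) i j)); first by move=> q; rewrite [RHS]mxE.
apply: sm_add; first exact: sm_mxB. apply: sm_mulmx => a b; first exact: sm_mxA.
apply: (sm_ext (f := fun q => \sum_l (pd a (Ch l) (rsubmx q) * kd (tm q) l b (rsubmx q) -
   pd b (Ch l) (rsubmx q) * kd (tm q) l a (rsubmx q)))); first by move=> q; rewrite mxE.
apply: sm_sum => l; apply: sm_sub; apply: sm_mul; try exact: sm_kd.
  by apply: (sm_r (h := pd a (Ch l))); exact: sm_derive.
by apply: (sm_r (h := pd b (Ch l))); exact: sm_derive.
Qed.

Lemma sm_frame_det : sm frame_det.
Proof. by apply: Cinf_det => // i j; exact: sm_frameM. Qed.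

Lemma sm_primM a : sm (fun q : 'rV[R]_(1 + D) => primM (rsubmx q) 0 a).
Proof.
apply: (sm_r (h := fun z => primM z 0 a)).
apply: (sm_ext (f := fun z => \sum_l Ch l z * (pd a (Fh l) z - pd a (Ih l) z))); first by move=> z; rewrite mxE.
by apply: sm_sum => l; apply: sm_mul => //; apply: sm_sub; exact: sm_derive.
Qed.

Lemma fieldS_den e q : 0 < e -> 0 < frame_det q ^+ 2 + step (e - frame_det q ^+ 2).
Proof.
move=> e0; have := sqr_ge0 (frame_det q); rewrite le_eqVlt => /orP[/eqP <-|h].
  by rewrite add0r subr0 step_gt0. by rewrite ltr_pwDl// step_ge0.
Qed.

Lemma sm_fieldS e a : 0 < e -> sm (fun q => fieldS e q 0 a).
Proof.
move=> e0; have s2 : sm (fun q => frame_det q ^+ 2) by apply: sm_exp; exact: sm_frame_det.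
apply: (sm_ext (f := fun q => frame_det q / (frame_det q ^+ 2 + step (e - frame_det q ^+ 2)) *
    (primM (rsubmx q) *m \adj (frameM q)) 0 a)); first by move=> q; rewrite [RHS]mxE. apply: sm_mul.
  apply: sm_mul; first exact: sm_frame_det. move=> k; apply: Ck_inv => //.
    by move=> q _; rewrite lt0r_neq0// fieldS_den.
  have h : sm (fun q => frame_det q ^+ 2 + step (e - frame_det q ^+ 2)).
    by apply: sm_add => //; apply: sm_step; apply: sm_sub => //; exact: sm_cst. exact: h.
apply: (sm_mulmx (a := fun q => primM (rsubmx q))) => i j. by rewrite (ord1 i); exact: sm_primM.
apply: (sm_ext (f := fun q => (-1) ^+ (j + i) * \det (row' j (col' i (frameM q))))). by move=> q; rewrite mxE.
apply: sm_mul; first exact: sm_cst. apply: Cinf_det => // a' b'.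
by apply: sm_ext (sm_frameM (lift j a') (lift i b')) => q; rewrite !mxE.
Qed.

Lemma sm_fieldV e a : 0 < e -> sm (fun q => fieldV e q 0 a).
Proof.
move=> e0; apply: (sm_mulmx (a := fieldS e)) => i j; last exact: sm_mxA.
by rewrite (ord1 i); exact: sm_fieldS.
Qed.

Lemma fieldSE e q : 0 < e -> e <= frame_det q ^+ 2 -> fieldS e q *m frameM q = primM (rsubmx q).
Proof.
move=> e0 eq; rewrite /fieldS step0 ?subr_le0// addr0 -scalemxAl -mulmxA mul_adj_mx mul_mx_scalar.
have d0 : frame_det q != 0 by rewrite -sqrf_eq0 lt0r_neq0// (lt_le_trans e0).
by rewrite scalerA -/(frame_det q) expr2 invfM mulrA divff// mul1r mulVf// scale1r.
Qed.

Lemma fieldS_unique e q s : 0 < e -> e <= frame_det q ^+ 2 -> s *m frameM q = primM (rsubmx q) ->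
  s = fieldS e q.
Proof.
move=> e0 eq hs; have um : frameM q \in unitmx.
  by rewrite unitmxE unitfE -sqrf_eq0 lt0r_neq0// (lt_le_trans e0).
by rewrite -[s](mulmxK um) hs -(fieldSE e0 eq) mulmxK.
Qed.

Lemma det_lower : (forall t : R, 0 <= t <= 1 -> frame_det (tv t z0) != 0) -> exists2 e, 0 < e &
  \forall z \near z0, forall t, 0 <= t <= 1 -> e < frame_det (tv t z) ^+ 2.
Proof.
move=> inv0; apply: (tube_lower (g := fun q => frame_det q ^+ 2)). by apply: sm_exp; exact: sm_frame_det.
by move=> t ht; rewrite lt0r sqr_ge0 andbT sqrf_eq0 inv0.
Qed.

Notation et := (ev (lshift D 0) : 'rV[R]_(1 + D)).

Hypothesis C0 : forall l, Ch l z0 = 0.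

Lemma prim0 : primM z0 = 0.
Proof. by apply/rowP => a; rewrite !mxE big1// => l _; rewrite C0 mul0r. Qed.

(** The cutoff makes the field bounded on bounded time intervals, as [param_flow] requires. Since
    [primM] vanishes at z0, this point does not move, and nearby points keep P and stay where the
    cutoff is 1 during the unit time. *)
Lemma moser_flow e P : 0 < e -> (\forall z \near z0, P z) ->
  exists ph : 'I_D -> fn R (1 + D), [/\ forall a, sm (ph a), forall a z, ph a (tv 0 z) = z 0 a,
    forall t, 0 <= t <= 1 -> pos ph (tv t z0) = z0,
    forall a q, 'D_et (ph a) q = cutoff z0 1 (pos ph q) * fieldV e (tv (tm q) (pos ph q)) 0 a &
    exists2 d, 0 < d & forall z t, `|z - z0| < d -> 0 <= t <= 1 ->
      P (pos ph (tv t z)) /\ \forall q \near tv t z, cutoff z0 1 (pos ph q) = 1 /\ P (pos ph q)].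
Proof.
move=> e0 nP; pose g k q := fieldV e q 0 k. have sg k : sm (g k) by exact: sm_fieldV.
pose F k (s : 'rV[R]_((1 + D) + D)) := cutoff z0 1 (rsubmx s) * g k (tv (tm (lsubmx s)) (rsubmx s)).
have sF' k : sm (F k). apply: sm_mul.
    by apply: (sm_comp (F := cutoff z0 1)) => [|j]; [exact: sm_cutoff|exact: sm_rsubmx].
  apply: (sm_comp (F := g k)) => // j; apply: sm_row_mx => l; last exact: sm_rsubmx.
  apply: (sm_ext (f := fun s => lsubmx s 0 (lshift D 0))); last exact: sm_lsubmx.
  by move=> s; rewrite [RHS]mxE (ord1 l) eqxx.
have grow rr : exists2 K, 0 <= K & forall q z k, `|q| <= rr -> `|F k (row_mx q z)| <= K * (1 + `|z|).
  have [K K0 hK] := cont_bounded_fin (Num.max `|rr| (`|z0| + 1)) (fun k => sm_cont (sg k)).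
  exists K => // q z k hq; apply: (@le_trans _ _ K); last by rewrite ler_peMr// lerDl.
  rewrite /F row_mxKl row_mxKr; have [->|cz] := eqVneq (cutoff z0 1 z) 0. by rewrite mul0r normr0.
  rewrite normrM ger0_norm ?cutoff_ge0//; apply: (@le_trans _ _ (1 * K)); last by rewrite mul1r.
  apply: ler_pM; rewrite ?cutoff_ge0 ?cutoff_le1//; apply: hK.
  apply: norm_row_mx_le; first by rewrite le_max normr_ge0.
    apply: le_trans (norm_scalar1 _) _; apply: le_trans (coord_le_norm _ _) _.
    by rewrite le_max (le_trans hq)// ler_norm. by rewrite le_max (cutoff_support ltr01 cz) orbT.
have [ph [sph ph0 phode]] := param_flow sF' (@sm_coord R D) grow.
have ode a q : 'D_et (ph a) q = cutoff z0 1 (pos ph q) * fieldV e (tv (tm q) (pos ph q)) 0 a.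
  by rewrite phode /F row_mxKl row_mxKr. have gz t k : g k (tv t z0) = 0.
  by rewrite /g /fieldV /fieldS row_mxKr prim0 mul0mx scaler0 mul0mx mxE.
(* The cut off field G is Lipschitz and vanishes at z0 for every time, so Gronwall applies to the
   distance from z0. *)
have cst t : 0 <= t <= 1 -> pos ph (tv t z0) = z0. pose G k q := cutoff z0 1 (rsubmx q) * g k q.
  have sG k : sm (G k) by apply: sm_mul => //; apply: sm_r; exact: sm_cutoff.
  have [b b0 hb] := cont_bounded_fin (Num.max 1 `|z0|) (fun k => sm_cont (sph k)).
  have /choice[Ck hCk] k : exists K, 0 <= K /\ forall x y, `|x| <= Num.max 1 (Num.max b `|z0|) ->
      `|y| <= Num.max 1 (Num.max b `|z0|) -> `|G k y - G k x| <= K * `|y - x|.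
    by have [K K0 hK] := sm_lip (Num.max 1 (Num.max b `|z0|)) (sG k); exists K.
  pose K := \sum_k Ck k; have K0 : 0 <= K by apply: sumr_ge0 => k _; case: (hCk k).
  pose cc s := pos ph (tv s z0) - z0; pose dc s := \row_k G k (tv s (pos ph (tv s z0))).
  suff h s : 0 <= s <= 1 -> cc s = 0 by move=> ht; have /eqP := h t ht; rewrite subr_eq0 => /eqP.
  apply: (@gronwall_rV _ _ cc dc K 0 1 0) => //.
  - move=> t' ht' k; have D1 := derive_tv (sm_diff (tv t' z0) (sph k)).
    have D2 := drv_sub D1 (drv_cst (z0 0 k) t'); apply: (drv_eq D2). by move=> s'; rewrite /cc !mxE.
    by rewrite subr0 ode tm_tv /dc [RHS]mxE /G row_mxKr.
  - move=> t' ht'; apply: norm_le_coord; first by rewrite mulr_ge0.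
    move=> k; rewrite mxE; have Gz : G k (tv t' z0) = 0 by rewrite /G gz mulr0.
    rewrite -[X in `|X|]subr0 -Gz; have [Ck0 /(_ (tv t' z0) (tv t' (pos ph (tv t' z0))))] := hCk k.
    have hp : `|pos ph (tv t' z0)| <= b.
      by apply: norm_le_coord => // l; rewrite mxE; apply: hb; exact: tv_norm.
    have n1 : `|tv t' z0| <= Num.max 1 (Num.max b `|z0|).
      by apply: le_trans (tv_norm _ ht') _; rewrite ge_max !le_max !lexx !orbT.
    have n2 : `|tv t' (pos ph (tv t' z0))| <= Num.max 1 (Num.max b `|z0|).
      by apply: le_trans (tv_norm _ ht') _; rewrite ge_max !le_max !lexx hp !orbT.
    move=> /(_ n1 n2)/le_trans; apply. have -> : tv t' (pos ph (tv t' z0)) - tv t' z0 = row_mx 0 (cc t').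
      by rewrite opp_row_mx add_row_mx subrr.
    apply: ler_pM => //; last by apply: norm_row_mx_le => //; rewrite normr0.
    by rewrite /K (bigD1 k)//= lerDl sumr_ge0// => l _; case: (hCk l).
  - by rewrite lexx ler01.
  - by apply/rowP => k; rewrite !mxE ph0 subrr. exists ph; split=> //.
have /nbhs_rVP[rho rho0 hrho] : \forall z \near z0, cutoff z0 1 z = 1 /\ P z.
  have nc := cutoff_near z0 ltr01; exact: filterI nc nP.
have cst' t k : 0 <= t <= 1 -> ph k (tv t z0) = z0 0 k.
  by move=> ht; have /rowP/(_ k) := cst t ht; rewrite mxE. have [d d0 hd] := tube_rV sph cst' rho0.
exists d => // z t hz ht; split; first by have [] := hrho _ (hd t z ht hz).
have cp : {for tv t z, continuous (pos ph)}. apply: sm_cont_rV => k.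
  have e1 : (fun q => pos ph q 0 k) = ph k by apply/funext => q; rewrite mxE. by rewrite e1.
have nb : nbhs (pos ph (tv t z)) [set u | `|u - z0| < rho].
  by apply: open_nbhs_nbhs; split; [exact: open_norm_lt|exact: hd].
have n3 : \forall q \near tv t z, `|pos ph q - z0| < rho := cp _ nb.
by apply: filterS n3 => q hq; exact: hrho.
Qed.

Lemma wedge_sum (V U : 'I_D -> R) (P Q : 'I_N -> 'I_D -> R) :
  \sum_a (\sum_b V b * \sum_l (P l b * Q l a - P l a * Q l b)) * U a =
  \sum_l ((\sum_b V b * P l b) * (\sum_a U a * Q l a) - (\sum_a U a * P l a) * (\sum_b V b * Q l b)).
Proof.
under eq_bigr do rewrite mulr_suml; under eq_bigr do under eq_bigr do rewrite mulr_sumr mulr_suml.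
under eq_bigr do rewrite exchange_big/=; rewrite exchange_big/=; apply: eq_bigr => l _.
rewrite [X in _ = X - _]mulrC !big_distrlr/= -sumrB; apply: eq_bigr => a _.
by rewrite -sumrB; apply: eq_bigr => b _; ring.
Qed.

Section MoserTransport.
Variables (e : R) (ph : 'I_D -> fn R (1 + D)) (z : 'rV[R]_D).
Hypotheses (e0 : 0 < e) (sph : forall a, sm (ph a)) (ph0 : forall a z, ph a (tv 0 z) = z 0 a).
Hypothesis ode : forall a q, 'D_et (ph a) q = cutoff z0 1 (pos ph q) * fieldV e (tv (tm q) (pos ph q)) 0 a.
Hypothesis hz : forall t, 0 <= t <= 1 -> [/\ \forall q \near tv t z, cutoff z0 1 (pos ph q) = 1,
  dirac_frame_at Ah Bh c (lsubmx (pos ph (tv t z))) & e < frame_det (tv t (pos ph (tv t z))) ^+ 2].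
(** Transport takes place over X: only the base coordinates of the flow move in a frame of L, and
    only the first n frame coordinates of the field carry covectors, the other r belonging to
    vertical vectors. *)
Let y l := ph (lshift r l).
Let sg j q := cutoff z0 1 (pos ph q) * fieldS e (tv (tm q) (pos ph q)) 0 (lshift r j).
Let cl l q := Ch l (pos ph q).
Let fl l q := Fh l (pos ph q).
Let gl l q := Ih l (pos ph q).

Let posy q : pos y q = lsubmx (pos ph q). Proof. by apply/rowP => l; rewrite !mxE. Qed.
Let sy l : sm (y l). Proof. exact: sph. Qed.
Let scl l : sm (cl l). Proof. exact: (smY sph). Qed.
Let sfl l : sm (fl l). Proof. exact: (smY sph). Qed.
Let sgl l : sm (gl l). Proof. exact: (smY sph). Qed.

Let stq (h : fn R (1 + D)) : sm h -> sm (fun q => h (tv (tm q) (pos ph q))).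
Proof.
move=> sh; apply: (sm_comp (F := h)) => // j; apply: sm_row_mx => l.
  apply: (sm_ext (f := tm)); last exact: sm_coord. by move=> s; rewrite [RHS]mxE (ord1 l) eqxx.
by apply: (sm_ext (f := ph l)) => // q; rewrite mxE.
Qed.

Let ssg j : sm (sg j).
Proof.
apply: sm_mul; first by apply: (smY sph); exact: sm_cutoff.
by apply: (stq (h := fun q => fieldS e q 0 (lshift r j))); exact: sm_fieldS.
Qed.

Lemma mul_mxA (s : 'rV[R]_D) u l : (s *m mxA r Ah u) 0 (lshift r l) = \sum_j s 0 (lshift r j) * Ah j l u.
Proof.
rewrite mxE big_split_ord/= [X in _ + X]big1 ?addr0; last first. by move=> a _; rewrite block_mxEdl mxE mulr0.
by apply: eq_bigr => j _; rewrite block_mxEul mxE.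
Qed.

Lemma mul_mxB (s : 'rV[R]_D) u (U : 'I_D -> R) : \sum_a (s *m mxB r Bh u) 0 a * U a =
  \sum_l (\sum_j s 0 (lshift r j) * Bh j l u) * U (lshift r l).
Proof.
rewrite big_split_ord/= [X in _ + X]big1 ?addr0; last first. move=> a _; rewrite mxE big1 ?mul0r// => b _.
  by case: (fintype.split_ordP b) => b' ->; rewrite ?block_mxEur ?block_mxEdr mxE mulr0.
apply: eq_bigr => l _; congr (_ * _); rewrite mxE big_split_ord/= [X in _ + X]big1 ?addr0; last first.
  by move=> a _; rewrite block_mxEdl mxE mulr0. by apply: eq_bigr => j _; rewrite block_mxEul mxE.
Qed.

Let ode1 l q : 'D_et (y l) q = \sum_j sg j q * Ah j l (pos y q).
Proof. rewrite /y ode /fieldV row_mxKr mul_mxA mulr_sumr posy. by apply: eq_bigr => j _; rewrite mulrA. Qed.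

(** The covector of the Moser field is sum_l C_l d(F_l - I_l) minus the contraction of the field
    with the moving form. Here it is split, for every l, into four terms [gg] d [hh] along the flow,
    to which [two_form] applies. *)
Let gg (lk : 'I_N * 'I_4) q : R := let l := lk.1 in match val lk.2 with
  | 0%N => cl l q | 1%N => - ('D_et (cl l) q * (1 - tm q)) | 2%N => - ('D_et (cl l) q * tm q)
  | _ => 'D_et (fl l) q + tm q * ('D_et (gl l) q - 'D_et (fl l) q) end.

Let hh (lk : 'I_N * 'I_4) q : R := let l := lk.1 in match val lk.2 with
  | 0%N => fl l q - gl l q | 1%N => fl l q | 2%N => gl l q | _ => cl l q end.

Let sDet (h : fn R (1 + D)) : sm h -> sm ('D_et h). Proof. exact: sm_derive. Qed.
Let stm : sm tm. Proof. exact: sm_coord. Qed.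

Let sgg lk : sm (gg lk).
Proof.
case: lk => l [[|[|[|k]]] hk]; rewrite /gg/=.
- exact: scl.
- apply: sm_opp; apply: sm_mul; first exact: sDet. by apply: sm_sub => //; exact: sm_cst.
- by apply: sm_opp; apply: sm_mul => //; exact: sDet.
- apply: sm_add; first exact: sDet. by apply: sm_mul => //; apply: sm_sub; exact: sDet.
Qed.

Let shh lk : sm (hh lk).
Proof. by case: lk => l [[|[|[|k]]] hk]; rewrite /hh/=; [exact: sm_sub|exact: sfl|exact: sgl|exact: scl]. Qed.

Let form_eq v q : cutoff z0 1 (pos ph q) = 1 -> e < frame_det (tv (tm q) (pos ph q)) ^+ 2 ->
  \sum_l alpha Bh sg y l q * 'D_v (y l) q = \sum_lk gg lk q * 'D_v (hh lk) q.
Proof.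
move=> c1 he; set s := fieldS e (tv (tm q) (pos ph q)).
transitivity (\sum_a (s *m mxB r Bh (lsubmx (pos ph q))) 0 a * 'D_v (ph a) q).
  rewrite mul_mxB; apply: eq_bigr => l _; congr (_ * _); apply: eq_bigr => j _. by rewrite /sg c1 mul1r posy.
have := fieldSE e0 (ltW he); rewrite /frameM row_mxKr mulmxDr mulmxA -/s => /eqP.
rewrite eq_sym -subr_eq => /eqP <-. under eq_bigr do rewrite mxE [X in _ + X]mxE mulrDl mulNr; rewrite sumrB.
have DE (F : fn R D) u : sm F -> 'D_u (fun q => F (pos ph q)) q = \sum_a 'D_u (ph a) q * pd a F (pos ph q).
  by move=> sF'; exact: (D_Y sph).
have -> : \sum_a primM (pos ph q) 0 a * 'D_v (ph a) q = \sum_l cl l q * ('D_v (fl l) q - 'D_v (gl l) q).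
  under eq_bigr do rewrite mxE mulr_suml; rewrite exchange_big/=; apply: eq_bigr => l _.
  rewrite /fl /gl !DE// -sumrB mulr_sumr; apply: eq_bigr => a _; rewrite /cl; ring.
have -> : \sum_a (s *m mxA r Ah (lsubmx (pos ph q)) *m etaM (tv (tm q) (pos ph q))) 0 a * 'D_v (ph a) q =
    \sum_l ('D_et (cl l) q * ('D_v (fl l) q + tm q * ('D_v (gl l) q - 'D_v (fl l) q)) -
      'D_v (cl l) q * ('D_et (fl l) q + tm q * ('D_et (gl l) q - 'D_et (fl l) q))).
  transitivity (\sum_a (\sum_b 'D_et (ph b) q * \sum_l (pd b (Ch l) (pos ph q) * kd (tm q) l a (pos ph q) -
      pd a (Ch l) (pos ph q) * kd (tm q) l b (pos ph q))) * 'D_v (ph a) q).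
    apply: eq_bigr => a _; congr (_ * _); rewrite mxE; apply: eq_bigr => b _.
    rewrite ode c1 mul1r /fieldV row_mxKr -/s; congr (_ * _). by rewrite mxE tm_tv row_mxKr.
  rewrite wedge_sum; apply: eq_bigr => l _. have kE u : \sum_a 'D_u (ph a) q * kd (tm q) l a (pos ph q) =
      'D_u (fl l) q + tm q * ('D_u (gl l) q - 'D_u (fl l) q).
    rewrite /fl /gl !DE// -sumrB mulr_sumr -big_split/=; apply: eq_bigr => a _; rewrite /kd; ring.
  by rewrite !kE -!(DE (Ch l)). rewrite -sumrB -(pair_bigA _ (fun l k => gg (l, k) q * 'D_v (hh (l, k)) q))/=.
apply: eq_bigr => l _; rewrite !big_ord_recl big_ord0 /gg /hh/= /bump/=.
rewrite D_sub//; move: (cl l q) (tm q) ('D_et (cl l) q) ('D_v (cl l) q) ('D_et (fl l) q)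
  ('D_v (fl l) q) ('D_et (gl l) q) ('D_v (gl l) q) => *; ring.
Qed.

Lemma D_tm v q : 'D_v tm q = tm v.
Proof.
rewrite derive_pd; last exact: sm_diff.
by under eq_bigr do rewrite (pd_coord (lshift D 0)); exact: sum_deltar.
Qed.

Definition wedge (c f : fn R D) (w v : 'rV[R]_D) x : R := 'D_w c x * 'D_v f x - 'D_v c x * 'D_w f x.

(** The conserved quantity is the pairing b(D_v y) plus the pulled back moving form on (w, v). Its
    derivative is the exterior derivative of the covector of the field plus the time derivative of
    that form, and [moser_cancel] makes them cancel for each l. At time 0 the form involves F_l, at
    time 1 it involves I_l. *)
Lemma moser_transport (w : 'rV[R]_D) (b0 : 'rV[R]_n) :
  (forall i, \sum_l (b0 0 l * Ah i l (lsubmx z) + Bh i l (lsubmx z) * w 0 (lshift r l)) = 0) ->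
  let phi (x : 'rV[R]_D) : 'rV[R]_D := pos ph (tv 1 x) in
  exists b1 : 'rV[R]_n, (forall i, \sum_l (b1 0 l * Ah i l (lsubmx (phi z)) +
      Bh i l (lsubmx (phi z)) * 'D_w (fun x => phi x 0 (lshift r l)) z) = 0) /\
    forall v : 'rV[R]_D, \sum_l b1 0 l * 'D_v (fun x => phi x 0 (lshift r l)) z +
      \sum_l wedge (fun x => Ch l (phi x)) (fun x => Ih l (phi x)) w v z =
      \sum_l b0 0 l * v 0 (lshift r l) + \sum_l wedge (Ch l) (Fh l) w v z.
Proof.
move=> hb0 phi; pose w' := row_mx (0 : 'rV[R]_1) w.
have p0 x : pos ph (tv 0 x) = x by apply/rowP => a; rewrite mxE ph0.
have phiE l : (fun x => phi x 0 (lshift r l)) = fun x => y l (tv 1 x). by apply/funext => x; rewrite mxE.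
have y0E l u : 'D_(row_mx 0 u) (y l) (tv 0 z) = u 0 (lshift r l).
  rewrite D_slice; have -> : (fun z => y l (tv 0 z)) = fun z => z 0 (lshift r l) by apply/funext => x; exact: ph0.
  rewrite derive_pd; last by apply: sm_diff; exact: sm_coord.
  by under eq_bigr do rewrite pd_coord; exact: sum_deltar.
have frt t : 0 <= t <= 1 -> dirac_frame_at Ah Bh c (pos y (tv t z)).
  by move=> ht; rewrite posy; case: (hz ht).
have [|b [bi bP bd]] := transport sA sB sc ssg sy ode1 frt (b0 := b0) (w := w').
  by move=> j; rewrite posy p0; rewrite -[RHS](hb0 j); apply: eq_bigr => l _; rewrite y0E.
exists (\row_l b l (tv 1 z)); split=> [j|v].
  have := bP 1 j in01_1; rewrite posy => E; rewrite -[RHS]E; apply: eq_bigr => l _.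
  by rewrite mxE phiE D_slice. pose v' := row_mx (0 : 'rV[R]_1) v.
pose k u l q := 'D_u (fl l) q + tm q * ('D_u (gl l) q - 'D_u (fl l) q).
pose Q q := \sum_l ('D_w' (cl l) q * k v' l q - 'D_v' (cl l) q * k w' l q). have sk u l : sm (k u l).
  apply: sm_add; first exact: sm_derive. by apply: sm_mul => //; apply: sm_sub; exact: sm_derive.
have sDc u l : sm ('D_u (cl l)) by exact: sm_derive.
have sDk u l : sm (fun q => 'D_u (cl l) q * k u l q) by exact: sm_mul.
have sQ : sm Q by apply: sm_sum => l; apply: sm_sub; exact: sm_mul.
have tmw u q : 'D_(row_mx 0 u) tm q = 0 by rewrite D_tm /tm row_mxEl mxE.
have te q : 'D_et tm q = 1 by rewrite D_tm /tm mxE !eqxx.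
have DQ t : 0 <= t <= 1 -> \sum_l ('D_w' (alpha Bh sg y l) (tv t z) * 'D_v' (y l) (tv t z) -
    'D_v' (alpha Bh sg y l) (tv t z) * 'D_w' (y l) (tv t z)) + 'D_et Q (tv t z) = 0.
  move=> ht; have [nc _ he] := hz ht.
  have n1 : \forall q \near tv t z, e < frame_det (tv (tm q) (pos ph q)) ^+ 2.
    have s2 : sm (fun q => frame_det (tv (tm q) (pos ph q)) ^+ 2) by apply: sm_exp; apply: stq; exact: sm_frame_det.
    by apply: open_nbhs_nbhs; split; [by have := open_sm_gt (c := e) s2|rewrite /= tm_tv].
  have sal l : sm (alpha Bh sg y l) by apply: sm_alpha.
  rewrite (two_form (q := tv t z) sal sy sgg shh); last first.
    by move=> u; apply: filterS2 nc n1 => q; exact: form_eq.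
  rewrite -(pair_bigA _ (fun l k => 'D_w' (gg (l, k)) (tv t z) * 'D_v' (hh (l, k)) (tv t z) -
    'D_v' (gg (l, k)) (tv t z) * 'D_w' (hh (l, k)) (tv t z)))/=.
  rewrite /Q D_sum; last by move=> l; apply: sm_sub; exact: sm_mul.
  rewrite -big_split big1// => l _; rewrite !big_ord_recl big_ord0 /gg /hh/= /bump/=.
  have wT : 'D_w' tm (tv t z) = 0 by exact: tmw. have vT : 'D_v' tm (tv t z) = 0 by exact: tmw.
  rewrite addr0 !addrA. exact: (moser_cancel (scl l) (sfl l) (sgl l) stm wT vT (te _)).
have hd t : 0 <= t <= 1 -> is_derive (t : R) 1 (fun s => \sum_l b l (tv s z) * 'D_v' (y l) (tv s z) + Q (tv s z)) 0.
  move=> ht; apply: (drv_eq (drv_add (bd t v' ht) (derive_tv (sm_diff (tv t z) sQ)))) => //. exact: DQ.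
have := derive0_constant ler01 hd (fun _ _ => erefl).
have sl (h : 'I_N -> fn R D) l t u : 'D_(row_mx 0 u) (fun q => h l (pos ph q)) (tv t z) =
    'D_u (fun x => h l (pos ph (tv t x))) z by exact: D_slice. rewrite /Q /k => E.
transitivity (\sum_l b l (tv 1 z) * 'D_v' (y l) (tv 1 z) +
    \sum_l ('D_w' (cl l) (tv 1 z) * ('D_v' (fl l) (tv 1 z) + tm (tv 1 z) * ('D_v' (gl l) (tv 1 z) - 'D_v' (fl l) (tv 1 z))) -
      'D_v' (cl l) (tv 1 z) * ('D_w' (fl l) (tv 1 z) + tm (tv 1 z) * ('D_w' (gl l) (tv 1 z) - 'D_w' (fl l) (tv 1 z))))).
  congr +%R; first by apply: eq_bigr => l _; rewrite mxE phiE /v' D_slice.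
  apply: eq_bigr => l _; rewrite tm_tv !mul1r /wedge /v' /w' /cl /gl !sl; ring.
rewrite E; congr +%R; first by apply: eq_bigr => l _; rewrite bi y0E.
apply: eq_bigr => l _; rewrite tm_tv !mul0r !addr0 /wedge /v' /w' /cl /fl !sl.
have e1 (h : 'I_N -> fn R D) : (fun x => h l (pos ph (tv 0 x))) = h l by apply/funext => x; rewrite p0.
by rewrite !e1.
Qed.

End MoserTransport.
End Moser.

Lemma sopen_dist (R : realType) (S : diffspace R) (g : S -> R) (c e : R) : smooth g ->
  sopen [set q | `|g q - c| < e].
Proof.
move=> sg q0 /= h0; exists 1%N, (fun _ => g), (e - `|g q0 - c|); split=> //; first by rewrite subr_gt0.
move=> y /(_ ord0) hy; apply: le_lt_trans (ler_distD (g q0) _ _) _. by rewrite -ltrBrDr.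
Qed.

(** * Maps that are smooth near a point *)

Section GermMaps.
Variables (R : realType) (d e : nat) (S T : diffspace R) (F : S -> T).
Hypotheses (gS : good d S) (gT : good e T).
#[local] Hint Resolve gS gT : core.

Definition smooth_near (p : S) : Prop := forall f, smooth f ->
  exists2 g, smooth g & snear p [set q | f (F q) = g q].

(** The tangent map through germs: for a map smooth only near p, [f \o F] need not be globally
    smooth and [push] would return 0. *)
Definition dpush (p : S) (v : vec S) : vec T := patch (fun=> 0) (@smooth R T) (fun f => v (germ p (f \o F))).

Lemma dpushE p v f g : tangent p v -> smooth f -> smooth g ->
  snear p [set q | f (F q) = g q] -> dpush p v f = v g.
Proof. move=> hv sf sg n; rewrite /dpush patchT ?in_setE//. by have [_ ->] := germP gS sg n. Qed.

Lemma dpush_tangent p v : smooth_near p -> tangent p v -> tangent (F p) (dpush p v).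
Proof.
move=> sF hv; split=> [f nf|t f g sf sg|f g sf sg].
- by rewrite /dpush patchN ?notin_setE.
- have [f' sf' nf] := sF f sf; have [g' sg' ng] := sF g sg.
  have stf : smooth (fun q => t * f' q) by apply: (smooth_mul gS) => //; exact: smooth_cst.
  rewrite (dpushE hv sf sf' nf) (dpushE hv sg sg' ng). rewrite (@dpushE p v _ (fun q => t * f' q + g' q) hv).
  - by rewrite (tan_add hv)// (tan_scale gS _ hv).
  - by apply: (smooth_add gT) => //; apply: (smooth_mul gT) => //; exact: smooth_cst.
  - exact: (smooth_add gS).
  - by apply: snear2 nf ng _ => q /= -> ->.
- have [f' sf' nf] := sF f sf; have [g' sg' ng] := sF g sg.
  rewrite (dpushE hv sf sf' nf) (dpushE hv sg sg' ng). rewrite (@dpushE p v _ (fun q => f' q * g' q) hv).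
  - by rewrite (tan_mul hv)// (snear_self nf) (snear_self ng).
  - exact: (smooth_mul gT).
  - exact: (smooth_mul gS).
  - by apply: snear2 nf ng _ => q /= -> ->.
Qed.

Lemma smooth_near_preim p (P : set T) : smooth_near p -> snear (F p) P -> snear p [set q | P (F q)].
Proof.
move=> sF [A [oA Ap hA]]; have [k [g [eps [sg e0 hg]]]] := oA _ Ap.
have /choice[g' hg'] : forall j, exists g', smooth g' /\ snear p [set q | g j (F q) = g' q].
  by move=> j; have [g' s n] := sF _ (sg j); exists g'.
have ng : snear p [set q | forall j, `|g' j q - g' j p| < eps]. apply: snear_fin => j; have [sg' _] := hg' j.
  by apply: snear_open; [exact: sopen_dist|rewrite /= subrr normr0].
apply: snear2 ng (snear_fin (fun j => (hg' j).2)) _ => q hq gq; apply/hA/hg => j.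
by rewrite gq (snear_self (hg' j).2).
Qed.

Section InCoordinates.
Variables (x : S -> 'rV[R]_d) (y : 'rV[R]_d -> S) (A : set S) (B : set 'rV[R]_d).
Variables (x' : T -> 'rV[R]_e) (y' : 'rV[R]_e -> T) (A' : set T) (B' : set 'rV[R]_e).
Hypotheses (cx : coords x y A B) (cx' : coords x' y' A' B').
Variables (p : S) (Fh : 'I_e -> fn R d).
Hypotheses (Ap : A p) (sFh : forall k, sm (Fh k)).
Hypothesis nF : snear p [set q | A' (F q) /\ x' (F q) = \row_k Fh k (x q)].

Lemma coords_smooth_near : smooth_near p.
Proof.
move=> f sf; have [A'p xp] := snear_self nF. have [G [sG _ nG]] := co_ext cx' sf A'p.
have sGF : sm (fun z => G (\row_k Fh k z)). apply: (sm_comp (F := G)) => // k.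
  by apply: (sm_ext (f := Fh k)) => // z; rewrite mxE. exists (fun q => G (\row_k Fh k (x q))).
  by have := smooth_xcomp gS cx sGF.
have sFx k : smooth (fun q => Fh k (x q)) by have := smooth_xcomp gS cx (sFh k).
have cnt : snear p [set q | B' (\row_k Fh k (x q)) /\ f (y' (\row_k Fh k (x q))) = G (\row_k Fh k (x q))].
  have n1 := near_pull cx' A'p nG. have n2 : \forall z \near x' (F p), B' z /\ f (y' z) = G z.
    apply: filterS n1 => z [Bz fz]; split=> //; by rewrite fz (co_xy cx').
  have n3 : nbhs (x p) [set z | B' (\row_k Fh k z) /\ f (y' (\row_k Fh k z)) = G (\row_k Fh k z)].
    have cF : {for x p, continuous (fun z => \row_k Fh k z)}.
      apply: sm_cont_rV => k; by apply: (sm_ext (f := Fh k)) => // z; rewrite mxE.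
    by rewrite xp in n2; exact: cF _ n2. by apply: snearS (snear_push cx Ap n3) => q [_].
by apply: snear2 nF cnt _ => q [A'q xq] [_ /= <-]; rewrite -xq (co_yx cx').
Qed.

Lemma tcode_dpush v : tangent p v -> tcode x' (F p) (dpush p v) = \row_k 'D_(tcode x p v) (Fh k) (x p).
Proof.
move=> hv; apply/rowP => k; rewrite !mxE.
have sFx : smooth (fun q => Fh k (x q)) by have := smooth_xcomp gS cx (sFh k).
rewrite (@dpushE p v _ (fun q => Fh k (x q)) hv (co_smooth cx' k) sFx); last first.
  by apply: snearS nF => q [_ /= ->]; rewrite mxE. rewrite derive_pd; last exact: sm_diff.
rewrite (tan_coords gS cx Ap hv sFx (sFh k)); last first. by exists setT; split=> //; exact: sopenT.
by apply: eq_bigr => a _; rewrite mxE.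
Qed.

End InCoordinates.
End GermMaps.

(* Near p, psi is a Poisson immersion of the manifold with the Poisson structure
   whose graph is D: both halves ga_trans and ga_ann are needed for this. *)
Record poisson_germ (R : realType) (S M : diffspace R) (D : S -> set (vec S * covec S))
    (pi : M -> covec M -> covec M -> R) (psi : S -> M) (p : S) : Prop := PoissonGerm {
  ga_smooth : smooth_near psi p;
  ga_trans : forall a, D p a -> exists b, [/\ cotangent (psi p) b,
    dpush psi p a.1 = sharp pi (psi p) b & forall v, tangent p v -> b (dpush psi p v) = a.2 v];
  ga_ann : forall b, cotangent (psi p) b -> (forall v, tangent p v -> b (dpush psi p v) = 0) ->
    sharp pi (psi p) b = fun=> 0;
  ga_gt : forall a, D p a -> generalized_tangent p a;
  ga_lin : forall t a b, D p a -> D p b -> D p (t \*o a.1 \+ b.1, t \*o a.2 \+ b.2);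
  ga_iso : forall a b, D p a -> D p b -> pairing a b = 0;
  ga_surj : forall g, cotangent p g -> exists w, D p (w, g);
  ga_nondeg : forall w, D p (w, fun=> 0) -> w = fun=> 0 }.

(** Every covector at p belongs to some element of D and is therefore of the form b composed with
    the tangent map, so a vector killed by the tangent map is killed by all covectors. *)
Lemma dpush_inj (R : realType) (d : nat) (S M : diffspace R) (D : S -> set (vec S * covec S))
    (pi : M -> covec M -> covec M -> R) (psi : S -> M) p v : good d S -> smooth_near psi p ->
  (forall a, D p a -> exists b, [/\ cotangent (psi p) b,
    dpush psi p a.1 = sharp pi (psi p) b & forall v, tangent p v -> b (dpush psi p v) = a.2 v]) ->
  (forall g, cotangent p g -> exists w, D p (w, g)) ->
  tangent p v -> dpush psi p v = (fun=> 0) -> v = fun=> 0.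
Proof.
move=> gS sF tr su hv v0; have [x [x' [A [B [cx Ap]]]]] := good_coords gS p.
have t0 : tangent p (fun=> 0 : R) by case: (lin_set_tangent p).
apply: (tan_eq gS cx Ap hv t0) => k; have sx := co_smooth cx k.
have [w /tr[b [cb _ hb]]] := su _ (diff_at_cotangent p sx).
have := hb v hv; rewrite /= diff_atE// => <-; rewrite v0. exact: dual_zero (lin_set_tangent (psi p)) cb.
Qed.

Lemma immersion_coords (R : realType) (d e : nat) (S T : diffspace R) (F : S -> T) p :
  good d S -> good e T -> smooth_near F p ->
  (forall v, tangent p v -> dpush F p v = (fun=> 0) -> v = fun=> 0) ->
  exists x y A B x' y' A' B' (G : 'rV[R]_d -> 'rV[R]_e),
  [/\ @coords R S d x y A B /\ A p, @coords R T e x' y' A' B' /\ A' (F p),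
    forall k, sm (fun z => G z 0 k), row_free (jac G (x p)) &
    snear p [set q | A' (F q) /\ x' (F q) = G (x q)]].
Proof.
move=> gS gT sF inj; have [x [y [A [B [cx Ap]]]]] := good_coords gS p.
have [x' [y' [A' [B' [cx' A'p]]]]] := good_coords gT (F p).
have /choice[Fh hF] : forall k, exists Fh, sm Fh /\ snear p [set q | x' (F q) 0 k = Fh (x q)].
  move=> k; have [g sg ng] := sF _ (co_smooth cx' k).
  have [G [sG _ nG]] := co_ext cx sg Ap; exists G; split=> //. by apply: snear2 ng nG _ => q /= -> ->.
have nF : snear p [set q | A' (F q) /\ x' (F q) = \row_k Fh k (x q)].
  apply: snear2 (smooth_near_preim sF (snear_A cx' A'p)) (snear_fin (fun k => (hF k).2)) _ => q h1 h2.
  by split=> //; apply/rowP => k; rewrite mxE; exact: h2. have sFh k : sm (Fh k) by case: (hF k).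
pose G z : 'rV[R]_e := \row_k Fh k z.
have sG k : sm (fun z => G z 0 k) by apply: sm_ext (sFh k) => z; rewrite mxE.
exists x, y, A, B, x', y', A', B', G; split=> //.
have t0 : tangent (F p) (fun=> 0 : R) by case: (lin_set_tangent (F p)).
apply: row_freeI => s hs; have hv := tvec_tangent gS cx s Ap.
rewrite -(tvecK cx s Ap) (_ : tvec x y p s = fun=> 0); first by apply/rowP => k; rewrite !mxE.
apply: (inj _ hv); apply: (tan_eq gT cx' A'p (dpush_tangent gS gT sF hv) t0) => k.
have /rowP/(_ k) := tcode_dpush gS cx cx' Ap sFh nF hv; rewrite !mxE (tvecK cx _ Ap) => ->.
have := derive_jac (x p) s k sG; rewrite hs mxE => <-. by congr ('D_s _ _); apply/funext => z; rewrite mxE.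
Qed.

(** The lower Lipschitz bound of [immersion_estimate] holds for all pairs of points of O and so
    gives injectivity with continuous inverse. The conclusion states this as closeness in M of
    images forcing closeness of points, the form used for gluing. *)
Lemma immersion_embed (R : realType) (d e : nat) (S T : diffspace R) (F : S -> T) p :
  good d S -> good e T -> smooth_near F p ->
  (forall v, tangent p v -> dpush F p v = (fun=> 0) -> v = fun=> 0) ->
  exists O, snear p O /\ forall q A, O q -> snear q A ->
    snear (F q) [set z | forall q', O q' -> F q' = z -> A q'].
Proof.
move=> gS gT sF inj.
have [x [y [A [B [x' [y' [A' [B' [G [[cx Ap] [cx' A'p] sG fj nF]]]]]]]]]] := immersion_coords gS gT sF inj.
have [c [r [c0 r0 hc]]] := immersion_estimate sG fj.
have nb : nbhs (x p) [set z | `|z - x p| < r] by apply/nbhs_rVP; exists r.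
exists [set q | (A q /\ `|x q - x p| < r) /\ (A' (F q) /\ x' (F q) = G (x q))]; split.
  by apply: snear2 (snear_push cx Ap nb) nF _ => q h1 h2; split.
move=> q P [[Aq qr] [A'q xq]] nP; have /nbhs_rVP[del del0 hdel] := near_pull cx Aq nP.
have n2 : nbhs (x' (F q)) [set z | `|z - x' (F q)| < del / c].
  by apply/nbhs_rVP; exists (del / c) => //; rewrite divr_gt0.
apply: snearS (snear_push cx' A'q n2) => z [_ hz] q' [[Aq' q'r] [_ xq']] Fq'; subst z.
rewrite -(co_yx cx Aq'); have [] // := hdel (x q'). apply: le_lt_trans (hc _ _ qr q'r) _.
by rewrite -xq -xq' mulrC -ltr_pdivlMr.
Qed.

(** * From local embeddings to an embedding near the zero section *)

Section Neighbourhood.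
Variables (R : realType) (X S M : diffspace R).
Variables (pro : S -> X) (zero : X -> S) (psi : S -> M) (i : X -> M) (nu : S -> R).
Variables (d : M -> M -> R) (ok : set S).
Hypotheses (dT : forall p q z, d p z <= d p q + d q z) (dC : forall p q, d p q = d q p).
Hypotheses (d0 : forall p, d p p = 0) (dn : forall p e, 0 < e -> snear p [set q | d p q < e]).
Hypothesis basis : forall x O, snear (zero x) O -> exists2 e, 0 < e &
  forall p, d (i x) (i (pro p)) < e -> nu p < e -> O p.
Hypotheses (snu : smooth nu) (sip : smooth_map (fun p => i (pro p))).
Hypotheses (nu0 : forall x, nu (zero x) = 0) (pro0 : forall x, pro (zero x) = x).
Hypotheses (psi0 : forall x, psi (zero x) = i x) (sep : forall p q : S, (forall f, smooth f -> f p = f q) -> p = q).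
Hypotheses (okS : forall p, ok p -> smooth_near psi p) (okn : forall x, snear (zero x) ok).
Hypothesis emb : forall x, exists O, snear (zero x) O /\ forall q A, O q -> snear q A ->
  snear (psi q) [set z | forall q', O q' -> psi q' = z -> A q'].

Let e_ k : R := (2 ^+ k)^-1.
Let e0 k : 0 < e_ k. Proof. by rewrite invr_gt0 exprn_gt0. Qed.
Let eS k l : (k <= l)%N -> e_ l <= e_ k.
Proof. by move=> kl; rewrite lef_pV2 ?posrE ?exprn_gt0// ler_eXn2l ?ltr1n. Qed.

Let ball x k p := d (i x) (i (pro p)) < e_ k /\ nu p < e_ k.

Let G x k := (forall p, ball x k p -> ok p) /\ forall q A, ball x k q -> snear q A ->
  snear (psi q) [set z | forall q', ball x k q' -> psi q' = z -> A q'].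

Let Gex x : exists k, G x k.
Proof.
have [Q [nQ hQ]] := emb x; have nok := okn x. have [e e_gt0 he] := basis (snearI nQ nok).
have [k hk] : exists k, e_ k < e. have [k _ /(_ k (leqnn k))] := near_infty_natSinv_expn_lt (PosNum e_gt0).
  by rewrite /= div1r => h; exists k.
have bQ p : ball x k p -> Q p /\ ok p by move=> [h1 h2]; apply: he; apply: lt_trans hk.
exists k; split=> [p /bQ[]//|q A' /bQ[Qq _] nA]; apply: snearS (hQ q A' Qq nA) => z hz q' /bQ[Qq' _].
exact: hz.
Qed.

(** Embedding near each zero point does not yield injectivity on a union of neighbourhoods. The
    dyadic balls on which psi embeds are shrunk by the factor 8 and restricted to points that psi
    moves little; when two points of the union have close images, a ball of largest radius for one
    of them contains both. *)
Lemma neighbourhood : exists U : set S, [/\ sopen U, forall x, U (zero x), U `<=` ok &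
  forall p A, U p -> snear p A -> snear (psi p) [set z | forall q, U q -> psi q = z -> A q]].
Proof.
pose V k x p := [/\ G x k, d (i x) (i (pro p)) < e_ k / 8, nu p < e_ k / 8 &
  d (i (pro p)) (psi p) < e_ k / 8]. have e8 k : e_ k / 8 < e_ k by have := e0 k; lra.
have e80 k : 0 < e_ k / 8 by have := e0 k; lra. have Vb k x p : V k x p -> ball x k p.
  by move=> [_ h1 h2 _]; split; apply: lt_trans (e8 k). exists [set p | exists k x, V k x p]; split.
- apply: sopen_local => p [k [x hV]]; have okp : ok p by have [[h _] _ _ _] := hV; apply: h; exact: Vb.
  have [hG h1 h2 h3] := hV. have n1 : snear p [set q | d (i x) (i (pro q)) < e_ k / 8].
    have g0 : 0 < e_ k / 8 - d (i x) (i (pro p)) by rewrite subr_gt0.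
    apply: snearS (snear_preim (p := p) sip (dn (i (pro p)) g0)) => q /= hq.
    by apply: le_lt_trans (dT _ (i (pro p)) _) _; lra. have n2 : snear p [set q | nu q < e_ k / 8].
    apply: snear_open h2 => q hq; exists 1%N, (fun=> nu), (e_ k / 8 - nu q); split=> //; first by rewrite subr_gt0.
    by move=> z /(_ ord0); rewrite ltr_norml /= => /andP[_]; rewrite ltrBDr subrK.
  have n3 : snear p [set q | d (i (pro q)) (psi q) < e_ k / 8].
    have g0 : 0 < (e_ k / 8 - d (i (pro p)) (psi p)) / 2 by rewrite divr_gt0// subr_gt0.
    apply: snear2 (snear_preim (p := p) sip (dn (i (pro p)) g0))
      (smooth_near_preim (okS okp) (dn (psi p) g0)) _ => q /= hq hq'.
    have := dT (i (pro q)) (i (pro p)) (psi q); have := dT (i (pro p)) (psi p) (psi q).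
    rewrite (dC (i (pro q)) (i (pro p))); lra. have [A [oA Ap hA]] := snearI n1 (snearI n2 n3).
  by exists A; split=> // q /hA[? [? ?]]; exists k, x.
- move=> x; have [k hG] := Gex x; exists k, x; split=> //; first by rewrite pro0 d0. by rewrite nu0.
  by rewrite pro0 psi0 d0.
- by move=> p [k [x hV]]; have [[h _] _ _ _] := hV; apply: h; exact: Vb.
move=> p A [kp [xp hVp]] nA; have [hG h1 h2 h3] := hVp.
(* The least k, that is the largest radius, among embedding balls that contain the base point of p
   within half their radius. *)
have exk : exists k, `[< exists x, G x k /\ d (i x) (i (pro p)) < e_ k / 2 >].
  exists kp; apply/asboolP; exists xp; split=> //; have := e0 kp; lra.
case: (ex_minnP exk) => k /asboolP[x [Gx dx]] kmin. have kkp : e_ kp <= e_ k.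
  by apply: eS; apply: kmin; apply/asboolP; exists xp; split=> //; have := e0 kp; lra.
have bp : ball x k p by split; have := e0 k; lra. have [_ /(_ _ _ bp nA) nB] := Gx.
apply: snear2 nB (dn (psi p) (e80 kp)) _ => z hz dz q [kq [xq hVq]] qz; apply: hz => //.
have [hGq g1 g2 g3] := hVq; rewrite -qz /= in dz.
have T1 := dT (i xq) (i (pro q)) (psi q); have T2 := dT (i xq) (psi q) (psi p).
have T3 := dT (i xq) (psi p) (i (pro p)). rewrite (dC (psi q)) in T2; rewrite (dC (psi p) (i (pro p))) in T3.
(* If the radius for q exceeds that for p, four distances of at most an eighth of it put the base
   point of p within half of the ball for q, and minimality of k applies to kq. *)
have kkq : e_ kq <= e_ k. have [le|lt] := leP (e_ kq) (e_ kp); first exact: le_trans le kkp.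
  apply: eS; apply: kmin; apply/asboolP; exists xq; split=> //; lra.
have T4 := dT (i x) (i (pro p)) (psi p); have T5 := dT (i x) (psi p) (psi q).
have T6 := dT (i x) (psi q) (i (pro q)); rewrite (dC (psi q) (i (pro q))) in T6.
(* The base point of q is closer to the centre than e_k / 2 plus three eighths of radii that are at
   most e_k. *)
split; have := e0 kq; have := e0 kp; lra.
Qed.

End Neighbourhood.

(** * Poisson structures on open sets induced by Poisson immersions *)

Section GraphGerm.
Variables (R : realType) (m : nat) (M : diffspace R) (pi : M -> covec M -> covec M -> R).
Hypotheses (gM : good m M) (pP : poisson pi).

Lemma cot_diff (f : M -> R) x : cotangent x (diff_at f x).
Proof.
have [sf|nf] := pselect (smooth f); first exact: diff_at_cotangent.
have -> : diff_at f x = fun=> 0; last exact: dual_of0.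
apply/funext => v; rewrite /diff_at; have [hv|nv] := pselect (tangent x v).
  by rewrite patchT ?in_setE//; case: hv => ->. by rewrite patchN// notin_setE.
Qed.

Lemma sharp_lin x t a b : cotangent x a -> cotangent x b ->
  sharp pi x (t \*o a \+ b) = t \*o sharp pi x a \+ sharp pi x b.
Proof. by move=> ca cb; apply/funext => f; rewrite /sharp (poisson_linear pP)//; exact: cot_diff. Qed.

Lemma cot_sharp x a b : cotangent x a -> cotangent x b -> a (sharp pi x b) = pi x b a.
Proof.
move=> ca cb; have [y [y' [A [B [cy Ax]]]]] := good_coords gM x. have cd k := cot_diff (fun q => y q 0 k) x.
rewrite (cot_code gM cy Ax ca (sharp_tangent pP cb)) (poisson_skew pP cb ca).
rewrite [in RHS](cot_sum_dy gM cy Ax ca) (poisson_comb pP _ _ cd cb) -sumrN; apply: eq_bigr => k _.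
by rewrite [tcode _ _ _ _ _]mxE /sharp (poisson_skew pP cb (cd k)) mulrN.
Qed.

(** Taking psi to be the identity lets [open_poisson] also produce the restriction of a Poisson
    structure to an open set. *)
Lemma graph_germ x : poisson_germ (graph_of pi) pi id x.
Proof.
have idE v : tangent x v -> dpush id x v = v.
  move=> hv; apply/funext => f; have [sf|nf] := pselect (smooth f).
    by rewrite (dpushE gM hv sf sf)//; exists setT; split=> //; exact: sopenT.
  by rewrite /dpush patchN ?notin_setE//; case: hv => ->.
have c0 : cotangent x (fun=> 0 : R) by exact: dual_of0. constructor.
- by move=> f sf; exists f => //; exists setT; split=> //; exact: sopenT.
- move=> _ [a ca <-]; exists a; rewrite /= idE; last by have := sharp_tangent pP ca.
  by split=> // v hv; rewrite idE.
- move=> b cb hb; have -> : b = fun=> 0 by apply: (dual_ext cb c0) => v hv; rewrite -(hb v hv) idE.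
  by apply/funext => f; rewrite /sharp (poisson0l pP)//; exact: cot_diff.
- by move=> _ [a ca <-]; split=> //=; have := sharp_tangent pP ca.
- move=> t _ _ [a ca <-] [b cb <-]; exists (t \*o a \+ b); first exact: dual_lin. by rewrite /= sharp_lin.
- by move=> _ _ [a ca <-] [b cb <-]; rewrite /pairing/= !cot_sharp// (poisson_skew pP cb ca) addNr.
- by move=> g cg; exists (sharp pi x g); exists g.
- move=> w [a ca [<- ->]]; apply/funext => f. by rewrite /sharp (poisson0l pP)//; exact: cot_diff.
Qed.

End GraphGerm.

Section OpenPoisson.
Variables (R : realType) (d m : nat) (S M : diffspace R) (D : S -> set (vec S * covec S)).
Variables (pi : M -> covec M -> covec M -> R) (psi : S -> M) (U : set S).
Hypotheses (gS : good d S) (gM : good m M) (pP : poisson pi) (oU : sopen U).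
Hypothesis hU : forall p, U p -> poisson_germ D pi psi p.
#[local] Hint Resolve gS gM : core.
Notation T := (subspace_of U).
Notation incl := (fun q : T => sval q).
Notation psiU := (fun q : T => psi (sval q)).
Let gT : good d T := sub_good gS oU.
#[local] Hint Resolve gT : core.
Let si : smooth_map incl. Proof. exact: incl_smooth. Qed.

Lemma sharp_sub x a b : cotangent x a -> cotangent x b ->
  sharp pi x ((-1) \*o a \+ b) = fun f => sharp pi x b f - sharp pi x a f.
Proof. by move=> ca cb; rewrite (sharp_lin pP)//; apply/funext => f /=; rewrite mulN1r addrC. Qed.

(** [ga_trans] gives a covector b with pi^sharp(b) equal to the image of w and with b = df on the
    image of the tangent map. Then df - b annihilates that image, and by [ga_ann] pi^sharp(df) is
    the image of w as well. *)
Lemma germ_bracket p f g h k w : U p -> smooth f -> smooth g -> smooth h -> smooth k ->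
  snear p [set q | f (psi q) = h q] -> snear p [set q | g (psi q) = k q] ->
  D p (w, diff_at h p) -> bracket pi f g (psi p) = w k.
Proof.
move=> Up sf sg sh sk nh nk Dw; have G := hU Up; have [/= hw _] := ga_gt G Dw.
have [b [cb wE hb]] := ga_trans G Dw; have cf := diff_at_cotangent (psi p) sf.
have := ga_ann G (dual_lin (-1) cb cf) => /(_ _)/(congr1 (fun v => v g)).
rewrite sharp_sub//= => E; rewrite -(dpushE gS hw sg sk nk) wE.
apply/eqP; rewrite -subr_eq0; apply/eqP/E => v hv.
rewrite /= hb//= (diff_atE f (dpush_tangent gS gM (ga_smooth G) hv)).
by rewrite (dpushE gS hv sf sh nh) diff_atE// mulN1r addNr.
Qed.

Lemma psiU_smooth : smooth_map psiU.
Proof.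
move=> f sf; apply/sub_smoothE => q; have [g sg ng] := ga_smooth (hU (svalP q)) sf.
exists g => //; by apply: snearS ng => z E q' qz; rewrite -[RHS]E -qz.
Qed.

Lemma psiU_push (q : T) w : tangent q w -> push psiU w = dpush psi (sval q) (push incl w).
Proof.
move=> hw; apply/funext => f; have hv := push_tangent gS si hw.
have [sf|nf] := pselect (smooth f); last by rewrite /push /dpush !patchN ?notin_setE.
have [g sg ng] := ga_smooth (hU (svalP q)) sf.
rewrite (dpushE gS hv sf sg ng) !pushE//; apply: (tan_local gT hw).
- exact: psiU_smooth.
- exact: si.
- exact: sub_snear ng.
Qed.

Lemma psiU_inj q v w : tangent q v -> tangent q w -> push psiU v = push psiU w -> v = w.
Proof.
move=> hv hw E; have G := hU (svalP q); have [_ lt] := lin_set_tangent q.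
have hu := lt (-1) _ _ hv hw; have hi := push_tangent gS si hu.
have := dpush_inj gS (ga_smooth G) (ga_trans G) (ga_surj G) hi; rewrite -psiU_push// push_lin E => z.
have t0 : tangent q (fun=> 0 : R) by case: (lin_set_tangent q). have E0 : (-1) \*o v \+ w = fun=> 0.
  apply: (push_incl_inj gS oU hu t0); rewrite z. by apply/funext => f; rewrite /push /patch; case: ifP.
  by apply/funext => f /=; rewrite mulN1r addNr.
by apply/funext => f; have /(congr1 (fun u => u f)) /= := E0; rewrite mulN1r addrC => /eqP; rewrite subr_eq0 => /eqP.
Qed.

Let D' := pullback incl D.

Let pull_inj (q : T) b b' : cotangent (sval q) b -> cotangent (sval q) b' ->
  pull incl q b = pull incl q b' -> b = b'.
Proof.
move=> cb cb' E; apply: (dual_ext cb cb') => v hv.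
by have [w [hw <-]] := push_incl_surj gS oU hv; rewrite -!(pullE _ _ hw) E.
Qed.

Let pull_surj (q : T) a : cotangent q a -> exists2 b, cotangent (sval q) b & a = pull incl q b.
Proof.
move=> ca; pose l v : vec T := xget (fun=> 0) [set w | tangent q w /\ push incl w = v].
have lP v : tangent (sval q) v -> tangent q (l v) /\ push incl (l v) = v.
  move=> hv; rewrite /l; case: xgetP => [w -> []//|]. by have [w hw] := push_incl_surj gS oU hv => /(_ w).
have lE w : tangent q w -> l (push incl w) = w. move=> hw; have [h1 h2] := lP _ (push_tangent gS si hw).
  exact: (push_incl_inj gS oU h1 hw h2). exists (patch (fun=> 0) (tangent (sval q)) (fun v => a (l v))).
  split=> [t u v hu hv|v nv]; last by rewrite patchN// notin_setE.
  have huv := (lin_set_tangent (sval q)).2 t _ _ hu hv; rewrite !patchT ?in_setE//.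
  have [h1 e1] := lP u hu; have [h2 e2] := lP v hv; case: ca => al _; rewrite -al//; congr a.
  by rewrite -[in LHS]e1 -[in LHS]e2 -push_lin lE//; exact: (lin_set_tangent q).2.
apply/funext => w; have [hw|nw] := pselect (tangent q w); last by case: ca => _ ->//; rewrite /pull patchN ?notin_setE.
by rewrite pullE// patchT ?in_setE ?lE//; exact: (push_tangent gS si).
Qed.

Let D'P (q : T) (w : vec T) (b : covec S) : tangent q w -> cotangent (sval q) b -> D' q (w, pull incl q b) <-> D (sval q) (push incl w, b).
Proof.
move=> hw cb; split=> [[_ [b' [cb' Db' E]]]|Db]; last by split=> //; exists b. by rewrite (pull_inj cb cb' E).
Qed.

Let D'gt q a : D' q a -> [/\ tangent q a.1, cotangent q a.2 & exists2 b, cotangent (sval q) b & a.2 = pull incl q b].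
Proof.
move=> [hw [b [cb _ E]]]; split=> //; last by exists b. by rewrite E; exact: (pull_cotangent gS si).
Qed.

Let D'uniq q w w' a : D' q (w, a) -> D' q (w', a) -> w = w'.
Proof.
move=> Dw Dw'; have [/= hw _ [b cb E]] := D'gt Dw; have [/= hw' _ _] := D'gt Dw'; subst a.
have G := hU (svalP q); have := ga_lin G (-1) ((D'P hw cb).1 Dw) ((D'P hw' cb).1 Dw').
have -> : (-1) \*o b \+ b = fun=> 0 by apply/funext => v /=; rewrite mulN1r addNr.
move=> /(ga_nondeg G) E; apply: (push_incl_inj gS oU hw hw'); apply/funext => f.
by have /(congr1 (fun u => u f)) /= := E; rewrite mulN1r addrC => /eqP; rewrite subr_eq0 => /eqP.
Qed.

Let D'surj q a : cotangent q a -> exists w, D' q (w, a).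
Proof.
move=> /pull_surj[b cb ->]; have G := hU (svalP q); have [w Dw] := ga_surj G cb.
have [/= hw _] := ga_gt G Dw; have [u [hu uw]] := push_incl_surj gS oU hw.
by exists u; apply/(D'P hu cb); rewrite uw.
Qed.

Let D'iso q a b : D' q a -> D' q b -> pairing a b = 0.
Proof.
case: a b => [v al] [w be] Da Db; have [/= hv _ [a' ca' E]] := D'gt Da; have [/= hw _ [b' cb' E']] := D'gt Db.
subst al be; rewrite /pairing/= !pullE//.
by have := ga_iso (hU (svalP q)) ((D'P hv ca').1 Da) ((D'P hw cb').1 Db).
Qed.

Definition sh (q : T) a : vec T := xget (fun=> 0) [set w | pullback incl D q (w, a)].
Definition piU (q : T) a b : R := b (sh q a).

Let shP q a : cotangent q a -> D' q (sh q a, a).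
Proof. by move=> /D'surj[w Dw]; rewrite /sh; case: xgetP => [u -> //|/(_ w)]. Qed.

Let sh_tangent q a : cotangent q a -> tangent q (sh q a).
Proof. by move=> /shP/D'gt[]. Qed.

Let piU_skew q a b : cotangent q a -> cotangent q b -> piU q a b = - piU q b a.
Proof.
move=> ca cb; have := D'iso (shP ca) (shP cb); rewrite /pairing/= addrC => /eqP. by rewrite addr_eq0 => /eqP.
Qed.

Let piU_map f g q : smooth f -> smooth g ->
  bracket piU (f \o psiU) (g \o psiU) q = bracket pi f g (psi (sval q)).
Proof.
move=> sf sg; have sfp := psiU_smooth sf; have sgp := psiU_smooth sg.
have G := hU (svalP q); have [h sh' nh] := ga_smooth G sf; have [k sk nk] := ga_smooth G sg.
have ca := diff_at_cotangent q sfp; have Da := shP ca; have hw := sh_tangent ca.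
have ch := diff_at_cotangent (sval q) sh'. have dE : diff_at (f \o psiU) q = pull incl q (diff_at h (sval q)).
  apply: (dual_ext ca (pull_cotangent gS si ch)) => v hv; have hiv := push_tangent gS si hv.
  rewrite pullE// !diff_atE// pushE//; apply: (tan_local gT hv) => //; first exact: si. exact: sub_snear nh.
rewrite /bracket /piU diff_atE// dE; rewrite dE in Da hw.
rewrite -[RHS]/(bracket pi f g (psi (sval q))) (germ_bracket (svalP q) sf sg sh' sk nh nk ((D'P hw ch).1 Da)) pushE//.
apply: (tan_local gT hw) => //; first exact: si. exact: sub_snear nk.
Qed.

Let piU_sharp q a : cotangent q a -> sharp piU q a = sh q a.
Proof. by move=> ca; apply/funext => f; rewrite /sharp /piU diff_atE//; exact: sh_tangent. Qed.

(** Differentials of functions pulled back from M span the cotangent spaces of U. Smoothness of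
    [piU] and its Jacobi identity are thereby reduced to such functions. *)
Lemma immersed_frame (q : T) : exists (f : 'I_m -> M -> R) (W : 'I_m -> T -> vec T),
  [/\ forall b, smooth (f b), forall b, field (W b) &
    snear q [set q' : T | forall u, tangent q' u -> u = fun h => \sum_b u (f b \o psiU) * W b q' h]].
Proof. by have := immersion_local gT gM psiU_smooth psiU_inj q. Qed.

Let piU_smooth a b : form1 a -> form1 b -> smooth (fun q => piU q (a q) (b q)).
Proof.
move=> fa fb; apply: (smooth_loc gT) => q; have [f [W [sf fW nF]]] := immersed_frame q.
have [ca sa] := fa; have [cb sb] := fb.
exists (fun q' => - \sum_l \sum_k b q' (W l q') * (a q' (W k q') * bracket pi (f l) (f k) (psi (sval q')))).
  apply: (smooth_opp gT); apply: (smooth_sum gT) => l; apply: (smooth_sum gT) => k.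
  apply: (smooth_mul gT); first exact: sb. apply: (smooth_mul gT); first exact: sa.
  have sbr : smooth (bracket pi (f l) (f k)) by apply: (bracket_smooth pP). exact: psiU_smooth sbr.
apply: snearS nF => q' hu /=; have lt := lin_set_tangent q'. have tW l : tangent q' (W l q') by case: (fW l).
have ha := sh_tangent (ca q'); rewrite {1}/piU (hu _ ha) (dual_comb _ _ lt (cb q') tW) -sumrN.
apply: eq_bigr => l _; have cl := diff_at_cotangent q' (psiU_smooth (sf l)).
rewrite -sumrN -(diff_atE _ ha) -/(piU _ _ _) piU_skew// /piU (hu _ (sh_tangent cl)).
rewrite (dual_comb _ _ lt (ca q') tW) mulNr mulr_suml -sumrN; apply: eq_bigr => k _.
rewrite -(piU_map q' (sf l) (sf k)) /bracket /piU diff_atE; last exact: sh_tangent. by rewrite -mulrN; ring.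
Qed.

Let X g (q : T) := sharp piU q (diff_at g q).

Let X_field g : smooth g -> field (X g).
Proof.
move=> sg; split=> [q|f sf]; last exact: piU_smooth (form1_diff sg) (form1_diff sf).
have cg := diff_at_cotangent q sg; rewrite /X piU_sharp//; exact: sh_tangent.
Qed.

Let jac3 f g h q := bracket piU f (bracket piU g h) q + bracket piU g (bracket piU h f) q
  + bracket piU h (bracket piU f g) q.

(* For fixed g and h, the Jacobiator is the vector [X_g, X_h] - X_{g,h}. *)
Let jac3_first f g h q : smooth f -> smooth g -> smooth h ->
  (forall k, smooth k -> jac3 (k \o psiU) g h q = 0) -> jac3 f g h q = 0.
Proof.
move=> sf sg sh' J0; have brS k l : smooth k -> smooth l -> bracket piU l k = fun q => - bracket piU k l q.
  by move=> sk sl; apply/funext => q'; apply: piU_skew; exact: diff_at_cotangent.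
have brs k l : smooth k -> smooth l -> smooth (bracket piU k l).
  by move=> sk sl; exact: piU_smooth (form1_diff sk) (form1_diff sl).
pose v : vec T := (-1) \*o X (bracket piU g h) q \+ lie_bracket (X g) (X h) q. have hv : tangent q v.
  apply: (lin_set_tangent q).2; first by case: (X_field (brs _ _ sg sh')).
  by apply: (lie_bracket_tangent gT); exact: X_field. have vE k : smooth k -> jac3 k g h q = v k.
  move=> sk; rewrite /jac3 (brS _ _ (brs _ _ sg sh') sk) (brS g k sg sk) /v /lie_bracket /=.
  have [tX _] := X_field sh'.
  have -> : bracket piU h (fun q => - bracket piU g k q) q = - X h q (bracket piU g k).
    by rewrite -[LHS]/(X h q _) (tan_opp gT (tX q))//; exact: brs. by rewrite mulN1r addrA.
have [F [W [sF fW nF]]] := immersed_frame q. rewrite vE// (snear_self nF _ hv) big1// => b _.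
by rewrite -vE ?J0 ?mul0r//; exact: psiU_smooth.
Qed.

(** The Jacobi identity holds for three functions pulled back from M because [psiU] respects
    brackets. [jac3_first] frees one argument after another, the cyclic symmetry C bringing each to
    the front. *)
Theorem open_poisson : [/\ poisson piU, forall q, pullback incl D q = graph_of piU q & poisson_map piU pi psiU].
Proof.
split; last by split; [exact: psiU_smooth|move=> f g sf sg q; exact: piU_map].
  have C f g h q : jac3 f g h q = jac3 g h f q by rewrite /jac3 -addrA addrC. split=> //.
    move=> q t a b c ca cb cc; rewrite piU_skew//; last exact: dual_lin.
    by rewrite /piU /= opprD -mulrN -!piU_skew// /piU. move=> f g h q sf sg sh'.
  have J1 k l f' : smooth k -> smooth l -> smooth f' -> jac3 f' (k \o psiU) (l \o psiU) q = 0.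
    move=> sk sl sf'; apply: jac3_first => //; try exact: psiU_smooth.
    move=> k' sk'; have E u u' : smooth u -> smooth u' ->
        bracket piU (u \o psiU) (u' \o psiU) = bracket pi u u' \o psiU.
      by move=> su su'; apply/funext => q'; exact: piU_map.
    rewrite /jac3 !E//; try exact: (bracket_smooth pP). exact: poisson_jacobi pP _ _ _ _ sk' sk sl.
  have J2 l f' g' : smooth l -> smooth f' -> smooth g' -> jac3 g' (l \o psiU) f' q = 0.
    move=> sl sf' sg'; apply: jac3_first => //; first exact: psiU_smooth.
    by move=> k sk; rewrite C C; apply: J1. by apply: jac3_first => // k sk; rewrite C C; apply: J2.
move=> q; apply/seteqP; split=> [[w a] Dw|_ [a ca <-]].
  have [/= _ ca _] := D'gt Dw; exists a => //; congr pair. by rewrite piU_sharp//; exact: D'uniq (shP ca) Dw.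
by rewrite piU_sharp//; exact: shP.
Qed.

End OpenPoisson.

(** * The two stages near the zero section *)

Section Model.
Variables (R : realType) (n r m : nat) (X M : diffspace R).
Variables (L : X -> set (vec X * covec X)) (C : X -> set (vec X)).
Variables (pi : M -> covec M -> covec M -> R) (i : X -> M).
Variables (f : nat -> M -> R) (W : nat -> X -> vec X).
Hypothesis H : setting n r m L C pi i f W.
Notation K := (tangent_part L).
Notation S := (dual_bundle K).
Let gX : good n X := manifold_good (st_mX H).
Let gM : good m M := manifold_good (st_mM H).
Let gS : good (n + r) S := model_good gX (st_dL H) (st_dim H) (st_comp H).
#[local] Hint Resolve gX gM gS : core.

Definition Cf l : S -> R := fun z => - fib z (proj_K L C (base z) (W l (base z))).
Definition Ff l : S -> R := fun z => f l (i (base z)).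

Lemma i_smooth : smooth_map i. Proof. by case: (st_emb H) => -[]. Qed.

Lemma Cf_smooth l : smooth (Cf l).
Proof.
apply: smooth_opp => //; apply: (fib_smooth (V := fun q => proj_K L C q (W l q))).
exact: (proj_K_section gX (st_dL H) (st_dim H) (st_comp H) (st_W H l)).
Qed.

Lemma base_smooth h : smooth h -> @smooth R S (fun z => h (base z)).
Proof. move=> sh; have sp : smooth_map (@pr R X K) by exact: pr_smooth. exact: sp h sh. Qed.

Lemma Ff_smooth l : smooth (Ff l).
Proof. by apply: (base_smooth (h := fun x => f l (i x))); exact: i_smooth (st_f H l). Qed.

Lemma Cf_zero l x : Cf l (zero_section K x) = 0.
Proof. by rewrite /Cf oppr0. Qed.

Lemma Cf_W l (z : S) : W l (base z) = (fun=> 0) -> Cf l z = 0.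
Proof.
move=> Wl; have lK := linK (st_dim H) (base z); have dz : dual_of (K (base z)) (fib z) := svalP z.
rewrite /Cf Wl (proj_K_id (st_dim H) (st_comp H)); last by case: lK. by rewrite (dual_zero lK dz) oppr0.
Qed.

Lemma Cf_fam (p : S) : exists N, snear p [set z : S | (forall l, (N <= l)%N -> Cf l z = 0) /\
  forall u, tangent (base z) u -> u = fun h => \sum_(l < N) u (f l \o i) * W l (base z) h].
Proof.
have [N nN] := st_fam H (base p); exists N. have sp : smooth_map (@pr R X K) by exact: pr_smooth.
apply: snearS (snear_preim sp nN) => z [hN hu]; split=> // l Nl. by apply: Cf_W; exact: hN.
Qed.

(** The sum over l is finite at p but no bound is part of the data; the relation asks for its value
    at every admissible truncation, and all of them agree. *)
Definition flow1 (p : S) (t : R) (q : M) (v : vec M) : Prop :=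
  forall N, (forall l, (N <= l)%N -> Cf l p = 0) ->
  v = fun g => \sum_(l < N) Cf l p * sharp pi q (diff_at (f l) q) g.

Definition sol1 (p : S) (c : R -> M) : Prop := c 0 = i (base p) /\ curve_of (flow1 p) c.

Lemma sol1_unique p c c' : sol1 p c -> sol1 p c' -> forall t, 0 <= t <= 1 -> c t = c' t.
Proof.
move=> [c0 hc] [c0' hc']; apply: (curve_unique gM hc hc'); first by rewrite c0 c0'.
move=> t _; have [N nN] := Cf_fam p; have [hN _] := snear_self nN.
have [y [y' [A [B [cy Aq]]]]] := good_coords gM (c t). have sy k := co_smooth cy k.
pose b k q := \sum_(l < N) Cf l p * bracket pi (f l) (fun q => y q 0 k) q. have sb k : smooth (b k).
  apply: smooth_sum => // l; apply: smooth_mul => //; first exact: smooth_cst.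
  by apply: (bracket_smooth (st_pi H)); [exact: st_f H l|exact: sy]. have [F hF] := co_ext_fam cy sb Aq.
exists y, y', A, B, (fun k q => F k (rsubmx q)); split=> //. move=> k; apply: sm_comp; first by case: (hF k).
  by move=> l; exact: sm_rsubmx. apply: snearS (snear_fin (fun k => (hF k).2)) => q hq s v hs /(_ N hN) -> k.
by rewrite row_mxKr -hq.
Qed.

(** The default [i (base p)] is taken where no solution exists on the unit interval; elsewhere
    [sol1_unique] makes the chosen solution irrelevant. *)
Definition psi1 (p : S) : M :=
  if pselect (exists c, sol1 p c) is left h then projT1 (cid h) 1 else i (base p).

Definition prim (l : nat) (p : S) : R := xget 0 [set a | exists c J,
  [/\ sol1 p c, J 0 = 0, (forall t, 0 <= t <= 1 -> is_derive (t : R) 1 J (f l (c t))) & a = J 1]].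

Lemma psi1E p c : sol1 p c -> psi1 p = c 1.
Proof.
move=> hc; rewrite /psi1; case: pselect => [h|[]]; last by exists c.
by case: (cid h) => c' hc' /=; apply: (sol1_unique hc' hc); rewrite ler01 lexx.
Qed.

Lemma primE l p c J : sol1 p c -> J 0 = 0 ->
  (forall t, 0 <= t <= 1 -> is_derive (t : R) 1 J (f l (c t))) -> prim l p = J 1.
Proof.
move=> hc J0 dJ; rewrite /prim; case: xgetP => [a -> /= [c' [J' [hc' J0' dJ' ->]]]|/(_ (J 1))]; last first.
  by case; exists c, J.
have h t : 0 <= t <= 1 -> is_derive (t : R) 1 (fun s => J' s - J s) (f l (c' t) - f l (c t)).
  by move=> ht; exact: drv_sub (dJ' t ht) (dJ t ht).
have := derive0_constant ler01 h; rewrite J0 J0' subrr => /(_ _)/eqP; rewrite subr_eq0 => E.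
apply/eqP/E => t ht; by rewrite (sol1_unique hc' hc ht) subrr.
Qed.

Lemma sol1_zero x : sol1 (zero_section K x) (fun=> i x).
Proof.
split=> // t _; exists (fun=> 0); split; last by move=> g _; exact: drv_cst.
by move=> N _; apply/funext => g; rewrite big1// => l _; rewrite Cf_zero mul0r.
Qed.

Lemma psi1_zero x : psi1 (zero_section K x) = i x.
Proof. by rewrite (psi1E (sol1_zero x)). Qed.

Lemma prim_zero l x : prim l (zero_section K x) = f l (i x).
Proof.
have D t : 0 <= t <= 1 -> is_derive (t : R) 1 (fun s => s * f l (i x)) (f l (i x)).
  move=> _; have := drv_mul (drv_id t) (drv_cst (f l (i x)) t). by rewrite mul1r mulr0 addr0.
by have := primE (sol1_zero x) (mul0r (f l (i x))) D; rewrite mul1r.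
Qed.

(** In coordinates at z: an element of the graph of pi over the initial map [io] is carried to one
    over the final map [ps], while the pairing with variations v grows by the value of sum_l dC_l /\
    dI_l on (w, v). *)
Definition trans_at (Pi : 'I_m -> 'I_m -> fn R m) (io : 'I_m -> fn R (n + r)) (N : nat)
    (Ch Ih : 'I_N -> fn R (n + r)) (ps : 'I_m -> fn R (n + r)) z : Prop :=
  forall (w : 'rV[R]_(n + r)) (b0 : 'rV[R]_m),
    (forall k, 'D_w (io k) z = \sum_j b0 0 j * Pi j k (\row_k io k z)) ->
    exists b1 : 'rV[R]_m, (forall k, 'D_w (ps k) z = \sum_j b1 0 j * Pi j k (\row_k ps k z)) /\
      forall v, \sum_k b1 0 k * 'D_v (ps k) z = \sum_k b0 0 k * 'D_v (io k) z +
        \sum_l wedge (Ch l) (Ih l) w v z.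

Definition ann_at (Pi : 'I_m -> 'I_m -> fn R m) (io ps : 'I_m -> fn R (n + r)) z : Prop :=
  exists P : 'M[R]_m, P \in unitmx /\
    forall b0 : 'rV[R]_m, (forall k, \sum_j b0 0 j * Pi j k (\row_k io k z) = 0) ->
      (forall k, \sum_j (b0 *m P) 0 j * Pi j k (\row_k ps k z) = 0) /\
      forall v, \sum_k (b0 *m P) 0 k * 'D_v (ps k) z = \sum_k b0 0 k * 'D_v (io k) z.

(* The local expression of the first stage near the zero of x0. *)
Record rep1 (x0 : X) (xs : S -> 'rV[R]_(n + r)) (As : set S)
    (y : M -> 'rV[R]_m) (y' : 'rV[R]_m -> M) (A : set M)
    (Pi : 'I_m -> 'I_m -> fn R m) (io : 'I_m -> fn R (n + r))
    (N : nat) (Ch Fh Ih : 'I_N -> fn R (n + r)) (ps : 'I_m -> fn R (n + r)) : Prop :=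
  Rep1 {
  r1_smPi : forall j k, sm (Pi j k);
  r1_smio : forall k, sm (io k);
  r1_smC : forall l, sm (Ch l);
  r1_smF : forall l, sm (Fh l);
  r1_smI : forall l, sm (Ih l);
  r1_smps : forall k, sm (ps k);
  r1_near : snear (zero_section K x0) [set p : S | [/\ As p,
    (forall l, (N <= l)%N -> Cf l p = 0) /\
    (forall u, tangent (base p) u -> u = fun h => \sum_(l < N) u (f l \o i) * W l (base p) h),
    forall l : 'I_N, [/\ Cf l p = Ch l (xs p), Ff l p = Fh l (xs p) & prim l p = Ih l (xs p)],
    (A (i (base p)) /\ y (i (base p)) = \row_k io k (xs p)) /\
    (A (psi1 p) /\ y (psi1 p) = \row_k ps k (xs p)) &
    (forall j k, bracket pi (fun q => y q 0 j) (fun q => y q 0 k) (i (base p)) =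
      Pi j k (\row_k io k (xs p))) /\
    (forall j k, bracket pi (fun q => y q 0 j) (fun q => y q 0 k) (psi1 p) =
      Pi j k (\row_k ps k (xs p)))]];
  r1_trans : snear (zero_section K x0) [set p : S | trans_at Pi io Ch Ih ps (xs p)];
  r1_ann : snear (zero_section K x0) [set p : S | ann_at Pi io ps (xs p)] }.

Section StageOneLocal.
Variables (x0 : X) (xs : S -> 'rV[R]_(n + r)) (ys : 'rV[R]_(n + r) -> S) (As : set S)
  (Bs : set 'rV[R]_(n + r)).
Variables (y : M -> 'rV[R]_m) (y' : 'rV[R]_m -> M) (A : set M) (B : set 'rV[R]_m).
Hypotheses (cs : coords xs ys As Bs) (As0 : As (zero_section K x0)).
Hypotheses (cy : coords y y' A B) (A0 : A (i x0)).

(** The point of M and the N integrals I_l are solved for together, as m + N unknowns with a cutoff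
    around y0. At z0 all C_l are 0, so the curve rests at y0, and curves for nearby z stay where the
    cutoff is 1 and solve the true equation. *)
Lemma stage1_local : exists Pi io N Ch Fh Ih ps, @rep1 x0 xs As y y' A Pi io N Ch Fh Ih ps.
Proof.
pose p0 := zero_section K x0; pose z0 := xs p0; pose y0 := y (i x0). have sy k := co_smooth cy k.
have [N nN] := Cf_fam p0. have [Ch hC] := co_ext_fam cs (fun l : 'I_N => Cf_smooth l) As0.
have [Fh hF] := co_ext_fam cs (fun l : 'I_N => Ff_smooth l) As0.
have siy k : smooth (fun z : S => y (i (base z)) 0 k).
  by apply: (base_smooth (h := fun x => y (i x) 0 k)); exact: i_smooth (sy k).
have [io hio] := co_ext_fam cs siy As0. have [ph hph] := co_ext_fam cy (fun l : 'I_N => st_f H l) A0.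
have [Pi [sPi nPi frPi]] := poisson_rep gM (st_pi H) cy A0. have sC l : sm (Ch l) by case: (hC l).
have sph l : sm (ph l) by case: (hph l). have sio k : sm (io k) by case: (hio k). pose chi := cutoff y0 1.
pose PM q := [/\ A q, forall l : 'I_N, snear q [set q' | f l q' = ph l (y q')],
  forall j k, bracket pi (fun q => y q 0 j) (fun q => y q 0 k) q = Pi j k (y q) & poisson_frame Pi (y q)].
have nPM : snear (i x0) PM. apply: snear2 (snearI (snear_push cy A0 frPi) nPi)
    (snear_fin (fun l => snear_snear (hph l).2)) _ => q [[Aq hfr] hPi] hq. by split.
have [rho rho0 hrho] := nbhs_rV2 (cutoff_near y0 ltr01) (near_pull cy A0 nPM).
have C0 l : Ch l z0 = 0 by rewrite -(snear_self (hC l).2) Cf_zero. have io0 : \row_k io k z0 = y0.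
  by apply/rowP => k; rewrite mxE -(snear_self (hio k).2). pose g l k z := \sum_j pd j (ph l) z * Pi j k z.
have sD (F : fn R m) v : sm F -> sm ('D_v F) by exact: sm_derive.
have sg l k : sm (g l k) by apply: sm_sum => j; apply: sm_mul => //; exact: sD.
pose F (k : 'I_(m + N)) (s : 'rV[R]_((1 + (n + r)) + (m + N))) : R := match fintype.split k with
  | inl k => \sum_l Ch l (rsubmx (lsubmx s)) * (chi (lsubmx (rsubmx s)) * g l k (lsubmx (rsubmx s)))
  | inr l => chi (lsubmx (rsubmx s)) * ph l (lsubmx (rsubmx s)) end. have schi : sm chi by exact: sm_cutoff.
have sz (h : fn R (n + r)) : sm h -> sm (fun s : 'rV[R]_((1 + (n + r)) + (m + N)) => h (rsubmx (lsubmx s))).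
  move=> sh; apply: (sm_comp (F := h)) => // k.
  apply: (sm_comp (F := fun q => rsubmx q 0 k) (g := fun s => lsubmx s)). exact: sm_rsubmx.
  by move=> l; exact: sm_lsubmx. have su (h : fn R m) : sm h ->
    sm (fun s : 'rV[R]_((1 + (n + r)) + (m + N)) => h (lsubmx (rsubmx s))).
  move=> sh; apply: (sm_comp (F := h)) => // k.
  apply: (sm_comp (F := fun q => lsubmx q 0 k) (g := fun s => rsubmx s)). exact: sm_lsubmx.
  by move=> l; exact: sm_rsubmx. have sF k : sm (F k). rewrite /F; case: (fintype.split k) => [k'|l].
    by apply: sm_sum => l; apply: sm_mul; [exact: sz|apply: sm_mul; exact: su]. by apply: sm_mul; exact: su.
pose yi (k : 'I_(m + N)) (z : 'rV[R]_(n + r)) : R :=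
  match fintype.split k with inl k => io k z | inr _ => 0 end. have syi k : sm (yi k).
  by rewrite /yi; case: (fintype.split k) => [k'|_]; [exact: sio|exact: sm_cst].
have grow rr : exists2 K', 0 <= K' & forall q z k, `|q| <= rr -> `|F k (row_mx q z)| <= K' * (1 + `|z|).
  have [c c0 hc] := cont_bounded_fin rr (fun l => sm_cont (sC l)).
  have [k1 k10 hk1] := cutoff_bounded y0 ltr01 (fun lk : 'I_N * 'I_m => sg lk.1 lk.2).
  have [k2 k20 hk2] := cutoff_bounded y0 ltr01 sph.
  exists (N%:R * (c * k1) + k2); first by rewrite addr_ge0// !mulr_ge0.
  move=> q z k hq; apply: (@le_trans _ _ (N%:R * (c * k1) + k2)); last first.
    by rewrite ler_peMr ?addr_ge0 ?mulr_ge0// lerDl.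
  rewrite /F; case: (fintype.split k) => [k'|l]; rewrite row_mxKr ?row_mxKl.
    apply: le_trans (norm_sum_le (C := c * k1) _) _; last by rewrite lerDl.
    move=> l; rewrite normrM; apply: ler_pM => //; last exact: (hk1 (l, k')).
    by apply: hc; apply: le_trans hq; exact: norm_rsubmx.
  by apply: le_trans (hk2 l _) _; rewrite lerDr !mulr_ge0. have [Y [sY Y0 Yode]] := param_flow sF syi grow.
pose ym k := Y (lshift N k); pose Im l := Y (rshift m l). have sym k : sm (ym k) by exact: sY.
have sIm l : sm (Im l) by exact: sY. have posE q : lsubmx (\row_j Y j q) = pos ym q.
  by apply/rowP => k; rewrite !mxE.
have Iode l q : pd (lshift (n + r) 0) (Im l) q = chi (pos ym q) * ph l (pos ym q).
  by rewrite /Im Yode /F split_rshift row_mxKr posE.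
have ym0 k z : ym k (tv 0 z) = io k z by rewrite /ym Y0 /yi split_lshift.
have Im0 l z : Im l (tv 0 z) = 0 by rewrite /Im Y0 /yi split_rshift.
pose sg1 j q := \sum_l Ch l (rsubmx q) * (chi (pos ym q) * pd j (ph l) (pos ym q)).
have sCz l : sm (fun q : 'rV[R]_(1 + (n + r)) => Ch l (rsubmx q)).
  by apply: (sm_comp (F := Ch l)) => // k; exact: sm_rsubmx.
have spos (h : fn R m) : sm h -> sm (fun q => h (pos ym q)). by move=> sh; exact: (smY sym).
have ssg1 j : sm (sg1 j). apply: sm_sum => l; apply: sm_mul => //; apply: sm_mul; first exact: spos.
  by apply: (spos (pd j (ph l))); exact: sD.
have ode1 k q : pd (lshift (n + r) 0) (ym k) q = \sum_j sg1 j q * Pi j k (pos ym q).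
  rewrite /ym Yode /F split_lshift row_mxKr posE row_mxKl /sg1.
  under [RHS]eq_bigr do rewrite mulr_suml; rewrite [RHS]exchange_big/=.
  apply: eq_bigr => l _; rewrite /g !mulr_sumr; apply: eq_bigr => j _; ring.
have pos0 z : pos ym (tv 0 z) = \row_k io k z. by apply/rowP => k; rewrite !mxE ym0.
have cst0 t k : 0 <= t <= 1 -> ym k (tv t z0) = y0 0 k. move=> /andP[t0 t1].
  have h s : 0 <= s <= t -> is_derive (s : R) 1 (fun s => ym k (tv s z0)) (pd (lshift (n + r) 0) (ym k) (tv s z0)).
    by move=> _; apply: derive_tv; exact: sm_diff.
  have := derive0_constant t0 h; rewrite ym0 -io0 mxE; apply => s hs.
  rewrite ode1 big1// => j _; rewrite /sg1 big1 ?mul0r// => l _. by rewrite row_mxKr C0 mul0r.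
have [del del0 hdel] := tube_rV sym cst0 rho0. have goodt z : `|z - z0| < del -> forall t, 0 <= t <= 1 ->
    chi (pos ym (tv t z)) = 1 /\ B (pos ym (tv t z)) /\ PM (y' (pos ym (tv t z))).
  by move=> hz t ht; apply: hrho; exact: hdel. have nz := snear_ball cs As0 del0.
have frt z : `|z - z0| < del -> forall t, 0 <= t <= 1 -> poisson_frame Pi (pos ym (tv t z)).
  move=> hz t ht; have [_ [Bz [_ _ _]]] := goodt z hz t ht. by rewrite (co_xy cy).
pose ps k z := ym k (tv 1 z); pose Ih l z := Im l (tv 1 z).
have stv (h : fn R (1 + (n + r))) t : sm h -> sm (fun z => h (tv t z)).
  move=> sh; apply: (sm_comp (F := h)) => // k; apply: sm_row_mx => l. exact: sm_cst. exact: sm_coord.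
have sB1 (j k : 'I_m) : sm (fun _ : 'rV[R]_m => (j == k)%:R : R) by exact: sm_cst.
have sc1 (j i' l : 'I_m) : sm (pd l (Pi j i')) by exact: sD. exists Pi, io, N, Ch, Fh, Ih, ps; split=> //.
- by move=> l; case: (hF l).
- by move=> l; exact: stv.
- by move=> k; exact: stv.
- have sib : smooth_map (fun z : S => i (base z)).
    by move=> h sh; apply: (base_smooth (h := fun x => h (i x))); exact: i_smooth sh.
  have nA : snear p0 [set p : S | A (i (base p))]. by apply: (snear_preim sib); exact: snear_A cy _ A0.
  apply: snear2 (snearI nN nz) (snearI (snear_fin (fun l => (hC l).2))
    (snearI (snear_fin (fun l => (hF l).2)) (snearI nA (snear_fin (fun k => (hio k).2))))) _.
  move=> p [[hN hfam] [Ap hp]] [CE [FE [Aip ioE]]]. pose z := xs p; pose c (t : R) := y' (pos ym (tv t z)).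
  have [_ [B0 PM0]] := goodt z hp 0 in01_0; have [_ [B1 PM1]] := goodt z hp 1 in01_1. rewrite pos0 in B0 PM0.
  have yio : y (i (base p)) = \row_k io k z. by apply/rowP => k; rewrite mxE; exact: ioE.
  have c0 : y' (\row_k io k z) = i (base p) by rewrite -yio (co_yx cy). have hc : sol1 p c.
    split; first by rewrite /c pos0. move=> t ht; have [chi1 [Bt [Act fph brPi _]]] := goodt z hp t ht.
    exists (fun g => \sum_(l < N) Cf l p * sharp pi (c t) (diff_at (f l) (c t)) g); split.
      move=> N' hN'; apply/funext => h.
      apply: (sum_trunc (a := fun l => Cf l p * sharp pi (c t) (diff_at (f l) (c t)) h)) => l hl.
        by rewrite (hN l hl) mul0r. by rewrite (hN' l hl) mul0r.
    move=> h sh; have [G [sG nGh nG]] := co_ext cy sh Act.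
    have yc : y (c t) = pos ym (tv t z) by rewrite /c (co_xy cy). rewrite yc in nGh.
    have nE : \forall s \near t, G (pos ym (tv s z)) = h (c s) by exact: pos_tv_cont sym _ nGh.
    apply: near_eq_is_derive nE _. have dG := derive_tv (sm_diff (tv t z) (spos G sG)).
    apply: (drv_eq dG) => // ; rewrite (D_et_Y sym ode1 _ sG).
    transitivity (\sum_(l < N) Cf l p * \sum_j \sum_k pd j (ph l) (pos ym (tv t z)) *
        pd k G (pos ym (tv t z)) * Pi j k (pos ym (tv t z))); last first. apply: eq_bigr => l _; congr *%R.
      rewrite /sharp (poisson_code gM (st_pi H) cy Act); try exact: diff_at_cotangent (st_f H l).
        rewrite (ccode_diff gM cy Act (st_f H l) (sph l) (fph l)) (ccode_diff gM cy Act sh sG nG).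
        apply: eq_bigr => j _; apply: eq_bigr => k _; rewrite -/(c t) in brPi. by rewrite !mxE brPi yc.
      exact: diff_at_cotangent. rewrite /sg1; under eq_bigr do rewrite mulr_suml; rewrite exchange_big/=.
    apply: eq_bigr => l _; rewrite CE mulr_sumr; apply: eq_bigr => j _.
    rewrite row_mxKr chi1 mul1r -mulrA mulr_sumr; congr *%R. by apply: eq_bigr => k _; ring.
  have psE : psi1 p = y' (\row_k ps k z). by rewrite (psi1E hc) /c; congr y'; apply/rowP => k; rewrite !mxE.
  have p1E : pos ym (tv 1 z) = \row_k ps k z by apply/rowP => k; rewrite !mxE. rewrite p1E in B1 PM1.
  split=> //.
  + move=> l; split; [exact: CE|exact: FE|].
    have dJ t : 0 <= t <= 1 -> is_derive (t : R) 1 (fun t => Im l (tv t z)) (f l (c t)).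
      move=> ht; have [chi1 [Bt [Act fph _ _]]] := goodt z hp t ht.
      apply: (drv_eq (derive_tv (sm_diff (tv t z) (sIm l)))) => //.
      by rewrite Iode chi1 mul1r (snear_self (fph l)) (co_xy cy). by have := primE hc (Im0 l z) dJ.
  + split; first by split. by rewrite psE (co_xy cy)//; split=> //; case: PM1.
  + split=> j k. by case: PM0 => _ _ + _; rewrite c0 yio; apply.
    by case: PM1 => _ _ + _; rewrite -psE (psE) (co_xy cy)//; apply.
- apply: snearS nz => p [Ap hp] w b0 hb0; pose z := xs p; pose w' := row_mx (0 : 'rV[R]_1) w.
  have Dsl (h : fn R (1 + (n + r))) (t : R) u :
      'D_(row_mx 0 u) h (tv t z) = 'D_u (fun z => h (tv t z)) z by exact: D_slice.
  have D0 k u : 'D_(row_mx 0 u) (ym k) (tv 0 z) = 'D_u (io k) z.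
    by rewrite Dsl; congr ('D_u _ z); apply/funext => z'; exact: ym0.
  have D1 k u : 'D_(row_mx 0 u) (ym k) (tv 1 z) = 'D_u (ps k) z by exact: Dsl.
  have DI0 l u : 'D_(row_mx 0 u) (Im l) (tv 0 z) = 0.
    rewrite Dsl; have -> : (fun z => Im l (tv 0 z)) = fun=> 0 by apply/funext => z'; exact: Im0. exact: D_cst.
  have DI1 l u : 'D_(row_mx 0 u) (Im l) (tv 1 z) = 'D_u (Ih l) z by exact: Dsl.
  have DC l u t : 'D_(row_mx 0 u) (fun q => Ch l (rsubmx q)) (tv t z) = 'D_u (Ch l) z.
    by rewrite Dsl; congr ('D_u _ z); apply/funext => z'; rewrite row_mxKr.
  have P0 k : \sum_l (b0 0 l * Pi k l (pos ym (tv 0 z)) + (k == l)%:R * 'D_w' (ym l) (tv 0 z)) = 0.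
    rewrite big_split/= sum_deltal /w' D0 hb0 pos0 -big_split big1// => l _.
    by have := poisson_frame_skew k l (frt z hp 0 in01_0); rewrite pos0 /= => ->; rewrite mulrN addNr.
  have [b [bi bP bd]] := transport sPi sB1 sc1 ssg1 sym ode1 (frt z hp) P0.
  have al l : alpha (fun j k _ => (j == k)%:R) sg1 ym l = sg1 l.
    apply/funext => q; rewrite /alpha (bigD1 l)//= big1 ?addr0; first by rewrite eqxx mulr1.
    by move=> j jl; rewrite (negPf jl) mulr0. exists (\row_l b l (tv 1 z)); split=> [k|v].
    have := bP 1 k in01_1; rewrite big_split/= sum_deltal /w' D1 => /eqP.
    rewrite addrC addr_eq0 => /eqP ->; rewrite -sumrN.
    have p1E : pos ym (tv 1 z) = \row_k ps k z by apply/rowP => j; rewrite !mxE.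
    apply: eq_bigr => j _; rewrite mxE -p1E. by rewrite (poisson_frame_skew j k (frt z hp 1 in01_1)) mulrN.
  (* The function h is constant: along the flow the transported 1-form is sum_l C_l d(f_l), so the
     pairing grows at the rate sum_l dC_l /\ d(f_l), and d(f_l) is the time derivative of the
     differential of the running integral [Im l]. *)
  pose v' := row_mx (0 : 'rV[R]_1) v. pose h (s : R) := \sum_l b l (tv s z) * 'D_v' (ym l) (tv s z) -
    \sum_l ('D_w (Ch l) z * 'D_v' (Im l) (tv s z) - 'D_v (Ch l) z * 'D_w' (Im l) (tv s z)).
  have sDI l u : sm ('D_u (Im l)) by exact: sm_derive.
  pose dh (s : R) := \sum_l ('D_w' (sg1 l) (tv s z) * 'D_v' (ym l) (tv s z) -
               'D_v' (sg1 l) (tv s z) * 'D_w' (ym l) (tv s z)) -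
    \sum_l ('D_w (Ch l) z * pd (lshift (n + r) 0) ('D_v' (Im l)) (tv s z) -
      'D_v (Ch l) z * pd (lshift (n + r) 0) ('D_w' (Im l)) (tv s z)).
  have hd t : 0 <= t <= 1 -> is_derive (t : R) 1 h (dh t). move=> ht; apply: drv_sub.
      by apply: (drv_eq (bd t v' ht)) => //; apply: eq_bigr => l _; rewrite al.
    apply: drv_sum => l _; apply: drv_sub.
      have := drv_mul (drv_cst ('D_w (Ch l) z) t) (derive_tv (sm_diff (tv t z) (sDI l v'))).
      by rewrite mul0r add0r.
    have := drv_mul (drv_cst ('D_v (Ch l) z) t) (derive_tv (sm_diff (tv t z) (sDI l w'))).
    by rewrite mul0r add0r. have hd0 t : 0 <= t <= 1 -> dh t = 0.
    move=> ht; have nchi : \forall q \near tv t z, chi (pos ym q) = 1.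
      have := hdel t z ht hp; set u0 := \row_k ym k (tv t z) => hu.
      have : nbhs (pos ym (tv t z)) [set u | `|u - y0| < rho].
        by apply: open_nbhs_nbhs; split=> //; exact: open_norm_lt.
      move=> nb; have n3 : \forall q \near tv t z, `|pos ym q - y0| < rho := pos_cont sym nb.
      by apply: filterS n3 => q hq; have [] := hrho _ hq.
    have sphY l : sm (fun q => ph l (pos ym q)) by exact: spos.
    have tf := two_form (q := tv t z) (a := sg1) (y := ym) (g := fun l q => Ch l (rsubmx q))
      (h := fun l q => ph l (pos ym q)) ssg1 sym sCz sphY. rewrite /dh tf; last first.
      move=> u; apply: filterS nchi => q chi1. under [RHS]eq_bigr do rewrite (D_Y sym _ _ (sph _)) mulr_sumr.
      rewrite [RHS]exchange_big/=; apply: eq_bigr => l _; rewrite /sg1 mulr_suml.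
      by apply: eq_bigr => a _; rewrite chi1; ring.
    apply/eqP; rewrite subr_eq0; apply/eqP; apply: eq_bigr => l _; rewrite !DC.
    have E u : pd (lshift (n + r) 0) ('D_u (Im l)) (tv t z) = 'D_u (fun q => ph l (pos ym q)) (tv t z).
      rewrite schwarz//. have s1 : sm (pd (lshift (n + r) 0) (Im l)) by exact: sm_derive.
      apply: (D_near _ s1 (sphY l)). by apply: filterS nchi => q chi1; rewrite Iode chi1 mul1r. by rewrite !E.
  have := derive0_constant ler01 hd hd0; rewrite /h. under [in RHS]eq_bigr do rewrite bi D0.
  rewrite [X in _ = _ - X -> _]big1; last by move=> l _; rewrite !DI0 !mulr0 subrr.
  rewrite subr0 => /eqP; rewrite subr_eq => /eqP E.
  transitivity (\sum_l b l (tv 1 z) * 'D_v' (ym l) (tv 1 z)). by apply: eq_bigr => l _; rewrite mxE /v' D1.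
  rewrite E; congr +%R; apply: eq_bigr => l _; by rewrite /v' /w' !DI1.
- apply: snearS nz => p [Ap hp]; pose z := xs p.
  have [P [uP hP]] := annihilator_transport sPi sB1 sc1 ssg1 sym ode1 (frt z hp). exists P; split=> // b0 hb0.
  have p1E : pos ym (tv 1 z) = \row_k ps k z by apply/rowP => j; rewrite !mxE.
  have sk t (ht : 0 <= t <= 1) b k : \sum_l b 0 l * Pi k l (pos ym (tv t z)) =
      - \sum_l b 0 l * Pi l k (pos ym (tv t z)).
    by rewrite -sumrN; apply: eq_bigr => l _; rewrite (poisson_frame_skew k l (frt z hp t ht)) mulrN.
  have [|hP1 hP2] := hP b0. by move=> k; rewrite (sk _ _ in01_0) pos0 hb0 oppr0. split=> [k|v].
    by have /eqP := hP1 k; rewrite (sk _ _ in01_1) oppr_eq0 p1E => /eqP. have := hP2 (row_mx 0 v) => E.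
  transitivity (\sum_k (b0 *m P) 0 k * 'D_(row_mx 0 v) (ym k) (tv 1 z)).
    by apply: eq_bigr => k _; rewrite D_slice. rewrite E; apply: eq_bigr => k _; congr *%R; rewrite D_slice.
  by congr ('D_v _ z); apply/funext => z'; exact: ym0.
Qed.

End StageOneLocal.
Let dL := st_dL H.
Notation pro := (@pr R X K).
Notation zero := (zero_section K).
Notation D := (n + r)%N.

Lemma pro_smooth : smooth_map pro. Proof. exact: pr_smooth. Qed.

Lemma zero_smooth : smooth_map zero.
Proof. by have := @zero_section_smooth R n X K gX. Qed.

(* The closed 2-form sum_l dC_l /\ d((1 - t) F_l + t I_l). *)
Definition etaN N (t : R) (q : S) (v w : vec S) : R :=
  \sum_(l < N) (v (Cf l) * (w (Ff l) + t * (w (germ q (prim l)) - w (Ff l))) -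
                w (Cf l) * (v (Ff l) + t * (v (germ q (prim l)) - v (Ff l)))).

(** The Moser field as a relation free of coordinates: v together with sum_l C_l d(F_l - I_l) lies
    in pr^! L twisted by the moving form. The truncation N is treated as in [flow1], except that the
    C_l must vanish near q, since they are differentiated. *)
Definition flow2 (t : R) (q : S) (v : vec S) : Prop :=
  tangent q v /\ forall N, snear q [set z | forall l, (N <= l)%N -> Cf l z = 0] ->
  exists b, L (base q) (push pro v, b) /\ forall w, tangent q w ->
    b (push pro w) = \sum_(l < N) Cf l q * (w (Ff l) - w (germ q (prim l))) - etaN N t q v w.

Definition sol2 (p : S) (c : R -> S) : Prop := c 0 = p /\ curve_of flow2 c.

Lemma proj_K_comb q N (t : 'I_N -> R) (v : 'I_N -> vec X) : (forall l, tangent q (v l)) ->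
  proj_K L C q (fun h => \sum_l t l * v l h) = fun h => \sum_l t l * proj_K L C q (v l) h.
Proof.
move=> hv; have Pv l := proj_KP (st_dim H) (st_comp H) (hv l). apply: (proj_K_unique (st_dim H) (st_comp H)).
  by apply: lin_comb; [exact: linK (st_dim H) q|move=> l; case: (Pv l)].
have := lin_comb (index_enum 'I_N) t (linC (st_comp H) q) (fun l => (Pv l).2).
congr (C q); apply/funext => h; rewrite -sumrB. by apply: eq_bigr => l _; rewrite mulrBr.
Qed.

(** Projecting the resolution of the identity to K shows that the numbers C_l determine the
    functional. The same identity governs vertical derivatives at the zero section and the size of
    fibre coordinates. *)
Lemma fib_families (p : S) N Z :
  (forall u, tangent (base p) u -> u = fun h => \sum_(l < N) u (f l \o i) * W l (base p) h) ->
  section_of K Z -> fib p (Z (base p)) = - \sum_(l < N) Cf l p * Z (base p) (f l \o i).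
Proof.
move=> hN [[tZ _] KZ]. have dp : dual_of (K (base p)) (fib p) := svalP p.
have tW l : tangent (base p) (W l (base p)) by case: (st_W H l).
rewrite -{1}(proj_K_id (st_dim H) (st_comp H) (KZ (base p))) {1}(hN _ (tZ _)) proj_K_comb//.
rewrite (dual_comb _ _ (linK (st_dim H) _) dp); last first.
  by move=> l; case: (proj_KP (st_dim H) (st_comp H) (tW l)).
by rewrite -sumrN; apply: eq_bigr => l _; rewrite /Cf; ring.
Qed.

Lemma push_zero x u : tangent x u -> push pro (push zero u) = u.
Proof.
move=> hu; apply/funext => g; have [sg|ng] := pselect (smooth g).
  rewrite pushE// pushE//; exact: pro_smooth sg. by rewrite /push patchN ?notin_setE//; case: hu => ->.
Qed.

Section Transversality.
Variables (x : X) (N : nat) (Ih : nat -> S -> R).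
Notation p := (zero x).
Hypothesis nN : snear p [set z : S | (forall l, (N <= l)%N -> Cf l z = 0) /\
  forall u, tangent (base z) u -> u = fun h => \sum_(l < N) u (f l \o i) * W l (base z) h].
Hypothesis sIh : forall l, smooth (Ih l).
Hypothesis nIh : forall l, (l < N)%N -> snear p [set z | prim l z = Ih l z].

Lemma zero_Cf u l : tangent x u -> push zero u (Cf l) = 0.
Proof.
move=> hu; rewrite pushE; last exact: (Cf_smooth).
have -> : Cf l \o zero = fun=> 0 by apply/funext => z; exact: Cf_zero. exact: (tan_cst gX _ hu).
Qed.

Lemma zero_Ff u l : tangent x u -> push zero u (Ff l) = u (f l \o i).
Proof. by move=> hu; rewrite pushE//; exact: (Ff_smooth). Qed.

Lemma germ_prim l w : (l < N)%N -> tangent p w -> w (germ p (prim l)) = w (Ih l).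
Proof. by move=> lN hw; have [_ ->] := germP gS (sIh l) (nIh lN). Qed.

Lemma zero_prim u l : (l < N)%N -> tangent x u -> push zero u (germ p (prim l)) = push zero u (Ff l).
Proof.
move=> lN hu; have hz := push_tangent gS zero_smooth hu; rewrite germ_prim//.
rewrite pushE// zero_Ff//; apply: (tan_local gX hu); last first.
- apply: snearS (snear_preim zero_smooth (nIh lN)) => z /= <-. exact: (prim_zero).
- exact: i_smooth _ (st_f H l).
- exact: zero_smooth (sIh l).
Qed.

Lemma fib_deriv v Z : tangent p v -> section_of K Z ->
  v (fun z : S => fib z (Z (base z))) = - \sum_(l < N) v (Cf l) * Z x (f l \o i).
Proof.
move=> hv sZ; have [fZ KZ] := sZ. have sZf l : smooth (fun z : S => Z (base z) (f l \o i)).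
  have [_ sZ'] := fZ; apply: (base_smooth (h := fun q => Z q (f l \o i))).
  by apply: sZ'; exact: i_smooth _ (st_f H l).
have s1 l : smooth (fun z : S => Cf l z * Z (base z) (f l \o i)).
  by apply: (smooth_mul gS) => //; exact: (Cf_smooth).
rewrite (@tan_local _ _ _ gS _ _ _ (fun z : S => - \sum_(l < N) Cf l z * Z (base z) (f l \o i)) hv).
- rewrite (tan_opp gS hv); last exact: (smooth_sum gS).
  rewrite (tan_sum gS _ _ hv)//; congr (- _); apply: eq_bigr => l _.
  rewrite (tan_mul hv)//; last exact: (Cf_smooth). by rewrite Cf_zero mul0r addr0.
- exact: fib_smooth.
- by apply: (smooth_opp gS); exact: (smooth_sum gS).
- by apply: snearS nN => z [_ hz] /=; exact: fib_families.
Qed.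

Lemma model_tan_eq v w : tangent p v -> tangent p w ->
  (forall g, smooth g -> v (fun z : S => g (base z)) = w (fun z : S => g (base z))) ->
  (forall Z, section_of K Z ->
    v (fun z : S => fib z (Z (base z))) = w (fun z : S => fib z (Z (base z)))) -> v = w.
Proof.
move=> hv hw hb hf; have lK := linK (st_dim H). have [xc [yc [A [B [cx Ax]]]]] := good_coords gX x.
have [e [ww [se fw [A0 [oA0 A0x hA0]]]]] := frameK gX dL (st_dim H) (st_comp H) x. have sub := @subK R X L dL.
have cd := dual_coords lK sub cx se fw oA0 hA0. apply: (tan_eq gS cd (p := p)) => // k; rewrite /dual_x.
case: (fintype.split_ordP k) => a ->.
  have -> : (fun q : S => row_mx (xc (base q)) (\row_a fib q (e a (base q))) 0 (lshift r a)) =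
      fun q : S => xc (base q) 0 a by apply/funext => q; rewrite row_mxEl.
  exact: (hb (fun q => xc q 0 a) (co_smooth cx a)).
have -> : (fun q : S => row_mx (xc (base q)) (\row_a fib q (e a (base q))) 0 (rshift n a)) =
    fun q : S => fib q (e a (base q)) by apply/funext => q; rewrite row_mxEr mxE. exact: hf.
Qed.

(** On X the C_l vanish and I_l = F_l, so testing with vectors along X gives b = - sum_l v(C_l)
    d(f_l \o i). Pairing with K, which is isotropic to (v, b), kills the vertical part of v; hence b
    = 0 and v lies in K. Testing with vertical vectors, on which the form reduces to the pairing of
    K with its dual, leaves v = 0. *)
Lemma transversal0 t v b : tangent p v -> L x (push pro v, b) ->
  (forall w, tangent p w -> b (push pro w) = - etaN N t p v w) -> v = fun=> 0.
Proof.
move=> hv Lb hb; pose vX := push pro v. have hvX : tangent x vX by have := push_tangent gX pro_smooth hv.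
have [_ cb] := dirac_gt dL Lb. have bu u : tangent x u -> b u = - \sum_(l < N) v (Cf l) * u (f l \o i).
  move=> hu; have hz := push_tangent gS zero_smooth hu.
  rewrite -{1}(push_zero hu) hb// /etaN; congr (- _); apply: eq_bigr => l _.
  by rewrite zero_Cf// mul0r subr0 zero_prim// subrr mulr0 addr0 zero_Ff.
have fv Z : section_of K Z -> v (fun z : S => fib z (Z (base z))) = 0.
  move=> sZ; rewrite fib_deriv//; have [[tZ _] KZ] := sZ. rewrite -bu//; have := dirac_iso dL Lb (KZ x).
  by rewrite /pairing/= addr0. have vE : v = push zero vX.
  apply: model_tan_eq => //; first exact: push_tangent gS zero_smooth _ _ hvX.
    move=> g sg; rewrite pushE; last by exact: pro_smooth sg. by rewrite -/(vX _) /vX pushE.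
  move=> Z sZ; rewrite fv// fib_deriv//; last exact: push_tangent gS zero_smooth _ _ hvX.
  by rewrite big1 ?oppr0// => l _; rewrite zero_Cf// mul0r. have vC l : v (Cf l) = 0 by rewrite vE zero_Cf.
have b0 : b = fun=> 0. apply: (dual_ext cb); first exact: dual_of0.
  by move=> u hu; rewrite /= bu// big1 ?oppr0// => l _; rewrite vC mul0r.
have KvX : K x vX by have := Lb; rewrite b0.
have [e [ww [se fw nE]]] := frameK gX dL (st_dim H) (st_comp H) x. have [hev wd] := snear_self nE.
have [Z [fZ Zx]] := tan_field_ext gX hvX. have sZK := proj_K_section gX dL (st_dim H) (st_comp H) fZ.
pose ZK q := proj_K L C q (Z q). have ZKx : ZK x = vX by rewrite /ZK Zx (proj_K_id (st_dim H) (st_comp H)).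
have wF w : tangent p w -> push pro w = (fun=> 0) -> w (fun z : S => fib z (ZK (base z))) = 0.
  move=> hw w0; rewrite fib_deriv// ZKx.
  have := hb w hw; rewrite b0 /etaN => /esym/eqP; rewrite oppr_eq0 => /eqP E.
  rewrite -[RHS]E; apply/eqP; rewrite -sumrN; apply/eqP; apply: eq_bigr => l _.
  by rewrite vC mul0r sub0r vE zero_prim// subrr mulr0 addr0 zero_Ff. have w0 a : ww a x vX = 0.
  have [xc [yc [A [B [cx Ax]]]]] := good_coords gX x. have sub := @subK R X L dL; have lK := linK (st_dim H).
  have [A0 [oA0 A0x hA0]] := nE. have cd := dual_coords lK sub cx se fw oA0 hA0.
  have sfe b' : smooth (fun z : S => fib z (e b' (base z))) := fib_smooth (se b').
  pose w := @tvec R (n + r) S (dual_x xc e) (dual_y lK sub yc fw) p (row_mx 0 (ev a)).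
  have hw : tangent p w by exact: (tvec_tangent gS cd). have wx k : w (fun z : S => xc (base z) 0 k) = 0.
    have := tvec_coord cd (row_mx 0 (ev a)) (lshift r k) (p := p) => /(_ (conj Ax A0x)).
    rewrite row_mxEl mxE => h; rewrite -[RHS]h; congr w; apply/funext => z. by rewrite /dual_x row_mxEl.
  have we b' : w (fun z : S => fib z (e b' (base z))) = (a == b')%:R.
    have := tvec_coord cd (row_mx 0 (ev a)) (rshift n b') (p := p) => /(_ (conj Ax A0x)).
    rewrite row_mxEr mxE eqxx/= eq_sym => h; rewrite -[RHS]h; congr w; apply/funext => z.
    by rewrite /dual_x row_mxEr mxE. have pw : push pro w = fun=> 0.
    have t0 : tangent x (fun=> 0 : R) by case: (lin_set_tangent x).
    apply: (tan_eq gX cx Ax (push_tangent gX pro_smooth hw) t0) => k.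
    by rewrite pushE ?wx//; exact: co_smooth cx k.
  have := wF w hw pw; have sfw b' : smooth (fun z : S => ww b' (base z) (ZK (base z))).
    by apply: (base_smooth (h := fun q => ww b' q (ZK q))); case: (fw b') => _; apply; case: sZK.
  have sm1 b' : smooth (fun z : S => ww b' (base z) (ZK (base z)) * fib z (e b' (base z))).
    exact: (smooth_mul gS).
  rewrite (@tan_local _ _ _ gS _ _ _ (fun z : S => \sum_b' ww b' (base z) (ZK (base z)) *
      fib z (e b' (base z))) hw); last 3 first.
  - exact: (fib_smooth (V := ZK)).
  - exact: (smooth_sum gS).
  - have np := snear_preim (phi := pro) (p := p) pro_smooth nE. apply: snearS np => z [hz _] /=.
    have dz : dual_of (K (base z)) (fib z) := svalP z. have KZ : K (base z) (ZK (base z)) by case: sZK.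
    rewrite {1}(hz _ KZ) (dual_comb _ _ (lK _) dz)// => b'. by case: (se b').
  rewrite (tan_sum gS _ _ hw)// (bigD1 a)//= big1 ?addr0.
    by rewrite (tan_mul hw)// we eqxx mulr1 mulr0 add0r /= ZKx.
  by move=> b' b'a; rewrite (tan_mul hw)// we eq_sym (negPf b'a) /= !mulr0 addr0. have vX0 : vX = fun=> 0.
  by rewrite (hev _ KvX); apply/funext => g; rewrite big1// => a _; rewrite w0 mul0r.
rewrite vE vX0; apply/funext => g; have [sg|ng] := pselect (smooth g). by rewrite pushE.
by rewrite /push patchN// notin_setE.
Qed.

End Transversality.

(** Regularity is demanded of the chosen solution because the uniqueness argument needs it along one
    of the two curves. *)
Definition Phi (p : S) : S :=
  if pselect (exists c, sol2 p c /\ forall t, 0 <= t <= 1 -> regular_at D flow2 t (c t)) is left h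
  then projT1 (cid h) 1 else p.

Definition psi (p : S) : M := psi1 (Phi p).

Lemma PhiE p c : sol2 p c -> (forall t, 0 <= t <= 1 -> regular_at D flow2 t (c t)) -> Phi p = c 1.
Proof.
move=> [c0 hc] rc; rewrite /Phi; case: pselect => [h|[]]; last by exists c.
case: (cid h) => c' [[c0' hc'] rc'] /=. have e0 : c' 0 = c 0 by rewrite c0 c0'.
by have := curve_unique gS hc' hc e0 rc' (t := 1); apply; rewrite ler01 lexx.
Qed.

Variable j : S -> cotangent_bundle X.
Hypothesis jP : induced_inclusion C j.

Notation good_at := (poisson_germ (local_model j) pi psi).

Section Near.
Variables (x0 : X) (xc : X -> 'rV[R]_n) (yc : 'rV[R]_n -> X) (A : set X) (B : set 'rV[R]_n).
Variables (e : 'I_r -> X -> vec X) (ww : 'I_r -> X -> covec X) (A0 : set X).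
Hypotheses (cx : coords xc yc A B) (Ax0 : A x0) (se : forall a, section_of K (e a)).
Hypotheses (fw : forall a, form1 (ww a)) (oA0 : sopen A0) (A0x0 : A0 x0).
Hypothesis hA0 : forall q : X, A0 q -> (forall v, K q v -> v = fun f => \sum_a ww a q v * e a q f) /\
      forall a b, ww a q (e b q) = (a == b)%:R.
Let lK := linK (st_dim H).
Let sub := @subK R X L dL.
Notation xs := (dual_x xc e : S -> 'rV[R]_D).
Notation ys := (dual_y lK sub yc fw : 'rV[R]_D -> S).
Notation As := (dual_A A A0 : set S).
Notation tcs := (@tcode R (n + r) S (dual_x xc e)).
Notation tvs := (@tvec R (n + r) S (dual_x xc e) (dual_y lK sub yc fw)).
Let cs := dual_coords lK sub cx se fw oA0 hA0.
Variables (Ah Bh : 'I_n -> 'I_n -> fn R n) (c : 'I_n -> 'I_n -> 'I_n -> fn R n)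
  (Hh : 'I_(n + n) -> 'I_n -> fn R n).
Hypothesis rL : dirac_rep L xc yc A x0 Ah Bh c Hh.
Notation mxA := (mxA r Ah).
Notation mxB := (mxB r Bh).

Lemma push_pro_tcode (q : S) v : tangent q v -> tcode xc (base q) (push pro v) = lsubmx (tcs q v).
Proof.
move=> hv; apply/rowP => k; rewrite !mxE pushE; last exact: (co_smooth cx k).
by congr v; apply/funext => z; rewrite /dual_x /= row_mxEl.
Qed.

(** A frame of L over X together with r vertical vectors carrying the covector 0 spans pr^! L, so
    membership becomes a pair of matrix equations in the frame coordinates s. *)
Lemma dmodel : snear x0 [set b : X | forall (q : S) v (om : 'rV[R]_(n + r)), base q = b -> A0 b -> tangent q v ->
  (exists be, L (base q) (push pro v, be) /\ forall w, tangent q w ->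
     be (push pro w) = \sum_k om 0 k * tcs q w 0 k) <->
  exists s : 'rV[R]_(n + r), tcs q v = s *m mxA (xc b) /\ om = s *m mxB (xc b)].
Proof.
apply: snearS (dr_mem rL) => b [Ab mb] q v om qb A0b hv; subst b. have dq : dual_A A A0 q by [].
have hv' : tangent (base q) (push pro v) by have := push_tangent gX pro_smooth hv.
have tw w k : tangent q w -> tcode xc (base q) (push pro w) 0 k = tcs q w 0 (lshift r k).
  by move=> hw; rewrite push_pro_tcode// mxE. split=> [[be [/mb[[_ cbe] [k hk]] hom]]|[s [vE omE]]].
  exists (row_mx k (rsubmx (tcs q v))); rewrite !mul_row_block !mulmx0 !addr0 add0r mulmx1. split.
    rewrite -[LHS]hsubmxK; congr row_mx; apply/rowP => l; rewrite -push_pro_tcode//.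
    by rewrite (hk l).1 !mxE; apply: eq_bigr => i1 _; rewrite mxE.
  apply/rowP => a; have := hom _ (tvec_tangent gS cs (ev a) dq). rewrite (tvecK cs _ dq) sum_ev => <-.
  have ht : tangent (base q) (push pro (tvs q (ev a))).
    by have := push_tangent gX pro_smooth (tvec_tangent gS cs (ev a) dq).
  have := cot_code gX cx Ab cbe ht; rewrite /= => ->.
  under eq_bigr do rewrite (tw _ _ (tvec_tangent gS cs (ev a) dq)).
  rewrite (tvecK cs _ dq); case: (fintype.split_ordP a) => l ->.
    rewrite row_mxEl; under eq_bigr do rewrite [X in _ * X]mxE eqxx eq_sym (inj_eq (@lshift_inj _ _)) /=.
    by rewrite sum_deltar (hk l).2 !mxE; apply: eq_bigr => i1 _; rewrite mxE.
  by rewrite row_mxEr mxE big1// => l' _; rewrite [X in _ * X]mxE eq_lrshift andbF mulr0.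
exists (cvec xc (base q) (lsubmx om)); split. apply/mb; split; first by split=> //=; exact: cvec_cotangent.
  exists (lsubmx s) => l; rewrite (cvecK gX cx _ Ab) push_pro_tcode// vE omE.
  have -> : s = row_mx (lsubmx s) (rsubmx s) by rewrite hsubmxK.
  rewrite !mul_row_block !row_mxKl !mulmx0 !addr0 !(mxE _ _ 0 l).
  by split; apply: eq_bigr => i1 _; rewrite !mxE.
move=> w hw; rewrite cvecE; last by have := push_tangent gX pro_smooth hw. have om0 a : om 0 (rshift n a) = 0.
  by rewrite omE -(hsubmxK s) mul_row_block row_mxEr !mulmx0 addr0 mxE.
rewrite big_split_ord/= [X in _ + X]big1 ?addr0; last by move=> a _; rewrite om0 mul0r.
by apply: eq_bigr => k _; rewrite -tw// !mxE.
Qed.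

Variables (y : M -> 'rV[R]_m) (y' : 'rV[R]_m -> M) (AM : set M) (BM : set 'rV[R]_m).
Hypotheses (cy : coords y y' AM BM) (AM0 : AM (i x0)).
Variables (Pi : 'I_m -> 'I_m -> fn R m) (io : 'I_m -> fn R D) (N : nat)
  (Ch Fh Ih : 'I_N -> fn R D) (ps : 'I_m -> fn R D).
Hypothesis r1 : rep1 x0 xs As y y' AM Pi io Ch Fh Ih ps.
Notation p0 := (zero x0).
Notation z0 := (xs p0).
Notation etaM := (@etaM R n r N Ch Fh Ih).
Notation frameM := (@frameM R n r N Ah Bh Ch Fh Ih).
Notation primM := (@primM R n r N Ch Fh Ih).
Notation br q := (fun j k => bracket pi (fun z => y z 0 j) (fun z => y z 0 k) q).

(** Everything used from the local representations, stated at a moving point because both p and its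
    image under the Moser flow have to satisfy it. *)
Record nice (q : S) : Prop := Nice {
  nc_A : As q;
  nc_C : snear q [set p : S | (forall l, (N <= l)%N -> Cf l p = 0) /\ forall l : 'I_N,
    [/\ Cf l p = Ch l (xs p), Ff l p = Fh l (xs p) & prim l p = Ih l (xs p)]];
  nc_io : snear q [set p : S | AM (i (base p)) /\ y (i (base p)) = \row_k io k (xs p)];
  nc_ps : snear q [set p : S | AM (psi1 p) /\ y (psi1 p) = \row_k ps k (xs p)];
  nc_br0 : forall j k, br (i (base q)) j k = Pi j k (\row_k io k (xs q));
  nc_br1 : forall j k, br (psi1 q) j k = Pi j k (\row_k ps k (xs q));
  nc_tr : trans_at Pi io Ch Ih ps (xs q);
  nc_ann : ann_at Pi io ps (xs q);
  nc_dm : forall v (om : 'rV[R]_D), tangent q v ->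
    (exists be, L (base q) (push pro v, be) /\ forall w, tangent q w ->
      be (push pro w) = \sum_k om 0 k * tcs q w 0 k) <->
    exists s : 'rV[R]_D, tcs q v = s *m mxA (xc (base q)) /\ om = s *m mxB (xc (base q));
  nc_mem : forall a, L (base q) a <-> generalized_tangent (base q) a /\
      exists k : 'rV[R]_n, forall l,
        tcode xc (base q) a.1 0 l = \sum_b k 0 b * Ah b l (xc (base q)) /\
        ccode xc yc (base q) a.2 0 l = \sum_b k 0 b * Bh b l (xc (base q));
  nc_fr : dirac_frame_at Ah Bh c (xc (base q)) }.

Let As0 : As p0. Proof. by []. Qed.

Lemma pro_near (P : set X) : snear x0 P -> snear p0 [set q : S | P (base q)].
Proof.
have sp : smooth_map pro by exact: pro_smooth. by move=> nP; have := snear_preim (phi := pro) (p := p0) sp nP.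
Qed.

Lemma nice_near : snear p0 nice.
Proof.
have nfr : snear x0 [set b | dirac_frame_at Ah Bh c (xc b)].
  have nb : nbhs (xc x0) [set u | dirac_frame_at Ah Bh c u].
    have n1 := dr_iso rL; have n2 := dr_brT rL; have n3 := dr_brC rL.
    by move: n1 n2 n3; apply: filterS3 => u h1 h2 h3; split. by apply: snearS (snear_push cx Ax0 nb) => q [].
have n1 := snear_snear (r1_near r1). have n2 := snearI (r1_trans r1) (r1_ann r1).
have n3 := pro_near (snearI (dr_mem rL) nfr). have n4 := pro_near (dmodel).
apply: snear2 (snearI n1 n2) (snearI n3 n4) _.
move=> q [hs [htr han]] [[[Ab hm] hf] hd]; have [Asq _ _ _ [b0 b1]] := snear_self hs. have [_ A0b] := Asq.
constructor=> //.
- by apply: snearS hs => p [_ [hN _] h _ _].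
- by apply: snearS hs => p [_ _ _ [h _] _].
- by apply: snearS hs => p [_ _ _ [_ h] _].
- by move=> v om hv; exact: hd.
Qed.

Lemma xsl (q : S) : lsubmx (xs q) = xc (base q). Proof. exact: row_mxKl. Qed.

Lemma code_diff q v h (hh : fn R D) : As q -> tangent q v -> smooth h -> sm hh ->
  snear q [set p : S | h p = hh (xs p)] -> v h = \sum_a tcs q v 0 a * pd a hh (xs q).
Proof.
move=> Aq hv sh shh nh; rewrite (tan_coords gS cs Aq hv sh shh nh). by apply: eq_bigr => a _; rewrite mxE.
Qed.

Lemma code_C q v (l : 'I_N) : nice q -> tangent q v ->
  [/\ v (Cf l) = \sum_a tcs q v 0 a * pd a (Ch l) (xs q), v (Ff l) = \sum_a tcs q v 0 a * pd a (Fh l) (xs q) &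
      v (germ q (prim l)) = \sum_a tcs q v 0 a * pd a (Ih l) (xs q)].
Proof.
move=> nq hv; have Aq := nc_A nq; split.
- apply: code_diff => //; [exact: (Cf_smooth)|exact: (r1_smC r1)|].
  by apply: snearS (nc_C nq) => p [_ /(_ l)[]].
- apply: code_diff => //; [exact: (Ff_smooth)|exact: (r1_smF r1)|].
  by apply: snearS (nc_C nq) => p [_ /(_ l)[]].
have sI : smooth (fun q : S => Ih l (xs q)) by have := smooth_xcomp gS cs (r1_smI r1 l).
have np : snear q [set p : S | prim l p = Ih l (xs p)]. by apply: snearS (nc_C nq) => p [_ /(_ l)[]].
have [_ ->//] := germP gS sI np. apply: code_diff => //; first exact: (r1_smI r1).
by exists setT; split=> //; exact: sopenT.
Qed.

Lemma etaN_code t q v w : nice q -> tangent q v -> tangent q w ->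
  etaN N t q v w = \sum_k (tcs q v *m etaM (tv t (xs q))) 0 k * tcs q w 0 k.
Proof.
move=> nq hv hw; transitivity (\sum_b (\sum_a tcs q v 0 a * \sum_l
   (pd a (Ch l) (xs q) * kd Fh Ih t l b (xs q) - pd b (Ch l) (xs q) * kd Fh Ih t l a (xs q))) * tcs q w 0 b).
  rewrite wedge_sum; apply: eq_bigr => l _.
  have [-> -> ->] := code_C l nq hv; have [-> -> ->] := code_C l nq hw.
  have kE u : \sum_a tcs q u 0 a * kd Fh Ih t l a (xs q) = \sum_a tcs q u 0 a * pd a (Fh l) (xs q) +
      t * (\sum_a tcs q u 0 a * pd a (Ih l) (xs q) - \sum_a tcs q u 0 a * pd a (Fh l) (xs q)).
    rewrite -sumrB mulr_sumr -big_split/=; apply: eq_bigr => a _; rewrite /kd; ring. by rewrite !kE.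
apply: eq_bigr => b _; congr (_ * _); rewrite mxE; apply: eq_bigr => a _.
by rewrite [etaM _ _ _]mxE row_mxKr tm_tv.
Qed.

Lemma prim_code q w : nice q -> tangent q w ->
  \sum_(l < N) Cf l q * (w (Ff l) - w (germ q (prim l))) = \sum_k primM (xs q) 0 k * tcs q w 0 k.
Proof.
move=> nq hw; under [RHS]eq_bigr do rewrite mxE mulr_suml.
rewrite [RHS]exchange_big/=; apply: eq_bigr => l _; have [_ -> ->] := code_C l nq hw.
have [_ /(_ l)[-> _ _]] := snear_self (nc_C nq). rewrite -sumrB mulr_sumr; apply: eq_bigr => a _; ring.
Qed.

Lemma tan_Cf_zero (q : S) v l : tangent q v -> snear q [set z | Cf l z = 0] -> v (Cf l) = 0.
Proof.
move=> hv nz; rewrite (tan_local gS hv (Cf_smooth l) (smooth_cst gS 0) nz). exact: (tan_cst gS 0 hv).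
Qed.

(** The summands in which two truncations differ involve functions C_l that vanish near q, and so
    does their derivative along v and w. *)
Lemma trunc2 t (q : S) v w k k' : tangent q v -> tangent q w ->
  snear q [set z | forall l, (k <= l)%N -> Cf l z = 0] ->
  snear q [set z | forall l, (k' <= l)%N -> Cf l z = 0] ->
  \sum_(l < k) Cf l q * (w (Ff l) - w (germ q (prim l))) - etaN k t q v w =
  \sum_(l < k') Cf l q * (w (Ff l) - w (germ q (prim l))) - etaN k' t q v w.
Proof.
move=> hv hw nk nk'.
have h k1 : snear q [set z | forall l, (k1 <= l)%N -> Cf l z = 0] -> forall l, (k1 <= l)%N ->
    [/\ Cf l q = 0, v (Cf l) = 0 & w (Cf l) = 0].
  move=> n1 l kl; have nl : snear q [set z | Cf l z = 0] by apply: snearS n1 => z; apply.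
  by split; [exact: (snear_self nl)|exact: tan_Cf_zero hv nl|exact: tan_Cf_zero hw nl]. congr (_ - _).
  apply: (sum_trunc (a := fun l => Cf l q * (w (Ff l) - w (germ q (prim l))))) => l hl.
    by have [-> _ _] := h _ nk l hl; rewrite mul0r. by have [-> _ _] := h _ nk' l hl; rewrite mul0r.
apply: (sum_trunc (a := fun l => v (Cf l) * (w (Ff l) + t * (w (germ q (prim l)) - w (Ff l))) -
   w (Cf l) * (v (Ff l) + t * (v (germ q (prim l)) - v (Ff l))))) => l hl.
  by have [_ -> ->] := h _ nk l hl; rewrite !mul0r subrr.
by have [_ -> ->] := h _ nk' l hl; rewrite !mul0r subrr.
Qed.

(** In frame coordinates the Moser relation is the linear system with matrix [frameM] and right-hand
    side [primM], which has a unique solution where the determinant is not 0. *)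
Lemma flow2_code t q v : nice q -> flow2 t q v <-> tangent q v /\
  exists s : 'rV[R]_D, tcs q v = s *m mxA (xc (base q)) /\ s *m frameM (tv t (xs q)) = primM (xs q).
Proof.
move=> nq; have nN : snear q [set z | forall l, (N <= l)%N -> Cf l z = 0]. by apply: snearS (nc_C nq) => z [].
have fE s : s *m frameM (tv t (xs q)) = s *m mxB (xc (base q)) + s *m mxA (xc (base q)) *m etaM (tv t (xs q)).
  by rewrite /frameM row_mxKr xsl mulmxDr mulmxA.
have E v' w : tangent q v' -> tangent q w -> \sum_(l < N) Cf l q * (w (Ff l) - w (germ q (prim l))) - etaN N t q v' w =
    \sum_k (primM (xs q) - tcs q v' *m etaM (tv t (xs q))) 0 k * tcs q w 0 k.
  move=> hv hw; rewrite etaN_code// prim_code// -sumrB; apply: eq_bigr => k _.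
  by rewrite -mulrBl [in RHS]mxE [X in _ = (_ + X) * _]mxE.
split=> [[hv /(_ N nN)[b [Lb hb]]]|[hv [s [vs hs]]]]; split=> //.
  have [|s [vs os]] := (nc_dm nq (primM (xs q) - tcs q v *m etaM (tv t (xs q))) hv).1.
    by exists b; split=> // w hw; rewrite hb// E. by exists s; split=> //; rewrite fE -os -vs subrK.
move=> N' nN'. have [|b [Lb hb]] := (nc_dm nq (primM (xs q) - tcs q v *m etaM (tv t (xs q))) hv).2.
  by exists s; split=> //; rewrite -hs fE -vs addrK.
by exists b; split=> // w hw; rewrite (trunc2 t hv hw nN' nN) E// hb.
Qed.

Lemma frame_inj (s : 'rV[R]_D) : s *m mxA (xc x0) = 0 -> s *m mxB (xc x0) = 0 -> s = 0.
Proof.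
move=> sA sB; have inv := nbhs_singleton (dr_inv rL). have hA l : \sum_j lsubmx s 0 j * Ah j l (xc x0) = 0.
  have /rowP/(_ (lshift r l)) := sA; rewrite mul_mxA mxE => E; rewrite -[RHS]E.
  by apply: eq_bigr => a _; rewrite mxE. have hB l : \sum_j lsubmx s 0 j * Bh j l (xc x0) = 0.
  have := mul_mxB Bh s (xc x0) (fun a => (a == lshift r l)%:R); rewrite sB.
  rewrite big1; last by move=> a _; rewrite mxE mul0r.
  rewrite (bigD1 l)//= eqxx mulr1 [X in _ + X]big1 ?addr0 => [E|k kl].
    by rewrite [RHS]E; apply: eq_bigr => a _; rewrite mxE.
  by rewrite (inj_eq (@lshift_inj _ _)) (negPf kl) mulr0. rewrite -[s]hsubmxK; have -> : lsubmx s = 0.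
  apply/rowP => l; rewrite inv mxE big1 ?add0r; last by move=> k _; rewrite hA mul0r.
  by rewrite big1// => k _; rewrite hB mul0r. have -> : rsubmx s = 0.
  apply/rowP => a; have /rowP/(_ (rshift n a)) := sA; rewrite !mxE big_split_ord/= big1 ?add0r.
    rewrite (bigD1 a)//= big1 ?addr0 => [|b ba]; rewrite block_mxEdr mxE. by rewrite eqxx mulr1.
    by rewrite (negPf ba) mulr0. by move=> k _; rewrite block_mxEur mxE mulr0. by rewrite row_mx0.
Qed.

(** A left null vector s of [frameM] gives a tangent vector s mxA contained in the twisted
    structure. It is 0 by [transversal0], and then s = 0 by independence of the frame. *)
Lemma det_z0 (t : R) : 0 <= t <= 1 -> frame_det Ah Bh Ch Fh Ih (tv t z0) != 0.
Proof.
move=> ht; rewrite -unitfE -unitmxE -row_free_unit; apply: row_freeI => s hs.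
have nq := snear_self nice_near; have x0E : xc (base p0) = xc x0 by []. pose v := tvs p0 (s *m mxA (xc x0)).
have hv : tangent p0 v := tvec_tangent gS cs _ As0.
have vE : tcs p0 v = s *m mxA (xc x0) by have := tvecK cs (s *m mxA (xc x0)) As0.
have [|be [Lb hb]] := (nc_dm nq (s *m mxB (xc x0)) hv).2; first by exists s.
have sE : s *m mxB (xc x0) = - (s *m mxA (xc x0) *m etaM (tv t z0)).
  apply/eqP; rewrite -addr_eq0; apply/eqP; rewrite -[RHS]hs /frameM row_mxKr.
  by rewrite (xsl p0) mulmxDr mulmxA.
(* [transversal0] expects smooth functions indexed by all naturals; from N on the default is 0. *)
pose IhS l := oapp (fun k : 'I_N => fun q : S => Ih k (xs q)) (fun=> 0) (insub l). have v0 : v = fun=> 0.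
  apply: (transversal0 (N := N) (Ih := IhS) _ _ _ (t := t) hv Lb).
  - by apply: snearS (r1_near r1) => q [].
  - move=> l; rewrite /IhS; case: insub => [k|]; last exact: smooth_cst.
    by have := smooth_xcomp gS cs (r1_smI r1 k).
  - move=> l lN; rewrite /IhS insubT/=; apply: snearS (nc_C nq) => z [_ h]. by case: (h (Ordinal lN)).
  - move=> w hw; rewrite hb// etaN_code// vE sE -sumrN; apply: eq_bigr => k _. by rewrite mxE mulNr.
have sA : s *m mxA (xc x0) = 0 by rewrite -vE v0; apply/rowP => k; rewrite !mxE.
by apply: frame_inj => //; rewrite sE sA mul0mx oppr0.
Qed.

Lemma flow_near : exists Ph : 'I_D -> fn R D, [/\ forall a, sm (Ph a), Phi p0 = p0 &
  snear p0 [set p : S | [/\ nice p, nice (Phi p), xs (Phi p) = \row_a Ph a (xs p),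
    frame_det Ah Bh Ch Fh Ih (tv 0 (xs p)) != 0 & forall (w : 'rV[R]_D) (b0 : 'rV[R]_n),
      (forall k, \sum_l (b0 0 l * Ah k l (xc (base p)) + Bh k l (xc (base p)) * w 0 (lshift r l)) = 0) ->
      exists b1 : 'rV[R]_n, (forall k, \sum_l (b1 0 l * Ah k l (xc (base (Phi p))) +
         Bh k l (xc (base (Phi p))) * 'D_w (Ph (lshift r l)) (xs p)) = 0) /\
        forall v : 'rV[R]_D, \sum_l b1 0 l * 'D_v (Ph (lshift r l)) (xs p) +
          \sum_l wedge (fun x => Ch l (\row_a Ph a x)) (fun x => Ih l (\row_a Ph a x)) w v (xs p) =
          \sum_l b0 0 l * v 0 (lshift r l) + \sum_l wedge (Ch l) (Fh l) w v (xs p)]]].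
Proof.
have sA := dr_smA rL; have sB := dr_smB rL; have sc := dr_smc rL.
have sC := r1_smC r1; have sF := r1_smF r1; have sI := r1_smI r1.
have [e1 e10 ne1] := det_lower sA sB sC sF sI det_z0.
(* What the solution must meet at every time of the unit interval: the chart domain, the local
   representations, and a determinant bounded away from 0, so that the regularized field is the true
   Moser field. *)
pose P0 z := (dual_B yc B A0 z /\ nice (ys z)) /\ forall t, 0 <= t <= 1 -> e1 < frame_det Ah Bh Ch Fh Ih (tv t z) ^+ 2.
have nP0 : nbhs z0 P0. have n1 := near_pull cs As0 nice_near; exact: filterI n1 ne1. have C0 l : Ch l z0 = 0.
  by have [_ /(_ l)[<- _ _]] := snear_self (nc_C (snear_self nice_near)); exact: Cf_zero.
have [ph [sph ph0 cst ode [d d0 hd]]] := moser_flow sA sB sC sF sI C0 e10 (near_join nP0).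
have p0E z : pos ph (tv 0 z) = z by apply/rowP => a; rewrite mxE ph0. have nz := snear_ball cs As0 d0.
have goodp p : As p -> `|xs p - z0| < d -> forall t, 0 <= t <= 1 ->
    [/\ nbhs (pos ph (tv t (xs p))) P0, dual_B yc B A0 (pos ph (tv t (xs p))),
      nice (ys (pos ph (tv t (xs p)))), xs (ys (pos ph (tv t (xs p)))) = pos ph (tv t (xs p)) &
      \forall q \near tv t (xs p), cutoff z0 1 (pos ph q) = 1].
  move=> Ap hp t ht; have [nP nq] := hd _ t hp ht.
  have [[hB hn] _] := nbhs_singleton nP; split=> //; first exact: (co_xy cs). by apply: filterS nq => q [].
have PhiP p : As p -> `|xs p - z0| < d -> Phi p = ys (pos ph (tv 1 (xs p))).
  move=> Ap hp; apply: (PhiE (c := fun t => ys (pos ph (tv t (xs p))))).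
    split; first by rewrite p0E (co_yx cs). move=> t ht; set u := pos ph (tv t (xs p)); set q := ys u.
    have [nP Bu nq xq nc] := goodp p Ap hp t ht; rewrite -/u -/q in nP Bu nq xq.
    have Aq := nc_A nq; have [_ dt] := nbhs_singleton nP.
    have tv1 := tvec_tangent gS cs (fieldV Ah Bh Ch Fh Ih e1 (tv t u)) Aq.
    have tE := tvecK cs (fieldV Ah Bh Ch Fh Ih e1 (tv t u)) Aq.
    exists (tvs q (fieldV Ah Bh Ch Fh Ih e1 (tv t u))); split. apply/(flow2_code t _ nq); split=> //.
      exists (fieldS Ah Bh Ch Fh Ih e1 (tv t u)); rewrite tE /fieldV row_mxKr xq -xsl xq; split=> //.
      by have := fieldSE e10 (ltW (dt t ht)); rewrite row_mxKr.
    move=> h sh; have [G [sG nGh nG]] := co_ext cs sh Aq.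
    have nE : \forall s \near t, G (pos ph (tv s (xs p))) = h (ys (pos ph (tv s (xs p)))).
      by rewrite xq in nGh; exact: pos_tv_cont sph _ nGh. apply: near_eq_is_derive nE _.
    have dG := derive_tv (sm_diff (tv t (xs p)) (smY sph sG)).
    apply: (drv_eq dG) => //; rewrite (D_Y sph _ _ sG) (tvecE cs _ Aq sh sG nG) xq.
    apply: eq_bigr => k _; congr (_ * _). by rewrite ode (nbhs_singleton nc) mul1r tm_tv.
  move=> t ht; set u := pos ph (tv t (xs p)).
  have [nP Bu nq xq _] := goodp p Ap hp t ht; rewrite -/u in nP Bu nq xq.
  exists (dual_x xc e), (dual_y lK sub yc fw), (dual_A A A0), (dual_B yc B A0).
  exists (fun k q => fieldV Ah Bh Ch Fh Ih e1 q 0 k); split=> //.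
  - exact: nc_A nq.
  - by move=> k; exact: sm_fieldV. have nb : nbhs (xs (ys u)) P0 by rewrite xq.
  apply: snearS (snear_push cs (nc_A nq) nb) => q' [Aq' [[_ nq'] dt]] s v hs.
  have yq' : ys (xs q') = q' := co_yx cs Aq'; rewrite yq' in nq'.
  move=> /(flow2_code s _ nq')[hv [s' [vE sE]]] k.
  have sE' : s' *m frameM (tv s (xs q')) = primM (rsubmx (tv s (xs q'))) by rewrite row_mxKr.
  have := fieldS_unique e10 (ltW (dt s hs)) sE' => s'E.
  have /rowP/(_ k) := vE; rewrite mxE => ->; rewrite s'E /fieldV row_mxKr. by rewrite -xsl.
pose Ph a z := ph a (tv 1 z); exists Ph; split.
- move=> a; apply: (sm_comp (F := ph a)) => // k; apply: sm_row_mx => l; first exact: sm_cst. exact: sm_coord.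
- rewrite PhiP ?subrr ?normr0// (cst _ in01_1); exact: (co_yx cs).
have PhE z : \row_a Ph a z = pos ph (tv 1 z) by []. apply: snear2 nz nice_near _ => p [Ap hp] np.
have [_ B1 n1 x1 _] := goodp p Ap hp 1 in01_1; have [nP _ _ _ _] := goodp p Ap hp 0 in01_0.
rewrite p0E in nP; have [_ dt] := nbhs_singleton nP. have PE := PhiP p Ap hp; rewrite /= PE; split=> //.
  by rewrite -sqrf_eq0 lt0r_neq0// (lt_trans e10)// (dt _ in01_0).
have hz t : 0 <= t <= 1 -> [/\ \forall q \near tv t (xs p), cutoff z0 1 (pos ph q) = 1,
    dirac_frame_at Ah Bh c (lsubmx (pos ph (tv t (xs p)))) &
    e1 < frame_det Ah Bh Ch Fh Ih (tv t (pos ph (tv t (xs p)))) ^+ 2].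
  move=> ht; have [nPt Bt nt xt nct] := goodp p Ap hp t ht; split=> //. by rewrite -xt xsl; exact: nc_fr nt.
  by have [_] := nbhs_singleton nPt; apply. have tr := moser_transport sA sB sc sC sF sI e10 sph ph0 ode hz.
move=> w b0 hb0; have [|b1 [hb1 vb1]] := tr w b0; first by move=> k; rewrite xsl.
have E (l : 'I_n) : (fun x => pos ph (tv 1 x) 0 (lshift r l)) = Ph (lshift r l).
  by apply/funext => x; rewrite mxE. exists b1; split=> [k|v].
  by rewrite -[RHS](hb1 k) -xsl x1; apply: eq_bigr => l _; rewrite E.
by rewrite -vb1; congr +%R; apply: eq_bigr => l _; rewrite E.
Qed.

Lemma etaN0_wedge p w v : nice p -> tangent p w -> tangent p v ->
  etaN N 0 p w v = \sum_l wedge (Ch l) (Fh l) (tcs p w) (tcs p v) (xs p).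
Proof.
move=> np hw hv; apply: eq_bigr => l _; rewrite !mul0r !addr0 /wedge.
have sC := sm_diff (xs p) (r1_smC r1 l); have sF := sm_diff (xs p) (r1_smF r1 l).
by have [-> -> _] := code_C l np hv; have [-> -> _] := code_C l np hw; rewrite !derive_pd.
Qed.

Lemma omega_etaN p w v : nice p -> tangent p w -> tangent p v ->
  pull_form2 j (@omega_can R X) p w v = etaN N 0 p w v.
Proof.
move=> np hw hv; have [N' nN'] := st_fam H (base p).
rewrite (canonical_form gX dL (st_dim H) (st_comp H) jP (N := N') (W := fun l => W l)
  (h := fun l => f l \o i) _ _ _ hw hv).
- have n' : snear p [set z | forall l, (N' <= l)%N -> Cf l z = 0].
    have sp : smooth_map pro by exact: pro_smooth.
    apply: snearS (snear_preim (phi := pro) sp nN') => z [hN _] l Nl. by apply: (Cf_W); exact: hN.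
  have nN : snear p [set z | forall l, (N <= l)%N -> Cf l z = 0]. by apply: snearS (nc_C np) => z [].
  have Z k l : snear p [set z | forall l, (k <= l)%N -> Cf l z = 0] -> (k <= l)%N -> w (Cf l) = 0 /\ v (Cf l) = 0.
    move=> nk kl; have nl : snear p [set z | Cf l z = 0] by apply: snearS nk => z; apply.
    by split; [exact: tan_Cf_zero hw nl|exact: tan_Cf_zero hv nl].
  transitivity (\sum_(l < N) (w (Cf l) * v (Ff l) - v (Cf l) * w (Ff l))); last first.
    by apply: eq_bigr => l _; rewrite !mul0r !addr0.
  apply: (sum_trunc (a := fun l => w (Cf l) * v (Ff l) - v (Cf l) * w (Ff l))) => l hl.
    by have [-> ->] := Z _ l n' hl; rewrite !mul0r subrr.
  by have [-> ->] := Z _ l nN hl; rewrite !mul0r subrr.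
- by move=> l; exact: st_W H l.
- by move=> l; exact: i_smooth _ (st_f H l).
- by apply: snearS nN' => q [].
Qed.

Lemma omega_cvec p w : nice p -> tangent p w -> pull_form2 j (@omega_can R X) p w =
  @cvec R D S (dual_x xc e) p (tcs p w *m etaM (tv 0 (xs p))).
Proof.
move=> np hw; apply/funext => v; have [hv|nv] := pselect (tangent p v).
  rewrite omega_etaN// etaN_code// cvecE//; apply: eq_bigr => k _; by rewrite [tcs _ _ _ _]mxE.
by rewrite /pull_form2 /pull /cvec !patchN// notin_setE.
Qed.

Lemma model_code p a : nice p -> local_model j p a <-> generalized_tangent p a /\
  exists s : 'rV[R]_D, tcs p a.1 = s *m mxA (xc (base p)) /\
    forall v, tangent p v -> a.2 v = \sum_k (s *m frameM (tv 0 (xs p))) 0 k * tcs p v 0 k.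
Proof.
move=> np; have sp : smooth_map pro by exact: pro_smooth. have fE s : s *m frameM (tv 0 (xs p)) =
    s *m mxB (xc (base p)) + s *m mxA (xc (base p)) *m etaM (tv 0 (xs p)).
  by rewrite /frameM row_mxKr xsl mulmxDr mulmxA.
have oE w v : tangent p w -> tangent p v -> pull_form2 j (@omega_can R X) p w v =
    \sum_k (tcs p w *m etaM (tv 0 (xs p))) 0 k * tcs p v 0 k. by move=> hw hv; rewrite omega_etaN// etaN_code.
have oC w : tangent p w -> cotangent p (pull_form2 j (@omega_can R X) p w).
  by move=> hw; rewrite omega_cvec//; exact: cvec_cotangent.
have cD (al be : covec S) : cotangent p al -> cotangent p be -> cotangent p (al \+ be).
  move=> h1 h2; have := dual_lin 1 h1 h2; congr (dual_of _); apply/funext => v /=; by rewrite mul1r.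
split=> [[[w al] [/= hw [be [cb Lb ->]]] <-]|[[hw ca] [s [wE aE]]]] /=. have cp := pull_cotangent gX sp cb.
  split; first by split=> //=; apply: cD => //; exact: oC.
  have [|s [ws os]] := (nc_dm np (@ccode R D S (dual_x xc e) (dual_y lK sub yc fw) p (pull pro p be)) hw).1.
    exists be; split=> // v hv; rewrite -(pullE _ _ hv). by have := cot_code gS cs (nc_A np) cp hv.
  exists s; split=> // v hv; rewrite fE -os -ws oE// (cot_code gS cs (nc_A np) cp hv) -big_split/=.
  by apply: eq_bigr => k _; rewrite [X in _ = X * _]mxE mulrDl.
have [|be [Lb hb]] := (nc_dm np (s *m mxB (xc (base p))) hw).2; first by exists s.
have [_ cb] := dirac_gt dL Lb; have cp := pull_cotangent gX sp cb.
exists (a.1, pull pro p be); first by split=> //; exists be. rewrite [RHS]surjective_pairing; congr pair.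
apply: (dual_ext (cD _ _ cp (oC _ hw)) ca) => v hv /=.
rewrite aE// (pullE _ _ hv) hb// oE// fE wE -big_split/=.
by apply: eq_bigr => k _; rewrite [X in _ = X * _]mxE mulrDl.
Qed.

Lemma frame_in p k : nice p -> L (base p) (tvec xc yc (base p) (\row_l Ah k l (xc (base p))),
  cvec xc (base p) (\row_l Bh k l (xc (base p)))).
Proof.
move=> np; have [Ab _] := nc_A np; apply/(nc_mem np); split.
  by split; [exact: (tvec_tangent gX cx _ Ab)|exact: cvec_cotangent].
exists (ev k) => l; rewrite /= (tvecK cx _ Ab) (cvecK gX cx _ Ab) !mxE.
by split; rewrite (bigD1 k)//= big1 ?addr0 => [|b bk]; rewrite mxE ?eqxx ?mul1r// (negPf bk) mul0r.
Qed.

(** By maximal isotropy, pairing to 0 with the elements of a frame is enough for membership. *)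
Lemma in_L p v be : nice p -> tangent (base p) v -> cotangent (base p) be ->
  L (base p) (v, be) <-> forall k, \sum_l (ccode xc yc (base p) be 0 l * Ah k l (xc (base p)) +
    Bh k l (xc (base p)) * tcode xc (base p) v 0 l) = 0.
Proof.
move=> np hv cb; have [Ab _] := nc_A np; split=> [Lv k|h].
  have := dirac_iso dL Lv (frame_in k np); rewrite /pairing /= => E; rewrite -[RHS]E big_split/=.
  rewrite (cot_code gX cx Ab cb (tvec_tangent gX cx _ Ab)) (tvecK cx _ Ab).
  rewrite cvecE//; congr +%R; apply: eq_bigr => l _; by rewrite !mxE.
apply/(dirac_lagrangian dL); split=> // -[u al] /(nc_mem np)[[/= hu cu] [kk hk]].
rewrite /pairing/= (cot_code gX cx Ab cb hu) (cot_code gX cx Ab cu hv) -big_split/=.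
transitivity (\sum_l \sum_k kk 0 k * (ccode xc yc (base p) be 0 l * Ah k l (xc (base p)) +
    Bh k l (xc (base p)) * tcode xc (base p) v 0 l)).
  apply: eq_bigr => l _; have [-> ->] := hk l; rewrite mulr_sumr mulr_suml -big_split/=.
  by apply: eq_bigr => k _; ring. by rewrite exchange_big/= big1// => k _; rewrite -mulr_sumr h mulr0.
Qed.

Lemma io_push q u k : nice q -> tangent q u ->
  push i (push pro u) (fun z => y z 0 k) = 'D_(tcs q u) (io k) (xs q).
Proof.
move=> nq hu; have sy := co_smooth cy k; have si := i_smooth. have sp : smooth_map pro by exact: pro_smooth.
rewrite pushE// pushE; last exact: si. rewrite derive_pd; last exact: (sm_diff _ (r1_smio r1 k)).
apply: (code_diff (h := fun z : S => y (i (base z)) 0 k)); [exact: (nc_A nq)|exact: hu| |exact: (r1_smio r1)|].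
  exact: sp _ (si _ sy). by apply: snearS (nc_io nq) => z [_ /= ->]; rewrite mxE.
Qed.

Lemma chainP (Ph : 'I_D -> fn R D) (h : fn R D) v z : (forall a, sm (Ph a)) -> sm h ->
  'D_v (fun x => h (\row_a Ph a x)) z = 'D_(\row_a 'D_v (Ph a) z) h (\row_a Ph a z).
Proof.
move=> sPh sh; have e1 a : (fun x => (\row_a Ph a x) 0 a) = Ph a by apply/funext => x; rewrite mxE.
rewrite -[LHS]/('D_v (h \o (fun x => \row_a Ph a x)) z) derive_compE; last 2 first.
- by apply: sm_diff_rV => a; rewrite e1.
- exact: sm_diff. rewrite derive_pd; last exact: sm_diff. by apply: eq_bigr => a _; rewrite e1 mxE.
Qed.

(** An element of the local model at p is carried by the Moser flow to an element of L at q = Phi p,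
    up to the form sum_l dC_l /\ dI_l. The pullback condition replaces its covector by one on M, and
    stage one transports that covector and restores exactly this form. *)
Lemma local_good : snear p0 good_at.
Proof.
have [Ph [sPh _ nPh]] := flow_near. apply: snearS (snear_snear nPh) => p nnp.
have [np nq xq dt tr] := snear_self nnp; set q := Phi p in nq xq tr.
have Ap := nc_A np; have Aq := nc_A nq; have [Abq A0q] := Aq.
have si := i_smooth; have sp : smooth_map pro by exact: pro_smooth.
have spsh k : sm (fun z => ps k (\row_a Ph a z)).
  apply: (sm_comp (F := ps k)) => [|a]; first exact: r1_smps r1 k. by apply: sm_ext (sPh a) => z; rewrite mxE.
have nF : snear p [set z | AM (psi z) /\ y (psi z) = \row_k ps k (\row_a Ph a (xs z))].
  by apply: snearS nnp => z [_ nz xz _ _]; have := snear_self (nc_ps nz); rewrite /= xz.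
have sF : smooth_near psi p := coords_smooth_near gS cs cy Ap spsh nF. have [AMp yp] := snear_self nF.
pose Dv (v : vec S) : 'rV[R]_D := \row_a 'D_(tcs p v) (Ph a) (xs p).
have tD v k : tangent p v -> dpush psi p v (fun z => y z 0 k) = 'D_(Dv v) (ps k) (xs q).
  move=> hv; have /rowP/(_ k) := tcode_dpush gS cs cy Ap spsh nF hv; rewrite !mxE => ->.
  by rewrite (chainP _ _ sPh (r1_smps r1 k)) xq.
have bD b1 v : tangent p v -> cvec y (psi p) b1 (dpush psi p v) = \sum_k b1 0 k * 'D_(Dv v) (ps k) (xs q).
  move=> hv; rewrite cvecE; last exact: (dpush_tangent gS gM sF hv). by apply: eq_bigr => k _; rewrite tD.
have shE b1 k : sharp pi (psi p) (cvec y (psi p) b1) (fun z => y z 0 k) =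
    \sum_j b1 0 j * Pi j k (\row_k ps k (xs q)). have cb := cvec_cotangent y (psi p) b1.
  rewrite (sharp_code gM (st_pi H) cy k AMp cb) (cvecK gM cy _ AMp).
  by apply: eq_bigr => a _; rewrite -(nc_br1 nq).
have wedgeP (h1 h2 : 'I_N -> fn R D) w v : (forall l, sm (h1 l)) -> (forall l, sm (h2 l)) ->
    \sum_l wedge (fun x => h1 l (\row_a Ph a x)) (fun x => h2 l (\row_a Ph a x)) (tcs p w) (tcs p v) (xs p) =
    \sum_l wedge (h1 l) (h2 l) (Dv w) (Dv v) (xs q).
  by move=> s1 s2; apply: eq_bigr => l _; rewrite /wedge !(chainP _ _ sPh)// xq.
pose uq (v : vec S) := tvs q (Dv v). have huq v : tangent q (uq v) := tvec_tangent gS cs _ Aq.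
have tuq v : tcs q (uq v) = Dv v := tvecK cs (Dv v) Aq.
have hpu v : tangent (base q) (push pro (uq v)) by have := push_tangent gX sp (huq v).
have tpu v l : tcode xc (base q) (push pro (uq v)) 0 l = 'D_(tcs p v) (Ph (lshift r l)) (xs p).
  have := push_pro_tcode (huq v); rewrite tuq => ->; by rewrite !mxE.
have hpp v : tangent p v -> tangent (base p) (push pro v) by move=> hv; have := push_tangent gX sp hv.
have tpp v l : tangent p v -> tcode xc (base p) (push pro v) 0 l = tcs p v 0 (lshift r l).
  by move=> hv; have := push_pro_tcode hv => ->; rewrite mxE.
have gtrans a : local_model j p a -> exists b, [/\ cotangent (psi p) b,
    dpush psi p a.1 = sharp pi (psi p) b & forall v, tangent p v -> b (dpush psi p v) = a.2 v].
  move=> La; case: (La) => -[w al] [/= hw [be [cb Lb alE]]] aE. have aw : a.1 = w by rewrite -aE.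
  have [Abp _] := Ap. have [|b1 [hb1 vb1]] := tr (tcs p w) (ccode xc yc (base p) be).
    move=> k; rewrite -[RHS]((in_L np (hpp w hw) cb).1 Lb k). by apply: eq_bigr => l _; rewrite tpp.
  have cb1 := cvec_cotangent xc (base q) b1. have : L (base q) (push pro (uq w), cvec xc (base q) b1).
    apply/(in_L nq (hpu w) cb1) => k; rewrite (cvecK gX cx _ Abq) -[RHS](hb1 k).
    by apply: eq_bigr => l _; rewrite tpu.
  (* The condition that L is the pullback of the graph of pi produces a covector of M at
     [i (base q)] from the element of L. *)
  have [_ hL _] := st_emb H; rewrite -hL => -[_ [bb [cbb [bb' cbb' [pE bE]] b1E]]]; subst bb'.
  have [AMi _] := snear_self (nc_io nq).
  have tr1 := nc_tr nq; have [|b1' [hb1' vb1']] := tr1 (Dv w) (ccode y y' (i (base q)) bb).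
    move=> k; rewrite -(tuq w) -(io_push k nq (huq w)) -pE (sharp_code gM (st_pi H) cy k AMi cbb).
    by apply: eq_bigr => a' _; rewrite -(nc_br0 nq). have cb' := cvec_cotangent y (psi p) b1'.
  exists (cvec y (psi p) b1'); split=> //. rewrite aw; apply: (tan_eq gM cy AMp).
    - by have := dpush_tangent gS gM sF hw.
    - by have := sharp_tangent (st_pi H) cb'.
    - by move=> k; rewrite tD// shE; exact: hb1'. move=> v hv; rewrite bD// vb1' -aE /=.
  have -> : \sum_k ccode y y' (i (base q)) bb 0 k * 'D_(Dv v) (io k) (xs q) =
      \sum_l b1 0 l * 'D_(tcs p v) (Ph (lshift r l)) (xs p). transitivity (bb (push i (push pro (uq v)))).
      rewrite (cot_code gM cy AMi cbb (push_tangent gM si (hpu v))).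
      apply: eq_bigr => k _; congr (_ * _); rewrite [RHS]mxE (io_push k nq (huq v)) tuq //.
    have := pullE i bb (hpu v); rewrite -b1E /= cvecE// => <-. by apply: eq_bigr => l _; rewrite -tpu mxE.
  rewrite -(wedgeP Ch Ih w v (r1_smC r1) (r1_smI r1)) vb1 omega_etaN// etaN0_wedge//.
  congr +%R; rewrite alE (pullE _ _ hv) (cot_code gX cx Abp cb (hpp v hv)).
  by apply: eq_bigr => l _; rewrite tpp. have gsurj g : cotangent p g -> exists w, local_model j p (w, g).
  move=> cg; have um : frameM (tv 0 (xs p)) \in unitmx by rewrite unitmxE unitfE.
  pose s := @ccode R D S (dual_x xc e) (dual_y lK sub yc fw) p g *m invmx (frameM (tv 0 (xs p))).
  have hv := tvec_tangent gS cs (s *m mxA (xc (base p))) Ap.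
  exists (tvs p (s *m mxA (xc (base p)))); apply/(model_code _ np); split=> //.
  exists s; split=> [|v hv']; first by have := tvecK cs (s *m mxA (xc (base p))) Ap.
  rewrite /s mulmxKV//; by have := cot_code gS cs Ap cg hv'. constructor=> //.
(* The rank count. Z is the annihilator of TX intersected with the kernel of pi^sharp. Coisotropy
   sends the annihilator, of dimension at least m - n, into K, of dimension r, so Z has dimension at
   least m - n - r. P maps Z injectively into the annihilator of the image of the tangent map, which
   has dimension m - n - r by injectivity. So that annihilator is Z P and lies in the kernel of
   pi^sharp. *)
- move=> b cb hb; have [P [uP hP]] := nc_ann nq. have [AMi _] := snear_self (nc_io nq).
  pose Pi0 : 'M[R]_m := \matrix_(a, k) Pi a k (\row_k io k (xs q)).
  pose J : 'M[R]_(n, m) := \matrix_(a, k) push i (tvec xc yc (base q) (ev a)) (fun z => y z 0 k).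
  pose Js : 'M[R]_(D, m) := \matrix_(a, k) pd a (fun z => ps k (\row_a Ph a z)) (xs p).
  pose E : 'M[R]_(r, m) := \matrix_(a, k) push i (e a (base q)) (fun z => y z 0 k).
  pose Z := (kermx J^T :&: kermx Pi0)%MS.
  have tJs v k : tangent p v -> dpush psi p v (fun z => y z 0 k) = (tcs p v *m Js) 0 k.
    move=> hv; have /rowP/(_ k) := tcode_dpush gS cs cy Ap spsh nF hv; rewrite [LHS]mxE => ->.
    rewrite mxE derive_pd; last exact: sm_diff.
    by rewrite [RHS]mxE; apply: eq_bigr => a _; rewrite [Js _ _]mxE.
  have tJ u k : tangent (base q) u -> push i u (fun z => y z 0 k) = (tcode xc (base q) u *m J) 0 k.
    move=> hu; have sy := co_smooth cy k; rewrite pushE//.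
    rewrite -{1}(tcodeK gX cx Abq hu) (tvec_sum gX cx _ Abq) mxE; apply: eq_bigr => a _.
    by rewrite [J _ _]mxE pushE. have fJs : row_free Js.
    apply: row_freeI => s sJ; have hv := tvec_tangent gS cs s Ap.
    have tcv := tvecK cs s Ap; rewrite -tcv (_ : tvs p s = fun=> 0); first by apply/rowP => k; rewrite !mxE.
    apply: (dpush_inj gS sF gtrans gsurj hv); apply: (tan_eq gM cy AMp).
    - exact: (dpush_tangent gS gM sF hv).
    - by case: (lin_set_tangent (psi p)).
    - by move=> k; rewrite tJs// tcv sJ mxE.
  have annJ (b0 : 'rV[R]_m) u : b0 *m J^T = 0 -> tangent (base q) u ->
      \sum_k b0 0 k * push i u (fun z => y z 0 k) = 0.
    move=> bJ hu; transitivity ((b0 *m J^T *m (tcode xc (base q) u)^T) 0 0); last by rewrite bJ mul0mx mxE.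
    rewrite -mulmxA -trmx_mul mxE; apply: eq_bigr => k _; by rewrite tJ// [X in _ = _ * X]mxE.
  have hZ (b0 : 'rV[R]_m) : (b0 <= Z)%MS -> b0 *m P *m Js^T = 0 /\
      forall k, \sum_j (b0 *m P) 0 j * Pi j k (\row_k ps k (xs q)) = 0.
    rewrite sub_capmx => /andP[/sub_kermxP bJ /sub_kermxP bPi]. have [|h1 h2] := hP b0.
      move=> k; have /rowP/(_ k) := bPi; rewrite !mxE => h; rewrite -[RHS]h.
      by apply: eq_bigr => a _; rewrite mxE. split=> //; apply/rowP => a; rewrite mxE [RHS]mxE.
    transitivity (\sum_k (b0 *m P) 0 k * 'D_(\row_a' pd a (Ph a') (xs p)) (ps k) (xs q)).
      apply: eq_bigr => k _; congr (_ * _). by rewrite !mxE (chainP _ _ sPh (r1_smps r1 k)) xq.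
    rewrite h2; set v := \row_a' _; have hv := tvec_tangent gS cs v Aq.
    have hpv : tangent (base q) (push pro (tvs q v)) by have := push_tangent gX sp hv.
    rewrite -[RHS](annJ b0 _ bJ hpv); apply: eq_bigr => k _; congr (_ * _).
    by rewrite (io_push k nq hv); have := tvecK cs v Aq => ->. have rE : (kermx J^T *m Pi0 <= E)%MS.
    apply/row_subP => t; rewrite row_mul; set b0 := row t _.
    have bJ : b0 *m J^T = 0 by apply/sub_kermxP; exact: row_sub. have c0 := cvec_cotangent y (i (base q)) b0.
    have an u : tangent (base q) u -> cvec y (i (base q)) b0 (push i u) = 0.
      by move=> hu; rewrite cvecE; [exact: annJ|exact: (push_tangent gM si hu)].
    have [_ hL hco] := st_emb H; have [u [hu uE]] := hco _ _ c0 an. have Ku : K (base q) u.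
      rewrite /tangent_part /= -hL; split=> //; exists (cvec y (i (base q)) b0); split=> //.
        by exists (cvec y (i (base q)) b0) => //=; rewrite uE.
      apply/funext => v /=; have [hv|nv] := pselect (tangent (base q) v); first by rewrite pullE// an.
      by rewrite /pull patchN// notin_setE. apply/submxP; exists (\row_a ww a (base q) u); apply/rowP => k.
    have [hKu _] := hA0 A0q; have := hKu u Ku => uK. have sy := co_smooth cy k.
    transitivity (push i u (fun z => y z 0 k)).
      rewrite uE (sharp_code gM (st_pi H) cy k AMi c0) (cvecK gM cy _ AMi) mxE.
      by apply: eq_bigr => a _; rewrite [Pi0 _ _]mxE (nc_br0 nq).
    rewrite pushE// [in LHS]uK mxE; apply: eq_bigr => a _. by rewrite [E _ _]mxE pushE// mxE.
  have rZ : (m - D <= \rank Z)%N. have h1 := mxrank_mul_ker (kermx J^T) Pi0; have h2 := mxrank_ker J^T.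
    have h3 := rank_leq_col J^T; have h4 := mxrankS rE; have h5 := rank_leq_row E.
    rewrite leq_subLR -addnA; apply: (@leq_trans (\rank J^T + \rank (kermx J^T))). by rewrite h2 -leq_subLR.
    by rewrite -h1 leq_add// leq_add2r (leq_trans h4). have ZP : (kermx Js^T <= Z *m P)%MS.
    have h1 : (Z *m P <= kermx Js^T)%MS. apply/row_subP => t; rewrite row_mul; apply/sub_kermxP.
      by have [] := hZ (row t Z) (row_sub _ _).
    rewrite -(geq_leqif (mxrank_leqif_sup h1)) mxrank_ker mxrank_tr (eqP fJs).
    by rewrite mxrankMfree ?row_free_unit. have bJs : (ccode y y' (psi p) b <= kermx Js^T)%MS.
    apply/sub_kermxP/rowP => a; have hv := tvec_tangent gS cs (ev a) Ap.
    rewrite [RHS]mxE -[RHS](hb _ hv) (cot_code gM cy AMp cb (dpush_tangent gS gM sF hv)) mxE.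
    apply: eq_bigr => k _; congr (_ * _); rewrite [RHS]mxE tJs// [LHS]mxE.
    have := tvecK cs (ev a) Ap => ->; by rewrite -rowE [RHS]mxE.
  have /submxP[c0 c0E] := submx_trans bJs ZP; rewrite mulmxA in c0E. have [_ h0] := hZ _ (submxMl c0 Z).
  apply: (tan_eq gM cy AMp); first by have := sharp_tangent (st_pi H) cb. by case: (lin_set_tangent (psi p)).
  move=> k; rewrite (sharp_code gM (st_pi H) cy k AMp cb) c0E -[RHS](h0 k).
  by apply: eq_bigr => a _; rewrite -(nc_br1 nq).
- by move=> a /(model_code a np)[].
- move=> t a b /(model_code a np)[[h1 c1] [s [sE aE]]] /(model_code b np)[[h2 c2] [s' [sE' bE]]].
  apply/(model_code _ np); split; first by split; [exact: (lin_set_tangent p).2|exact: dual_lin].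
  exists (t *: s + s'); split=> [|v hv] /=.
    rewrite mulmxDl -scalemxAl -sE -sE'; apply/rowP => k; by rewrite !mxE.
  rewrite aE// bE// mulr_sumr -big_split/=; apply: eq_bigr => k _.
  by rewrite mulmxDl -scalemxAl [X in _ = X * _]mxE [X in _ = (X + _) * _]mxE mulrDl mulrA.
- move=> a b La Lb; case: (La) => -[w al] [/= hw [be [cb Lbe alE]]] <-.
  case: (Lb) => -[w' al'] [/= hw' [be' [cb' Lbe' alE']]] <-; rewrite /pairing /=.
  rewrite alE alE' !(pullE) // !omega_etaN// !etaN0_wedge//.
  have := dirac_iso dL Lbe Lbe'; rewrite /pairing/= => E.
  have -> : \sum_l wedge (Ch l) (Fh l) (tcs p w') (tcs p w) (xs p) =
      - \sum_l wedge (Ch l) (Fh l) (tcs p w) (tcs p w') (xs p).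
    by rewrite -sumrN; apply: eq_bigr => l _; rewrite /wedge; ring. by rewrite addrACA E add0r subrr.
- move=> w /(model_code _ np)[[hw _] [s [/= wE zE]]].
  have um : frameM (tv 0 (xs p)) \in unitmx by rewrite unitmxE unitfE. have s0 : s = 0.
    rewrite -[s](mulmxK um); suff -> : s *m frameM (tv 0 (xs p)) = 0 by rewrite mul0mx.
    apply/rowP => k; have := zE _ (tvec_tangent gS cs (ev k) Ap).
    by have := tvecK cs (ev k) Ap => ->; rewrite sum_ev => <-; rewrite mxE.
  have w0 : tcs p w = 0 by rewrite wE s0 mul0mx.
  have t0 : tangent p (fun=> 0 : R) by case: (lin_set_tangent p).
  apply: (tan_eq gS cs Ap hw t0) => k; have /rowP/(_ k) := w0; by rewrite !mxE.
Qed.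

End Near.

Theorem local_theorem x : snear (zero x) good_at /\ psi (zero x) = i x.
Proof.
have [xc [yc [A [B [cx Ax]]]]] := good_coords gX x.
have [e [ww [se fw [A0 [oA0 A0x hA0]]]]] := frameK gX dL (st_dim H) (st_comp H) x.
have [Ah [Bh [c [Hh rL]]]] := dirac_rep_exists gX dL cx Ax.
have [y [y' [AM [BM [cy AMx]]]]] := good_coords gM (i x).
have cs := dual_coords (linK (st_dim H)) (@subK R X L dL) cx se fw oA0 hA0.
have As0 : dual_A A A0 (zero x) by [].
have [Pi [io [N [Ch [Fh [Ih [ps r1]]]]]]] := stage1_local cs As0 cy AMx.
split; first exact: (local_good cx Ax se fw oA0 A0x hA0 rL cy r1).
have [_ [_ P0 _]] := flow_near cx Ax se fw oA0 A0x hA0 rL r1. by rewrite /psi P0 (psi1_zero).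
Qed.

(** A smooth substitute for a fibre norm, adequate because the C_l determine the functional. The
    truncation comes from a choice at each p, which [nuE] shows to be harmless. *)
Definition nu (p : S) : R := \sum_(l < projT1 (cid (Cf_fam p))) Cf l p ^+ 2.

Lemma nuE p N : (forall l, (N <= l)%N -> Cf l p = 0) -> nu p = \sum_(l < N) Cf l p ^+ 2.
Proof.
move=> hN; rewrite /nu; case: cid => N' /= /snear_self[hN' _].
apply: (sum_trunc (a := fun l => Cf l p ^+ 2)) => l hl. by rewrite (hN' l hl) expr0n.
by rewrite (hN l hl) expr0n.
Qed.

Lemma nu_smooth : smooth nu.
Proof.
apply: (smooth_loc gS) => p; have [N nN] := Cf_fam p. exists (fun q => \sum_(l < N) Cf l q * Cf l q).
  by apply: (smooth_sum gS) => l; apply: (smooth_mul gS); exact: (Cf_smooth).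
by apply: snearS nN => q [hN _] /=; rewrite (nuE hN); apply: eq_bigr => l _; rewrite expr2.
Qed.

(** The base point is controlled because X carries the topology induced by i, and the fibre
    coordinates because [fib_families] bounds them by the C_l, hence by nu. *)
Lemma nu_basis (d : M -> M -> R) :
  (forall p (A : set M), snear p A -> exists2 e, 0 < e & forall q, d p q < e -> A q) ->
  forall x O, snear (zero x) O -> exists2 e, 0 < e &
    forall p : S, d (i x) (i (base p)) < e -> nu p < e -> O p.
Proof.
move=> dA x Q nQ; have [xc [yc [A [B [cx Ax]]]]] := good_coords gX x.
have [e [ww [se fw [A0 [oA0 A0x hA0]]]]] := frameK gX (st_dL H) (st_dim H) (st_comp H) x.
have cs := dual_coords (linK (st_dim H)) (@subK R X L (st_dL H)) cx se fw oA0 hA0.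
have As0 : dual_A A A0 (zero x) by []. have /nbhs_rVP[del del0 hdel] := near_pull cs As0 nQ.
have [N nN] := st_fam H x. have shh (a : 'I_r) (l : 'I_N) : smooth (fun q => e a q (f l \o i)).
  by case: (se a) => -[_ s] _; apply: s; exact: i_smooth _ (st_f H l).
pose b a (l : 'I_N) := `|e a x (f l \o i)| + 1. pose c := 1 + \sum_a \sum_l b a l.
have b0 a l : 0 <= b a l by rewrite addr_ge0.
have c0 : 0 < c by rewrite ltr_pwDl// sumr_ge0// => a _; exact: sumr_ge0. have bc a l : b a l <= c.
  rewrite /c (bigD1 a)//= (bigD1 l)//= ler_wpDl// -addrA lerDl addr_ge0//. by apply: sumr_ge0 => *; exact: b0.
  by apply: sumr_ge0 => *; apply: sumr_ge0 => *; exact: b0.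
have nb : snear x [set q | forall al : 'I_r * 'I_N, `|e al.1 q (f al.2 \o i)| <= c].
  apply: snear_fin => -[a l] /=. have n1 : snear x [set q | `|e a q (f l \o i) - e a x (f l \o i)| < 1].
    by apply: snear_open; [exact: sopen_dist|rewrite /= subrr normr0].
  apply: snearS n1 => q hq; apply: le_trans (bc a l); rewrite /b addrC -lerBlDr.
  by apply: le_trans (lerB_dist _ _) _; exact: ltW. have nx := snear_ball cx Ax del0.
have [P [oP Px hP]] := snearI (snearI nN nb) (snearI nx (snear_open oA0 A0x)).
have [[_ _ _ iO] _ _] := st_emb H; have [P' [oP' PE]] := iO P oP; subst P.
have [e1 e10 he1] := dA _ _ (snear_open oP' Px).
(* Chosen so that (N + 1) eta c = del: a fibre coordinate is a sum of N terms bounded by eta c,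
   hence strictly below del, also when N = 0. *)
pose eta := del / N.+1%:R / c; have eta0 : 0 < eta by rewrite !divr_gt0.
exists (Num.min e1 (eta ^+ 2)); first by rewrite lt_min e10 exprn_gt0.
move=> p; rewrite !lt_min => /andP[h1 _] /andP[_ h2]. have [[[hN hf] hb] [[Ab hx] A0b]] := hP _ (he1 _ h1).
have Ap : dual_A A A0 p by []. have CN l : (N <= l)%N -> Cf l p = 0 by move=> /hN Wl; exact: (Cf_W Wl).
have Ceta (l : 'I_N) : `|Cf l p| <= eta.
  rewrite -ler_sqr ?nnegrE ?(ltW eta0)// real_normK ?num_real//; apply: ltW; apply: le_lt_trans h2.
  by rewrite (nuE CN) (bigD1 l)//= lerDl; apply: sumr_ge0 => k _; exact: sqr_ge0.
have [//|_ Qp] := hdel (dual_x xc e p); last by rewrite (co_yx cs) in Qp.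
have -> : dual_x xc e p - dual_x xc e (zero x) = row_mx (xc (base p) - xc x) (\row_a fib p (e a (base p))).
  by rewrite opp_row_mx add_row_mx; congr row_mx; apply/rowP => a; rewrite !mxE subr0.
apply: norm_lt_coord => // k; case: (fintype.split_ordP k) => a ->.
  by rewrite row_mxEl; apply: le_lt_trans hx; exact: coord_le_norm.
rewrite row_mxEr mxE (fib_families hf (se a)) normrN. apply: le_lt_trans (norm_sum_le (C := eta * c) _) _.
  by move=> l; rewrite normrM ler_pM//; exact: hb (a, l).
have -> : del = N.+1%:R * (eta * c) by rewrite /eta divfK ?gt_eqF// mulrC divfK// pnatr_eq0.
by rewrite ltr_pM2r ?ltr_nat// mulr_gt0.
Qed.

End Model.

(** * Open Poisson embeddings *)

Theorem model_map (R : realType) (n r m : nat) (X M : diffspace R)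
    (L : X -> set (vec X * covec X)) (C : X -> set (vec X))
    (j : dual_bundle (tangent_part L) -> cotangent_bundle X)
    (pi : M -> covec M -> covec M -> R) (i : X -> M) :
  manifold n X -> dirac_structure L -> (forall x, has_dim r (tangent_part L x)) ->
  complement_of (tangent_part L) C -> induced_inclusion C j ->
  manifold m M -> poisson pi -> coisotropic_embedding L pi i ->
  exists (U : set (dual_bundle (tangent_part L))) psi,
  [/\ sopen U, forall x, U (zero_section _ x), forall p, U p -> poisson_germ (local_model j) pi psi p,
    forall p A, U p -> snear p A -> snear (psi p) [set z | forall q, U q -> psi q = z -> A q] &
    forall x, psi (zero_section _ x) = i x].
Proof.
move=> mX dL dimK compC jP mM pP emb; have gX := manifold_good mX; have gM := manifold_good mM.
have gS := model_good gX dL dimK compC; have [[si _ imm _] _ _] := emb.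
have [f [W [sf fW fam]]] := families mX gM si imm. have H : setting n r m L C pi i f W by [].
have loc := local_theorem H jP; pose psi p := psi n r C pi i f W (p : dual_bundle (tangent_part L)).
have [d [dT dC d0 dn dA]] := manifold_metric mM.
have sp : smooth_map (@pr R X (tangent_part L)) by exact: pr_smooth.
have nu0 x : nu H (zero_section (tangent_part L) x) = 0.
  by rewrite (nuE H (N := 0)) ?big_ord0// => l _; exact: Cf_zero.
have embed x : exists Q, snear (zero_section (tangent_part L) x) Q /\ forall q A, Q q -> snear q A ->
    snear (psi q) [set z | forall q', Q q' -> psi q' = z -> A q'].
  have G := snear_self (loc x).1; apply: (immersion_embed gS gM (ga_smooth G)) => v.
  exact: dpush_inj gS (ga_smooth G) (ga_trans G) (ga_surj G).
have ok p : poisson_germ (local_model j) pi psi p -> smooth_near psi p by move=> G; exact: ga_smooth G.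
have [U [oU zU Uok sepU]] := neighbourhood (pro := @pr R X (tangent_part L)) dT dC d0 dn (nu_basis H dA)
  (nu_smooth H) (fun h sh => sp _ (si h sh)) nu0 (fun x => erefl) (fun x => (loc x).2) ok
  (fun x => (loc x).1) embed. by exists U, psi; split=> // x; case: (loc x).
Qed.

Section OpenEmbedding.
Variables (R : realType) (d : nat) (S M M' : diffspace R) (D : S -> set (vec S * covec S)).
Variables (pi : M -> covec M -> covec M -> R) (pi' : M' -> covec M' -> covec M' -> R).
Variables (psi : S -> M) (psi' : S -> M') (U : set S).
Hypotheses (gS : good d S) (gM : good d M) (gM' : good d M') (oU : sopen U).
Hypotheses (pP : poisson pi) (pP' : poisson pi').
Hypothesis hU : forall p, U p -> poisson_germ D pi psi p.
Hypothesis hU' : forall p, U p -> poisson_germ D pi' psi' p.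
Hypothesis sepU : forall p A, U p -> snear p A -> snear (psi p) [set z | forall q, U q -> psi q = z -> A q].

(** A neighbourhood of p that misses q would have to contain q if both had the same image. *)
Lemma sep_inj p q : U p -> U q -> psi p = psi q -> p = q.
Proof.
move=> Up Uq E; apply: (good_sep gS) => f sf; apply: contrapT => /eqP ne.
have n1 : snear p [set z | `|f z - f p| < `|f q - f p|].
  by apply: snear_open; [exact: sopen_dist|rewrite /= subrr normr0 normr_gt0 subr_eq0 eq_sym].
by have /= := snear_self (sepU Up n1) q Uq (esym E); rewrite ltxx.
Qed.

(** In equal dimensions the full rank of the tangent map is invertibility of the Jacobian. The
    smooth right inverse I provides preimages near p and expresses h as a function on M. *)
Lemma open_image p h : U p -> smooth h -> exists2 g, smooth g &
  snear (psi p) [set z | exists q, [/\ U q, psi q = z & h q = g z]].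
Proof.
move=> Up sh; have P := hU Up. have inj v : tangent p v -> dpush psi p v = (fun=> 0) -> v = fun=> 0.
  exact: dpush_inj gS (ga_smooth P) (ga_trans P) (ga_surj P).
have [x [y [A [B [x' [y' [A' [B' [G [[cx Ap] [cx' A'p] sG fj nF]]]]]]]]]] :=
  immersion_coords gS gM (ga_smooth P) inj.
have dG : \det (jac G (x p)) != 0 by rewrite -unitfE -unitmxE -row_free_unit.
have [I [sI I0 nI]] := inverse_function sG dG; have [_ xp] := snear_self nF.
have [H [sH nH _]] := co_ext cx sh Ap. exists (fun z => H (I (x' z))).
  by have := smooth_xcomp gM cx' (sm_comp (F := H) sH sI).
have n1 := near_pull cx Ap (snearI nF (snear_open oU Up)).
have n2 : \forall w \near x p, (B w /\ ((A' (psi (y w)) /\ x' (psi (y w)) = G (x (y w))) /\ U (y w))) /\ H w = h (y w).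
  exact: filterI n1 nH. have cI : {for G (x p), continuous I} by exact: sm_cont_rV. rewrite -I0 in n2.
have n3 : \forall w \near G (x p), ((B (I w) /\ ((A' (psi (y (I w))) /\ x' (psi (y (I w))) = G (x (y (I w)))) /\
    U (y (I w)))) /\ H (I w) = h (y (I w))) /\ G (I w) = w. by apply: filterI nI; exact: cI _ n2.
rewrite -xp in n3. apply: snearS (snear_push cx' A'p n3) => z [A'z [[[Bw [[A'w xw] Uw]] HE] GI]].
exists (y (I (x' z))); split=> //. by rewrite -(co_yx cx' A'w) xw (co_xy cx)// GI (co_yx cx').
Qed.

Notation image := (psi @` U).
Notation image' := (psi' @` U).

Lemma image_open : sopen image.
Proof.
apply: sopen_local => _ [p Up <-]; have [g _ [A [oA Ap hA]]] := open_image Up (smooth_cst gS 0).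
by exists A; split=> // z /hA[q [Uq qz _]]; exists q.
Qed.

Lemma transfer_in (z : subspace_of image) : image' (psi' (s2val (cid2 (svalP z)))).
Proof. by case: cid2 => p Up _ /=; exists p. Qed.

(** The map psi' after the inverse of psi. The preimage is a choice in U, made unique by
    [sep_inj]. *)
Definition transfer (z : subspace_of image) : subspace_of image' := exist _ _ (transfer_in z).

Lemma transferE p z : U p -> sval z = psi p -> sval (transfer z) = psi' p.
Proof.
move=> Up zp; rewrite /transfer /=; case: cid2 => q Uq qz /=; congr psi'. by apply: sep_inj => //; rewrite qz.
Qed.

(* Functions on the image of psi' pull back to S and push forward along psi. *)
Lemma transfer_germ (h : subspace_of image' -> R) p (z' : subspace_of image') : smooth h -> U p -> sval z' = psi' p ->
  exists (F : M' -> R) (k : S -> R) (F' : M -> R), [/\ smooth F, smooth k, smooth F' & [/\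
    snear (sval z') [set w | forall z : subspace_of image', sval z = w -> h z = F w],
    snear p [set q | F (psi' q) = k q], snear p [set q | F' (psi q) = k q] &
    snear (psi p) [set w | forall z : subspace_of image, sval z = w -> h (transfer z) = F' w]]].
Proof.
move=> /sub_smoothE/(_ z')[F sF nF] Up zp; rewrite zp in nF *; have P' := hU' Up.
have [k sk nk] := ga_smooth P' sF; have [F' sF' nF'] := open_image Up sk.
have nU := snear_open oU Up; have nFp := smooth_near_preim (ga_smooth P') nF.
exists F, k, F'; split=> //; split=> //.
  apply: snear2 (smooth_near_preim (ga_smooth (hU Up)) nF') nU _ => q [q' [Uq' E kE]] Uq /=.
  by rewrite -kE (sep_inj Uq' Uq E).
apply: snear2 nF' (sepU Up (snearI nk nFp)) _ => w [q [Uq qw kq]] hq z zw.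
have [/= Fk hF] := hq q Uq qw; rewrite -kq -Fk; apply: hF; apply: transferE => //. by rewrite zw.
Qed.

Lemma transfer_smooth : smooth_map transfer.
Proof.
move=> h sh; apply/sub_smoothE => z; have [p Up pz] := svalP z.
have [F [k [F' [_ _ sF' [_ _ _ n]]]]] := transfer_germ sh Up (transferE Up (esym pz)).
by exists F' => //; rewrite -pz.
Qed.

(** Both brackets are computed on S: by [germ_bracket], for psi and for psi', each equals w b, with
    b the common pullback of the second function and w paired in D with the differential of the
    pullback of the first. *)
Lemma transfer_poisson piV piV' : poisson_map piV pi (fun z : subspace_of image => sval z) ->
  poisson_map piV' pi' (fun z : subspace_of image' => sval z) -> sopen image' ->
  poisson_map piV piV' transfer.
Proof.
move=> [_ mV] [_ mV'] o'; split=> [|h k sh sk z]; first exact: transfer_smooth.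
have [p Up pz] := svalP z; have zp := transferE Up (esym pz).
have [F [a [F' [sF sa sF' [n1 n2 n3 n4]]]]] := transfer_germ sh Up zp.
have [E [b [E' [sE sb sE' [m1 m2 m3 m4]]]]] := transfer_germ sk Up zp.
have loc (T : diffspace R) (gT : good d T) (V : set T) (oV : sopen V) (u : subspace_of V) (g : subspace_of V -> R) f :
    smooth g -> smooth f -> snear (sval u) [set w | forall z : subspace_of V, sval z = w -> g z = f w] ->
    diff_at g u = diff_at (f \o (fun z : subspace_of V => sval z)) u.
  move=> sg sf nf; have gV := sub_good gT oV.
  have sf' : smooth (fun z : subspace_of V => f (sval z)) by exact: sub_smooth.
  apply: (dual_ext (diff_at_cotangent u sg) (diff_at_cotangent u sf')) => v hv.
  rewrite !diff_atE//; apply: (tan_local gV hv sg sf'). by apply: snearS (sub_snear nf) => z' /= ->.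
have oI := image_open; rewrite pz in n4 m4. have [w Dw] := ga_surj (hU Up) (diff_at_cotangent p sa).
have bV := mV _ _ sF' sE' z; have bV' := mV' _ _ sF sE (transfer z). rewrite /bracket in bV bV'.
rewrite /bracket (loc _ gM _ oI z _ _ (transfer_smooth sh) sF' n4) (loc _ gM _ oI z _ _ (transfer_smooth sk) sE' m4).
rewrite (loc _ gM' _ o' _ _ _ sh sF n1) (loc _ gM' _ o' _ _ _ sk sE m1) bV bV' zp -pz.
rewrite -![pi _ _ _]/(bracket pi F' E' _) -![pi' _ _ _]/(bracket pi' F E _).
by rewrite (germ_bracket gS gM pP hU Up sF' sE' sa sb n3 m3 Dw) (germ_bracket gS gM' pP' hU' Up sF sE sa sb n2 m2 Dw).
Qed.

End OpenEmbedding.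

Theorem proposition5p1 (R : realType) (n r : nat) (X : diffspace R)
    (L : X -> set (vec X * covec X)) (C : X -> set (vec X))
    (j : dual_bundle (tangent_part L) -> cotangent_bundle X) :
  manifold n X -> dirac_structure L ->
  (forall x, has_dim r (tangent_part L x)) ->
  complement_of (tangent_part L) C ->
  induced_inclusion C j ->
  (forall (m : nat) (M : diffspace R) (pi : M -> covec M -> covec M -> R)
      (i : X -> M),
    manifold m M -> poisson pi -> coisotropic_embedding L pi i ->
    exists (U : set (dual_bundle (tangent_part L)))
      (piU : subspace_of U -> covec (subspace_of U) ->
             covec (subspace_of U) -> R)
      (psi : subspace_of U -> M),
      [/\ sopen U /\ (forall x, U (zero_section (tangent_part L) x)),
          poisson piU /\
          (forall p, pullback (fun q : subspace_of U => sval q)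
                       (local_model j) p = graph_of piU p),
          embedding psi, poisson_map piU pi psi &
          forall x (Ux : U (zero_section (tangent_part L) x)),
            psi (exist U (zero_section (tangent_part L) x) Ux) = i x])
  /\
  (forall (M1 M2 : diffspace R) (pi1 : M1 -> covec M1 -> covec M1 -> R)
      (pi2 : M2 -> covec M2 -> covec M2 -> R) (i1 : X -> M1) (i2 : X -> M2),
    manifold (n + r) M1 -> poisson pi1 -> coisotropic_embedding L pi1 i1 ->
    manifold (n + r) M2 -> poisson pi2 -> coisotropic_embedding L pi2 i2 ->
    poisson_diffeomorphic_around pi1 pi2 i1 i2).
Proof.
move=> mX dL dimK compC jP; have gX := manifold_good mX; have gS := model_good gX dL dimK compC.
split=> [m M pi i mM pP emb|M1 M2 pi1 pi2 i1 i2 mM1 pP1 emb1 mM2 pP2 emb2]. have gM := manifold_good mM.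
  have [U [psi [oU zU hU sepU psi0]]] := model_map mX dL dimK compC jP mM pP emb.
  have [pU gU mU] := open_poisson gS gM pP oU hU.
  exists U, (@piU R _ (local_model j) U), (fun q => psi (sval q)); split=> //; last by move=> x Ux /=.
  have [sU _] := mU; split=> //.
  - by move=> p q E; apply: sub_inj; exact: (sep_inj gS sepU (svalP p) (svalP q) E).
  - exact: (psiU_inj gS oU hU).
  (* This is the largest open set of M whose preimage lies in A; the separation property shows that
     the preimage is all of A. *)
  - move=> A oA; exists [set z | exists B, [/\ sopen B, B z & forall q : subspace_of U, B (psi (sval q)) -> A q]].
    split. apply: sopen_local => z [B [oB Bz hB]]; exists B; split=> // w Bw; exists B; split=> //.
    apply/seteqP; split=> [p Ap|p [B [_ Bp hB]]]; last exact: hB.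
    have [B [oB Bp hB]] := sepU _ _ (svalP p) (sub_snearV (snear_open oA Ap)).
    by exists B; split=> // q Bq; exact: (hB _ Bq _ (svalP q) erefl q erefl).
have gM1 := manifold_good mM1; have gM2 := manifold_good mM2.
have [U1 [psi1 [oU1 zU1 hU1 sepU1 psi10]]] := model_map mX dL dimK compC jP mM1 pP1 emb1.
have [U2 [psi2 [oU2 zU2 hU2 sepU2 psi20]]] := model_map mX dL dimK compC jP mM2 pP2 emb2.
(* On the common domain both maps carry the same Dirac structure to their targets, which is what
   makes their comparison Poisson. *)
have oU := sopenI oU1 oU2; pose U := U1 `&` U2.
have h1 p : U p -> poisson_germ (local_model j) pi1 psi1 p by move=> [/hU1].
have h2 p : U p -> poisson_germ (local_model j) pi2 psi2 p by move=> [_ /hU2].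
have s1 p A : U p -> snear p A -> snear (psi1 p) [set z | forall q, U q -> psi1 q = z -> A q].
  by move=> [Up _] nA; apply: snearS (sepU1 _ _ Up nA) => z hz q [Uq _]; exact: hz.
have s2 p A : U p -> snear p A -> snear (psi2 p) [set z | forall q, U q -> psi2 q = z -> A q].
  by move=> [_ Up] nA; apply: snearS (sepU2 _ _ Up nA) => z hz q [_ Uq]; exact: hz.
have o1 := image_open gS gM1 oU h1; have o2 := image_open gS gM2 oU h2.
have [p1 _ m1] := open_poisson gM1 gM1 pP1 o1 (fun p _ => graph_germ gM1 pP1 p).
have [p2 _ m2] := open_poisson gM2 gM2 pP2 o2 (fun p _ => graph_germ gM2 pP2 p).
exists (psi1 @` U), (psi2 @` U), (piU (graph_of pi1) (U := _)), (piU (graph_of pi2) (U := _)).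
exists (@transfer R _ M1 M2 psi1 psi2 U), (@transfer R _ M2 M1 psi2 psi1 U). split.
- by split=> // _ [x _ <-]; exists (zero_section _ x).
- by split=> // _ [x _ <-]; exists (zero_section _ x).
- by split; split; [exact: p1|exact: m1|exact: p2|exact: m2].
- split.
  + move=> z; apply: sub_inj; have [p Up pz] := svalP z; rewrite -pz.
    by apply: (transferE psi1 gS s2 Up); apply: (transferE psi2 gS s1 Up).
  + move=> z; apply: sub_inj; have [p Up pz] := svalP z; rewrite -pz.
    by apply: (transferE psi2 gS s1 Up); apply: (transferE psi1 gS s2 Up).
  + exact: (transfer_smooth gS gM2 oU h2 h1 s2).
- exact: (transfer_poisson gS gM1 gM2 oU pP1 pP2 h1 h2 s1 m1 m2 o2).
Qed.
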